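(* Let $\mu>0$, $0<\sigma<1$ and let $n$ be a positive integer. Put $n_0=\dfrac{1}{2-3\sigma}$ (used when $\tfrac12\le\sigma<\tfrac23$). Let $$F_{n,\sigma}(x;\mu)=\sum_{k=0}^\infty \frac{\sin(n\gamma_k)}{\sin\gamma_k}\,\frac{x^k}{k!\,\Gamma(\mu-\sigma k)},\qquad \gamma_k=\frac{(k+1)\pi}{2n},$$ and let $\mathbf{E}(x)$ and $\mathbf{H}(x)$ be the formal exponential and algebraic expansions defined in the context. Then, as $x\to+\infty$, $$F_{n,\sigma}(x;\mu)\sim\begin{cases}\mathbf{E}(x)+\mathbf{H}(x) & (0<\sigma<\tfrac12;\ n\ge 2),\\[2pt] \mathbf{E}(x)+\mathbf{H}(x) & (\tfrac12\le\sigma<\tfrac23;\ n\ge n_0),\\[2pt] \mathbf{H}(x) & (\tfrac12\le\sigma<\tfrac23;\ n<n_0),\\[2pt] \mathbf{H}(x) & (\tfrac23\le\sigma<1;\ n\ge 2).\end{cases}$$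
   Context: Here $x$ is real. When $\sin\gamma_k=0$, the quotient $\sin(n\gamma_k)/\sin\gamma_k$ is understood by continuity, i.e. as $\sum_{r=0}^{n-1}e^{i\gamma_k(2r-n+1)}$; and $1/\Gamma$ is the entire reciprocal gamma function. Parameters: $\kappa=1-\sigma$, $h=\sigma^\sigma$, $\delta=1-\mu$, $\vartheta=\delta-\tfrac12=\tfrac12-\mu$, $N=\lfloor n/2\rfloor$, $\Delta_n=0$ for $n$ even and $\Delta_n=1$ for $n$ odd, and $$\omega_r=\frac{(n-2r-1)\pi}{2n}\quad(0\le r\le n-1),\qquad \phi_r^\pm=\pm\pi\sigma-\omega_r,\qquad \Phi_r^\pm=\pm\frac{\pi\vartheta}{\kappa}-\omega_r\Bigl(1+\frac{\vartheta}{\kappa}\Bigr),\qquad X=\kappa(hx)^{1/\kappa}.$$ Coefficients $A_j(\sigma)$ (they also depend on $\delta$): these are the coefficients in the inverse factorial expansion $$\frac{\Gamma(\sigma s+\delta)}{\Gamma(1+s)}=\kappa\,(h\kappa^\kappa)^s\left\{\sum_{j=0}^{M-1}\frac{A_j(\sigma)}{\Gamma(\kappa s+1-\vartheta+j)}+\frac{O(1)}{\Gamma(\kappa s+1-\vartheta+M)}\right\}\qquad (s\to+\infty,\ M=1,2,\dots).$$ In particular $A_0(\sigma)=(2\pi/\kappa)^{1/2}(\sigma/\kappa)^\vartheta$ and $A_1(\sigma)/A_0(\sigma)=\frac{1}{24\sigma}\{2+7\sigma+2\sigma^2-12\delta(1+\sigma)+12\delta^2\}$. Formal sum: $S(Xe^{i\Omega}):=\sum_{j=0}^\infty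 A_j(\sigma)\,(Xe^{i\Omega/\kappa})^{-j}$ for real $\Omega$. Exponential expansion: $$\mathbf{E}(x)=\frac{X^\vartheta}{\pi}\,\Re\Bigl\{\sum_{r=0}^{N-1}\Bigl(\exp[Xe^{i\phi_r^+/\kappa}+i\Phi_r^+]\,S(Xe^{i\phi_r^+})+\exp[Xe^{i\phi_r^-/\kappa}+i\Phi_r^-]\,S(Xe^{i\phi_r^-})\Bigr)+\Delta_n\exp[Xe^{\pi i\sigma/\kappa}+\pi i\vartheta/\kappa]\,S(Xe^{\pi i\sigma})\Bigr\},$$ with the convention that only exponential terms with $|\phi_r^\pm|\le\tfrac12\pi\kappa$ (for the $\Delta_n$ term: $\pi\sigma\le\tfrac12\pi\kappa$) are retained, all other terms being omitted. Algebraic expansion: $$\mathbf{H}(x)=\frac1\sigma\sum_{k=0}^\infty\frac{x^{-K}}{k!\,\Gamma(1-K)}\,\theta_{n,k},\qquad K=\frac{k+\delta}{\sigma},\qquad \theta_{n,k}=\Re\Bigl\{2\sum_{r=0}^{N-1}e^{(K-1)i\omega_r}+\Delta_n\Bigr\}.$$ Meaning of $\sim$: the series are formal asymptotic (in general divergent) series, and $\sim$ is a compound asymptotic expansion. That is, for all positive integers $M,M'$, if each retained sum $S$ is truncated to the terms $j<M$ and the algebraic series to the terms $k<M'$, then the difference between $F_{n,\sigma}(x;\mu)$ and the resulting truncated expression is big-$O$ of the sum of $X^{\vartheta-M}$ times the modulus of the exponential factor over all retained exponential terms, plus $x^{-(M'+\delta)/\sigma}$, as $x\to+\infty$. *)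

(* Defs.v *)
From mathcomp Require Import all_boot all_order all_algebra.
From mathcomp Require Import all_classical all_reals all_analysis.
From mathcomp Require Import complex.

Set Implicit Arguments.
Unset Strict Implicit.
Unset Printing Implicit Defensive.

Import Order.TTheory GRing.Theory Num.Theory.
Import numFieldNormedType.Exports.

Local Open Scope classical_set_scope.
Local Open Scope ring_scope.
Local Open Scope complex_scope.

Canonical pinfty_filterType (R : numFieldType) :=
  FilterType (pinfty_nbhs R) _.

(* The reciprocal gamma function on the real line, by the Gauss product
   1/Gamma(z) = lim_m z (z + 1) ... (z + m) / (m! m^z); the limit exists for
   every real z and vanishes exactly at 0, -1, -2, ... *)
Definition rgamma (R : realType) (z : R) : R :=
  limn (fun m : nat => (\prod_(i < m.+1) (z + i%:R)) / (m`!%:R * m%:R `^ z)).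

(* At the poles 0, -1, -2, ... the value is 0. *)
Definition gamma (R : realType) (z : R) : R := (rgamma z)^-1.

Definition expi (R : realType) (t : R) : R[i] := cos t +i* sin t.

Definition cexp (R : realType) (z : R[i]) : R[i] :=
  (expR (complex.Re z))%:C * expi (complex.Im z).

Definition cmod (R : realType) (z : R[i]) : R := ComplexField.Normc.normc z.

Definition gamma_k (R : realType) (n k : nat) : R := k.+1%:R * pi / (2 * n%:R).

(* sin(n g) / sin g, extended by continuity to the zeros of sin. *)
Definition sin_quot (R : realType) (n : nat) (g : R) : R :=
  if sin g == 0
  then complex.Re (\sum_(r < n) expi (g * (2 * r%:R - n%:R + 1)))
  else sin (n%:R * g) / sin g.

Definition Fsum (R : realType) (n : nat) (sigma mu x : R) : R :=
  limn (series (fun k : nat => sin_quot n (gamma_k R n k) *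
                  (x ^+ k / k`!%:R * rgamma (mu - sigma * k%:R)))).

Definition kappa (R : realType) (sigma : R) : R := 1 - sigma.
Definition hsig (R : realType) (sigma : R) : R := sigma `^ sigma.
Definition delta (R : realType) (mu : R) : R := 1 - mu.
Definition vartheta (R : realType) (mu : R) : R := delta mu - 1 / 2.
Definition Xvar (R : realType) (sigma x : R) : R :=
  kappa sigma * (hsig sigma * x) `^ (1 / kappa sigma).
Definition omega (R : realType) (n r : nat) : R :=
  (n%:R - 2 * r%:R - 1) * pi / (2 * n%:R).

(* eps = 1 and eps = -1 give the upper and lower signs in phi_r^{+/-} and
   Phi_r^{+/-}. *)
Definition phi (R : realType) (n : nat) (sigma eps : R) (r : nat) : R :=
  eps * pi * sigma - omega R n r.
Definition Phi (R : realType) (n : nat) (sigma mu eps : R) (r : nat) : R :=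
  eps * pi * vartheta mu / kappa sigma
  - omega R n r * (1 + vartheta mu / kappa sigma).

(* A j is the coefficient A_j(sigma) of the inverse factorial expansion
   Gamma(sigma s + delta) / Gamma(1 + s) =
     kappa (h kappa^kappa)^s
       { sum_(j < M) A_j / Gamma(kappa s + 1 - vartheta + j)
         + O(1) / Gamma(kappa s + 1 - vartheta + M) },  s -> +oo, M >= 1;
   the expansion determines the sequence A uniquely. *)
Definition inverse_factorial_coef (R : realType) (sigma mu : R)
    (A : nat -> R) : Prop :=
  let scale s :=
    kappa sigma * (hsig sigma * kappa sigma `^ kappa sigma) `^ s in
  let rg s (j : nat) :=
    rgamma (kappa sigma * s + 1 - vartheta mu + j%:R) in
  forall M : nat, (0 < M)%N ->
    (fun s : R => gamma (sigma * s + delta mu) / gamma (1 + s)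
                  - scale s * \sum_(j < M) A j * rg s j)
    =O_+oo (fun s : R => scale s * rg s M).

(* The partial sum over j < M of S(X e^{i Omega}). *)
Definition S_trunc (R : realType) (sigma : R) (A : nat -> R) (M : nat)
    (Xx Omega : R) : R[i] :=
  \sum_(j < M) (A j)%:C * (Xx%:C * expi (Omega / kappa sigma)) ^- j.

(* All pairs (phi, Phi) occurring in the exponential expansion. The term
   carrying the factor Delta_n has phi = pi sigma, Phi = pi vartheta / kappa
   and is listed exactly when n is odd. *)
Definition exp_terms (R : realType) (n : nat) (sigma mu : R) : seq (R * R) :=
  [seq (phi n sigma 1 r, Phi n sigma mu 1 r) | r <- iota 0 n./2]
  ++ [seq (phi n sigma (-1) r, Phi n sigma mu (-1) r) | r <- iota 0 n./2]
  ++ (if odd n then [:: (pi * sigma, pi * vartheta mu / kappa sigma)] else [::]).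

Definition retained (R : realType) (n : nat) (sigma mu : R) : seq (R * R) :=
  [seq p <- exp_terms n sigma mu | `|p.1| <= pi * kappa sigma / 2].

Definition exp_factor (R : realType) (sigma : R) (p : R * R) (x : R) : R[i] :=
  cexp ((Xvar sigma x)%:C * expi (p.1 / kappa sigma) + (0 +i* p.2)).

Definition E_trunc (R : realType) (n : nat) (sigma mu : R) (A : nat -> R)
    (M : nat) (x : R) : R :=
  Xvar sigma x `^ vartheta mu / pi *
  complex.Re (\sum_(p <- retained n sigma mu)
                exp_factor sigma p x * S_trunc sigma A M (Xvar sigma x) p.1).

Definition E_error (R : realType) (n : nat) (sigma mu : R) (M : nat)
    (x : R) : R :=
  \sum_(p <- retained n sigma mu)
    Xvar sigma x `^ (vartheta mu - M%:R) * cmod (exp_factor sigma p x).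

Definition Kexp (R : realType) (sigma mu : R) (k : nat) : R :=
  (k%:R + delta mu) / sigma.

Definition theta (R : realType) (n : nat) (sigma mu : R) (k : nat) : R :=
  complex.Re (2 * \sum_(r < n./2) expi ((Kexp sigma mu k - 1) * omega R n r)
              + (odd n)%:R).

Definition H_trunc (R : realType) (n : nat) (sigma mu : R) (M' : nat)
    (x : R) : R :=
  sigma^-1 * \sum_(k < M')
    x `^ (- Kexp sigma mu k) / k`!%:R * rgamma (1 - Kexp sigma mu k)
    * theta n sigma mu k.

(* f ~ E + H as a compound asymptotic expansion at +oo. *)
Definition sim_E_plus_H (R : realType) (n : nat) (sigma mu : R)
    (A : nat -> R) (f : R -> R) : Prop :=
  forall M M' : nat, (0 < M)%N -> (0 < M')%N ->
    (fun x : R => f x - (E_trunc n sigma mu A M x + H_trunc n sigma mu M' x))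
    =O_+oo (fun x : R => E_error n sigma mu M x + x `^ (- Kexp sigma mu M')).

(* f ~ H at +oo, without any exponential term. *)
Definition sim_H (R : realType) (n : nat) (sigma mu : R)
    (f : R -> R) : Prop :=
  forall M' : nat, (0 < M')%N ->
    (fun x : R => f x - H_trunc n sigma mu M' x)
    =O_+oo (fun x : R => x `^ (- Kexp sigma mu M')).

(* Main.v *)
(* Hankel's integral for 1/Gamma gives F(x) = (1/pi) Im sum_(r < n) e^(i omega_r) L(omega_r),
   where L(w) is the integral of exp (u + x e^(i w) u^sigma) u^(delta - 1) over the upper
   half of a Hankel loop.  Put theta = w + pi sigma.  If |theta| < pi kappa / 2, deform the
   loop through the saddle point: L(w) is an exponential times a series in inverse
   powers of X e^(i theta / kappa) whose coefficients do not depend on w, and the part near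
   u = 0 is exponentially smaller.  If theta > pi kappa / 2, expand e^u in L(w): this gives
   the algebraic series with factors 1/Gamma(1 - K).  If theta = pi kappa / 2, both
   contributions occur.  The contributions of the base point of the half loops cancel, because
   they are conjugate for w and -w.  (theta < - pi kappa / 2 does not happen.)

   To identify the coefficients with the A_j take theta = 0, where the saddle point is real
   and L(w) is, up to smaller terms, a positive integral.  The integral of
   Gamma(sigma s + delta) x^s / Gamma(1 + s) over s >= s_1 is evaluated twice: by Tonelli with
   Euler's integral for Gamma(sigma s + delta), which gives back this positive integral, and by
   inserting the inverse factorial expansion.  Both evaluations rest on the estimate
   int_(s >= s_1) y^(c s + b) / Gamma(c s + b + 1) c ds = e^y + O(y^B). *)
From HB Require Import structures.
From mathcomp Require Import all_boot all_order all_algebra.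
From mathcomp Require Import all_classical all_reals all_analysis.
From mathcomp Require Import measurable_realfun complex ring lra.
Require Import Defs.

Set Implicit Arguments.
Unset Strict Implicit.
Unset Printing Implicit Defensive.

Import Order.TTheory GRing.Theory Num.Theory.
Import numFieldNormedType.Exports.

Local Open Scope classical_set_scope.
Local Open Scope ring_scope.
Local Open Scope complex_scope.

(** In the variable z = log u all integrands are entire, so u^sigma needs no branch cut, a contour
    integral is a difference of values of one primitive, and deforming a contour costs nothing. Each
    leg is estimated by comparing derivatives with an explicit real antiderivative; the comparison
    functions are chosen for that: exponentials, arctan(v y) / v for Gaussian peaks, 1 / (1 + e^v)
    for whole lines. With x = e^(kap l) / sigma and theta = 2 kap b the saddle has |u| = e^l in
    every direction, so only b varies. The saddle coefficients are never computed: they are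
    recovered at b = 0 from the uniqueness of asymptotic coefficients. The delicate direction is
    theta = pi kap / 2: the exponential has modulus 1, it competes with the algebraic terms, and the
    contour passes through a region where e^u grows. If some retained exponential grows, it swallows
    all such terms; the final argument therefore splits on the direction of r = n - 1, where theta
    is smallest. *)

Notation Re := complex.Re.
Notation Im := complex.Im.

(* Locked, so that unification never unfolds it into a product. *)
HB.lock Definition ce (R : realType) (z : R[i]) : R[i] := cexp z.

(** * Complex numbers by real and imaginary parts *)

Section ComplexModulus.
Context {R : realType}.
Implicit Types (z w : R[i]) (t x y : R).

Lemma cmod_ge0 z : 0 <= cmod z.
Proof. by case: z => a b; exact: sqrtr_ge0. Qed.

Lemma cmodM z w : cmod (z * w) = cmod z * cmod w.
Proof. exact: ComplexField.Normc.normcM. Qed.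

Lemma cmodD z w : cmod (z + w) <= cmod z + cmod w.
Proof. exact: le_normcD. Qed.

Lemma cmodN z : cmod (- z) = cmod z.
Proof. exact: normcN. Qed.

Lemma cmodB z w : cmod (z - w) <= cmod z + cmod w.
Proof. by rewrite -(cmodN w) cmodD. Qed.

Lemma cmod0 : cmod (0 : R[i]) = 0.
Proof. exact: ComplexField.Normc.normc0. Qed.

Lemma cmod1 : cmod (1 : R[i]) = 1.
Proof. exact: ComplexField.Normc.normc1. Qed.

Lemma cmodX z n : cmod (z ^+ n) = cmod z ^+ n.
Proof.
by elim: n => [|n IH]; rewrite ?expr0 ?cmod1// !exprS cmodM IH.
Qed.

Lemma cmod_real x : cmod x%:C = `|x|.
Proof. by rewrite /cmod /= expr0n/= addr0 sqrtr_sqr. Qed.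

Lemma cmod_sqr z : cmod z ^+ 2 = Re z ^+ 2 + Im z ^+ 2.
Proof. by case: z => a b /=; rewrite sqr_sqrtr// addr_ge0// sqr_ge0. Qed.

Lemma cmod_eq0 z : cmod z = 0 -> z = 0.
Proof. exact: ComplexField.Normc.eq0_normc. Qed.

Lemma Re_le_cmod z : `|Re z| <= cmod z.
Proof.
rewrite -(@ler_pXn2r _ 2)// ?nnegrE ?cmod_ge0 ?normr_ge0//.
by rewrite cmod_sqr real_normK ?num_real// lerDl sqr_ge0.
Qed.

Lemma Im_le_cmod z : `|Im z| <= cmod z.
Proof.
rewrite -(@ler_pXn2r _ 2)// ?nnegrE ?cmod_ge0 ?normr_ge0//.
by rewrite cmod_sqr real_normK ?num_real// lerDr sqr_ge0.
Qed.

Lemma ler_Re_cmod z : Re z <= cmod z.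
Proof. exact: le_trans (ler_norm _) (Re_le_cmod z). Qed.

Lemma cmod_le_ReIm z : cmod z <= `|Re z| + `|Im z|.
Proof.
rewrite -(@ler_pXn2r _ 2)// ?nnegrE ?cmod_ge0 ?addr_ge0 ?normr_ge0//.
rewrite cmod_sqr sqrrD !real_normK ?num_real//.
by rewrite addrAC lerDl mulrn_wge0// mulr_ge0.
Qed.

Lemma cmodJ z : cmod (conjc z) = cmod z.
Proof. by case: z => a b; rewrite /cmod /= sqrrN. Qed.

Lemma cmod_sum (I : Type) (s : seq I) (P : pred I) (F : I -> R[i]) :
  cmod (\sum_(i <- s | P i) F i) <= \sum_(i <- s | P i) cmod (F i).
Proof.
elim/big_ind2: _ => [|a b c d ab cd|//]; first by rewrite cmod0.
by rewrite (le_trans (cmodD _ _))// lerD.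
Qed.

Lemma ReD z w : Re (z + w) = Re z + Re w. Proof. by case: z; case: w. Qed.
Lemma ImD z w : Im (z + w) = Im z + Im w. Proof. by case: z; case: w. Qed.
Lemma ReN z : Re (- z) = - Re z. Proof. by case: z. Qed.
Lemma ImN z : Im (- z) = - Im z. Proof. by case: z. Qed.
Lemma ReB z w : Re (z - w) = Re z - Re w. Proof. by rewrite ReD ReN. Qed.
Lemma ImB z w : Im (z - w) = Im z - Im w. Proof. by rewrite ImD ImN. Qed.
Lemma ReM z w : Re (z * w) = Re z * Re w - Im z * Im w.
Proof. by case: z; case: w. Qed.
Lemma ImM z w : Im (z * w) = Re z * Im w + Im z * Re w.
Proof. by case: z; case: w. Qed.
Lemma ReJ z : Re (conjc z) = Re z. Proof. by case: z. Qed.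
Lemma ImJ z : Im (conjc z) = - Im z. Proof. by case: z. Qed.
Lemma ReZ x z : Re (x%:C * z) = x * Re z.
Proof. by rewrite ReM /= mul0r subr0. Qed.
Lemma ImZ x z : Im (x%:C * z) = x * Im z.
Proof. by rewrite ImM /= mul0r addr0. Qed.

Lemma conjM z w : conjc (z * w) = conjc z * conjc w. Proof. exact: rmorphM. Qed.
Lemma conjD z w : conjc (z + w) = conjc z + conjc w. Proof. exact: rmorphD. Qed.
Lemma conjB z w : conjc (z - w) = conjc z - conjc w. Proof. exact: rmorphB. Qed.

Lemma complex_ext z w : Re z = Re w -> Im z = Im w -> z = w.
Proof. by case: z => a b; case: w => c d /= -> ->. Qed.

Lemma Re_sum (I : Type) (s : seq I) (P : pred I) (F : I -> R[i]) :
  Re (\sum_(i <- s | P i) F i) = \sum_(i <- s | P i) Re (F i).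
Proof. by elim/big_rec2: _ => //= i a b _ <-; rewrite ReD. Qed.

Lemma Im_sum (I : Type) (s : seq I) (P : pred I) (F : I -> R[i]) :
  Im (\sum_(i <- s | P i) F i) = \sum_(i <- s | P i) Im (F i).
Proof. by elim/big_rec2: _ => //= i a b _ <-; rewrite ImD. Qed.

Lemma expiD t x : expi (t + x) = expi t * expi x :> R[i].
Proof.
by apply: complex_ext; rewrite /expi ?ReM ?ImM /= ?cosD ?sinD// addrC.
Qed.

Lemma expi0 : expi 0 = 1 :> R[i].
Proof. by rewrite /expi cos0 sin0. Qed.

Lemma expiN t : expi (- t) = conjc (expi t) :> R[i].
Proof. by rewrite /expi cosN sinN. Qed.

Lemma cmod_expi t : cmod (expi t) = 1.
Proof. by rewrite /cmod /expi /= cos2Dsin2 sqrtr1. Qed.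

Lemma expiX t n : expi t ^+ n = expi (n%:R * t).
Proof.
elim: n => [|n IH]; first by rewrite mul0r expi0 expr0.
by rewrite exprS IH -expiD -natr1 mulrDl mul1r addrC.
Qed.

Lemma expi_neq0 t : expi t != 0.
Proof.
by apply/eqP => /(congr1 (@cmod R)); rewrite cmod_expi cmod0 => /eqP; rewrite oner_eq0.
Qed.

Lemma expiVN t : (expi t)^-1 = expi (- t).
Proof.
apply: (mulfI (expi_neq0 t)).
by rewrite mulfV ?expi_neq0// -expiD subrr expi0.
Qed.

Lemma expi_pihalf : expi (pi / 2) = 'i :> R[i].
Proof. by rewrite /expi cos_pihalf sin_pihalf. Qed.

Lemma expi_pi : expi pi = -1 :> R[i].
Proof. by rewrite /expi cospi sinpi; apply: complex_ext => /=; rewrite ?oppr0. Qed.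

Lemma ceE z : ce z = cexp z. Proof. by rewrite ce.unlock. Qed.

Lemma cexpD z w : ce (z + w) = ce z * ce w.
Proof.
rewrite !ceE /cexp ReD ImD expRD expiD.
by rewrite rmorphM /= -!mulrA; congr (_ * _); rewrite mulrCA.
Qed.

Lemma cexp0 : ce (0 : R[i]) = 1.
Proof. by rewrite !ceE /cexp /= expR0 expi0 mulr1. Qed.

Lemma cexpJ z : ce (conjc z) = conjc (ce z).
Proof. by rewrite !ceE /cexp ReJ ImJ expiN rmorphM /= oppr0. Qed.

Lemma cmod_cexp z : cmod (ce z) = expR (Re z).
Proof.
by rewrite !ceE /cexp cmodM cmod_expi mulr1 cmod_real ger0_norm// expR_ge0.
Qed.

Lemma cexp_real x : ce x%:C = (expR x)%:C.
Proof. by rewrite !ceE /cexp /= expi0 mulr1. Qed.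

Lemma cexp_im t : ce (0 +i* t) = expi t.
Proof. by rewrite !ceE /cexp /= expR0 mul1r. Qed.

Lemma cexpN z : ce (- z) = (ce z)^-1.
Proof.
have z0 : ce z != 0.
  apply/eqP => /(congr1 (@cmod R)); rewrite cmod_cexp cmod0 => /eqP.
  by rewrite expR_eq0.
by apply: (mulfI z0); rewrite mulfV// -cexpD subrr cexp0.
Qed.

Lemma cexpX z n : ce z ^+ n = ce (n%:R * z).
Proof.
elim: n => [|n IH]; first by rewrite mul0r cexp0 expr0.
by rewrite exprS IH -cexpD -natr1 mulrDl mul1r addrC.
Qed.

Lemma Re_cexp z : Re (ce z) = expR (Re z) * cos (Im z).
Proof. by rewrite !ceE /cexp ReZ. Qed.

Lemma Im_cexp z : Im (ce z) = expR (Re z) * sin (Im z).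
Proof. by rewrite !ceE /cexp ImZ. Qed.

Lemma Re_expi t : Re (expi t) = cos t. Proof. by []. Qed.
Lemma Im_expi t : Im (expi t) = sin t. Proof. by []. Qed.

End ComplexModulus.


(** * Derivatives along real lines and the mean value inequality *)

Section LineDerivative.
Context {R : realType}.
Implicit Types (f g : R -> R[i]) (z w : R[i]) (t x y : R).

Lemma is_derive_real_cst (c t : R) : is_derive t 1 (fun=> c) 0.
Proof. exact: (is_derive_cst c). Qed.

Definition is_cderive f t (d : R[i]) :=
  is_derive t 1 (fun r => Re (f r)) (Re d) /\
  is_derive t 1 (fun r => Im (f r)) (Im d).

Lemma is_cderive_eq f t d d' : is_cderive f t d -> d = d' -> is_cderive f t d'.
Proof. by move=> H <-. Qed.

Lemma is_cderive_ext f g t d : f =1 g -> is_cderive f t d -> is_cderive g t d.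
Proof. by move=> /funext ->. Qed.

Lemma is_cderive_cst z t : is_cderive (fun=> z) t 0.
Proof. by split; apply: is_derive_cst. Qed.

Lemma is_cderiveD f g t d e : is_cderive f t d -> is_cderive g t e ->
  is_cderive (fun r => f r + g r) t (d + e).
Proof.
move=> [f1 f2] [g1 g2]; split.
- rewrite (_ : (fun r => _) = (fun r => Re (f r)) \+ (fun r => Re (g r))); last first.
    by apply/funext => r /=; rewrite ReD.
  by rewrite ReD; apply: is_deriveD.
- rewrite (_ : (fun r => _) = (fun r => Im (f r)) \+ (fun r => Im (g r))); last first.
    by apply/funext => r /=; rewrite ImD.
  by rewrite ImD; apply: is_deriveD.
Qed.

Lemma is_cderiveM f g t d e : is_cderive f t d -> is_cderive g t e ->
  is_cderive (fun r => f r * g r) t (d * g t + f t * e).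
Proof.
move=> [f1 f2] [g1 g2]; split.
- rewrite (_ : (fun r => _) = (fun r => Re (f r)) * (fun r => Re (g r))
     - (fun r => Im (f r)) * (fun r => Im (g r))); last first.
    by apply/funext => r /=; rewrite ReM.
  apply: is_derive_eq; rewrite ReD !ReM /GRing.scale /=; ring.
- rewrite (_ : (fun r => _) = (fun r => Re (f r)) * (fun r => Im (g r))
     + (fun r => Im (f r)) * (fun r => Re (g r))); last first.
    by apply/funext => r /=; rewrite ImM.
  apply: is_derive_eq; rewrite ImD !ImM /GRing.scale /=; ring.
Qed.

Lemma is_cderiveZ z f t d : is_cderive f t d ->
  is_cderive (fun r => z * f r) t (z * d).
Proof.
move=> fd; apply: is_cderive_eq (is_cderiveM (is_cderive_cst z t) fd) _.
by rewrite mul0r add0r.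
Qed.

Lemma is_cderiveN f t d : is_cderive f t d -> is_cderive (fun r => - f r) t (- d).
Proof.
move=> fd; apply: is_cderive_ext (_ : is_cderive (fun r => -1 * f r) _ _).
  by move=> r; rewrite mulN1r.
by apply: is_cderive_eq (is_cderiveZ _ fd) _; rewrite mulN1r.
Qed.

Lemma is_cderiveB f g t d e : is_cderive f t d -> is_cderive g t e ->
  is_cderive (fun r => f r - g r) t (d - e).
Proof. by move=> fd ge; apply: is_cderiveD => //; apply: is_cderiveN. Qed.

Lemma is_cderive_sum (I : Type) (s : seq I) (f : I -> R -> R[i]) t (d : I -> R[i]) :
  (forall i, is_cderive (f i) t (d i)) ->
  is_cderive (fun r => \sum_(i <- s) f i r) t (\sum_(i <- s) d i).
Proof.
move=> fd; elim: s => [|i s IH].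
  rewrite big_nil; apply: is_cderive_ext (is_cderive_cst 0 t).
  by move=> r; rewrite big_nil.
rewrite big_cons; apply: is_cderive_ext (is_cderiveD (fd i) IH).
by move=> r; rewrite big_cons.
Qed.

Lemma is_cderive_real (f : R -> R) t (d : R) : is_derive t 1 f d ->
  is_cderive (fun r => (f r)%:C) t d%:C.
Proof. by move=> fd; split => //=; apply: is_derive_cst. Qed.

Lemma is_cderive_line z w t : is_cderive (fun r => z + r%:C * w) t w.
Proof.
apply: is_cderive_eq.
  apply: is_cderiveD; first exact: is_cderive_cst.
  apply: is_cderiveM; last exact: is_cderive_cst.
  by apply: (@is_cderive_real id); exact: is_derive_id.
by rewrite add0r mulr0 addr0 mul1r.
Qed.

Lemma is_cderive_cexp f t d : is_cderive f t d ->
  is_cderive (fun r => ce (f r)) t (d * ce (f t)).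
Proof.
move=> [f1 f2]; split.
- rewrite (_ : (fun r => _) = (expR \o (fun r => Re (f r))) *
     (cos \o (fun r => Im (f r)))); last first.
    by apply/funext => r; rewrite Re_cexp.
  have h1 := is_derive1_comp (is_derive_expR (Re (f t))) f1.
  have h2 := is_derive1_comp (is_derive_cos (Im (f t))) f2.
  apply: is_derive_eq; rewrite ReM Re_cexp Im_cexp /GRing.scale /=; ring.
- rewrite (_ : (fun r => _) = (expR \o (fun r => Re (f r))) *
     (sin \o (fun r => Im (f r)))); last first.
    by apply/funext => r; rewrite Im_cexp.
  have h1 := is_derive1_comp (is_derive_expR (Re (f t))) f1.
  have h2 := is_derive1_comp (is_derive_sin (Im (f t))) f2.
  apply: is_derive_eq; rewrite ImM Re_cexp Im_cexp /GRing.scale /=; ring.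
Qed.

End LineDerivative.

Section MeanValue.
Context {R : realType}.
Implicit Types (f : R -> R[i]) (z w : R[i]) (t x y : R).

Lemma is_derive_le (f g df dg : R -> R) (a b : R) : a <= b ->
  (forall t, a <= t <= b -> is_derive t 1 f (df t)) ->
  (forall t, a <= t <= b -> is_derive t 1 g (dg t)) ->
  (forall t, a <= t <= b -> df t <= dg t) -> f b - f a <= g b - g a.
Proof.
move=> ab fd gd le_fg.
have hd t : a <= t <= b -> is_derive t 1 (g - f) (dg t - df t).
  by move=> tab; have := fd _ tab; have := gd _ tab => ? ?; apply: is_deriveB.
have [c] : exists2 c, c \in `[a, b] &
    (g - f) b - (g - f) a = (dg c - df c) * (b - a).
  apply: (@MVT_segment R (g - f) (fun t => dg t - df t)) => //.
    move=> t; rewrite in_itv /= => /andP[at_ tb].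
    by apply: hd; rewrite !ltW.
  apply: derivable_within_continuous => t; rewrite in_itv /= => /hd.
  by move=> [].
rewrite in_itv /= => cab; rewrite -subr_ge0 => E.
have -> : g b - g a - (f b - f a) = (g - f) b - (g - f) a.
  by rewrite !fctE; ring.
by rewrite E mulr_ge0 ?subr_ge0// le_fg.
Qed.

(** Pairing [f] with the conjugate of its increment gives a real function, to which the real mean
    value theorem applies. This replaces the estimate of a contour integral by the integral of the
    modulus: [g] is an antiderivative of the bound. *)
Lemma complex_mvt f df (g dg : R -> R) (a b : R) : a <= b ->
  (forall t, a <= t <= b -> is_cderive f t (df t)) ->
  (forall t, a <= t <= b -> is_derive t 1 g (dg t)) ->
  (forall t, a <= t <= b -> cmod (df t) <= dg t) ->
  cmod (f b - f a) <= g b - g a.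
Proof.
move=> ab fd gd le_fg; set w := f b - f a.
have [w0|w0] := eqVneq (cmod w) 0.
  have := @is_derive_le (fun=> 0) g (fun=> 0) dg a b ab.
  rewrite subr0 w0; apply=> // t tab.
  by apply: le_trans (le_fg _ tab); exact: cmod_ge0.
have wgt0 : 0 < cmod w by rewrite lt_neqAle eq_sym w0 cmod_ge0.
have E : cmod w * cmod w = Re (conjc w * f b) - Re (conjc w * f a).
  rewrite -ReB -mulrBr -/w ReM ReJ ImJ -expr2 cmod_sqr; ring.
rewrite -(ler_pM2l wgt0) E.
have -> : cmod w * (g b - g a) = cmod w * g b - cmod w * g a by ring.
apply: (@is_derive_le (fun t => Re (conjc w * f t)) (fun t => cmod w * g t)
   (fun t => Re (conjc w * df t)) (fun t => cmod w * dg t)) => //.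
- by move=> t tab; have [] := is_cderiveZ (conjc w) (fd _ tab).
- move=> t tab; have := gd _ tab => ?.
  rewrite (_ : (fun t => cmod w * g t) = (cmod w *: g)); last by [].
  by apply: is_deriveZ.
- move=> t tab; apply: le_trans (ler_Re_cmod _) _.
  by rewrite cmodM cmodJ ler_pM2l// le_fg.
Qed.

Lemma is_cderive0_cst f : (forall t, is_cderive f t 0) -> forall a b, f a = f b.
Proof.
move=> fd; suff H a b : a <= b -> f b = f a.
  by move=> a b; have [/H|/ltW/H] := leP a b.
move=> ab; apply/eqP; rewrite -subr_eq0; apply/eqP/cmod_eq0.
apply/eqP; rewrite eq_le cmod_ge0 andbT.
have := @complex_mvt f (fun=> 0) (fun=> 0) (fun=> 0) a b ab.
rewrite subr0; apply=> t _ //.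
by rewrite cmod0.
Qed.

Lemma is_derive_expn (n : nat) t :
  is_derive t 1 (fun r : R => r ^+ n.+1) (n.+1%:R * t ^+ n).
Proof.
rewrite (_ : (fun r => _) = (@id R) ^+ n.+1).
  apply: is_derive_eq; rewrite /GRing.scale /= mulr1 //.
by apply/funext => r; rewrite fctE.
Qed.

(** The factor is e^max(Re w, 0) and not e^|w|: in the left half-plane the remainder is no larger
    than the first omitted term, which is what the algebraic expansion relies on. *)
Lemma cexp_taylor w (n : nat) :
  cmod (ce w - \sum_(i < n) w ^+ i / i`!%:R)
    <= cmod w ^+ n / n`!%:R * expR (Num.max (Re w) 0).
Proof.
pose T n (r : R) := ce (r%:C * w) - \sum_(i < n) (r%:C * w) ^+ i / i`!%:R.
(* Induction along the segment from 0 to w: the remainder of order m + 1 vanishes at 0, and its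
   derivative is w times the remainder of order m. *)
have key m r : 0 <= r <= 1 ->
   cmod (T m r) <= expR (Num.max (Re w) 0) * (cmod w ^+ m / m`!%:R) * r ^+ m.
  elim: m r => [|m IH] r /andP[r0 r1].
    rewrite /T big_ord0 subr0 cmod_cexp !expr0 fact0 divr1 !mulr1 ReZ ler_expR.
    rewrite le_max; have [w0|w0] := leP 0 (Re w).
      by rewrite ler_piMl.
    by rewrite (mulr_ge0_le0 r0 (ltW w0)) orbT.
  have T0 : T m.+1 0 = 0.
    rewrite /T rmorph0 mul0r cexp0 big_ord_recl expr0 fact0 divr1.
    by rewrite big1 ?addr0 ?subrr// => i _; rewrite lift0 expr0n /= mul0r.
  rewrite -(subr0 (T m.+1 r)) -T0.
  set c := expR _; pose d := c * (cmod w ^+ m.+1 / m.+1`!%:R).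
  rewrite -/d -(subr0 (d * _)).
  have -> : d * r ^+ m.+1 - 0 = d * r ^+ m.+1 - d * 0 ^+ m.+1.
    by rewrite expr0n mulr0.
  apply: (@complex_mvt (T m.+1) (fun t => w * T m t) (fun t => d * t ^+ m.+1)
            (fun t => d * (m.+1%:R * t ^+ m))) => //.
  - move=> t _; rewrite /T.
    have lin : is_cderive (fun r : R => r%:C * w) t w.
      apply: is_cderive_ext (is_cderive_line 0 w t).
      by move=> s; rewrite add0r.
    rewrite mulrBr; apply: is_cderiveB; first exact: is_cderive_cexp.
    apply: (@is_cderive_ext _ (fun r : R => 1 + \sum_(i < m) (r%:C * w) ^+ i.+1 / i.+1`!%:R)).
      by move=> s; rewrite big_ord_recl expr0 fact0 divr1.
    rewrite -[X in is_cderive _ _ X]add0r; apply: is_cderiveD; first exact: is_cderive_cst.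
    rewrite mulr_sumr; apply: is_cderive_sum => i.
    apply: (@is_cderive_ext _ (fun r : R => (w ^+ i.+1 / i.+1`!%:R) * (r ^+ i.+1)%:C)).
      by move=> s; rewrite exprMn rmorphXn /=; ring.
    apply: is_cderive_eq.
      by apply: is_cderiveZ; apply: is_cderive_real; exact: is_derive_expn.
    rewrite rmorphM /= rmorphXn /= rmorph_nat factS natrM exprMn exprS.
    field.
    by rewrite pnatr_eq0 -lt0n fact_gt0 /= addrC natr1 pnatr_eq0.
  - move=> t _.
    rewrite (_ : (fun t => _) = (d *: (fun r : R => r ^+ m.+1))); last by [].
    by apply: is_deriveZ; exact: is_derive_expn.
  - move=> t /andP[t0 tr].
    have -> : d * (m.+1%:R * t ^+ m) = cmod w * (c * (cmod w ^+ m / m`!%:R) * t ^+ m).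
      rewrite /d factS natrM exprS; field.
      by rewrite pnatr_eq0 -lt0n fact_gt0 /= addrC natr1 pnatr_eq0.
    rewrite cmodM ler_wpM2l ?cmod_ge0// IH// t0 /=.
    exact: le_trans r1.
have := key n 1; rewrite ler01 lexx => /(_ isT).
by rewrite expr1n mulr1 mulrC /T !mul1r.
Qed.

End MeanValue.

(** * Entire functions and their primitives *)

Section RealPrimitive.
Context {R : realType}.
Notation mu := (@lebesgue_measure R).
Implicit Types (r t x y : R).

Lemma is_derive_continuous (f df : R -> R) :
  (forall t, is_derive t 1 f (df t)) -> continuous f.
Proof.
move=> fd t; apply: differentiable_continuous; apply/derivable1_diffP.
by have [] := fd t.
Qed.

Lemma FTC01 (F f : R -> R) : (forall t, is_derive t 1 F (f t)) ->
  continuous f -> \int[mu]_(t in `[0, 1]) f t = F 1 - F 0.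
Proof.
move=> Fd cf; have cF := is_derive_continuous Fd.
rewrite /Rintegral (@continuous_FTC2 R f F 0 1) ?ltr01//.
- exact: continuous_subspaceT.
- split.
  + by move=> t _; have [] := Fd t.
  + by apply: cvg_at_right_filter; exact: cF.
  + by apply: cvg_at_left_filter; exact: cF.
- by move=> t _; rewrite derive1E; have [_ ->] := Fd t.
Qed.

(** Differentiation under the integral sign, where the integral of the derivative is evaluated at
    once by an antiderivative [Psi] in t. *)
Lemma is_derive_under01 (phi psi : R -> R -> R) (Psi : R -> R) (r0 B : R) :
  (forall r t, is_derive r 1 (phi ^~ t) (psi r t)) ->
  (forall r, continuous (phi r)) ->
  (forall r t, r0 - 1 < r < r0 + 1 -> 0 <= t <= 1 -> `|psi r t| <= B) ->
  (forall t, is_derive t 1 Psi (psi r0 t)) -> continuous (psi r0) ->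
  is_derive r0 1 (fun r => \int[mu]_(t in `[0, 1]) phi r t) (Psi 1 - Psi 0).
Proof.
move=> phid phic psiB Psid psic.
have B0 : 0 <= B.
  apply: le_trans (normr_ge0 (psi r0 0)) _.
  by apply: psiB; rewrite ?lexx ?ler01// ltrBlDr !ltrDl ltr01.
have Ir0 : `](r0 - 1), (r0 + 1)[%classic r0.
  by rewrite /= in_itv /= ltrBlDr !ltrDl ltr01.
have int_cont (f : R -> R) : continuous f -> mu.-integrable `[0, 1] (EFin \o f).
  move=> cf; apply: continuous_compact_integrable; first exact: segment_compact.
  exact: continuous_subspaceT.
have d1E x y : partial1of2 phi x y = psi x y.
  by rewrite partial1of2E; have [_ ->] := phid x y.
have h1 x : `](r0 - 1), (r0 + 1)[%classic x -> mu.-integrable `[0, 1] (EFin \o phi x).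
  by move=> _; exact: int_cont.
have h2 x y : `](r0 - 1), (r0 + 1)[%classic x -> `[0, 1]%classic y ->
    derivable (phi ^~ y) x 1.
  by move=> _ _; have [] := phid x y.
have h3 (y : R) : 0 <= (fun=> B) y by [].
have h4 : mu.-integrable `[0, 1] (EFin \o (fun _ : R => B)).
  by apply: int_cont => x; exact: cvg_cst.
have h5 x y : `](r0 - 1), (r0 + 1)[%classic x -> `[0, 1]%classic y ->
    `|partial1of2 phi x y| <= (fun=> B) y.
  rewrite /= !in_itv /= => xI yI; rewrite d1E; exact: psiB.
have m01 : measurable (`[0, 1]%classic : set R) by exact: measurable_itv.
split.
  by apply: (@derivable_under_integral R _ _ mu phi `[0, 1]%classic m01 r0 (r0 - 1) (r0 + 1) Ir0 h1 h2 (fun=> B) h3 h4 h5).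
rewrite -derive1E (@differentiation_under_integral R _ _ mu phi `[0, 1]%classic m01 r0 (r0 - 1) (r0 + 1) Ir0 h1 h2 (fun=> B) h3 h4 h5).
under eq_Rintegral do rewrite d1E.
exact: FTC01.
Qed.

End RealPrimitive.

(* For entire G the primitive vanishing at 0; a contour integral of G is encoded as a
   difference of values of [prim G]. *)
HB.lock Definition prim (R : realType) (G : R[i] -> R[i]) (z : R[i]) : R[i] :=
  (\int[@lebesgue_measure R]_(t in `[0, 1]) Re (z * G (t%:C * z))) +i*
  (\int[@lebesgue_measure R]_(t in `[0, 1]) Im (z * G (t%:C * z))).

Section ComplexPrimitive.
Context {R : realType}.
Implicit Types (G : R[i] -> R[i]) (z w : R[i]) (r t : R).

(* Holomorphy is only ever used along straight lines. *)
Definition hol G G1 := forall z w t,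
  is_cderive (fun r => G (z + r%:C * w)) t (w * G1 (z + t%:C * w)).

Definition locally_bounded G := forall rho : R, exists B : R,
  forall z, cmod z <= rho -> cmod (G z) <= B.

(** With u = z + r w, the r-derivative of u G(t u) is also the t-derivative of w t G(t u);
    integrated over t in [0, 1] it gives w G(u). The second derivative [G2] serves for continuity in
    t of the differentiated integrand. *)
Lemma hol_prim G G1 G2 : hol G G1 -> hol G1 G2 ->
  locally_bounded G -> locally_bounded G1 -> hol (prim G) G.
Proof.
move=> hG hG1 bG bG1 z w r0; rewrite prim.unlock.
pose phi (r t : R) := (z + r%:C * w) * G (t%:C * (z + r%:C * w)).
pose psi (r t : R) := w * G (t%:C * (z + r%:C * w)) +
  (z + r%:C * w) * (t%:C * w * G1 (t%:C * (z + r%:C * w))).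
pose Psi (t : R) := w * (t%:C * G (t%:C * (z + r0%:C * w))).
have hGt (u : R[i]) t : is_cderive (fun t => G (t%:C * u)) t (u * G1 (t%:C * u)).
  have := hG 0 u t; rewrite add0r; apply: is_cderive_ext => s; rewrite add0r//.
have hG1t (u : R[i]) t : is_cderive (fun t => G1 (t%:C * u)) t (u * G2 (t%:C * u)).
  have := hG1 0 u t; rewrite add0r; apply: is_cderive_ext => s; rewrite add0r//.
have id_d t : is_cderive (fun t : R => t%:C) t 1.
  by apply: (@is_cderive_real _ id); exact: is_derive_id.
have phid r t : is_cderive (phi ^~ t) r (psi r t).
  apply: is_cderiveM; first exact: is_cderive_line.
  have := hG (t%:C * z) (t%:C * w) r.
  rewrite !mulrDr ![t%:C * (r%:C * w)]mulrCA; apply: is_cderive_ext => s.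
  by rewrite mulrDr mulrCA.
have phit r t : is_cderive (phi r) t ((z + r%:C * w) * ((z + r%:C * w) *
    G1 (t%:C * (z + r%:C * w)))).
  exact: is_cderiveZ.
have Psid t : is_cderive Psi t (psi r0 t).
  apply: is_cderive_eq.
    by apply: is_cderiveZ; apply: is_cderiveM; [exact: id_d|exact: hGt].
  by rewrite /psi; ring.
have psit t : is_cderive (psi r0) t
   (w * ((z + r0%:C * w) * G1 (t%:C * (z + r0%:C * w))) + (z + r0%:C * w) *
      (w * G1 (t%:C * (z + r0%:C * w)) + t%:C * w *
         ((z + r0%:C * w) * G2 (t%:C * (z + r0%:C * w))))).
  apply: is_cderiveD; first exact: is_cderiveZ.
  apply: is_cderiveZ; apply: is_cderiveM => //.
  apply: is_cderive_eq (is_cderiveM (id_d t) (is_cderive_cst w t)) _.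
  by rewrite mul1r mulr0 addr0.
pose rho := cmod z + (`|r0| + 1) * cmod w.
have [B0 hB0] := bG rho; have [B1 hB1] := bG1 rho.
have psiB r t : r0 - 1 < r < r0 + 1 -> 0 <= t <= 1 ->
    cmod (psi r t) <= cmod w * B0 + rho * (cmod w * B1).
  move=> /andP[r1 r2] /andP[t0 t1].
  have rho0 : 0 <= rho by rewrite addr_ge0 ?mulr_ge0 ?addr_ge0 ?cmod_ge0.
  have le_r : `|r| <= `|r0| + 1.
    rewrite -[r](subrK r0) addrC (le_trans (ler_normD _ _))// lerD2l.
    by rewrite ler_norml; apply/andP; split; lra.
  have le_u : cmod (z + r%:C * w) <= rho.
    rewrite (le_trans (cmodD _ _))// lerD2l cmodM cmod_real.
    by rewrite ler_wpM2r ?cmod_ge0.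
  have le_tu : cmod (t%:C * (z + r%:C * w)) <= rho.
    rewrite cmodM cmod_real ger0_norm// (le_trans _ le_u)//.
    by rewrite ler_piMl ?cmod_ge0.
  rewrite (le_trans (cmodD _ _))// lerD//.
    by rewrite cmodM ler_wpM2l ?cmod_ge0 ?hB0.
  rewrite cmodM ler_pM ?cmod_ge0// !cmodM cmod_real ger0_norm//.
  rewrite ler_pM ?mulr_ge0 ?cmod_ge0 ?hB1//.
  by rewrite ler_piMl ?cmod_ge0.
have E : w * G (z + r0%:C * w) = Psi 1 - Psi 0.
  by rewrite /Psi mul0r mulr0 subr0 !mul1r.
rewrite E /is_cderive ReB ImB; split.
- apply: (@is_derive_under01 _ (fun r t => Re (phi r t)) (fun r t => Re (psi r t))
    (fun t => Re (Psi t)) r0 _).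
  + by move=> r t; have [] := phid r t.
  + by move=> r; apply: is_derive_continuous => t; have [h _] := phit r t; exact: h.
  + by move=> r t rI tI; apply: le_trans (Re_le_cmod _) (psiB _ _ rI tI).
  + by move=> t; have [] := Psid t.
  + by apply: is_derive_continuous => t; have [h _] := psit t; exact: h.
- apply: (@is_derive_under01 _ (fun r t => Im (phi r t)) (fun r t => Im (psi r t))
    (fun t => Im (Psi t)) r0 _).
  + by move=> r t; have [] := phid r t.
  + by move=> r; apply: is_derive_continuous => t; have [_ h] := phit r t; exact: h.
  + by move=> r t rI tI; apply: le_trans (Im_le_cmod _) (psiB _ _ rI tI).
  + by move=> t; have [] := Psid t.
  + by apply: is_derive_continuous => t; have [_ h] := psit t; exact: h.
Qed.

Lemma prim0 G : prim G 0 = 0.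
Proof.
rewrite prim.unlock; under eq_Rintegral do rewrite mul0r /=.
under [X in _ +i* X]eq_Rintegral do rewrite mul0r /=.
by rewrite !Rintegral_cst//= !mul0r.
Qed.

(** Stands in for Cauchy's theorem: an identity between contour integrals is proved by exhibiting
    two functions with the same derivative. *)
Lemma hol_unique F1 F2 G : hol F1 G -> hol F2 G ->
  forall z w, F1 z - F2 z = F1 w - F2 w.
Proof.
move=> h1 h2 z w.
pose d (r : R) := F1 (w + r%:C * (z - w)) - F2 (w + r%:C * (z - w)).
have dd t : is_cderive d t 0.
  by apply: is_cderive_eq (is_cderiveB (h1 _ _ _) (h2 _ _ _)) _; rewrite subrr.
have := is_cderive0_cst dd 1 0.
by rewrite /d !mul0r !mul1r !addr0 [w + _]addrC subrK.
Qed.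

Lemma is_cderive_conj f t d : is_cderive f t d ->
  is_cderive (fun r : R => conjc (f r)) t (conjc d).
Proof.
move=> [h1 h2]; split.
  rewrite ReJ (_ : (fun r => _) = (fun r => Re (f r)))//.
  by apply/funext => r; rewrite ReJ.
rewrite ImJ (_ : (fun r => _) = \- (fun r => Im (f r))); first exact: is_deriveN.
by apply/funext => r; rewrite ImJ.
Qed.

Lemma hol_conj F G : hol F G ->
  hol (fun z => conjc (F (conjc z))) (fun z => conjc (G (conjc z))).
Proof.
move=> h z w t.
have E (r : R) : conjc (z + r%:C * w) = conjc z + r%:C * conjc w.
  by rewrite rmorphD rmorphM /= oppr0.
have := is_cderive_conj (h (conjc z) (conjc w) t).
rewrite -E rmorphM /= conjcK; apply: is_cderive_ext => r.
by rewrite E.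
Qed.

Lemma hol_affine F G (a b : R[i]) : hol F G ->
  hol (fun z => F (a * z + b)) (fun z => a * G (a * z + b)).
Proof.
move=> h z w t.
have E (r : R) : a * (z + r%:C * w) + b = (a * z + b) + r%:C * (a * w) by ring.
apply: (@is_cderive_ext _ (fun r => F ((a * z + b) + r%:C * (a * w)))).
  by move=> r; rewrite E.
by apply: is_cderive_eq (h _ _ _) _; rewrite E; ring.
Qed.

Lemma holD F1 G1 F2 G2 : hol F1 G1 -> hol F2 G2 ->
  hol (fun z => F1 z + F2 z) (fun z => G1 z + G2 z).
Proof. by move=> h1 h2 z w t; rewrite mulrDr; exact: is_cderiveD. Qed.

Lemma holM F1 G1 F2 G2 : hol F1 G1 -> hol F2 G2 ->
  hol (fun z => F1 z * F2 z) (fun z => G1 z * F2 z + F1 z * G2 z).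
Proof.
move=> h1 h2 z w t; apply: is_cderive_eq (is_cderiveM (h1 _ _ _) (h2 _ _ _)) _.
ring.
Qed.

Lemma holZ (c : R[i]) F G : hol F G -> hol (fun z => c * F z) (fun z => c * G z).
Proof. by move=> h z w t; rewrite mulrCA; exact: is_cderiveZ. Qed.

Lemma hol_cst (c : R[i]) : hol (fun=> c) (fun=> 0).
Proof. by move=> z w t; rewrite mulr0; exact: is_cderive_cst. Qed.

Lemma hol_id : hol id (fun=> 1).
Proof. by move=> z w t; rewrite mulr1; exact: is_cderive_line. Qed.

Lemma hol_cexp F G : hol F G -> hol (fun z => ce (F z)) (fun z => G z * ce (F z)).
Proof. by move=> h z w t; rewrite mulrA; exact: is_cderive_cexp. Qed.

Lemma hol_ext F F' G G' : F =1 F' -> G =1 G' -> hol F G -> hol F' G'.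
Proof. by move=> /funext -> /funext ->. Qed.

Lemma hol_sum (I : Type) (s : seq I) (F G : I -> R[i] -> R[i]) :
  (forall i, hol (F i) (G i)) ->
  hol (fun z => \sum_(i <- s) F i z) (fun z => \sum_(i <- s) G i z).
Proof.
by move=> h z w t; rewrite mulr_sumr; apply: is_cderive_sum => i; exact: h.
Qed.

End ComplexPrimitive.

(** * Limits of primitives and elementary inequalities *)

Section TailLimit.
Context {R : realType}.
Implicit Types (F G : R[i] -> R[i]) (z w : R[i]) (r s t x y : R).

(** With e(s) = C e^(- N s) / N the function f - e is nondecreasing and lies below every value of f
    + e; its supremum is the limit, squeezed between the two. *)
Lemma real_tail_limit (f df : R -> R) (C N S : R) : 0 < N ->
  (forall s, is_derive s 1 f (df s)) ->
  (forall s, S <= s -> `|df s| <= C * expR (- N * s)) ->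
  exists l, forall s, S <= s -> `|f s - l| <= C / N * expR (- N * s).
Proof.
move=> N0 fd le_f.
have gd s : is_derive s 1 (fun s => - (C / N) * expR (- N * s)) (C * expR (- N * s)).
  have h : is_derive s 1 (fun s : R => - N * s) (- N).
    rewrite (_ : (fun s : R => _) = (- N) *: (@id R)); last by [].
    by apply: is_derive_eq; rewrite /GRing.scale /= mulr1.
  have := is_derive1_comp (is_derive_expR (- N * s)) h => h2.
  rewrite (_ : (fun s : R => _) = (- (C / N)) *: (expR \o (fun s => - N * s))); last by [].
  apply: is_derive_eq; rewrite /GRing.scale /=; field.
  by rewrite gt_eqF.
have le_diff s1 s2 : S <= s1 -> s1 <= s2 -> `|f s2 - f s1| <=
    C / N * expR (- N * s1) - C / N * expR (- N * s2).
  move=> S1 s12; have E : C / N * expR (- N * s1) - C / N * expR (- N * s2)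
     = - (C / N) * expR (- N * s2) - (- (C / N) * expR (- N * s1)) by ring.
  rewrite E ler_norml; apply/andP; split.
    rewrite lerNl.
    have -> : - (f s2 - f s1) = (\- f) s2 - (\- f) s1 by rewrite /=; ring.
    apply: (@is_derive_le R (\- f) (fun s => - (C / N) * expR (- N * s)) (fun s => - df s)
       (fun s => C * expR (- N * s))) => // t /andP[t1 t2].
    apply: le_trans (le_f t _); last exact: le_trans t1.
    by rewrite -normrN ler_norm.
  apply: (@is_derive_le R f (fun s => - (C / N) * expR (- N * s)) df
     (fun s => C * expR (- N * s))) => // t /andP[t1 t2].
  apply: le_trans (le_f t _); last exact: le_trans t1.
  by rewrite ler_norm.
have C0 : 0 <= C.
  have := le_trans (normr_ge0 _) (le_f S (lexx _)).
  by rewrite pmulr_lge0 ?expR_gt0.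
have CN0 : 0 <= C / N by rewrite divr_ge0// ltW.
have [e ee] : exists e, forall s, e s = C / N * expR (- N * s).
  by exists (fun s => C / N * expR (- N * s)).
have e0 s : 0 <= e s by rewrite ee mulr_ge0 ?expR_ge0.
have {}le_diff s1 s2 : S <= s1 -> s1 <= s2 -> `|f s2 - f s1| <= e s1 - e s2.
  by move=> h1 h2; rewrite !ee; exact: le_diff.
pose g s := f s - e s.
have g_nd s1 s2 : S <= s1 -> s1 <= s2 -> g s1 <= g s2.
  move=> h1 h2; have := le_diff _ _ h1 h2; rewrite ler_norml => /andP[h3 _].
  by rewrite /g; lra.
have g_le s1 s2 : S <= s1 -> S <= s2 -> g s1 <= f s2 + e s2.
  move=> h1 h2; have [h12|/ltW h21] := leP s1 s2.
    by apply: le_trans (g_nd _ _ h1 h12) _; have := e0 s2; rewrite /g; lra.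
  have := le_diff _ _ h2 h21; rewrite ler_norml => /andP[_ h3].
  by have := e0 s1; have := e0 s2; rewrite /g; lra.
pose A := [set g s | s in [set s | S <= s]].
have A0 : A !=set0 by exists (g S), S => //=.
have ubA s : S <= s -> ubound A (f s + e s).
  by move=> Ss _ [r Sr <-]; exact: g_le.
have supA : has_sup A.
  by split => //; exists (f S + e S); exact: ubA.
exists (sup A) => s Ss; rewrite -ee ler_norml; apply/andP; split.
  have : sup A <= f s + e s by apply: ge_sup => //; exact: ubA.
  by lra.
have : g s <= sup A by apply: ub_le_sup; [have [] := supA|exists s].
by rewrite /g; lra.
Qed.

Lemma tail_limit (f df : R -> R[i]) (C N S : R) : 0 < N ->
  (forall s, is_cderive f s (df s)) ->
  (forall s, S <= s -> cmod (df s) <= C * expR (- N * s)) ->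
  exists l : R[i], forall s, S <= s -> cmod (f s - l) <= 2 * C / N * expR (- N * s).
Proof.
move=> N0 fd le_f.
have [|lr hr] := @real_tail_limit (fun s => Re (f s)) (fun s => Re (df s)) C N S N0 (fun s => (fd s).1).
  by move=> s Ss; apply: le_trans (Re_le_cmod _) (le_f s Ss).
have [|li hi] := @real_tail_limit (fun s => Im (f s)) (fun s => Im (df s)) C N S N0 (fun s => (fd s).2).
  by move=> s Ss; apply: le_trans (Im_le_cmod _) (le_f s Ss).
exists (lr +i* li) => s Ss; apply: le_trans (cmod_le_ReIm _) _.
rewrite ReB ImB /=; have := hr s Ss; have := hi s Ss.
have -> : 2 * C / N * expR (- N * s) = C / N * expR (- N * s) + C / N * expR (- N * s) by ring.
move=> h1 h2; exact: lerD.
Qed.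

End TailLimit.

Section ExpDominate.
Context {R : realType}.
Implicit Types (r s t x y k A : R).

Lemma exp_dominate (sigma k A : R) : 0 < sigma < 1 -> 0 < k ->
  exists2 C, 0 <= C & forall s, A * expR (sigma * s) <= k * expR s + C.
Proof.
move=> /andP[s0 s1] k0.
have [A0|A0] := leP A 0.
  exists 0 => // s; rewrite addr0 (@le_trans _ _ 0)//.
    by rewrite mulr_le0_ge0 ?expR_ge0.
  by rewrite mulr_ge0 ?expR_ge0// ltW.
(* The point where A e^(sigma s) = k e^s: beyond it the right side wins, before it the left side is
   at most its value at [S]. *)
pose S := ln (A / k) / (1 - sigma).
exists (A * expR (sigma * S)).
  by rewrite mulr_ge0 ?expR_ge0// ltW.
move=> s; have [Ss|sS] := leP S s.
  rewrite (@le_trans _ _ (k * expR s))//; last first.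
    by rewrite lerDl mulr_ge0 ?expR_ge0// ltW.
  have -> : sigma * s = s - (1 - sigma) * s by ring.
  have Ak : 0 < A / k by rewrite divr_gt0.
  have : expR (- ((1 - sigma) * s)) <= expR (- ln (A / k)).
    rewrite ler_expR lerN2.
    rewrite -ler_pdivrMl ?subr_gt0// mulrC.
    by [].
  rewrite expRN lnK ?posrE// invf_div => H.
  rewrite expRD mulrCA mulrC ler_wpM2r ?expR_ge0//.
  by rewrite mulrC -ler_pdivlMr.
rewrite (@le_trans _ _ (A * expR (sigma * S)))//.
  by rewrite ler_pM2l// ler_expR ler_pM2l// ltW.
by rewrite lerDr mulr_ge0 ?expR_ge0// ltW.
Qed.

Lemma lin_dominate (k B : R) : 0 < k ->
  exists2 C, 0 <= C & forall s, 0 <= s -> B * s <= k * expR s + C.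
Proof.
move=> k0; have h : 0 < (2^-1 : R) < 1 by rewrite invr_gt0 ltr0n /= invf_lt1 ?ltr1n.
have [C C0 hC] := @exp_dominate 2^-1 k (2 * `|B|) h k0.
exists C => // s s0; apply: le_trans (hC s).
rewrite (@le_trans _ _ (`|B| * s))//; first by rewrite ler_wpM2r// ler_norm.
rewrite -mulrA mulrCA ler_wpM2l//.
have := expR_ge1Dx (2^-1 * s); lra.
Qed.

End ExpDominate.

Section Cosine.
Context {R : realType}.
Implicit Types (x y chi : R).

Lemma cos_le_max x a b : pi / 2 < a -> a <= x <= b -> b < 3 * pi / 2 ->
  cos x <= Num.max (cos a) (cos b) :> R.
Proof.
move=> ha /andP[ax xb] hb; have pi0 := pi_gt0 R; rewrite le_max.
have mono := @ltr_cos R.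
have cle u v : 0 <= u -> u <= v -> v <= pi -> cos v <= cos u :> R.
  move=> u0 uv v1; rewrite leNgt; apply/negP => h.
  have uI : u \in `[0, pi] by rewrite in_itv /= u0 (le_trans uv v1).
  have vI : v \in `[0, pi] by rewrite in_itv /= v1 (le_trans u0 uv).
  by move: h; rewrite (mono _ _ vI uI) ltNge uv.
have [xp|xp] := leP x pi.
  by rewrite cle//; lra.
apply/orP; right.
have E (u : R) : cos u = cos (pi *+ 2 - u) :> R.
  by rewrite -cosN -(cosD2pi (- u)) addrC.
by rewrite (E x) (E b) cle//; rewrite -mulr_natl; lra.
Qed.

Lemma cos_lt0 x : pi / 2 < x < 3 * pi / 2 -> cos x < 0 :> R.
Proof.
move=> /andP[x1 x2]; have -> : x = (x - pi) + pi by ring.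
rewrite cosDpi oppr_lt0; apply: cos_gt0_pihalf; apply/andP; split; lra.
Qed.

(** Up to 1/2 the slope of sin is at least 1/2; from there to pi/2 < 2 the monotonicity of sin gives
    at least 1/4, hence x / 8. *)
Lemma sin_ge_lin x : 0 <= x <= pi / 2 -> x / 8 <= sin x :> R.
Proof.
move=> /andP[x0 x1].
have cos_ge t : 0 <= t -> 1 - t <= cos t :> R.
  move=> t0; have := @is_derive_le R (fun t => - cos t) id (fun t => sin t) (fun=> 1) 0 t t0.
  have h1 : forall t0 : R, 0 <= t0 <= t -> is_derive t0 1 (fun t1 : R => - cos t1) (sin t0).
    move=> u _; rewrite -[sin u]opprK; exact: is_deriveN.
  move=> /(_ h1 (fun u _ => is_derive_id _ _) (fun u _ => sin_le1 _)).
  by rewrite cos0; lra.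
have sin_small t : 0 <= t <= 1 / 2 -> t / 2 <= sin t :> R.
  move=> /andP[t0 t1].
  have := @is_derive_le R (fun t => t / 2) sin (fun=> 1 / 2) cos 0 t t0.
  have h1 : forall t0 : R, 0 <= t0 <= t -> is_derive t0 1 (fun t1 : R => t1 / 2) (1 / 2).
    move=> u _; rewrite (_ : (fun t1 : R => _) = 2^-1 *: (@id R)); last first.
      by apply/funext => v; rewrite !fctE mulrC.
    by apply: is_derive_eq; rewrite /GRing.scale /= mulr1 div1r.
  move=> /(_ h1 (fun u _ => is_derive_sin _)); rewrite sin0 mul0r !subr0; apply.
  by move=> u /andP[u0 ut]; have := cos_ge u u0; lra.
have [xs|xs] := leP x (1 / 2).
  by have := sin_small x; rewrite x0 xs => /(_ isT); lra.
have pi2 : pi / 2 < 2 :> R by have /andP[] := @pihalf_02 R.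
have : sin (1 / 2) <= sin x :> R.
  have := @is_derive_le R (fun=> 0) sin (fun=> 0) cos (1 / 2) x (ltW xs).
  rewrite subrr subr_ge0; apply=> // t /andP[t1 t2].
  have [->|tn] := eqVneq t (pi / 2); first by rewrite cos_pihalf.
  apply/ltW/cos_gt0_pihalf; have h : t <= pi / 2 by exact: le_trans x1.
  apply/andP; split; last by rewrite lt_neqAle tn h.
  by have := pi_gt0 R; lra.
have h0 : 0 <= (1 / 2 : R) <= 1 / 2 by rewrite lexx divr_ge0.
have := sin_small _ h0; set a := sin (1 / 2); set b := sin x; move: x1 pi2; set c := pi / 2; lra.
Qed.

Lemma cos_le_quad x : 0 <= x <= pi -> cos x <= 1 - x ^+ 2 / 128 :> R.
Proof.
move=> /andP[x0 x1]; set u := x / 2.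
have E : x = u *+ 2 by rewrite /u -mulr_natl; field.
rewrite E cos_mulr2n cos2sin2.
have : u / 8 <= sin u by apply: sin_ge_lin; rewrite /u; apply/andP; split; lra.
have u0 : 0 <= u by rewrite /u; lra.
move=> h; have h2 : (u / 8) ^+ 2 <= sin u ^+ 2.
  by rewrite ler_pXn2r// nnegrE; [rewrite divr_ge0|apply: le_trans h; rewrite divr_ge0].
have -> : (u *+ 2) ^+ 2 / 128 = (u / 8) ^+ 2 * 2 by field.
move: h2; set a := sin u ^+ 2; set b := (u / 8) ^+ 2; lra.
Qed.

End Cosine.

(** * Hankel loop integrals *)

Section ExpFamily.
Context {R : realType}.
Variable sigma : R.
Hypothesis sigma01 : 0 < sigma < 1.
Implicit Types (z c : R[i]) (a w beta chi s t x y k N : R).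

(** With u = e^z this is a u + c u^sigma + beta log u, entire in z; u^(beta - 1) du has become
    e^(beta z) dz. Besides a = 1, the value a = m enters the Gauss limit and a = -1 gives Euler's
    integrals. *)
Definition expo a c beta z : R[i] :=
  a%:C * ce z + c * ce (sigma%:C * z) + beta%:C * z.

Definition loop_exp a c beta z := ce (expo a c beta z).

Lemma hol_expo a c beta : hol (expo a c beta)
  (fun z => a%:C * ce z + c * sigma%:C * ce (sigma%:C * z) + beta%:C).
Proof.
have h1 := holZ a%:C (hol_cexp (@hol_id R)).
have h2 := holZ c (hol_cexp (holZ sigma%:C (@hol_id R))).
have h3 := holZ beta%:C (@hol_id R).
apply: hol_ext (holD (holD h1 h2) h3) => z //.
by rewrite mulr1 mul1r; ring.
Qed.

Lemma hol_loop_exp a c beta : hol (loop_exp a c beta) (fun z =>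
  (a%:C * ce z + c * sigma%:C * ce (sigma%:C * z) + beta%:C) * loop_exp a c beta z).
Proof. exact: hol_cexp (hol_expo a c beta). Qed.

Lemma locally_bounded_exp c : locally_bounded (fun z => ce (c * z)).
Proof.
move=> rho; exists (expR (cmod c * rho)) => z zrho.
rewrite cmod_cexp ler_expR (le_trans (ler_Re_cmod _))// cmodM.
by rewrite ler_wpM2l ?cmod_ge0.
Qed.

Lemma locally_bounded_cst c : locally_bounded (fun=> c).
Proof. by move=> rho; exists (cmod c). Qed.

Lemma locally_boundedD (F G : R[i] -> R[i]) : locally_bounded F ->
  locally_bounded G -> locally_bounded (fun z => F z + G z).
Proof.
move=> hF hG rho; have [A hA] := hF rho; have [B hB] := hG rho.
by exists (A + B) => z zr; rewrite (le_trans (cmodD _ _))// lerD ?hA ?hB.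
Qed.

Lemma locally_boundedM (F G : R[i] -> R[i]) : locally_bounded F ->
  locally_bounded G -> locally_bounded (fun z => F z * G z).
Proof.
move=> hF hG rho; have [A hA] := hF rho; have [B hB] := hG rho.
by exists (A * B) => z zr; rewrite cmodM ler_pM ?cmod_ge0 ?hA ?hB.
Qed.

Lemma locally_bounded_cexp (F : R[i] -> R[i]) : locally_bounded F ->
  locally_bounded (fun z => ce (F z)).
Proof.
move=> hF rho; have [A hA] := hF rho.
exists (expR A) => z zr; rewrite cmod_cexp ler_expR.
exact: le_trans (ler_Re_cmod _) (hA _ zr).
Qed.

Lemma locally_bounded_id : locally_bounded (@id R[i]).
Proof. by move=> rho; exists rho. Qed.

Lemma locally_bounded_cexp_id : locally_bounded (@ce R).
Proof. exact: locally_bounded_cexp locally_bounded_id. Qed.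

Lemma locally_bounded_loop_exp a c beta : locally_bounded (loop_exp a c beta).
Proof.
apply: locally_bounded_cexp; apply: locally_boundedD; first apply: locally_boundedD.
- apply: locally_boundedM; [exact: locally_bounded_cst|exact: locally_bounded_cexp_id].
- by apply: locally_boundedM; [exact: locally_bounded_cst|exact: locally_bounded_exp].
- by apply: locally_boundedM; [exact: locally_bounded_cst|exact: locally_bounded_id].
Qed.

Definition loop_prim a c beta := prim (loop_exp a c beta).

Lemma hol_loop_prim a c beta : hol (loop_prim a c beta) (loop_exp a c beta).
Proof.
have h1 := holZ a%:C (hol_cexp (@hol_id R)).
have h2 := holZ (c * sigma%:C) (hol_cexp (holZ sigma%:C (@hol_id R))).
have h := holD (holD h1 h2) (hol_cst beta%:C).
apply: (hol_prim (hol_loop_exp a c beta) (holM h (hol_loop_exp a c beta))).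
  exact: locally_bounded_loop_exp.
apply: locally_boundedM; last exact: locally_bounded_loop_exp.
apply: locally_boundedD; last exact: locally_bounded_cst.
apply: locally_boundedD; apply: locally_boundedM; try exact: locally_bounded_cst.
  exact: locally_bounded_cexp_id.
exact: locally_bounded_exp.
Qed.

Lemma loop_prim0 a c beta : loop_prim a c beta 0 = 0.
Proof. exact: prim0. Qed.

Lemma loop_expJ a c beta z : loop_exp a (conjc c) beta (conjc z) = conjc (loop_exp a c beta z).
Proof.
have E : sigma%:C * conjc z = conjc (sigma%:C * z) by rewrite conjM conjc_real.
rewrite /loop_exp -cexpJ /expo !conjD E !cexpJ (conjM a%:C) (conjM c) (conjM beta%:C).
by rewrite !conjc_real.
Qed.

Lemma loop_primJ a c beta z : loop_prim a (conjc c) beta (conjc z) = conjc (loop_prim a c beta z).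
Proof.
have h1 := hol_conj (hol_loop_prim a (conjc c) beta).
have h1' : hol (fun z => conjc (loop_prim a (conjc c) beta (conjc z))) (loop_exp a c beta).
  by apply: hol_ext h1 => // w; rewrite loop_expJ conjcK.
have J0 : conjc 0 = 0 :> R[i] by exact: conjc0.
have := hol_unique h1' (hol_loop_prim a c beta) z 0.
rewrite J0 !loop_prim0 J0 subrr => /eqP; rewrite subr_eq0 => /eqP <-.
by rewrite conjcK.
Qed.

Lemma Im_loop_prim_real a x beta s : Im (loop_prim a x%:C beta s%:C) = 0.
Proof.
have := loop_primJ a x%:C beta s%:C; rewrite !conjc_real => /(congr1 (@Im R)).
by rewrite ImJ; set u := Im _ => h; lra.
Qed.

Lemma hol_hor (F G : R[i] -> R[i]) chi s : hol F G ->
  is_cderive (fun s : R => F (s +i* chi)) s (G (s +i* chi)).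
Proof.
move=> h; have E (r : R) : (0 +i* chi) + r%:C * 1 = r +i* chi.
  by apply: complex_ext; rewrite ?ReD ?ImD ?ReZ ?ImZ /= ?add0r ?mulr1 ?mulr0 ?addr0.
have := h (0 +i* chi) 1 s; rewrite mul1r E; apply: is_cderive_ext => r.
by rewrite E.
Qed.

Lemma hol_ver (F G : R[i] -> R[i]) s y : hol F G ->
  is_cderive (fun y : R => F (s +i* y)) y ('i * G (s +i* y)).
Proof.
move=> h; have E (r : R) : s%:C + r%:C * 'i = s +i* r.
  by apply: complex_ext; rewrite ?ReD ?ImD ?ReZ ?ImZ /= ?add0r ?mulr1 ?mulr0 ?addr0.
have := h s%:C 'i y; rewrite E; apply: is_cderive_ext => r.
by rewrite E.
Qed.

Lemma cmod_loop_exp a x w beta s y :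
  cmod (loop_exp a (x%:C * expi w) beta (s +i* y)) =
  expR (a * expR s * cos y + x * expR (sigma * s) * cos (w + sigma * y) + beta * s).
Proof.
have E1 : Re (a%:C * ce (s +i* y)) = a * expR s * cos y.
  by rewrite (ReZ a) Re_cexp mulrA.
have E2 : Re (x%:C * expi w * ce (sigma%:C * (s +i* y))) =
    x * expR (sigma * s) * cos (w + sigma * y).
  rewrite -[_ * _ * _]mulrA (ReZ x) ReM Re_cexp Im_cexp (ReZ sigma) (ImZ sigma).
  by rewrite Re_expi Im_expi cosD /=; ring.
have E3 : Re (beta%:C * (s +i* y)) = beta * s by rewrite (ReZ beta).
by rewrite /loop_exp cmod_cexp /expo !ReD E1 E2 E3.
Qed.

(** Half of a k e^s absorbs x e^(sigma s), the other half absorbs (beta + N) s; the rate [N] is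
    therefore arbitrary. *)
Lemma loop_exp_decay a x w beta N k : 0 < a -> 0 < k -> 0 <= x ->
  exists2 C, 0 <= C & forall s y, 0 <= s -> cos y <= - k ->
   cmod (loop_exp a (x%:C * expi w) beta (s +i* y)) <= C * expR (- N * s).
Proof.
move=> a0 k0 x0; have h : 0 < a * k / 2 by rewrite divr_gt0// mulr_gt0.
have [C1 C10 hC1] := exp_dominate x sigma01 h.
have [C2 C20 hC2] := lin_dominate (beta + N) h.
exists (expR (C1 + C2)); first exact: expR_ge0.
move=> s y s0 cy; rewrite cmod_loop_exp -expRD ler_expR.
have h1 : a * expR s * cos y <= - (a * k * expR s).
  have -> : - (a * k * expR s) = a * expR s * - k by ring.
  by rewrite ler_wpM2l// mulr_ge0 ?expR_ge0// ltW.
have h2 : x * expR (sigma * s) * cos (w + sigma * y) <= x * expR (sigma * s).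
  by rewrite ler_piMr ?cos_le1// mulr_ge0 ?expR_ge0.
have := hC1 s; have := hC2 s s0; rewrite mulrDl mulNr.
set e := expR s; set e2 := x * expR _; move: h1 h2; rewrite -/e -/e2.
set u := a * e * cos y; set v := e2 * _ => h1 h2 h3 h4.
have h5 : a * k / 2 * e + a * k / 2 * e = a * k * e by field.
rewrite -/e -/e2 in h3 h4; lra.
Qed.

(* With u = e^z, [lup] is the upper half of a Hankel loop integral of
   exp (a u + x e^(i w) u^sigma) u^(beta - 1): the limit of the primitive along
   z = s + i chi, s -> +oo, where exp (a u) decays and the choice of chi is irrelevant. *)
Definition is_lup a x w beta l := forall chi, pi / 2 < chi < 3 * pi / 2 ->
  forall N, 0 < N -> exists C, forall s, 0 <= s ->
  cmod (loop_prim a (x%:C * expi w) beta (s +i* chi) - l) <= C * expR (- N * s).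

Lemma lup_ex a x w beta : 0 < a -> 0 <= x -> exists l, is_lup a x w beta l.
Proof.
move=> a0 x0; set F := loop_prim a (x%:C * expi w) beta.
have lim chi N : pi / 2 < chi < 3 * pi / 2 -> 0 < N -> exists l C, forall s, 0 <= s ->
    cmod (F (s +i* chi) - l) <= C * expR (- N * s).
  move=> /cos_lt0; rewrite -oppr_gt0 => c0 N0.
  have [C C0 hC] := loop_exp_decay w beta N a0 c0 x0.
  have [||l hl] := @tail_limit R (fun s => F (s +i* chi))
      (fun s => loop_exp a (x%:C * expi w) beta (s +i* chi)) C N 0 N0.
  - by move=> s; apply: hol_hor; exact: hol_loop_prim.
  - by move=> s s0; apply: hC; rewrite ?opprK.
  by exists l, (2 * C / N).
have small_eq (l l' : R[i]) : (exists C, forall s, 0 <= s ->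
    cmod (l - l') <= C * expR (- 1 * s)) -> l = l'.
  move=> [C hC]; apply/eqP; rewrite -subr_eq0; apply/eqP/cmod_eq0.
  apply/eqP; rewrite eq_le cmod_ge0 andbT leNgt; apply/negP => d0.
  have C0 : 0 < C.
    have := lt_le_trans d0 (hC 0 (lexx _)).
    by rewrite mulr0 expR0 mulr1.
  set d := cmod _ in d0 hC.
  have Cd : 0 <= C / d by rewrite divr_ge0// ltW.
  have := hC _ Cd.
  rewrite mulN1r expRN leNgt => /negP; apply.
  rewrite ltr_pdivrMr ?expR_gt0//.
  rewrite mulrC -ltr_pdivrMr//.
  by have := expR_ge1Dx (C / d); lra.
(* Two horizontal lines have the same limit because the vertical segment joining them contributes
   O(e^(- s)): on it cos is at most the larger of its end values, which are negative. *)
have indep chi1 chi2 l1 l2 C1 C2 : pi / 2 < chi1 -> chi1 <= chi2 -> chi2 < 3 * pi / 2 ->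
    (forall s, 0 <= s -> cmod (F (s +i* chi1) - l1) <= C1 * expR (- 1 * s)) ->
    (forall s, 0 <= s -> cmod (F (s +i* chi2) - l2) <= C2 * expR (- 1 * s)) -> l1 = l2.
  move=> c1 c12 c2 h1 h2; apply: small_eq.
  pose k := - Num.max (cos chi1) (cos chi2).
  have k0 : 0 < k.
    by rewrite oppr_gt0 gt_max !cos_lt0// ?c1 ?c2 ?(le_lt_trans c12 c2) ?(lt_le_trans c1 c12).
  have [C C0 hC] := loop_exp_decay w beta 1 a0 k0 x0.
  exists (C1 + C * (chi2 - chi1) + C2) => s s0.
  have h3 : cmod (F (s +i* chi2) - F (s +i* chi1)) <= C * (chi2 - chi1) * expR (- 1 * s).
    have -> : C * (chi2 - chi1) * expR (- 1 * s) =
       C * expR (- 1 * s) * chi2 - C * expR (- 1 * s) * chi1 by ring.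
    apply: (@complex_mvt R (fun y => F (s +i* y)) (fun y => 'i * loop_exp a (x%:C * expi w) beta (s +i* y))
      (fun y => C * expR (- 1 * s) * y) (fun=> C * expR (- 1 * s))) => //.
    - by move=> y _; apply: hol_ver; exact: hol_loop_prim.
    - move=> y _; rewrite (_ : (fun y : R => _) = (C * expR (- 1 * s)) *: (@id R)); last by [].
      by apply: is_derive_eq; rewrite /GRing.scale /= mulr1.
    - move=> y /andP[y1 y2]; rewrite cmodM.
      have -> : cmod ('i : R[i]) = 1 by rewrite -expi_pihalf cmod_expi.
      rewrite mul1r; apply: hC => //; rewrite opprK.
      by apply: cos_le_max => //; rewrite y1.
  have -> : l1 - l2 = - (F (s +i* chi1) - l1) - (F (s +i* chi2) - F (s +i* chi1))
     + (F (s +i* chi2) - l2) by ring.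
  rewrite (le_trans (cmodD _ _))// !mulrDl lerD ?h2//.
  apply: le_trans (cmodB _ _) _; rewrite (cmodN (F (s +i* chi1) - l1)).
  by apply: lerD; [exact: h1|exact: h3].
have pi0 := pi_gt0 R; have pi_in : pi / 2 < (pi : R) < 3 * pi / 2 by apply/andP; split; lra.
have [l [C hl]] := lim pi 1 pi_in ltr01.
exists l => chi chi_in N N0.
(* Rate N + 1 implies both rate 1, needed to compare with the limit found on Im z = pi, and the
   required rate N. *)
have N10 : 0 < N + 1 by rewrite addr_gt0.
have [l' [C' hl']] := lim chi (N + 1) chi_in N10.
have C'0 : 0 <= C'.
  have := le_trans (cmod_ge0 _) (hl' 0 (lexx _)).
  by rewrite mulr0 expR0 mulr1.
have hl'1 s : 0 <= s -> cmod (F (s +i* chi) - l') <= C' * expR (- 1 * s).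
  move=> s0; apply: le_trans (hl' s s0) _; rewrite ler_wpM2l// ler_expR.
  by rewrite ler_wpM2r// lerN2 lerDr ltW.
have <- : l' = l.
  have /andP[c1 c2] := chi_in; have /andP[p1 p2] := pi_in.
  have [cp|/ltW pc] := leP chi pi; first exact: indep c1 cp p2 hl'1 hl.
  by apply/esym; exact: indep p1 pc c2 hl hl'1.
exists C' => s s0; apply: le_trans (hl' s s0) _; rewrite ler_wpM2l// ler_expR.
by rewrite ler_wpM2r// lerN2 lerDl.
Qed.

End ExpFamily.

HB.lock Definition lup (R : realType) (sigma a x w beta : R) : R[i] :=
  xget 0 [set l | is_lup sigma a x w beta l].

Section UpperLimit.
Context {R : realType}.
Variable sigma : R.
Hypothesis sigma01 : 0 < sigma < 1.

Lemma lupP (a x w beta : R) : 0 < a -> 0 <= x ->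
  is_lup sigma a x w beta (lup sigma a x w beta).
Proof.
move=> a0 x0; have [l hl] := lup_ex sigma01 w beta a0 x0; rewrite lup.unlock.
by apply: (@xgetI _ 0 _ l).
Qed.

End UpperLimit.

Section HankelGamma.
Context {R : realType}.
Variable sigma : R.
Hypothesis sigma01 : 0 < sigma < 1.
Implicit Types (z : R[i]) (a w beta chi s t x y k N : R) (m : nat).

Notation EX := (loop_exp sigma).
Notation PR := (loop_prim sigma).
Notation c0 := ((0 : R)%:C * expi 0).
Notation lup0 a beta := (lup sigma a 0 0 beta).

(** Passage to the limit s -> +oo in an inequality with an exponentially small error; every contour
    extended to infinity ends with it. *)
Lemma le_exp_lim (u B C S N : R) : 0 < N ->
  (forall s, S <= s -> u <= B + C * expR (- N * s)) -> u <= B.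
Proof.
move=> N0 h; rewrite leNgt; apply/negP => Bu.
have d0 : 0 < u - B by rewrite subr_gt0.
pose s := Num.max S (Num.max 0 (C / (u - B) / N)).
have Ss : S <= s by rewrite le_max lexx.
have Cs : C / (u - B) / N <= s by rewrite !le_max lexx !orbT.
have := h s Ss; rewrite -lerBlDl mulNr expRN leNgt => /negP; apply.
rewrite ltr_pdivrMr ?expR_gt0// mulrC -ltr_pdivrMr//.
apply: lt_le_trans (expR_ge1Dx (N * s)).
rewrite (@le_lt_trans _ _ (N * s))//; last by rewrite ltrDr.
by rewrite -ler_pdivrMl// mulrC.
Qed.

Lemma cmod_exp_eq0 (d : R[i]) C S N : 0 < N ->
  (forall s, S <= s -> cmod d <= C * expR (- N * s)) -> d = 0.
Proof.
move=> N0 h; apply/cmod_eq0/eqP; rewrite eq_le cmod_ge0 andbT.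
by apply: (@le_exp_lim _ 0 C S N N0) => s Ss; rewrite add0r; exact: h.
Qed.

Lemma pi_in : pi / 2 < (pi : R) < 3 * pi / 2.
Proof. by have pi0 := pi_gt0 R; apply/andP; split; lra. Qed.

Lemma lup_pi a x w beta : 0 < a -> 0 <= x -> exists C, forall s, 0 <= s ->
  cmod (PR a (x%:C * expi w) beta (s +i* pi) - lup sigma a x w beta)
    <= C * expR (- s).
Proof.
move=> a0 x0; have [C hC] := lupP sigma01 w beta a0 x0 pi_in ltr01.
by exists C => s s0; rewrite -[- s]mulN1r; exact: hC.
Qed.

Lemma Im_loop_prim0_real a beta s : Im (PR a c0 beta s%:C) = 0.
Proof. by rewrite mul0r; exact: (@Im_loop_prim_real _ sigma a 0 beta s). Qed.

Lemma loop_exp0E a beta z : EX a c0 beta z = ce (a%:C * ce z + beta%:C * z).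
Proof. by rewrite /loop_exp /expo !mul0r addr0. Qed.

(** Integration by parts. The boundary term at infinity vanishes and the one at z = 0 is the real
    number e^a, so the recursion is clean only for imaginary parts. *)
Lemma Im_lupS a beta : 0 < a ->
  a * Im (lup0 a (beta + 1)) + beta * Im (lup0 a beta) = 0.
Proof.
move=> a0.
have h1 := holD (holZ a%:C (hol_loop_prim sigma a c0 (beta + 1)))
  (holZ beta%:C (hol_loop_prim sigma a c0 beta)).
have h2 : hol (EX a c0 beta)
    (fun z => a%:C * EX a c0 (beta + 1) z + beta%:C * EX a c0 beta z).
  apply: hol_ext (hol_loop_exp sigma a c0 beta) => // z.
  rewrite !loop_exp0E !mul0r addr0 mulrDl -mulrA -cexpD; congr (a%:C * ce _ + _).
  by rewrite rmorphD /= mulrDl mul1r; ring.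
have E := hol_unique h1 h2 ^~ 0.
have [C1 hC1] := @lup_pi a 0 0 (beta + 1) a0 (lexx _).
have [C2 hC2] := @lup_pi a 0 0 beta a0 (lexx _).
have k0 : 0 < - cos pi :> R by rewrite cospi opprK ltr01.
have [C3 C30 hC3] := loop_exp_decay sigma01 0 beta 1 a0 k0 (lexx 0).
set e0 := EX a c0 beta 0.
have e0E : e0 = (expR a)%:C by rewrite /e0 loop_exp0E cexp0 mulr1 mulr0 addr0 cexp_real.
have : a%:C * lup0 a (beta + 1) + beta%:C * lup0 a beta + e0 = 0.
  apply: (@cmod_exp_eq0 _ (a * C1 + `|beta| * C2 + C3) 0 1 ltr01) => s s0.
  have := E (s +i* pi); rewrite /= !loop_prim0 !mulr0 addr0 sub0r -/e0.
  set p1 := PR _ _ _ _; set p2 := PR _ _ _ _; set e := EX _ _ _ _ => E1.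
  have -> : a%:C * lup0 a (beta + 1) + beta%:C * lup0 a beta + e0 =
     - (a%:C * (p1 - lup0 a (beta + 1))) - beta%:C * (p2 - lup0 a beta) + e.
    have -> : e0 = - (a%:C * p1 + beta%:C * p2 - e) by rewrite E1 opprK.
    by ring.
  have -> : (a * C1 + `|beta| * C2 + C3) * expR (-1 * s) =
    a * (C1 * expR (- s)) + `|beta| * (C2 * expR (- s)) + C3 * expR (-1 * s).
    by rewrite mulN1r; ring.
  apply: le_trans (cmodD _ _) _; apply: lerD; last by apply: hC3; rewrite ?opprK.
  apply: le_trans (cmodB _ _) _; rewrite (cmodN (a%:C * _)); apply: lerD.
    by rewrite cmodM cmod_real gtr0_norm// ler_pM2l// hC1.
  by rewrite cmodM cmod_real ler_wpM2l// hC2.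
move=> /(congr1 (@Im R)); rewrite e0E !ImD !ImZ /= addr0; exact.
Qed.

(** This is 1/Gamma(1) = 1. On Im z = pi the integrand exp(e^z) is real, so the imaginary part of
    the primitive is constant there; as s -> -oo the integrand tends to 1 on the vertical segment,
    which contributes i pi. *)
Lemma Im_lup00 : Im (lup0 1 0) = pi.
Proof.
set F := PR 1 c0 0; have hF := hol_loop_prim sigma 1 c0 0.
have Ecst s t : Im (F (s +i* pi)) = Im (F (t +i* pi)).
  suff h r : is_cderive (fun s => (Im (F (s +i* pi)))%:C) r 0.
    by have := is_cderive0_cst h s t => -[].
  apply: is_cderive_real; have [_ h] := hol_hor pi r hF.
  have E : Im (EX 1 c0 0 (r +i* pi)) = 0.
    rewrite loop_exp0E mul1r mul0r addr0 Im_cexp Im_cexp /= sinpi mulr0 sin0 mulr0//.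
  by rewrite E in h.
have near s : s <= 0 -> `|Im (F (s +i* pi)) - pi| <= pi * expR 1 * expR s.
  move=> s0.
  have h : cmod ((F (s +i* pi) - 'i * pi%:C) - (F (s +i* 0) - 'i * 0%:C)) <=
     (expR 1 * expR s) * pi - (expR 1 * expR s) * 0.
    apply: (@complex_mvt R (fun y => F (s +i* y) - 'i * y%:C)
      (fun y => 'i * EX 1 c0 0 (s +i* y) - 'i * 1)
      (fun y => (expR 1 * expR s) * y) (fun=> expR 1 * expR s)).
    - exact: pi_ge0.
    - move=> y _; apply: is_cderiveB; first exact: hol_ver.
      by apply: is_cderiveZ; apply: (@is_cderive_real _ id); exact: is_derive_id.
    - move=> y _; rewrite (_ : (fun y : R => _) = (expR 1 * expR s) *: (@id R)); last by [].
      by apply: is_derive_eq; rewrite /GRing.scale /= mulr1.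
    - move=> y _; rewrite -mulrBr cmodM.
      have -> : cmod ('i : R[i]) = 1 by rewrite -expi_pihalf cmod_expi.
      rewrite mul1r loop_exp0E mul1r mul0r addr0.
      have := cexp_taylor (ce (s +i* y)) 1.
      rewrite big_ord1 expr0 fact0 divr1 expr1 fact_prod big_nat1 divr1 cmod_cexp /=.
      move=> /le_trans; apply; rewrite mulrC ler_wpM2r ?expR_ge0// ler_expR.
      rewrite ge_max ler01 andbT Re_cexp /=.
      apply: le_trans (_ : expR s <= 1); last by rewrite expR_le1.
      by rewrite ler_piMr ?expR_ge0// cos_le1.
  rewrite !mulr0 !subr0 in h.
  have -> : Im (F (s +i* pi)) - pi = Im ((F (s +i* pi) - 'i * pi%:C) - F (s +i* 0)).
    rewrite !ImB ImM /= mul0r mul1r add0r [Im (F (s +i* 0))]Im_loop_prim0_real subr0.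
    by [].
  by rewrite (le_trans (Im_le_cmod _))// (le_trans h)// mulrC mulrA.
have Fpi : Im (F (0 +i* pi)) = pi.
  apply/eqP; rewrite -subr_eq0 -normr_eq0 eq_le normr_ge0 andbT.
  apply: (@le_exp_lim _ 0 (pi * expR 1) 0 1 ltr01) => s s0.
  by rewrite add0r mulN1r (Ecst 0 (- s)); apply: near; rewrite oppr_le0.
have [C hC] := @lup_pi 1 0 0 0 ltr01 (lexx _).
apply/eqP; rewrite -subr_eq0 -normr_eq0 eq_le normr_ge0 andbT.
apply: (@le_exp_lim _ 0 C 0 1 ltr01) => s s0; rewrite add0r mulN1r.
rewrite -Fpi (Ecst 0 s) -normrN opprB -ImB.
by apply: le_trans (Im_le_cmod _) (hC s s0).
Qed.

(** The substitution z -> z + b, that is u -> e^b u. It moves the base point along the real axis,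
    where the primitive is real. *)
Lemma Im_lup_scale (b beta : R) : 0 <= b ->
  expR (beta * b) * Im (lup0 (expR b) beta) = Im (lup0 1 beta).
Proof.
move=> b0.
have h1 : hol (fun z => PR 1 c0 beta (1 * z + b%:C))
   (fun z => (expR (beta * b))%:C * EX (expR b) c0 beta z).
  apply: hol_ext (hol_affine 1 b%:C (hol_loop_prim sigma 1 c0 beta)) => // z.
  rewrite !loop_exp0E !mul1r -!cexp_real -!cexpD [b%:C + z]addrC; congr ce.
  by rewrite mulrDr rmorphM /=; ring.
have h2 := holZ (expR (beta * b))%:C (hol_loop_prim sigma (expR b) c0 beta).
have [C1 hC1] := @lup_pi 1 0 0 beta ltr01 (lexx _).
have [C2 hC2] := @lup_pi (expR b) 0 0 beta (expR_gt0 _) (lexx _).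
have C10 : 0 <= C1.
  by have := le_trans (cmod_ge0 _) (hC1 0 (lexx _)); rewrite oppr0 expR0 mulr1.
have : lup0 1 beta - (expR (beta * b))%:C * lup0 (expR b) beta - PR 1 c0 beta b%:C = 0.
  apply: (@cmod_exp_eq0 _ (C1 + expR (beta * b) * C2) 0 1 ltr01) => s s0.
  have := hol_unique h1 h2 (s +i* pi) 0.
  rewrite loop_prim0 !mulr0 subr0 add0r.
  have -> : 1 * (s +i* pi) + b%:C = (s + b) +i* pi.
    by rewrite mul1r; apply: complex_ext; rewrite ?ReD ?ImD /= ?addr0.
  set p1 := PR _ _ _ _; set p2 := PR _ _ _ _ => <-.
  have -> : lup0 1 beta - (expR (beta * b))%:C * lup0 (expR b) beta -
     (p1 - (expR (beta * b))%:C * p2) = - (p1 - lup0 1 beta) +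
      (expR (beta * b))%:C * (p2 - lup0 (expR b) beta) by ring.
  have sb0 : 0 <= s + b by exact: addr_ge0.
  apply: le_trans (cmodD _ _) _; rewrite (cmodN (p1 - _)) mulrDl mulN1r -mulrA.
  apply: lerD.
    apply: le_trans (hC1 _ sb0) _; rewrite ler_wpM2l// ler_expR lerN2.
    by rewrite lerDl.
  by rewrite cmodM cmod_real ger0_norm ?expR_ge0// ler_wpM2l ?expR_ge0// hC2.
move=> /(congr1 (@Im R)); rewrite !ImB ImZ Im_loop_prim0_real subr0 /= => /eqP.
by rewrite subr_eq0 => /eqP ->.
Qed.

End HankelGamma.

(** * The reciprocal gamma function as a loop integral *)

Section ReciprocalGamma.
Context {R : realType}.
Variable sigma : R.
Hypothesis sigma01 : 0 < sigma < 1.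
Implicit Types (z : R[i]) (a w beta chi s t x y k N : R) (m : nat).

Notation EX := (loop_exp sigma).
Notation PR := (loop_prim sigma).
Notation c0 := ((0 : R)%:C * expi 0).
Notation lup0 a beta := (lup sigma a 0 0 beta).

Lemma cmod_i : cmod ('i : R[i]) = 1.
Proof. by rewrite -expi_pihalf cmod_expi. Qed.

(** Worse than Stirling's formula by a factor of order sqrt m, which the ratio estimate can afford.
    The induction step is (m / (m + 1))^(m + 1) <= 1 / e. *)
Lemma fact_le m : (0 < m)%N -> (m`!%:R : R) <= expR (1 - m%:R) * m%:R ^+ m.+1.
Proof.
elim: m => // -[_ _|m IH _]; first by rewrite subrr expR0 factS fact0 muln1 expr1n mulr1.
rewrite factS natrM.
set M : R := m.+1%:R; have M0 : 0 < M by rewrite ltr0n.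
have -> : m.+2%:R = M + 1 :> R by rewrite natr1.
have h := IH isT; rewrite -/M in h.
apply: le_trans (_ : (M + 1) * (expR (1 - M) * M ^+ m.+2) <= _).
  by rewrite ler_pM2l// addr_gt0.
have key : M ^+ m.+2 <= expR (-1) * (M + 1) ^+ m.+2.
  have h1 : M / (M + 1) <= expR (- (M + 1)^-1).
    have := expR_ge1Dx (- (M + 1)^-1); congr (_ <= _).
    by field; rewrite gt_eqF// addr_gt0.
  have h2 : (M / (M + 1)) ^+ m.+2 <= expR (- (M + 1)^-1) ^+ m.+2.
    by rewrite ler_pXn2r// nnegrE ?expR_ge0// divr_ge0// ltW// addr_gt0.
  have E : m.+2%:R = M + 1 :> R by rewrite natr1.
  move: h2; rewrite -expRM_natl E mulrN divff ?gt_eqF ?addr_gt0//.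
  by rewrite expr_div_n ler_pdivrMr// exprn_gt0// addr_gt0.
have -> : expR (1 - (M + 1)) * (M + 1) ^+ m.+3 =
  (M + 1) * (expR (1 - M) * (expR (-1) * (M + 1) ^+ m.+2)).
  have -> : 1 - (M + 1) = (1 - M) + (-1) by ring.
  by rewrite expRD exprS; ring.
by rewrite ler_pM2l ?addr_gt0// ler_pM2l ?expR_gt0.
Qed.

(** The factor e^(- a z) - 1, corrected by a multiple of e^z - 1 to vanish to second order at the
    saddle z = 0. The correction does not change the imaginary part of the integral against e^(M e^z
    - M z), and it gains a factor 1 / M. *)
Definition qq (a : R) z := ce ((- a)%:C * z) - 1 + a%:C * (ce z - 1).

Lemma qq_le a z : cmod (qq a z) <=
  (a ^+ 2 + `|a|) * cmod z ^+ 2 * expR ((`|a| + 1) * cmod z).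
Proof.
have t2 (w : R[i]) : cmod (ce w - 1 - w) <= cmod w ^+ 2 * expR (cmod w).
  have := cexp_taylor w 2; rewrite 2!big_ord_recl big_ord0 /= /bump /= fact0 divr1 expr0.
  rewrite addr0 expr1 addn0 fact_prod big_nat1 divr1 opprD addrA => /le_trans; apply.
  apply: ler_pM; rewrite ?expR_ge0 ?divr_ge0 ?sqr_ge0//.
    by rewrite ler_pdivrMr// ler_peMr ?sqr_ge0// ler1n.
  by rewrite ler_expR ge_max ler_Re_cmod cmod_ge0.
have -> : qq a z = (ce ((- a)%:C * z) - 1 - (- a)%:C * z) + a%:C * (ce z - 1 - z).
  by rewrite /qq rmorphN /=; ring.
rewrite (le_trans (cmodD _ _))// !mulrDl; apply: lerD.
  apply: le_trans (t2 _) _.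
  rewrite cmodM cmod_real normrN exprMn real_normK ?num_real// ler_wpM2l//; first exact: mulr_ge0 (sqr_ge0 _) (sqr_ge0 _).
  by rewrite ler_expR lerDl mulr_ge0// cmod_ge0.
rewrite cmodM cmod_real -mulrA ler_wpM2l// (le_trans (t2 _))// ler_wpM2l ?sqr_ge0//.
by rewrite ler_expR mul1r lerDr !mulr_ge0 ?cmod_ge0.
Qed.

(** Trades a Gaussian for 1 / (1 + u y^2), whose antiderivative is an explicit bounded
    arctangent. *)
Lemma sqr_exp_le (u y : R) : 0 < u -> y ^+ 2 * expR (- (u * y ^+ 2)) <= 4 / u / (1 + u * y ^+ 2).
Proof.
move=> u0; set w := u * y ^+ 2; have w0 : 0 <= w by rewrite mulr_ge0 ?sqr_ge0// ltW.
have -> : y ^+ 2 = w / u by rewrite /w mulrAC divff ?mul1r// gt_eqF.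
have key : w * (1 + w) <= 4 * expR w.
  have := @expR_ge1Dxn R w 1 w0; have := expR_ge1Dx w.
  rewrite (_ : 2`! = 2)%N//.
  rewrite expr2; set ww := w * w; set e := expR w.
  by have -> : w * (1 + w) = w + ww; [rewrite mulrDr mulr1|lra].
have w1 : 0 < 1 + w by rewrite ltr_pwDl.
have -> : 4 / u / (1 + w) = u^-1 * (4 / (1 + w)) by rewrite mulrA [u^-1 * _]mulrC.
rewrite [w / u]mulrC -mulrA ler_wpM2l ?invr_ge0 ?(ltW u0)// ler_pdivlMr//.
by rewrite mulrAC expRN ler_pdivrMr ?expR_gt0.
Qed.

Lemma is_derive_atan_scale (v y : R) :
  is_derive y 1 (fun y => v^-1 * atan (v * y)) (if v == 0 then 0 else (1 + v ^+ 2 * y ^+ 2)^-1).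
Proof.
have h : is_derive y 1 (fun y : R => v * y) v.
  rewrite (_ : (fun y : R => _) = v *: (@id R)); last by [].
  by apply: is_derive_eq; rewrite /GRing.scale /= mulr1.
have h2 := is_derive1_comp (is_derive1_atan (v * y)) h.
rewrite (_ : (fun y : R => _) = v^-1 *: (atan \o (fun y => v * y))); last by [].
apply: is_derive_eq; rewrite /GRing.scale /= exprMn mulrCA.
by have [->|v0] := eqVneq v 0; rewrite ?invr0 ?mulr0// mulVf// mulr1.
Qed.

(** Laplace's method on the segment from 0 to i pi, where cos y <= 1 - y^2 / 128 makes the weight
    Gaussian of width M^(-1/2). The second-order zero of [qq] yields e^M / M^(3/2), and the
    horizontal ray only adds a constant. *)
Lemma Im_lup_ratio (a : R) : exists K, forall m, `|a| + 3 <= m%:R ->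
  `|Im (lup0 m%:R (- (m%:R + a))) - Im (lup0 m%:R (- m%:R))| <=
  K * (expR m%:R / (m%:R * Num.sqrt m%:R) + 1).
Proof.
pose K1 := (a ^+ 2 + `|a|) * expR ((`|a| + 1) * pi).
pose K3 := (a ^+ 2 + `|a|) * (2 * expR ((`|a| + 2) * pi)).
have a2 : 0 <= a ^+ 2 + `|a| by rewrite addr_ge0 ?sqr_ge0.
have K10 : 0 <= K1 by rewrite mulr_ge0 ?expR_ge0.
have K30 : 0 <= K3 by rewrite !mulr_ge0 ?expR_ge0.
exists (K1 * (8 * (128 * Num.sqrt 128)) + K3) => m; set M : R := m%:R => aM.
have M0 : 0 < M by apply: lt_le_trans aM; rewrite ltr_wpDl.
pose u := M / 128; have u0 : 0 < u by rewrite divr_gt0.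
pose v := Num.sqrt u; have v0 : 0 < v by rewrite sqrtr_gt0.
have vv : v ^+ 2 = u by rewrite sqr_sqrtr// ltW.
pose D z := PR M c0 (- (M + a)) z - PR M c0 (- M) z
  + a%:C * (PR M c0 (- M + 1) z - PR M c0 (- M) z).
pose dD z := EX M c0 (- M) z * qq a z.
have hD : hol D dD.
  have hP b := hol_loop_prim sigma M c0 b.
  have hB b b' := holD (hP b) (holZ (-1) (hP b')).
  apply: hol_ext (holD (hB (- (M + a)) (- M)) (holZ a%:C (hB (- M + 1) (- M)))) => z.
    by rewrite /D !mulN1r.
  rewrite /dD /qq !mulN1r !loop_exp0E.
  have -> : M%:C * ce z + (- (M + a))%:C * z = (M%:C * ce z + (- M)%:C * z) + (- a)%:C * z.
    by rewrite -addrA -mulrDl -rmorphD /= opprD.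
  have -> : M%:C * ce z + (- M + 1)%:C * z = (M%:C * ce z + (- M)%:C * z) + z.
    by rewrite -addrA rmorphD /= mulrDl mul1r.
  by rewrite !cexpD; ring.
have D0 : D 0 = 0 by rewrite /D !loop_prim0 subrr mulr0 addr0.
have vert : cmod (D (0 +i* pi)) <= K1 * expR M * (8 / (u * v)).
  have -> : D (0 +i* pi) = D (0 +i* pi) - D (0 +i* 0) by rewrite D0 subr0.
  pose cc := K1 * expR M * (4 / u).
  apply: le_trans (_ : cc * (v^-1 * atan (v * pi)) - cc * (v^-1 * atan (v * 0)) <= _).
    apply: (@complex_mvt R (fun y => D (0 +i* y)) (fun y => 'i * dD (0 +i* y))
      (fun y => cc * (v^-1 * atan (v * y))) (fun y => cc * (1 + u * y ^+ 2)^-1)).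
    - exact: pi_ge0.
    - by move=> y _; exact: hol_ver.
    - move=> y _; have := is_derive_atan_scale v y; rewrite gt_eqF// vv => h.
      rewrite (_ : (fun y : R => _) = cc *: (fun y => v^-1 * atan (v * y))); last by [].
      by apply: is_deriveZ.
    - move=> y /andP[y0 y1]; rewrite cmodM /dD cmodM.
      rewrite cmod_i mul1r cmod_loop_exp !mul0r expR0 mulr1 mulr0 !addr0.
      have cy : cmod (0 +i* y) = y.
        have -> : 0 +i* y = y%:C * 'i by apply: complex_ext; rewrite ?ReM ?ImM /=; ring.
        by rewrite cmodM cmod_real ger0_norm// cmod_i mulr1.
      have h1 : expR (M * cos y) <= expR M * expR (- (u * y ^+ 2)).
        rewrite -expRD ler_expR.
        have -> : M - u * y ^+ 2 = M * (1 - y ^+ 2 / 128) by rewrite /u; ring.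
        by rewrite ler_pM2l// cos_le_quad// y0.
      have h2 := qq_le a (0 +i* y); rewrite cy in h2.
      have h3 : (a ^+ 2 + `|a|) * y ^+ 2 * expR ((`|a| + 1) * y) <= K1 * y ^+ 2.
        rewrite /K1 mulrAC ler_wpM2r ?sqr_ge0// ler_wpM2l// ler_expR ler_wpM2l//.
      apply: le_trans (ler_pM (expR_ge0 _) (cmod_ge0 _) h1 (le_trans h2 h3)) _.
      have -> : expR M * expR (- (u * y ^+ 2)) * (K1 * y ^+ 2) =
        K1 * expR M * (y ^+ 2 * expR (- (u * y ^+ 2))) by ring.
      rewrite /cc -[leRHS]mulrA ler_wpM2l ?sqr_exp_le// mulr_ge0 ?expR_ge0//.
  rewrite mulr0 atan0 !mulr0 subr0.
  have -> : cc * (v^-1 * atan (v * pi)) = K1 * expR M * ((u * v)^-1 * (4 * atan (v * pi))).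
    by rewrite /cc; field; rewrite !gt_eqF.
  rewrite [8 / _]mulrC ler_wpM2l ?mulr_ge0 ?expR_ge0// ler_wpM2l ?invr_ge0 ?mulr_ge0 ?ltW//.
  by have := atan_ltpi2 (v * pi); have /andP[_] := @pihalf_02 R; lra.
(* On Im z = pi the weight is exp(- M e^r - M r); for M >= |a| + 3 it beats the growth of [qq] and
   leaves e^(- r). *)
have horiz s : 0 <= s -> cmod (D (s +i* pi) - D (0 +i* pi)) <= K3.
  move=> s0; apply: le_trans (_ : (- (K3 * expR (- s))) - (- (K3 * expR (- 0))) <= _); last first.
    rewrite oppr0 expR0 mulr1 opprK addrC lerBlDr lerDl mulr_ge0 ?expR_ge0//.
  apply: (@complex_mvt R (fun s => D (s +i* pi)) (fun s => dD (s +i* pi))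
      (fun s => - (K3 * expR (- s))) (fun s => K3 * expR (- s))) => //.
  - by move=> r _; exact: hol_hor.
  - move=> r _.
    have h : is_derive r 1 (fun r : R => - r) (- 1) by exact: is_deriveN.
    have h2 := is_derive1_comp (is_derive_expR (- r)) h.
    rewrite (_ : (fun r : R => _) = (- K3) *: (expR \o (fun r => - r))); last first.
      by apply/funext => x; rewrite /= -mulNr.
    by apply: is_derive_eq; rewrite /GRing.scale /=; ring.
  - move=> r /andP[r0 _]; rewrite /dD cmodM cmod_loop_exp mul0r mul0r addr0 cospi.
    have cz : cmod (r +i* pi) <= r + pi.
      apply: le_trans (cmod_le_ReIm _) _.
      by rewrite /= ger0_norm// ger0_norm ?pi_ge0.
    have rpi0 : 0 <= r + pi by rewrite addr_ge0 ?pi_ge0.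
    have h1 : cmod (r +i* pi) ^+ 2 <= 2 * expR (r + pi).
      apply: le_trans (_ : (r + pi) ^+ 2 <= _); first by rewrite ler_pXn2r// nnegrE cmod_ge0.
      have := @expR_ge1Dxn R (r + pi) 1 rpi0.
      by rewrite (_ : 2`! = 2)%N//; lra.
    have h2 : cmod (qq a (r +i* pi)) <= K3 * expR ((`|a| + 2) * r).
      apply: le_trans (qq_le _ _) _; rewrite -[leLHS]mulrA.
      have -> : K3 * expR ((`|a| + 2) * r) = (a ^+ 2 + `|a|) *
        (2 * (expR ((`|a| + 2) * pi) * expR ((`|a| + 2) * r))) by rewrite /K3; ring.
      rewrite ler_wpM2l//.
      apply: le_trans (_ : 2 * expR (r + pi) * expR ((`|a| + 1) * (r + pi)) <= _).
        apply: ler_pM => //; rewrite ?sqr_ge0 ?expR_ge0//.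
        by rewrite ler_expR ler_wpM2l// addr_ge0.
      rewrite -mulrA -!expRD ler_pM2l// ler_expR.
      by have := pi_ge0 R; lra.
    apply: le_trans (ler_wpM2l (expR_ge0 _) h2) _.
    rewrite mulrCA -expRD ler_wpM2l// ler_expR.
    have h3 : 0 <= M * expR r by rewrite mulr_ge0 ?expR_ge0// ltW.
    have h4 : 0 <= (M - (`|a| + 3)) * r by rewrite mulr_ge0// subr_ge0.
    by rewrite mulrN1 mulNr; lra.
pose d := lup0 M (- (M + a)) - lup0 M (- M) + a%:C * (lup0 M (- M + 1) - lup0 M (- M)).
have d_le : cmod d <= K1 * expR M * (8 / (u * v)) + K3.
  have [C1 hC1] := lup_pi sigma01 0 (- (M + a)) M0 (lexx 0).
  have [C2 hC2] := lup_pi sigma01 0 (- M) M0 (lexx 0).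
  have [C3 hC3] := lup_pi sigma01 0 (- M + 1) M0 (lexx 0).
  apply: (@le_exp_lim R _ _ (C1 + C2 + `|a| * (C3 + C2)) 0 1 ltr01) => s s0.
  rewrite mulN1r.
  move: (hC1 s s0) (hC2 s s0) (hC3 s s0) (horiz s s0) vert.
  set p1 := PR _ _ (- (M + a)) _; set p2 := PR _ _ (- M) _; set p3 := PR _ _ (- M + 1) _.
  move=> e1 e2 e3 e4 e5.
  have Dp : D (s +i* pi) = p1 - p2 + a%:C * (p3 - p2) by [].
  set l1 := lup0 M (- (M + a)) in e1 *; set l2 := lup0 M (- M) in e2 *.
  set l3 := lup0 M (- M + 1) in e3 *.
  have -> : d = D (0 +i* pi) + (D (s +i* pi) - D (0 +i* pi)) -
     ((p1 - l1) - (p2 - l2) + a%:C * ((p3 - l3) - (p2 - l2))).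
    rewrite Dp /d -/l1 -/l2 -/l3; set o := D _; ring.
  apply: le_trans (cmodB _ _) _; apply: lerD.
    by apply: le_trans (cmodD _ _) _; exact: lerD.
  apply: le_trans (cmodD _ _) _; rewrite mulrDl -mulrA; apply: lerD.
    by apply: le_trans (cmodB _ _) _; rewrite mulrDl; exact: lerD.
  rewrite cmodM cmod_real ler_wpM2l// mulrDl.
  by apply: le_trans (cmodB _ _) _; exact: lerD.
have Imd : Im d = Im (lup0 M (- (M + a))) - Im (lup0 M (- M)).
  (* At beta = - M the recursion says that the imaginary parts for - M + 1 and - M agree, so the
     correction term of [qq] drops out. *)
  have E := Im_lupS sigma01 (- M) M0.
  rewrite /d ImD ImZ !ImB.
  have -> : Im (lup0 M (- M + 1)) = Im (lup0 M (- M)).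
    apply: (mulfI (lt0r_neq0 M0)); move: E; set p := M * _; set q := Im _; lra.
  by rewrite subrr mulr0 addr0.
rewrite -Imd; apply: le_trans (Im_le_cmod _) (le_trans d_le _).
set C1 := K1 * (8 * _); set Q := expR M / _.
have C10 : 0 <= C1 by rewrite !mulr_ge0// ?sqrtr_ge0.
have Q0 : 0 <= Q by rewrite divr_ge0 ?expR_ge0// mulr_ge0 ?sqrtr_ge0// ltW.
have -> : K1 * expR M * (8 / (u * v)) = C1 * Q.
  have vE : v = Num.sqrt M / Num.sqrt 128.
    by rewrite /v /u sqrtrM ?sqrtrV// ltW.
  have sM : Num.sqrt M != 0 by rewrite gt_eqF// sqrtr_gt0.
  have s128 : Num.sqrt 128 != 0 :> R by rewrite gt_eqF// sqrtr_gt0.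
  rewrite vE /C1 /Q /u; set r1 := Num.sqrt M; set r2 := Num.sqrt 128.
  by field; rewrite /r1 /r2 sM s128 (gt_eqF M0).
have h1 : 0 <= K3 * Q by rewrite mulr_ge0.
have -> : (C1 + K3) * (Q + 1) = C1 * Q + K3 * Q + C1 + K3 by ring.
by move: h1 C10; set p := C1 * Q; set q := K3 * Q; lra.
Qed.

End ReciprocalGamma.

Section RGamma.
Context {R : realType}.
Variable sigma : R.
Hypothesis sigma01 : 0 < sigma < 1.
Implicit Types (a w beta chi s t x y k N : R) (m : nat).

Notation lup0 a beta := (lup sigma a 0 0 beta).
Notation h beta := (Im (lup0 1 beta)).

Definition gauss_seq a m : R :=
  (\prod_(i < m.+1) (a + i%:R)) / (m`!%:R * m%:R `^ a).

Lemma h_prod a m : h (1 - a) = (\prod_(i < m) (a + i%:R)) * h (1 - a - m%:R).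
Proof.
elim: m => [|m IH]; first by rewrite big_ord0 mul1r subr0.
rewrite IH big_ord_recr /= -mulrA; congr (_ * _).
have := Im_lupS sigma01 (1 - a - m.+1%:R) (@ltr01 R).
have -> : 1 - a - m.+1%:R + 1 = 1 - a - m%:R :> R by rewrite -natr1; ring.
have -> : 1 - a - m.+1%:R = - (a + m%:R) :> R by rewrite -natr1; ring.
by rewrite mul1r mulNr => /eqP; rewrite subr_eq0 => /eqP.
Qed.

Lemma h_neg m : h (- m%:R) = pi / m`!%:R.
Proof.
have := h_prod 1 m; rewrite subrr sub0r Im_lup00// => E.
have P : \prod_(i < m) (1 + i%:R) = m`!%:R :> R.
  elim: (m) => [|j IHj]; first by rewrite big_ord0 fact0.
  by rewrite big_ord_recr /= IHj factS mulnC natrM -natr1 [1 + _]addrC.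
by rewrite E P mulrAC mulfV ?mul1r// pnatr_eq0 -lt0n fact_gt0.
Qed.

Lemma lup_scaleE m beta : (0 < m)%N ->
  Im (lup0 m%:R beta) = expR (- (beta * ln m%:R)) * h beta.
Proof.
move=> m0; have M0 : 0 < m%:R :> R by rewrite ltr0n.
have b0 : 0 <= ln (m%:R : R) by rewrite ln_ge0// ler1n.
rewrite -(Im_lup_scale sigma01 beta b0) lnK ?posrE//.
by rewrite mulrA -expRD addNr expR0 mul1r.
Qed.

(** An exact identity: the Gauss product converges to h(1 - a) / pi as soon as the ratio tends to 1.
    Scaling u by m accounts for m^a and puts the saddle of the integrand at z = 0. *)
Lemma gauss_ratio a m : (0 < m)%N ->
  gauss_seq a m * (Im (lup0 m%:R (- (m%:R + a))) / Im (lup0 m%:R (- m%:R)))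
  = h (1 - a) / pi.
Proof.
move=> m0; have M0 : 0 < m%:R :> R by rewrite ltr0n.
rewrite !lup_scaleE// h_neg (h_prod a m.+1).
have -> : 1 - a - m.+1%:R = - (m%:R + a) :> R by rewrite -natr1; ring.
rewrite /gauss_seq /powR gt_eqF// !mulNr !opprK mulrDl expRD.
set e1 := expR (m%:R * _); set e2 := expR (a * _); set p := \prod_(i < _) _.
have e10 : e1 != 0 by rewrite gt_eqF ?expR_gt0.
have e20 : e2 != 0 by rewrite gt_eqF ?expR_gt0.
have f0 : m`!%:R != 0 :> R by rewrite pnatr_eq0 -lt0n fact_gt0.
have pi0 : pi != 0 :> R by rewrite gt_eqF ?pi_gt0.
set hh := Im _; move: pi0; generalize (@pi R) => q q0; field.
by rewrite e20 e10 f0 q0.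
Qed.

(** The denominator is at least pi e^(M - 1) / M by [fact_le], the error is of order e^M / M^(3/2);
    their quotient is of order M^(-1/2). *)
Lemma lup_ratio_cvg a : exists K m0, forall m, (m0 <= m)%N -> (0 < m)%N ->
  `|Im (lup0 m%:R (- (m%:R + a))) / Im (lup0 m%:R (- m%:R)) - 1| <= K / Num.sqrt m%:R.
Proof.
have [K hK] := Im_lup_ratio sigma01 a.
exists (`|K| * expR 1 * 3 / pi), (Num.bound (`|a| + 3)) => m m1 m0.
set M : R := m%:R; have M0 : 0 < M by rewrite ltr0n.
have M1 : 1 <= M by rewrite ler1n.
have aM : `|a| + 3 <= M.
  apply/ltW/(lt_le_trans (archi_boundP _)); first by rewrite addr_ge0.
  by rewrite ler_nat.
have lb : pi * expR (M - 1) / M <= Im (lup0 M (- M)).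
  rewrite lup_scaleE// h_neg mulNr opprK -/M.
  rewrite ler_pdivrMr//; set E := expR (M * ln M).
  have -> : E * (pi / m`!%:R) * M = pi * (E * M) / m`!%:R by ring.
  rewrite ler_pdivlMr ?ltr0n ?fact_gt0// -[leLHS]mulrA ler_pM2l ?pi_gt0// /E.
  have := @fact_le R m m0; rewrite -/M => hf.
  have -> : expR (M * ln M) = M ^+ m.
    by rewrite /M mulrC -powR_mulrn ?ler0n// /powR gt_eqF// mulrC.
  apply: le_trans (ler_wpM2l (expR_ge0 _) hf) _.
  rewrite mulrA -expRD.
  have -> : M - 1 + (1 - M) = 0 by ring.
  by rewrite expR0 mul1r exprSr.
set H := Im (lup0 M (- M)) in lb *.
have p0 : 0 < pi * expR (M - 1) / M by rewrite divr_gt0// mulr_gt0 ?pi_gt0 ?expR_gt0.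
have H0 : 0 < H by apply: lt_le_trans lb.
have -> : Im (lup0 M (- (M + a))) / H - 1 = (Im (lup0 M (- (M + a))) - H) / H.
  by rewrite mulrBl divff ?gt_eqF.
rewrite normrM normfV (gtr0_norm H0) ler_pdivrMr//.
apply: le_trans (hK m aM) _; rewrite -/M.
set r := Num.sqrt M; have r0 : 0 < r by rewrite sqrtr_gt0.
have rr : r ^+ 2 = M by rewrite sqr_sqrtr// ltW.
have K0 : 0 <= `|K| * expR 1 * 3 / pi / r.
  by rewrite !mulr_ge0 ?expR_ge0 ?invr_ge0 ?pi_ge0 ?(ltW r0).
apply: le_trans (_ : `|K| * expR 1 * 3 / pi / r * (pi * expR (M - 1) / M) <= _); last first.
  by rewrite ler_wpM2l.
have -> : `|K| * expR 1 * 3 / pi / r * (pi * expR (M - 1) / M) =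
  `|K| * (3 * (expR M / (M * r))).
  rewrite expRB; have := lt0r_neq0 (pi_gt0 R); generalize (@pi R) => q' q'0; field.
  by rewrite q'0 !gt_eqF ?expR_gt0.
have q0 : 0 <= expR M / (M * r) by rewrite divr_ge0 ?expR_ge0// mulr_ge0 ?ltW.
apply: le_trans (_ : `|K| * (expR M / (M * r) + 1) <= _).
  by rewrite ler_wpM2r ?ler_norm// addr_ge0.
rewrite ler_wpM2l//.
suff : 1 <= 2 * (expR M / (M * r)) by lra.
rewrite mulrA ler_pdivlMr ?mulr_gt0// mul1r.
have := @expR_ge1Dxn R M 1 (ltW M0); rewrite (_ : 2`! = 2)%N//.
have rM : r <= M by rewrite -rr expr2 ler_peMl ?(ltW r0)// -[leRHS]/r /r -sqrtr1 ler_wsqrtr.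
have : M * r <= M ^+ 2 by rewrite expr2 ler_pM2l.
by set e := expR M; set q := M ^+ 2; lra.
Qed.

Lemma lup_ratio_cvg1 a :
  (fun m => Im (lup0 m%:R (- (m%:R + a))) / Im (lup0 m%:R (- m%:R))) @ \oo --> (1 : R).
Proof.
have [K [m0 hK]] := lup_ratio_cvg a.
apply/cvgrPdist_le => e e0; near=> m.
have mgt0 : (0 < m)%N by near: m; exact: nbhs_infty_gt.
rewrite distrC (le_trans (hK m _ mgt0))//; first by near: m; exact: nbhs_infty_ge.
have M0 : 0 < m%:R :> R by rewrite ltr0n.
rewrite ler_pdivrMr ?sqrtr_gt0// -ler_pdivrMl//.
apply: le_trans (_ : `|e^-1 * K| <= _); first exact: ler_norm.
rewrite -sqrtr_sqr ler_wsqrtr//.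
by near: m; exact: nbhs_infty_ger.
Unshelve. all: by end_near. Qed.

Lemma gauss_seq_cvg a : gauss_seq a @ \oo --> h (1 - a) / pi.
Proof.
pose rho m : R := Im (lup0 m%:R (- (m%:R + a))) / Im (lup0 m%:R (- m%:R)).
have rho1 : rho @ \oo --> (1 : R) by exact: lup_ratio_cvg1.
have : (fun m => h (1 - a) / pi * (rho m)^-1) @ \oo --> h (1 - a) / pi * 1^-1.
  by apply: cvgMr; apply: cvgV => //; exact: oner_neq0.
rewrite invr1 mulr1; apply: cvg_trans; apply: near_eq_cvg.
have rho_half : \forall m \near \oo, 1 / 2 < rho m.
  by apply: (cvgr_gt _ rho1); lra.
near=> m.
have mgt0 : (0 < m)%N by near: m; exact: nbhs_infty_gt.
have rn0 : rho m != 0.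
  rewrite gt_eqF//; apply: (@lt_trans _ _ (1 / 2)) => //; near: m; exact: rho_half.
by rewrite -(gauss_ratio a mgt0) -/(rho m) mulfK.
Unshelve. all: by end_near.
Qed.

(** Hankel's formula: the lower half of the loop is the conjugate of the upper one, which leaves an
    imaginary part. *)
Lemma rgamma_lup a : rgamma a = h (1 - a) / pi.
Proof. by rewrite /rgamma; have /cvg_lim := @gauss_seq_cvg a; exact. Qed.

Lemma rgammaS a : rgamma a = a * rgamma (a + 1).
Proof.
rewrite !rgamma_lup (h_prod a 1) big_ord_recl big_ord0 mulr1 addr0 mulrA.
by congr (_ * Im (lup _ _ _ _ _) / _); ring.
Qed.

End RGamma.

(** * The integral representation of F *)

Section Representation.
Context {R : realType}.
Variable sigma : R.
Hypothesis sigma01 : 0 < sigma < 1.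
Implicit Types (a w beta chi s t x y N : R) (n m k : nat).

Notation EX := (loop_exp sigma).
Notation PR := (loop_prim sigma).
Notation c0 := ((0 : R)%:C * expi 0).
Notation lup0 a beta := (lup sigma a 0 0 beta).

Lemma omega_rev n (r : 'I_n) : omega R n (rev_ord r) = - omega R n r.
Proof.
rewrite /omega /= natrB ?ltn_ord//.
have n0 : (n%:R : R) != 0 by rewrite pnatr_eq0 -lt0n (leq_ltn_trans _ (ltn_ord r)).
by rewrite -natr1; generalize (@pi R) => q; field.
Qed.

(** The directions are symmetric under r -> n - 1 - r. This is the cancellation of all contributions
    of the base point. *)
Lemma Im_sym_sum n (f : R -> R[i]) : (forall w, f (- w) = conjc (f w)) ->
  Im (\sum_(r < n) f (omega R n r)) = 0.
Proof.
move=> fJ; set S := \sum_(r < n) _.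
suff E : S = conjc S by move: (congr1 (@Im R) E); rewrite ImJ; set u := Im S; lra.
rewrite {1}/S (reindex_inj rev_ord_inj) /= /S (big_morph _ (@conjD R) (conjc0 R)).
by apply: eq_bigr => r _; rewrite omega_rev fJ.
Qed.

(** Away from the zeros of sin the sum telescopes by 2 sin g cos A = sin(A + g) - sin(A - g); at the
    zeros the defining sum is the same up to the sign of the angle, which real parts ignore. *)
Lemma sin_quotE n k : (0 < n)%N ->
  (sin_quot n (gamma_k R n k))%:C = \sum_(r < n) expi (k.+1%:R * omega R n r).
Proof.
move=> n0; have nR0 : (n%:R : R) != 0 by rewrite pnatr_eq0 -lt0n.
set g := gamma_k R n k.
have E r : k.+1%:R * omega R n r = g * (n%:R - 2 * r%:R - 1).
  by rewrite /g /gamma_k /omega; generalize (@pi R) => q; field.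
apply: complex_ext => /=; last first.
  rewrite (@Im_sym_sum n (fun w => expi (k.+1%:R * w)))// => w.
  by rewrite mulrN expiN.
rewrite /sin_quot; case: ifPn => [_|sg].
  rewrite !Re_sum; apply: eq_bigr => r _; rewrite E !Re_expi -cosN; congr cos.
  by ring.
have tel m : 2 * sin g * Re (\sum_(r < m) expi (k.+1%:R * omega R n r)) =
    sin (g * n%:R) - sin (g * (n%:R - 2 * m%:R)).
  elim: m => [|m IH]; first by rewrite big_ord0 /= mulr0 mulr0 subr0 subrr.
  rewrite big_ord_recr ReD /= mulrDr IH E.
  set A := g * (n%:R - 2 * m%:R - 1).
  have -> : g * (n%:R - 2 * m%:R) = A + g by rewrite /A; ring.
  have -> : g * (n%:R - 2 * m.+1%:R) = A - g by rewrite /A -natr1; ring.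
  by rewrite sinD sinB; ring.
have := tel n; have -> : g * (n%:R - 2 * n%:R) = - (n%:R * g) by ring.
rewrite sinN opprK [g * _]mulrC => h.
apply: (mulfI sg); rewrite mulrCA divff// mulr1.
move: h; set a := sin (_ * _); set b := Re _; set c := sin g; rewrite -mulrA; lra.
Qed.

Lemma pow_fact_le (u : R) n : 0 <= u -> u ^+ n / n`!%:R <= expR u.
Proof.
move=> u0; case: n => [|n]; first by rewrite expr0 fact0 divr1; have := expR_ge1Dx u; lra.
by apply: le_trans (@expR_ge1Dxn R u n u0); rewrite lerDr.
Qed.

(** |w|^n / n! = 2^(- n) (2 |w|)^n / n! <= 2^(- n) e^(2 |w|): a geometric factor is extracted at the
    price of tripling |w|, harmless because w is of the lower order u^sigma. *)
Lemma exp_tail_le (w : R[i]) n :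
  cmod (ce w - \sum_(i < n) w ^+ i / i`!%:R) <= 2^-1 ^+ n * expR (3 * cmod w).
Proof.
apply: le_trans (cexp_taylor w n) _.
have -> : 3 * cmod w = 2 * cmod w + cmod w by ring.
rewrite expRD mulrA ler_pM ?divr_ge0 ?exprn_ge0 ?cmod_ge0 ?expR_ge0//; last first.
  by rewrite ler_expR ge_max ler_Re_cmod cmod_ge0.
have -> : cmod w ^+ n / n`!%:R = 2^-1 ^+ n * ((2 * cmod w) ^+ n / n`!%:R).
  by rewrite exprMn exprVn; field; rewrite expf_neq0//= pnatr_eq0 -lt0n fact_gt0.
by rewrite ler_wpM2l ?exprn_ge0 ?invr_ge0// pow_fact_le// mulr_ge0// cmod_ge0.
Qed.

(** Term by term integration of the exponential series in x e^(i w) u^sigma, with a geometric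
    remainder. *)
Lemma lup_series x w beta : 0 <= x -> exists C, forall n,
  cmod (lup sigma 1 x w beta - \sum_(k < n) (x%:C * expi w) ^+ k / k`!%:R *
     lup0 1 (beta + sigma * k%:R)) <= C * 2^-1 ^+ n.
Proof.
move=> x0; set c := x%:C * expi w.
have x30 : 0 <= 3 * x by rewrite mulr_ge0.
have k0 : 0 < - cos pi :> R by rewrite cospi opprK ltr01.
have [C C0 hC] := loop_exp_decay sigma01 (- (sigma * pi)) beta 1 ltr01 k0 x30.
exists (expR (1 + 3 * x) * pi + C) => n.
pose D z := PR 1 c beta z - \sum_(k < n) c ^+ k / k`!%:R * PR 1 c0 (beta + sigma * k%:R) z.
pose dD z := ce (1%:C * ce z + beta%:C * z) *
  (ce (c * ce (sigma%:C * z)) - \sum_(k < n) (c * ce (sigma%:C * z)) ^+ k / k`!%:R).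
have hD : hol D dD.
  have h1 := hol_loop_prim sigma 1 c beta.
  have h2 (k : 'I_n) := holZ (c ^+ k / k`!%:R) (hol_loop_prim sigma 1 c0 (beta + sigma * k%:R)).
  have h3 := hol_sum (index_enum 'I_n) h2.
  apply: hol_ext (holD h1 (holZ (-1) h3)) => z; first by rewrite mulN1r.
  rewrite mulN1r /dD mulrBr; congr (_ - _).
    by rewrite -cexpD /loop_exp /expo; congr ce; ring.
  rewrite mulr_sumr; apply: eq_bigr => k _; rewrite loop_exp0E.
  have -> : (1 : R)%:C * ce z + (beta + sigma * k%:R)%:C * z =
    (1 : R)%:C * ce z + beta%:C * z + k%:R * (sigma%:C * z).
    by rewrite !(rmorphD, rmorphM) /= rmorph_nat; ring.
  by rewrite [ce (_ + _ * (_ * _))]cexpD -cexpX [(c * _) ^+ _]exprMn; ring.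
(* The remainder is dominated by the modulus of a loop integrand of the same family, with x replaced
   by 3 x and the phase - sigma y chosen so that the cosine multiplying u^sigma equals 1. *)
have dDle s y : cmod (dD (s +i* y)) <=
    2^-1 ^+ n * cmod (EX 1 ((3 * x)%:C * expi (- (sigma * y))) beta (s +i* y)).
  rewrite /dD cmodM.
  have -> : cmod (ce (1%:C * ce (s +i* y) + beta%:C * (s +i* y))) =
    expR (expR s * cos y + beta * s).
    by rewrite cmod_cexp ReD !ReZ Re_cexp /= mul1r.
  have h := exp_tail_le (c * ce (sigma%:C * (s +i* y))) n.
  have E : cmod (c * ce (sigma%:C * (s +i* y))) = x * expR (sigma * s).
    by rewrite /c !cmodM cmod_real ger0_norm// cmod_expi mulr1 cmod_cexp ReZ.
  rewrite E in h.
  apply: le_trans (ler_wpM2l (expR_ge0 _) h) _.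
  rewrite mulrCA -expRD ler_wpM2l ?exprn_ge0 ?invr_ge0// cmod_loop_exp ler_expR.
  by rewrite addNr cos0 mulr1 mul1r; lra.
have D0 : D 0 = 0.
  by rewrite /D loop_prim0 big1 ?subrr// => k _; rewrite loop_prim0 mulr0.
have vert : cmod (D (0 +i* pi)) <= 2^-1 ^+ n * expR (1 + 3 * x) * pi.
  have -> : D (0 +i* pi) = D (0 +i* pi) - D (0 +i* 0) by rewrite D0 subr0.
  set K := 2^-1 ^+ n * _; have -> : K * pi = K * pi - K * 0 by rewrite mulr0 subr0.
  apply: (@complex_mvt R (fun y => D (0 +i* y)) (fun y => 'i * dD (0 +i* y))
      (fun y => K * y) (fun y => K)).
  - exact: pi_ge0.
  - by move=> y _; exact: hol_ver.
  - move=> y _; rewrite (_ : (fun y : R => _) = K *: (@id R)); last by [].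
    by apply: is_derive_eq; rewrite /GRing.scale /= mulr1.
  - move=> y _; rewrite cmodM cmod_i mul1r; apply: le_trans (dDle _ _) _.
    rewrite ler_wpM2l ?exprn_ge0 ?invr_ge0// cmod_loop_exp ler_expR !mulr0 expR0 addNr cos0 addr0 !mulr1.
    by rewrite mul1r lerD2r cos_le1.
have horiz s : 0 <= s -> cmod (D (s +i* pi) - D (0 +i* pi)) <= 2^-1 ^+ n * C.
  move=> s0; set K := 2^-1 ^+ n * C.
  have K0 : 0 <= K by rewrite mulr_ge0// exprn_ge0// invr_ge0.
  apply: le_trans (_ : (- (K * expR (- s))) - (- (K * expR (- 0))) <= _); last first.
    by rewrite oppr0 expR0 mulr1 opprK addrC lerBlDr lerDl mulr_ge0 ?expR_ge0.
  apply: (@complex_mvt R (fun s => D (s +i* pi)) (fun s => dD (s +i* pi))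
      (fun s => - (K * expR (- s))) (fun s => K * expR (- s))) => //.
  - by move=> r _; exact: hol_hor.
  - move=> r _.
    have h : is_derive r 1 (fun r : R => - r) (- 1) by exact: is_deriveN.
    have h2 := is_derive1_comp (is_derive_expR (- r)) h.
    rewrite (_ : (fun r : R => _) = (- K) *: (expR \o (fun r => - r))); last first.
      by apply/funext => u; rewrite /= -mulNr.
    by apply: is_derive_eq; rewrite /GRing.scale /=; ring.
  - move=> r /andP[r0 _]; apply: le_trans (dDle _ _) _.
    rewrite /K -mulrA ler_wpM2l ?exprn_ge0 ?invr_ge0//.
    have -> : - r = -1 * r by rewrite mulN1r.
    by apply: hC => //; rewrite opprK.
have [C1 hC1] := lup_pi sigma01 w beta ltr01 x0.
have hC2 (k : 'I_n) := lup_pi sigma01 0 (beta + sigma * k%:R) (@ltr01 R) (lexx 0).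
have {hC2}[C2 hC2] := choice hC2.
pose l := lup sigma 1 x w beta.
pose C3 := \sum_(k < n) cmod (c ^+ k / k`!%:R) * C2 k.
apply: (@le_exp_lim R _ _ (C1 + C3) 0 1 ltr01) => s s0; rewrite mulN1r.
set d := lup _ _ _ _ _ - _.
have -> : d = D (0 +i* pi) + (D (s +i* pi) - D (0 +i* pi)) - ((PR 1 c beta (s +i* pi) - l) -
  \sum_(k < n) c ^+ k / k`!%:R * (PR 1 c0 (beta + sigma * k%:R) (s +i* pi) - lup0 1 (beta + sigma * k%:R))).
  rewrite [D _ + _]addrC subrK /D /d -/l.
  have -> : \sum_(k < n) c ^+ k / k`!%:R * (PR 1 c0 (beta + sigma * k%:R) (s +i* pi) -
     lup0 1 (beta + sigma * k%:R)) = \sum_(k < n) c ^+ k / k`!%:R * PR 1 c0 (beta + sigma * k%:R) (s +i* pi)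
      - \sum_(k < n) c ^+ k / k`!%:R * lup0 1 (beta + sigma * k%:R).
    by rewrite -sumrB; apply: eq_bigr => k _; rewrite mulrBr.
  set A := \sum_(k < n) _; set B := \sum_(k < n) _; set p := PR _ _ _ _; ring.
have -> : (expR (1 + 3 * x) * pi + C) * 2^-1 ^+ n + (C1 + C3) * expR (- s) =
  2^-1 ^+ n * expR (1 + 3 * x) * pi + 2^-1 ^+ n * C + (C1 * expR (- s) + C3 * expR (- s)).
  by generalize (@pi R) => q; ring.
apply: le_trans (cmodB _ _) _; apply: lerD.
  by apply: le_trans (cmodD _ _) _; apply: lerD => //; exact: horiz.
apply: le_trans (cmodB _ _) _; apply: lerD; first exact: hC1.
apply: le_trans (cmod_sum _ _ _) _; rewrite /C3 mulr_suml; apply: ler_sum => k _.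
by rewrite cmodM -mulrA ler_wpM2l ?cmod_ge0// hC2.
Qed.

(** The sine quotient is the sum of e^(i (k + 1) omega_r): its k-th power joins x^k and one factor
    stays outside. The gamma factor is Hankel's integral at 1 - (mu - sigma k) = delta + sigma k. *)
Theorem Fsum_lup n mu x : (0 < n)%N -> 0 <= x ->
  Fsum n sigma mu x =
  Im (\sum_(r < n) expi (omega R n r) * lup sigma 1 x (omega R n r) (delta mu)) / pi.
Proof.
move=> n0 x0; set L := Im _ / pi; rewrite /Fsum.
have [C hC] : exists C : 'I_n -> R, forall (r : 'I_n) m,
  cmod (lup sigma 1 x (omega R n r) (delta mu) -
    \sum_(k < m) (x%:C * expi (omega R n r)) ^+ k / k`!%:R *
     lup0 1 (delta mu + sigma * k%:R)) <= C r * 2^-1 ^+ m.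
  by have [C hC] := choice (fun r : 'I_n => lup_series (omega R n r) (delta mu) x0); exists C.
have pi0 : 0 < pi :> R by exact: pi_gt0.
pose u k : R := sin_quot n (gamma_k R n k) * (x ^+ k / k`!%:R * rgamma (mu - sigma * k%:R)).
have uE m : series u m = Im (\sum_(r < n) expi (omega R n r) *
    \sum_(k < m) (x%:C * expi (omega R n r)) ^+ k / k`!%:R *
     lup0 1 (delta mu + sigma * k%:R)) / pi.
  rewrite /series /= big_mkord.
  under [in RHS]eq_bigr do rewrite mulr_sumr.
  rewrite exchange_big /= Im_sum mulr_suml; apply: eq_bigr => k _.
  have -> : \sum_(r < n) expi (omega R n r) * ((x%:C * expi (omega R n r)) ^+ k / k`!%:R *
     lup0 1 (delta mu + sigma * k%:R)) = (sin_quot n (gamma_k R n k))%:C *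
     ((x ^+ k / k`!%:R)%:C * lup0 1 (delta mu + sigma * k%:R)).
    rewrite sin_quotE// mulr_suml; apply: eq_bigr => r _.
    rewrite -natr1 mulrDl mul1r expiD -expiX exprMn rmorphM fmorphV /= rmorphXn /= rmorph_nat.
    by ring.
  rewrite !ImZ /u (rgamma_lup sigma01).
  have -> : 1 - (mu - sigma * k%:R) = delta mu + sigma * k%:R :> R by rewrite /delta; ring.
  by rewrite !mulrA.
have cv : series u @ \oo --> L.
  have e_cvg : (fun m => (\sum_r C r / pi) * (2^-1 : R) ^+ m) @ \oo --> (\sum_r C r / pi) * 0.
    by apply: cvgMr; apply: cvg_expr; rewrite ger0_norm ?invr_ge0// invf_lt1// ltr1n.
  rewrite mulr0 in e_cvg.
  apply/cvgrPdist_le => e e0; move/cvgrPdist_le : e_cvg => /(_ e e0) h.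
  near=> m; have : `|0 - (\sum_r C r / pi) * (2^-1 : R) ^+ m| <= e by near: m.
  rewrite sub0r normrN => /(le_trans (ler_norm _)); apply: le_trans.
  rewrite uE /L -mulrBl -ImB normrM normfV (gtr0_norm pi0).
  rewrite -mulr_suml mulrAC ler_wpM2r ?invr_ge0 ?(ltW pi0)//.
  apply: le_trans (Im_le_cmod _) _; rewrite -sumrB mulr_suml.
  apply: le_trans (cmod_sum _ _ _) _; apply: ler_sum => r _.
  by rewrite -mulrBr cmodM cmod_expi mul1r hC.
by have /cvg_lim := cv; exact.
Unshelve. all: by end_near.
Qed.

End Representation.

Section RealDerivatives.
Context {R : realType}.
Implicit Types (s b e d : R).

Lemma is_derive_affine b e s : is_derive s 1 (fun s : R => b + e * s) e.
Proof.
have h1 : is_derive s 1 (fun s : R => e * s) e.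
  rewrite (_ : (fun s : R => _) = e *: (@id R)); last by [].
  by apply: is_derive_eq; rewrite /GRing.scale /= mulr1.
have := is_deriveD (is_derive_real_cst b s) h1; rewrite add0r.
by rewrite (_ : (fun=> b) + _ = (fun s : R => b + e * s)).
Qed.

Lemma is_derive_expR_comp (f : R -> R) s d : is_derive s 1 f d ->
  is_derive s 1 (fun s => expR (f s)) (d * expR (f s)).
Proof.
move=> h; have := @is_derive1_comp R expR f s _ _ (is_derive_expR (f s)) h.
by rewrite mulrC.
Qed.

Lemma is_deriveZ_real (f : R -> R) c s d : is_derive s 1 f d ->
  is_derive s 1 (fun s => c * f s) (c * d).
Proof. by move=> h; exact: (@is_deriveZ R R R f c s 1 d h). Qed.

End RealDerivatives.

(** * The algebraic expansion *)

Section Algebraic.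
Context {R : realType}.
Variables (sigma delta0 : R).
Hypothesis sigma01 : 0 < sigma < 1.
Implicit Types (a w beta chi s t x y N L : R) (n m k : nat) (z : R[i]).

Notation PR := (loop_prim sigma).
Notation c0 := ((0 : R)%:C * expi 0).
Notation lup0 a beta := (lup sigma a 0 0 beta).

Let KK k : R := (k%:R + delta0) / sigma.

(* [algF] is the primitive of the integrand of [lup] with the first m terms of the Taylor
   series of e^u removed, u = e^z; the removed terms are primitives in the variable
   sigma z + L + i w, and their limits make up [algT]. *)
Definition alg_coef k L w : R[i] :=
  ((k`!%:R * sigma)^-1)%:C * ce (- (KK k)%:C * (L +i* w)).

Definition algF m L w z : R[i] := PR 1 ((expR L)%:C * expi w) delta0 z -
  \sum_(j < m) alg_coef j L w * PR 1 c0 (KK j) (sigma%:C * z + (L +i* w)).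

Definition algdF m L w z : R[i] :=
  ce ((expR L)%:C * expi w * ce (sigma%:C * z) + delta0%:C * z) *
    (ce (ce z) - \sum_(j < m) ce z ^+ j / j`!%:R).

Lemma ceLw L w : ce (L +i* w) = (expR L)%:C * expi w.
Proof.
have -> : L +i* w = L%:C + (0 +i* w).
  by apply: complex_ext; rewrite ?ReD ?ImD /= ?addr0 ?add0r.
by rewrite cexpD cexp_real cexp_im.
Qed.

Lemma hol_algF m L w : hol (algF m L w) (algdF m L w).
Proof.
have s0 : sigma != 0 by have /andP[/lt0r_neq0] := sigma01.
have h1 := hol_loop_prim sigma 1 ((expR L)%:C * expi w) delta0.
have h2 (j : 'I_m) := holZ (alg_coef j L w)
  (hol_affine sigma%:C (L +i* w) (hol_loop_prim sigma 1 c0 (KK j))).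
have h3 := hol_sum (index_enum 'I_m) h2.
apply: hol_ext (holD h1 (holZ (-1) h3)) => z; first by rewrite mulN1r.
rewrite mulN1r /algdF mulrBr; congr (_ - _).
  by rewrite -cexpD /loop_exp /expo; congr ce; ring.
rewrite mulr_sumr; apply: eq_bigr => j _; rewrite loop_exp0E /alg_coef cexpX.
set zL := L +i* w.
have E : ce (1%:C * ce (sigma%:C * z + zL) + (KK j)%:C * (sigma%:C * z + zL)) =
  ce ((expR L)%:C * expi w * ce (sigma%:C * z) + delta0%:C * z) * ce (j%:R * z) *
  ce ((KK j)%:C * zL).
  rewrite -!cexpD; congr ce; rewrite cexpD ceLw mul1r mulrDr.
  have -> : (KK j)%:C * (sigma%:C * z) = delta0%:C * z + j%:R * z.
    rewrite mulrA -rmorphM /KK mulfVK// rmorphD /= rmorph_nat; ring.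
  by ring.
rewrite E mulNr cexpN.
have n0 : ce ((KK j)%:C * zL) != 0.
  apply/eqP => /(congr1 (@cmod R)); rewrite cmod_cexp cmod0 => /eqP.
  by rewrite expR_eq0.
rewrite fmorphV rmorphM /= rmorph_nat; field.
rewrite n0 /= (_ : (sigma%:C != 0)); last by rewrite fmorph_eq0.
by rewrite pnatr_eq0 -lt0n fact_gt0.
Qed.

(** The maximum with 0 comes from [cexp_taylor]: where Re e^z < 0 only the first omitted term e^(m
    z) remains. *)
Lemma algdF_le m L w s y :
  cmod (algdF m L w (s +i* y)) <=
  expR (expR (L + sigma * s) * cos (w + sigma * y) + (m%:R + delta0) * s
        + Num.max (expR s * cos y) 0).
Proof.
rewrite /algdF cmodM cmod_cexp ReD.
have -> : Re ((expR L)%:C * expi w * ce (sigma%:C * (s +i* y))) =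
  expR (L + sigma * s) * cos (w + sigma * y).
  rewrite -ceLw -cexpD Re_cexp ReD ImD ReZ ImZ /=; congr (expR _ * cos _).
have -> : Re (delta0%:C * (s +i* y)) = delta0 * s by rewrite ReZ.
have h := cexp_taylor (ce (s +i* y)) m.
apply: le_trans (ler_wpM2l (expR_ge0 _) h) _.
rewrite cmod_cexp Re_cexp /=; set A := _ * cos (w + _); set B := Num.max _ _.
have hm : expR s ^+ m / m`!%:R <= expR (m%:R * s).
  rewrite expRM_natl ler_pdivrMr ?ltr0n ?fact_gt0//.
  by rewrite ler_peMr ?exprn_ge0 ?expR_ge0// ler1n fact_gt0.
apply: le_trans (_ : expR (A + delta0 * s) * (expR (m%:R * s) * expR B) <= _).
  by rewrite ler_wpM2l ?expR_ge0// ler_wpM2r ?expR_ge0.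
by rewrite -!expRD ler_expR; lra.
Qed.

(** Up to a constant the bound is the derivative of the logistic function of e v, so the integral
    over the whole line is controlled by a bounded antiderivative. *)
Lemma sech_dominate (e k : R) : 0 < e -> 0 < k ->
  exists2 C, 0 <= C & forall v, expR (e * v - k * expR v) <= C * (expR (e * v) / (1 + expR (e * v)) ^+ 2).
Proof.
move=> e0 k0; have [C C0 hC] := lin_dominate (2 * e) k0.
exists (4 * expR C); first by rewrite mulr_ge0 ?expR_ge0.
move=> v; rewrite expRD mulrCA; rewrite ler_wpM2l ?expR_ge0//.
have p0 : 0 < 1 + expR (e * v) by rewrite addr_gt0 ?expR_gt0.
rewrite ler_pdivlMr ?exprn_gt0// mulrC expRN ler_pdivrMr ?expR_gt0// -mulrA -expRD.
have [v0|v0] := leP 0 v.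
  apply: le_trans (_ : (2 * expR (e * v)) ^+ 2 <= _).
    rewrite ler_pXn2r ?nnegrE ?mulr_ge0 ?expR_ge0 ?(ltW p0)//.
    have : 1 <= expR (e * v) by rewrite -expR0 ler_expR mulr_ge0// ltW.
    by set u := expR _; lra.
  rewrite exprMn -expRM_natl (_ : (2 : R) ^+ 2 = 4); last by ring.
  by rewrite ler_pM2l// ler_expR mulrA addrC; exact: hC.
apply: le_trans (_ : 4 * 1 <= _); last first.
  by rewrite ler_pM2l// -expR0 ler_expR addr_ge0// mulr_ge0 ?expR_ge0// ltW.
have : expR (e * v) <= 1 by rewrite -expR0 ler_expR mulr_ge0_le0// ltW.
move=> u1; apply: le_trans (_ : 2 ^+ 2 <= _); last by rewrite mulr1 expr2; lra.
by rewrite ler_pXn2r ?nnegrE ?(ltW p0)//; move: u1; set u := expR _; lra.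
Qed.

Lemma is_derive_sech (A e b s : R) :
  is_derive s 1 (fun s => - (A / (1 + expR (b + e * s))))
    (A * e * (expR (b + e * s) / (1 + expR (b + e * s)) ^+ 2)).
Proof.
have h3 : is_derive s 1 (fun s : R => 1 + expR (b + e * s)) (e * expR (b + e * s)).
  have h2 := is_derive_expR_comp (is_derive_affine b e s).
  have := is_deriveD (is_derive_real_cst 1 s) h2; rewrite add0r.
  by rewrite (_ : (fun=> 1) + _ = (fun s : R => 1 + expR (b + e * s))).
have p0 : 1 + expR (b + e * s) != 0 by rewrite gt_eqF// addr_gt0 ?expR_gt0.
have h4 := @is_deriveZ_real R _ (- A) s _ (@is_deriveV R (fun s : R => 1 + expR (b + e * s)) s _ 1 p0 h3).
rewrite (_ : (fun s : R => _) = (fun s : R => - A * (1 + expR (b + e * s))^-1)); last first.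
  by apply/funext => r; rewrite -mulNr.
apply: is_derive_eq h4 _; rewrite /GRing.scale /=; move: p0; set u := 1 + _ => p0.
by set v := expR _; field.
Qed.

(** In the variable v = L + sigma s the integrand is e^(- K_m L) e^(K_m v - k e^v), integrable at
    both ends since K_m > 0. Hence a constant independent of [L] and [b]; the hypothesis weighs the
    growth of e^u against the decay of the other factor. *)
Lemma algF_hor m w chi (k : R) : 0 < m%:R + delta0 -> 0 < k ->
  exists2 C, 0 <= C & forall L b,
  (forall s, s <= b -> expR (L + sigma * s) * cos (w + sigma * chi) +
     Num.max (expR s * cos chi) 0 <= - (k * expR (L + sigma * s))) ->
  forall s, s <= b -> cmod (algF m L w (b +i* chi) - algF m L w (s +i* chi)) <=
    C * expR (- (KK m * L)).
Proof.
move=> m0 k0; have /andP[s0 s1] := sigma01.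
have K0 : 0 < KK m by rewrite divr_gt0.
have [C C0 hC] := sech_dominate K0 k0.
exists (C / (m%:R + delta0)); first by rewrite divr_ge0// ltW.
move=> L b hb s sb; set md := m%:R + delta0.
pose A := C / md * expR (- (KK m * L)).
have A0 : 0 <= A by rewrite mulr_ge0 ?expR_ge0// divr_ge0// ltW.
have KE r : KK m * (L + sigma * r) = KK m * L + md * r.
  by rewrite mulrDr [KK m * (_ * _)]mulrA /KK mulfVK// gt_eqF.
apply: le_trans (_ : - (A / (1 + expR (KK m * L + md * b))) -
    - (A / (1 + expR (KK m * L + md * s))) <= _).
  apply: (@complex_mvt R (fun s => algF m L w (s +i* chi)) (fun s => algdF m L w (s +i* chi))
    (fun s => - (A / (1 + expR (KK m * L + md * s))))
    (fun s => A * md * (expR (KK m * L + md * s) / (1 + expR (KK m * L + md * s)) ^+ 2))) => //.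
  - by move=> r _; apply: hol_hor; exact: hol_algF.
  - by move=> r _; exact: is_derive_sech.
  - move=> r /andP[_ rb]; apply: le_trans (algdF_le _ _ _ _ _) _.
    apply: le_trans (_ : expR (- (KK m * L)) * expR (KK m * (L + sigma * r) - k * expR (L + sigma * r)) <= _).
      rewrite -expRD ler_expR KE -/md; have := hb r rb.
      by set p := expR (L + _); set q := Num.max _ _; set c := cos _; lra.
    have := hC (L + sigma * r); rewrite KE => h.
    apply: le_trans (ler_wpM2l (expR_ge0 _) h) _.
    rewrite /A; set q := _ / _ ^+ 2; rewrite le_eqVlt; apply/orP; left; apply/eqP.
    by field; rewrite gt_eqF.
have p1 r : 0 < 1 + expR (KK m * L + md * r) by rewrite addr_gt0 ?expR_gt0.
rewrite opprK -/md -/A; apply: le_trans (_ : A / (1 + expR (KK m * L + md * s)) <= _).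
  by rewrite gerDr oppr_le0 divr_ge0// ltW.
by rewrite ler_pdivrMr// ler_peMr// lerDl expR_ge0.
Qed.

(** Near u = 0 the integrand with m Taylor terms removed is O(u^(m + delta)). The constant may
    depend on [L]: it is only used for s -> -oo with [L] fixed. *)
Lemma algF_ver m w L chi : 0 <= chi -> exists C, forall s, s <= 0 ->
  cmod (algF m L w (s +i* chi) - algF m L w (s +i* 0)) <= C * expR ((m%:R + delta0) * s).
Proof.
move=> chi0; exists (expR (expR L + 1) * chi) => s s0; have /andP[sg0 _] := sigma01.
set md := m%:R + delta0; set B := expR (expR L + 1) * expR (md * s).
have -> : expR (expR L + 1) * chi * expR (md * s) = B * chi - B * 0 by rewrite /B; ring.
apply: (@complex_mvt R (fun y => algF m L w (s +i* y)) (fun y => 'i * algdF m L w (s +i* y))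
   (fun y => B * y) (fun y => B)) => //.
- by move=> y _; apply: hol_ver; exact: hol_algF.
- move=> y _; rewrite (_ : (fun y : R => _) = B *: (@id R)); last by [].
  by apply: is_derive_eq; rewrite /GRing.scale /= mulr1.
- move=> y _; rewrite cmodM cmod_i mul1r; apply: le_trans (algdF_le _ _ _ _ _) _.
  rewrite /B -expRD ler_expR -/md.
  have h1 : expR (L + sigma * s) * cos (w + sigma * y) <= expR L.
    apply: le_trans (_ : expR (L + sigma * s) <= _); first by rewrite ler_piMr ?expR_ge0// cos_le1.
    by rewrite ler_expR gerDl mulr_ge0_le0// ltW.
  have h2 : Num.max (expR s * cos y) 0 <= 1.
    rewrite ge_max ler01 andbT; apply: le_trans (_ : expR s <= 1).
      by rewrite ler_piMr ?expR_ge0// cos_le1.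
    by rewrite -expR0 ler_expR.
  by move: h1 h2; set p := _ * cos _; set q := Num.max _ _; lra.
Qed.

Lemma algF_sym m L s w : expi (- w) * algF m L (- w) (s +i* 0) =
  conjc (expi w * algF m L w (s +i* 0)).
Proof.
rewrite conjM -expiN; congr (_ * _); rewrite /algF conjB (big_morph _ (@conjD R) (conjc0 R)).
have sJ : s +i* 0 = conjc (s +i* 0) by rewrite /= oppr0.
congr (_ - _).
  rewrite {1}sJ -loop_primJ; congr (PR _ _ _ _); rewrite conjM conjc_real expiN//.
apply: eq_bigr => j _; rewrite conjM /alg_coef conjM conjc_real -!cexpJ.
congr (_ * _ * _).
  by congr ce; rewrite conjM -!rmorphN conjc_real.
rewrite -loop_primJ; congr (PR _ _ _ _); first by rewrite !mul0r conjc0.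
by apply: complex_ext; rewrite ?ReJ ?ImJ ?ReD ?ImD ?ReZ ?ImZ /= ?mulr0 ?add0r.
Qed.

Definition algT m L w : R[i] := \sum_(j < m) alg_coef j L w * lup0 1 (KK j).

Lemma cmod_alg_coef j L w : cmod (alg_coef j L w) = (j`!%:R * sigma)^-1 * expR (- (KK j * L)).
Proof.
have /andP[s0 _] := sigma01.
rewrite /alg_coef cmodM cmod_real cmod_cexp ger0_norm ?invr_ge0 ?mulr_ge0 ?ler0n ?ltW//.
by rewrite -rmorphN (ReZ (- KK j)) mulNr.
Qed.

Lemma alg_tail m psi N : pi / 2 < psi < 3 * pi / 2 -> 0 < N ->
  exists2 C, 0 <= C & forall L w t, 0 <= L -> 0 <= t ->
  cmod (\sum_(j < m) alg_coef j L w * (PR 1 c0 (KK j) (t +i* psi) - lup0 1 (KK j)))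
  <= C * expR (`|delta0| / sigma * L) * expR (- N * t).
Proof.
move=> psi_in N0; have /andP[sg0 _] := sigma01.
have hC2 (j : 'I_m) := lupP sigma01 0 (KK j) (@ltr01 R) (lexx 0) psi_in N0.
have {hC2}[C2 hC2] := choice hC2.
have C20 j : 0 <= C2 j.
  have := le_trans (cmod_ge0 _) (hC2 j 0 (lexx _)).
  by rewrite mulr0 expR0 mulr1.
exists (\sum_(j < m) (j`!%:R * sigma)^-1 * C2 j).
  by apply: sumr_ge0 => j _; rewrite mulr_ge0// invr_ge0 mulr_ge0// ltW.
move=> L w t L0 t0; rewrite -mulrA mulr_suml.
apply: le_trans (cmod_sum _ _ _) _; apply: ler_sum => j _.
rewrite cmodM cmod_alg_coef -!mulrA ler_wpM2l ?invr_ge0 ?mulr_ge0 ?(ltW sg0)//.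
rewrite mulrA mulrCA.
have e1 : expR (- (KK j * L)) <= expR (`|delta0| / sigma * L).
  rewrite ler_expR -mulNr ler_wpM2r// /KK -mulNr ler_wpM2r ?invr_ge0 ?(ltW sg0)//.
  rewrite opprD; have h := ler_norm (- delta0); rewrite normrN in h.
  by have : 0 <= (j%:R : R) by []; lra.
rewrite [leRHS]mulrCA mulrA.
apply: le_trans (_ : expR (`|delta0| / sigma * L) * (C2 j * expR (- N * t)) <= _).
  by rewrite ler_pM ?cmod_ge0 ?expR_ge0// hC2.
by rewrite mulrA [_ * C2 j]mulrC -mulrA.
Qed.

(* The truncated expansion in the directions where exp (x e^(i w) u^sigma) decays:
   the base point s drops out of the final sum by [algF_sym]. *)
Lemma alg_partial m w chi (k N : R) : 0 < m%:R + delta0 -> 0 < k -> 0 < N -> 0 <= chi ->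
  pi / 2 < w + sigma * chi < 3 * pi / 2 ->
  exists2 C, 0 <= C & forall L, 0 <= L -> exists C', forall b, 0 <= b ->
  (forall s, s <= b -> expR (L + sigma * s) * cos (w + sigma * chi) +
     Num.max (expR s * cos chi) 0 <= - (k * expR (L + sigma * s))) ->
  forall s, s <= 0 ->
  cmod (PR 1 ((expR L)%:C * expi w) delta0 (b +i* chi) - algT m L w
    - algF m L w (s +i* 0)) <=
  C * expR (- (KK m * L)) + C * (expR (`|delta0| / sigma * L) *
    expR (- N * (L + sigma * b))) + C' * expR ((m%:R + delta0) * s).
Proof.
move=> m0 k0 N0 chi0 psi_in; have /andP[sg0 _] := sigma01.
have [C1 C10 hC1] := algF_hor w chi m0 k0.
have [C2 C20 hC2] := alg_tail m psi_in N0.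
exists (C1 + C2); first exact: addr_ge0.
move=> L L0; have [C' hC'] := algF_ver m w L chi0.
exists C' => b b0 hb s s0.
have t0 : 0 <= L + sigma * b by rewrite addr_ge0// mulr_ge0// ltW.
have bs : s <= b by exact: le_trans b0.
have e1 := hC1 L b hb s bs; have e2 := hC2 L w _ L0 t0; have e3 := hC' s s0.
have E : algF m L w (b +i* chi) = PR 1 ((expR L)%:C * expi w) delta0 (b +i* chi)
   - algT m L w - \sum_(j < m) alg_coef j L w *
     (PR 1 c0 (KK j) ((L + sigma * b) +i* (w + sigma * chi)) - lup0 1 (KK j)).
  rewrite /algF -addrA; congr (_ + _); rewrite -opprD; congr (- _).
  rewrite /algT -big_split; apply: eq_bigr => j _ /=.
  have -> : sigma%:C * (b +i* chi) + (L +i* w) = (L + sigma * b) +i* (w + sigma * chi).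
    by apply: complex_ext; rewrite ?ReD ?ImD ?ReZ ?ImZ /= addrC.
  by rewrite -mulrDr [X in _ = _ * X]addrC subrK.
move: e1 e2 e3; rewrite E; set P := PR _ _ _ _ - _; set S := \sum_(j < m) _.
set F := algF _ _ _ _; set F0 := algF _ _ _ _ => e1 e2 e3.
have -> : P - F0 = (P - S - F) + (F - F0) + S by ring.
apply: le_trans (cmodD _ _) _; apply: le_trans (lerD (cmodD _ _) (lexx _)) _.
apply: le_trans (lerD (lerD e1 e3) e2) _.
set a1 := expR (- _); set a2 := expR (_ * L); set a3 := expR (- N * _); set a4 := expR _.
have h1 : 0 <= C2 * a1 by rewrite mulr_ge0 ?expR_ge0.
have h2 : 0 <= C1 * (a2 * a3) by rewrite !mulr_ge0 ?expR_ge0.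
have -> : C2 * a2 * a3 = C2 * (a2 * a3) by ring.
by rewrite !mulrDl; set b1 := C1 * a1; set b2 := C2 * (_ * _); set b3 := C' * _; lra.
Qed.

(** Here both cosines are negative on Im z = chi: e^u stays bounded and the other factor decays, so
    [alg_partial] applies for every b and b -> +oo removes its tail. *)
Lemma alg_expansion m w chi : 0 < m%:R + delta0 -> pi / 2 < chi < 3 * pi / 2 ->
  pi / 2 < w + sigma * chi < 3 * pi / 2 ->
  exists2 C, 0 <= C & forall L, 0 <= L -> exists C', forall s, s <= 0 ->
  cmod (lup sigma 1 (expR L) w delta0 - algT m L w - algF m L w (s +i* 0)) <=
  C * expR (- (KK m * L)) + C' * expR ((m%:R + delta0) * s).
Proof.
move=> m0 chi_in psi_in; have cchi := cos_lt0 chi_in; have cpsi := cos_lt0 psi_in.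
have k0 : 0 < - cos (w + sigma * chi) by rewrite oppr_gt0.
have /andP[sg0 _] := sigma01; have /andP[chi1 chi2] := chi_in.
have chi0 : 0 <= chi by have := pi_gt0 R; lra.
have [C C0 hC] := alg_partial m0 k0 ltr01 chi0 psi_in; exists C => // L L0.
have [C' hC'] := hC L L0; exists C' => s s0.
have [C1 hC1] := lupP sigma01 w delta0 ltr01 (expR_ge0 L) chi_in sg0.
apply: (@le_exp_lim R _ _ (C1 + C * expR (`|delta0| / sigma * L)) 0 sigma sg0) => b b0.
have hb : forall s, s <= b -> expR (L + sigma * s) * cos (w + sigma * chi) +
     Num.max (expR s * cos chi) 0 <= - (- cos (w + sigma * chi) * expR (L + sigma * s)).
  move=> r _; have -> : Num.max (expR r * cos chi) 0 = 0.
    by apply: max_r; rewrite mulr_ge0_le0 ?expR_ge0// ltW.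
  by rewrite addr0 mulNr opprK mulrC.
have e1 := hC' b b0 hb s s0; have e2 := hC1 b b0.
move: e1 e2; set P := PR _ _ _ _; set l := lup _ _ _ _ _; set T := algT _ _ _.
set F := algF _ _ _ _ => e1 e2.
have -> : l - T - F = (P - T - F) - (P - l) by ring.
apply: le_trans (cmodB _ _) _; apply: le_trans (lerD e1 e2) _.
have e3 : expR (- 1 * (L + sigma * b)) <= expR (- sigma * b).
  by rewrite ler_expR mulN1r mulNr; lra.
have e4 : C * (expR (`|delta0| / sigma * L) * expR (- 1 * (L + sigma * b))) <=
  C * expR (`|delta0| / sigma * L) * expR (- sigma * b).
  by rewrite mulrA ler_wpM2l// mulr_ge0 ?expR_ge0.
move: e4; rewrite (mulrDl C1).
set r := C1 * _; set q := C * expR _ * expR _; set p := C * (expR _ * expR _).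
set u := C * expR _; set v := C' * _; lra.
Qed.

End Algebraic.

(** * Laplace's method at the saddle point *)

Section Moments.
Context {R : realType}.
Variable kap : R.
Hypothesis kap0 : 0 < kap.
Implicit Types (r s t x y N : R) (n m k : nat) (z : R[i]).

Lemma poly_exp_le (c : R) n : 0 < c ->
  exists2 C, 0 <= C & forall y, 0 <= y -> (1 + y) ^+ n * expR (- (c * y)) <= C.
Proof.
move=> c0; exists (n`!%:R * c^-1 ^+ n * expR c).
  by rewrite !mulr_ge0 ?expR_ge0 ?exprn_ge0// invr_ge0 ltW.
move=> y y0; have cy0 : 0 <= c * (1 + y) by rewrite mulr_ge0 ?addr_ge0// ltW.
have := pow_fact_le n cy0; rewrite ler_pdivrMr ?ltr0n ?fact_gt0// exprMn => h.
rewrite expRN ler_pdivrMr ?expR_gt0//.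
have cn0 : 0 < c ^+ n by rewrite exprn_gt0.
rewrite -(ler_pM2l cn0); apply: le_trans h _.
rewrite mulrDr mulr1 expRD exprVn le_eqVlt; apply/orP; left; apply/eqP.
by field; rewrite gt_eqF.
Qed.

Definition gm n z : R[i] := z ^+ n * ce ((- (kap / 2))%:C * (z * z)).

Lemma hol_pow n : hol (fun z => z ^+ n.+1) (fun z => n.+1%:R * z ^+ n).
Proof.
elim: n => [|n IH].
  by apply: hol_ext (@hol_id R) => z; rewrite ?expr1 ?expr0 ?mulr1.
apply: hol_ext (holM (@hol_id R) IH) => z; first by rewrite -exprS.
by rewrite -[in RHS]natr1 mul1r mulrDl mul1r exprS; ring.
Qed.

Lemma locally_bounded_pow n : locally_bounded (fun z : R[i] => z ^+ n).
Proof.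
elim: n => [|n IH].
  by move=> rho; exists 1 => z _; rewrite expr0 cmod1.
move=> rho; have [B hB] := locally_boundedM (@locally_bounded_id R) IH rho.
by exists B => z; rewrite exprS; exact: hB.
Qed.

Lemma hol_gauss : hol (fun z => ce ((- (kap / 2))%:C * (z * z)))
  (fun z => (- kap)%:C * z * ce ((- (kap / 2))%:C * (z * z))).
Proof.
apply: hol_ext (hol_cexp (holZ (- (kap / 2))%:C (holM (@hol_id R) (@hol_id R)))) => z //.
rewrite mul1r mulr1; congr (_ * _).
have -> : (- kap)%:C = (- (kap / 2))%:C * 2 :> R[i].
  by rewrite -(rmorph_nat (real_complex R)) -rmorphM /=; congr (_%:C); field.
by ring.
Qed.

Lemma locally_bounded_gauss : locally_bounded (fun z => ce ((- (kap / 2))%:C * (z * z))).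
Proof.
apply: locally_bounded_cexp; apply: locally_boundedM; first exact: locally_bounded_cst.
by apply: locally_boundedM; exact: locally_bounded_id.
Qed.

Lemma hol_prim_gm n : hol (prim (gm n)) (gm n).
Proof.
have hg := hol_gauss.
have hb := @locally_bounded_gauss.
have h1 : hol (gm n) (fun z => (match n with 0 => 0 | n'.+1 => n'.+1%:R * z ^+ n' end) *
    ce ((- (kap / 2))%:C * (z * z)) + z ^+ n * ((- kap)%:C * z * ce ((- (kap / 2))%:C * (z * z)))).
  rewrite /gm; case: n => [|n].
    by apply: hol_ext (holM (@hol_cst R 1) hg) => z; rewrite ?expr0.
  exact: (holM (@hol_pow n) hg).
have h2 : hol (fun z => match n with 0 => 0 | n'.+1 => n'.+1%:R * z ^+ n' end)
   (fun z => match n with 0 | 1 => 0 | n'.+2 => n'.+2%:R * (n'.+1%:R * z ^+ n') end).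
  case: n {h1} => [|[|n]]; first exact: hol_cst.
    by apply: hol_ext (@hol_cst R 1) => z //; rewrite expr0 mulr1.
  exact: holZ (@hol_pow n).
have h3 : hol (fun z : R[i] => z ^+ n) (fun z => match n with 0 => 0 | n'.+1 => n'.+1%:R * z ^+ n' end).
  case: n {h1 h2} => [|n]; last exact: hol_pow.
  by apply: hol_ext (@hol_cst R 1) => z //; rewrite expr0.
have h4 : hol (fun z => (- kap)%:C * z) (fun=> (- kap)%:C).
  by apply: hol_ext (holZ (- kap)%:C (@hol_id R)) => z //; rewrite mulr1.
have h5 := holD (holM h2 hg) (holM h3 (holM h4 hg)).
apply: (hol_prim h1 h5).
  by apply: locally_boundedM; [exact: locally_bounded_pow|].
apply: locally_boundedD; apply: locally_boundedM => //.
- case: n {h1 h2 h3 h5} => [|n]; first exact: locally_bounded_cst.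
  by apply: locally_boundedM; [exact: locally_bounded_cst|exact: locally_bounded_pow].
- exact: locally_bounded_pow.
- apply: locally_boundedM => //; apply: locally_boundedM; first exact: locally_bounded_cst.
  exact: locally_bounded_id.
Qed.

Definition gauss_prim n y : R := Re (prim (gm n) y%:C).

Lemma is_derive_gauss_prim n y : is_derive y 1 (gauss_prim n) (y ^+ n * expR (- (kap / 2 * y ^+ 2))).
Proof.
have := hol_prim_gm n 0 1 y; rewrite mul1r add0r mulr1 => -[h _].
have E : gm n y%:C = (y ^+ n * expR (- (kap / 2 * y ^+ 2)))%:C.
  by rewrite /gm -!rmorphM cexp_real -rmorphXn -rmorphM mulNr expr2.
rewrite E /= in h.
rewrite (_ : gauss_prim n = (fun r => Re (prim (gm n) (0 + r%:C * 1))))//.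
by apply/funext => r; rewrite add0r mulr1.
Qed.

Lemma gauss_prim0 n : gauss_prim n 0 = 0.
Proof. by rewrite /gauss_prim prim0. Qed.

Lemma gauss_primN n y : gauss_prim n (- y) = (-1) ^+ n.+1 * gauss_prim n y.
Proof.
have h r : is_derive r 1 (fun r => gauss_prim n (- r)) (- ((- r) ^+ n * expR (- (kap / 2 * r ^+ 2)))).
  have hN : is_derive r 1 (fun r : R => - r) (- 1) by exact: is_deriveN.
  have := @is_derive1_comp R (gauss_prim n) (fun r => - r) r _ _ (is_derive_gauss_prim n (- r)) hN.
  by rewrite mulrN1 sqrrN.
have h2 r : is_cderive (fun r => (gauss_prim n (- r) - (-1) ^+ n.+1 * gauss_prim n r)%:C) r 0.
  apply: is_cderive_real.
  have hB := is_deriveB (h r) (@is_deriveZ_real R _ ((-1) ^+ n.+1) r _ (is_derive_gauss_prim n r)).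
  by apply: is_derive_eq hB _; rewrite [(-1) ^+ n.+1]exprS (exprNn r); ring.
have := is_cderive0_cst h2 y 0; rewrite oppr0 !gauss_prim0 mulr0 subrr => -[/eqP].
by rewrite subr_eq0 => /eqP.
Qed.

Lemma gauss_prim_lim n : exists l C, 0 <= C /\ forall y, 0 <= y -> `|gauss_prim n y - l| <= C * expR (- y).
Proof.
have k4 : 0 < kap / 4 by rewrite divr_gt0.
have [C0 C00 hC0] := poly_exp_le n k4.
have [|l hl] := @real_tail_limit R (gauss_prim n) (fun y => y ^+ n * expR (- (kap / 2 * y ^+ 2)))
  (C0 * expR (kap^-1)) 1 0 ltr01 (is_derive_gauss_prim n).
  move=> y y0; rewrite mulN1r ger0_norm ?mulr_ge0 ?exprn_ge0 ?expR_ge0//.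
  have h1 : y ^+ n <= (1 + y ^+ 2) ^+ n.
    apply: lerXn2r; rewrite ?nnegrE ?addr_ge0 ?sqr_ge0//.
    by have := sqr_ge0 (y - 1); rewrite sqrrB expr1n mulr1; lra.
  have h2 := hC0 _ (sqr_ge0 y).
  have -> : expR (- (kap / 2 * y ^+ 2)) =
     expR (- (kap / 4 * y ^+ 2)) * expR (- (kap / 4 * y ^+ 2)).
    by rewrite -expRD; congr expR; field.
  rewrite mulrA -[leRHS]mulrA; apply: ler_pM; rewrite ?mulr_ge0 ?exprn_ge0 ?expR_ge0//.
    by apply: le_trans h2; rewrite ler_wpM2r ?expR_ge0.
  rewrite -expRD ler_expR.
  (* One half of the Gaussian absorbs y^n; the other half is below e^(1 / kap - y) because kap y^2 /
     4 - y + 1 / kap is a square divided by kap. *)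
  have := sqr_ge0 (kap / 2 * y - 1); rewrite sqrrB expr1n mulr1 => h.
  have : 0 <= kap^-1 * ((kap / 2 * y) ^+ 2 - kap / 2 * y *+ 2 + 1).
    by rewrite mulr_ge0// invr_ge0 ltW.
  have -> : kap^-1 * ((kap / 2 * y) ^+ 2 - kap / 2 * y *+ 2 + 1) =
     kap / 4 * y ^+ 2 - y + kap^-1 by field; rewrite gt_eqF.
  by lra.
exists l, (C0 * expR (kap^-1)); split; first by rewrite mulr_ge0 ?expR_ge0.
by move=> y y0; have := hl y y0; rewrite divr1 mulN1r.
Qed.

(** The integral of y^n exp(- kap y^2 / 2) over the whole line. Only its vanishing for odd n is
    used, never its value. *)
Definition gauss_moment n : R := xget 0 [set l | exists C, 0 <= C /\
  forall y, 0 <= y -> `|gauss_prim n y - gauss_prim n (- y) - l| <= C * expR (- y)].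

Lemma gauss_momentP n : exists C, 0 <= C /\
  forall y, 0 <= y -> `|gauss_prim n y - gauss_prim n (- y) - gauss_moment n| <= C * expR (- y).
Proof.
suff [l hl] : exists l, [set l | exists C, 0 <= C /\
  forall y, 0 <= y -> `|gauss_prim n y - gauss_prim n (- y) - l| <= C * expR (- y)] l.
  exact: (xgetI 0 hl).
have [l [C [C0 hC]]] := gauss_prim_lim n.
exists ((1 - (-1) ^+ n.+1) * l), (2 * C); split; first by rewrite mulr_ge0.
move=> y y0; rewrite gauss_primN.
have -> : gauss_prim n y - (-1) ^+ n.+1 * gauss_prim n y - (1 - (-1) ^+ n.+1) * l =
  (1 - (-1) ^+ n.+1) * (gauss_prim n y - l) by ring.
rewrite normrM -mulrA ler_pM// ?hC//.
rewrite (le_trans (ler_normB _ _))// normr1 normrX normrN1 expr1n.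
by lra.
Qed.

Lemma gauss_moment_odd n : odd n -> gauss_moment n = 0.
Proof.
move=> on; have [C [C0 hC]] := gauss_momentP n.
have E y : gauss_prim n y - gauss_prim n (- y) = 0.
  by rewrite gauss_primN -signr_odd /= on expr0 mul1r subrr.
apply/eqP; rewrite -normr_eq0 eq_le normr_ge0 andbT.
apply: (@le_exp_lim R _ 0 C 0 1 ltr01) => s s0.
by rewrite add0r mulN1r; have := hC s s0; rewrite E sub0r normrN.
Qed.

End Moments.

Section MonomialSums.
Context {R : realType}.
Implicit Types (z : R[i]) (y t : R).

(** A triple (c, j, l) stands for c z^j y^l. Such lists record that the truncated factor next to the
    Gaussian integrates term by term to moments; the coefficients are never made explicit. *)
Definition meval (s : seq (R * nat * nat)) z y : R[i] :=
  \sum_(p <- s) (p.1.1)%:C * z ^+ p.1.2 * y%:C ^+ p.2.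

Definition is_meval (f : R[i] -> R -> R[i]) := exists s, forall z y, f z y = meval s z y.

Lemma is_mevalD f g : is_meval f -> is_meval g -> is_meval (fun z y => f z y + g z y).
Proof. by move=> [s hs] [t ht]; exists (s ++ t) => z y; rewrite /meval big_cat hs ht. Qed.

Lemma is_mevalM f g : is_meval f -> is_meval g -> is_meval (fun z y => f z y * g z y).
Proof.
move=> [s hs] [t ht].
exists [seq (p.1.1 * q.1.1, (p.1.2 + q.1.2)%N, (p.2 + q.2)%N) | p <- s, q <- t] => z y.
rewrite /meval big_allpairs_dep hs ht /meval mulr_suml; apply: eq_bigr => p _.
rewrite mulr_sumr; apply: eq_bigr => q _ /=.
by rewrite rmorphM !exprD; ring.
Qed.

Lemma is_meval_mono (c : R) j l : is_meval (fun z y => c%:C * z ^+ j * y%:C ^+ l).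
Proof. by exists [:: (c, j, l)] => z y; rewrite /meval big_seq1. Qed.

Lemma is_meval_ext f g : (forall z y, f z y = g z y) -> is_meval f -> is_meval g.
Proof. by move=> fg [s hs]; exists s => z y; rewrite -fg. Qed.

Lemma is_meval_sum n (f : nat -> R[i] -> R -> R[i]) : (forall i, is_meval (f i)) ->
  is_meval (fun z y => \sum_(i < n) f i z y).
Proof.
move=> h; elim: n => [|n IH].
  by exists [::] => z y; rewrite /meval big_nil big_ord0.
by apply: is_meval_ext (is_mevalD IH (h n)) => z y; rewrite big_ord_recr.
Qed.

Lemma is_meval_exp n f : is_meval f -> is_meval (fun z y => f z y ^+ n).
Proof.
move=> h; elim: n => [|n IH].
  by apply: is_meval_ext (@is_meval_mono 1 0 0) => z y; rewrite !expr0 !mulr1.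
by apply: is_meval_ext (is_mevalM h IH) => z y; rewrite exprS.
Qed.

End MonomialSums.

Section Saddle.
Context {R : realType}.
Variables (sigma delta0 : R).
Hypothesis sigma01 : 0 < sigma < 1.
Implicit Types (r s t x y l b : R) (n m k : nat) (z : R[i]).

Let kap : R := 1 - sigma.

(* Recentred at its saddle point, the exponent is e^l e^(2ib) (gph z) + delta0 z, and
   gph z = kap/sigma - (kap/2) z^2 - sum_j (kc j) z^(j+3). *)
Definition gph z : R[i] := (sigma^-1)%:C * ce (sigma%:C * z) - ce z.

Definition dY l b z : R[i] :=
  ce ((expR l)%:C * expi (2 * b) * gph z + delta0%:C * z).

Definition kc j : R := (1 - sigma ^+ j.+2) / j.+3`!%:R.

(* y stands for e^l e^(2ib) z^2, which is real along the steepest direction z = t e^(-ib). *)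
Definition WI n z y : R[i] :=
  delta0%:C * z - y%:C * \sum_(j < n) (kc j)%:C * z ^+ j.+1.

Definition grem n z : R[i] := gph z - (kap / sigma)%:C + (kap / 2)%:C * z ^+ 2
   + \sum_(j < n) (kc j)%:C * z ^+ j.+3.

Lemma sig0 : 0 < sigma. Proof. by have /andP[] := sigma01. Qed.
Lemma kap_gt0 : 0 < kap. Proof. by rewrite subr_gt0; have /andP[] := sigma01. Qed.

Lemma gremE n z : grem n z =
  (sigma^-1)%:C * (ce (sigma%:C * z) - \sum_(i < n.+3) (sigma%:C * z) ^+ i / i`!%:R)
  - (ce z - \sum_(i < n.+3) z ^+ i / i`!%:R).
Proof.
have s0 := lt0r_neq0 sig0; have sC0 : sigma%:C != 0 :> R[i] by rewrite fmorph_eq0.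
rewrite /grem /gph !(big_ord_recl n.+2) !(big_ord_recl n.+1) !(big_ord_recl n).
rewrite !lift0 /= !expr0 !expr1 fact0 !divr1.
have -> : \sum_(i < n) (sigma%:C * z) ^+ lift ord0 (lift ord0 (lift ord0 i)) /
   (lift ord0 (lift ord0 (lift ord0 i)))`!%:R = sigma%:C *
   (\sum_(i < n) z ^+ lift ord0 (lift ord0 (lift ord0 i)) /
     (lift ord0 (lift ord0 (lift ord0 i)))`!%:R - \sum_(j < n) (kc j)%:C * z ^+ j.+3).
  rewrite -sumrB mulr_sumr; apply: eq_bigr => i _; rewrite !lift0 /kc.
  rewrite rmorphM rmorphB rmorphXn fmorphV rmorph_nat rmorph1 exprMn [sigma%:C ^+ i.+3]exprS.
  by ring.
set A := \sum_(i < n) _; set B := \sum_(i < n) _.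
rewrite (_ : (2`!%:R : R[i]) = 2)//.
have -> : (sigma^-1)%:C = (sigma%:C)^-1 :> R[i] by rewrite fmorphV.
have -> : (kap / sigma)%:C = (1 - sigma%:C) / sigma%:C :> R[i].
  by rewrite rmorphM rmorphB fmorphV rmorph1.
have -> : (kap / 2)%:C = (1 - sigma%:C) / 2 :> R[i].
  by rewrite rmorphM rmorphB fmorphV rmorph1 rmorph_nat.
by field.
Qed.

Lemma grem_le n : exists2 C, 0 <= C & forall z, cmod z <= 1 ->
  cmod (grem n z) <= C * cmod z ^+ n.+3.
Proof.
have s0 := sig0; have /andP[_ s1] := sigma01.
have T_le (w : R[i]) m : cmod w <= 1 ->
    cmod (ce w - \sum_(i < m) w ^+ i / i`!%:R) <= expR 1 * cmod w ^+ m.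
  move=> w1; apply: le_trans (cexp_taylor w m) _; rewrite mulrC ler_pM ?expR_ge0 ?divr_ge0 ?exprn_ge0 ?cmod_ge0//.
    by rewrite ler_expR ge_max ler01 andbT (le_trans (ler_Re_cmod _)).
  by rewrite ler_pdivrMr ?ltr0n ?fact_gt0// ler_peMr ?exprn_ge0 ?cmod_ge0// ler1n fact_gt0.
exists (sigma^-1 * expR 1 + expR 1); first by rewrite addr_ge0 ?mulr_ge0 ?expR_ge0// invr_ge0 ltW.
move=> z z1; rewrite gremE; apply: le_trans (cmodB _ _) _; rewrite mulrDl.
have sz : cmod (sigma%:C * z) <= cmod z.
  by rewrite cmodM cmod_real gtr0_norm// ler_piMl ?cmod_ge0// ltW.
apply: lerD; last exact: T_le.
rewrite cmodM cmod_real ger0_norm ?invr_ge0 ?(ltW s0)// -mulrA ler_wpM2l ?invr_ge0 ?(ltW s0)//.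
apply: le_trans (T_le _ _ (le_trans sz z1)) _; rewrite ler_wpM2l ?expR_ge0//.
by rewrite lerXn2r ?nnegrE ?cmod_ge0.
Qed.

Definition saddle_exp l b : R[i] := (expR l)%:C * expi (2 * b) * (kap / sigma)%:C.

Definition trunc n z y : R[i] := \sum_(i < n.+1) WI n z y ^+ i / i`!%:R.

(** With r0 = e^(l/2) and Y = (r0 y)^2 the integrand is the Gaussian e^(- kap Y / 2) times a
    polynomial, up to a relative r0^(- n - 1) / (1 + Y). The last factor is the derivative of an
    arctangent and integrates to O(1 / r0). *)
Lemma saddle_err n : exists rho0, [/\ 0 < rho0, rho0 <= 1 & exists2 C, 0 <= C &
  forall l b y, `|y| <= rho0 ->
  cmod (dY l b (y%:C * expi (- b)) - ce (saddle_exp l b) *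
    (expR (- (kap / 2 * (expR (l / 2) * y) ^+ 2)))%:C *
    trunc n (y%:C * expi (- b)) ((expR (l / 2) * y) ^+ 2)) <=
  cmod (ce (saddle_exp l b)) * (C * (expR (l / 2))^-1 ^+ n.+1 * (1 + expR (l / 2) ^+ 2 * y ^+ 2)^-1)].
Proof.
have k0 := kap_gt0.
have [C1 C10 hC1] := grem_le n.
pose K := \sum_(j < n) `|kc j|.
have K0 : 0 <= K by apply: sumr_ge0.
have KC : 0 < K + C1 + 1 by rewrite ltr_wpDl// addr_ge0.
(* So small that the terms of order three and more cost at most kap Y / 8 out of kap Y / 2; the
   surplus 3 kap Y / 8 is what [hC2] spends. *)
pose rho0 := Num.min 1 (kap / 8 / (K + C1 + 1)).
have rho_gt0 : 0 < rho0 by rewrite lt_min ltr01 !divr_gt0.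
have rho1 : rho0 <= 1 by rewrite ge_min lexx.
have rhoK : rho0 * (K + C1) <= kap / 8.
  apply: le_trans (_ : rho0 * (K + C1 + 1) <= _); first by rewrite ler_pM2l// lerDl.
  by rewrite -ler_pdivlMr// ge_min lexx orbT.
pose B := `|delta0| + K + C1.
have B0 : 0 <= B by rewrite !addr_ge0.
have k38 : 0 < 3 * kap / 8 by rewrite divr_gt0// mulr_gt0.
(* The powers of 1 + Y to be absorbed: n + 1 from the Taylor remainder, n + 1 from trading |y| for
   (1 + Y) / r0, and one for the arctangent denominator. *)
have [C2 C20 hC2] := poly_exp_le (n.+1 + n.+1).+1 k38.
exists rho0; split=> //; exists ((B ^+ n.+1 + B) * expR `|delta0| * C2).
  by rewrite !mulr_ge0 ?addr_ge0 ?exprn_ge0 ?expR_ge0.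
move=> l b y yrho; set r0 := expR (l / 2); set Y := (r0 * y) ^+ 2.
have r00 : 0 < r0 by exact: expR_gt0.
have Y0 : 0 <= Y by exact: sqr_ge0.
set z := y%:C * expi (- b).
have cz : cmod z = `|y| by rewrite /z cmodM cmod_real cmod_expi mulr1.
have y1 : `|y| <= 1 by exact: le_trans rho1.
have el : expR l = r0 ^+ 2 by rewrite /r0 expr2 -expRD; congr expR; field.
have lz : (expR l)%:C * expi (2 * b) * z ^+ 2 = Y%:C.
  rewrite el /z /Y !exprMn expiX.
  have -> : (r0 ^+ 2)%:C * expi (2 * b) * (y%:C ^+ 2 * expi (2 * - b)) =
     (r0 ^+ 2)%:C * y%:C ^+ 2 * (expi (2 * b) * expi (2 * - b)) by ring.
  by rewrite -expiD mulrN subrr expi0 mulr1 -rmorphXn -rmorphM.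
clearbody z.
pose Rr := (expR l)%:C * expi (2 * b) * grem n z.
have expE : (expR l)%:C * expi (2 * b) * gph z + delta0%:C * z =
    saddle_exp l b + (- (kap / 2 * Y))%:C + (WI n z Y + Rr).
  rewrite /Rr /grem /WI /saddle_exp.
  have -> : Y%:C * (\sum_(j < n) (kc j)%:C * z ^+ j.+1) =
     (expR l)%:C * expi (2 * b) * \sum_(j < n) (kc j)%:C * z ^+ j.+3.
    rewrite !mulr_sumr; apply: eq_bigr => j _; rewrite -lz.
    by have -> : z ^+ j.+3 = z ^+ 2 * z ^+ j.+1; [rewrite -exprD|ring].
  have -> : (- (kap / 2 * Y))%:C = - ((kap / 2)%:C * Y%:C) :> R[i] by rewrite rmorphN rmorphM.
  rewrite -lz; set S := \sum_(j < n) _; ring.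
have dYE : dY l b z = ce (saddle_exp l b) * (expR (- (kap / 2 * Y)))%:C * ce (WI n z Y + Rr).
  by rewrite /dY expE !cexpD cexp_real.
have WI_le : cmod (WI n z Y) <= `|y| * (`|delta0| + K * Y).
  rewrite /WI; apply: le_trans (cmodB _ _) _; rewrite !cmodM !cmod_real (ger0_norm Y0) cz.
  have h : cmod (\sum_(j < n) (kc j)%:C * z ^+ j.+1) <= `|y| * K.
    apply: le_trans (cmod_sum _ _ _) _; rewrite /K mulr_sumr; apply: ler_sum => j _.
    rewrite cmodM cmod_real cmodX cz mulrC ler_wpM2r//.
    by rewrite exprS ler_piMr// exprn_ile1.
  have -> : `|y| * (`|delta0| + K * Y) = `|delta0| * `|y| + Y * (`|y| * K) by ring.
  by rewrite lerD2l ler_wpM2l.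
have Rr_le : cmod Rr <= C1 * Y * `|y| ^+ n.+1.
  rewrite /Rr !cmodM cmod_expi mulr1 cmod_real ger0_norm ?expR_ge0//.
  have h := hC1 z; rewrite cz in h.
  apply: le_trans (ler_wpM2l (expR_ge0 _) (h y1)) _.
  rewrite el /Y exprMn -[y ^+ 2]real_normK ?num_real// le_eqVlt; apply/orP; left; apply/eqP.
  by have -> : `|y| ^+ n.+3 = `|y| ^+ 2 * `|y| ^+ n.+1; [rewrite -exprD|ring].
have yn1 : `|y| ^+ n.+1 <= `|y| by rewrite exprS ler_piMr// exprn_ile1.
pose q := Y * `|y|.
have ee : expR (cmod (WI n z Y)) * expR (cmod Rr) <= expR `|delta0| * expR (kap / 8 * Y).
  rewrite -!expRD ler_expR.
  have h1 : cmod (WI n z Y) <= `|delta0| + rho0 * K * Y.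
    apply: le_trans WI_le _; rewrite mulrDr; apply: lerD; first by rewrite ler_piMl.
    by rewrite [rho0 * K]mulrC -mulrA mulrCA ler_wpM2l// ler_wpM2r.
  have h2 : cmod Rr <= rho0 * C1 * Y.
    apply: le_trans Rr_le _; have -> : rho0 * C1 * Y = C1 * Y * rho0 by ring.
    by apply: ler_wpM2l; [exact: mulr_ge0|exact: le_trans yn1 yrho].
  have h3 : rho0 * (K + C1) * Y <= kap / 8 * Y by rewrite ler_wpM2r.
  by rewrite mulrDr mulrDl in h3; lra.
have Ile : cmod (ce (WI n z Y + Rr) - trunc n z Y) <=
    `|y| ^+ n.+1 * ((B ^+ n.+1 + B) * (1 + Y) ^+ n.+1) * (expR `|delta0| * expR (kap / 8 * Y)).
  (* Two errors: truncating the exponential of the polynomial part, and dropping the phase remainder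
     [Rr]. *)
  have -> : ce (WI n z Y + Rr) - trunc n z Y =
    (ce (WI n z Y) - trunc n z Y) + ce (WI n z Y) * (ce Rr - 1).
    by rewrite cexpD; ring.
  have Y1 : 1 <= 1 + Y by rewrite lerDl.
  set E2 := expR _ * expR _.
  have -> : `|y| ^+ n.+1 * ((B ^+ n.+1 + B) * (1 + Y) ^+ n.+1) * E2 =
    `|y| ^+ n.+1 * (B ^+ n.+1 * (1 + Y) ^+ n.+1) * E2 +
    `|y| ^+ n.+1 * (B * (1 + Y) ^+ n.+1) * E2 by ring.
  apply: le_trans (cmodD _ _) _; apply: lerD.
    apply: le_trans (cexp_taylor _ _) _.
    apply: ler_pM; rewrite ?divr_ge0 ?exprn_ge0 ?cmod_ge0 ?expR_ge0//.
      rewrite ler_pdivrMr ?ltr0n ?fact_gt0//.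
      apply: le_trans (_ : `|y| ^+ n.+1 * (B ^+ n.+1 * (1 + Y) ^+ n.+1) * 1 <= _).
        rewrite mulr1 -!exprMn lerXn2r ?nnegrE ?mulr_ge0 ?cmod_ge0 ?addr_ge0//.
        apply: le_trans WI_le _; rewrite ler_wpM2l// /B.
        have : 0 <= K + C1 + (`|delta0| + C1) * Y by rewrite !addr_ge0// mulr_ge0// addr_ge0.
        by rewrite mulrDr mulr1 !mulrDl; lra.
      by rewrite ler_wpM2l ?mulr_ge0 ?exprn_ge0 ?addr_ge0// ler1n fact_gt0.
    apply: le_trans ee; apply: le_trans (_ : expR (cmod (WI n z Y)) <= _).
      by rewrite ler_expR ge_max ler_Re_cmod cmod_ge0.
    by rewrite ler_peMr ?expR_ge0// -expR0 ler_expR cmod_ge0.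
  rewrite cmodM.
  have hR : cmod (ce Rr - 1) <= cmod Rr * expR (cmod Rr).
    have := cexp_taylor Rr 1; rewrite big_ord1 expr0 fact0 divr1 expr1 (_ : (1`!%:R : R) = 1)// divr1.
    move=> /le_trans; apply; rewrite ler_wpM2l ?cmod_ge0// ler_expR.
    by rewrite ge_max ler_Re_cmod cmod_ge0.
  apply: le_trans (_ : expR (cmod (WI n z Y)) * (cmod Rr * expR (cmod Rr)) <= _).
    apply: ler_pM => //; rewrite ?cmod_ge0// cmod_cexp ler_expR; exact: ler_Re_cmod.
  rewrite mulrCA; apply: ler_pM; rewrite ?mulr_ge0 ?cmod_ge0 ?expR_ge0//.
  apply: le_trans Rr_le _; rewrite mulrC ler_wpM2l ?exprn_ge0//.
  apply: le_trans (_ : B * (1 + Y) <= _).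
    rewrite /B; have : 0 <= `|delta0| + K + C1 + (`|delta0| + K) * Y by rewrite !addr_ge0// mulr_ge0// addr_ge0.
    by rewrite mulrDr mulr1 !mulrDl; lra.
  by rewrite ler_wpM2l// exprS ler_peMr ?addr_ge0// exprn_ege1.
rewrite dYE -mulrBr !cmodM cmod_real ger0_norm ?expR_ge0// -mulrA ler_wpM2l ?cmod_ge0//.
apply: le_trans (ler_wpM2l (expR_ge0 _) Ile) _.
have yr : `|y| ^+ n.+1 <= r0^-1 ^+ n.+1 * (1 + Y) ^+ n.+1.
  rewrite -exprMn lerXn2r ?nnegrE ?mulr_ge0 ?invr_ge0 ?addr_ge0 ?(ltW r00)//.
  rewrite mulrC ler_pdivlMr// mulrC.
  have -> : r0 * `|y| = `|r0 * y| by rewrite normrM gtr0_norm.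
  rewrite /Y -[(r0 * y) ^+ 2]real_normK ?num_real//.
  have := normr_ge0 (r0 * y); have := sqr_ge0 (`|r0 * y| - 1).
  by rewrite sqrrB expr1n mulr1; set u := `|_|; lra.
have -> : 1 + r0 ^+ 2 * y ^+ 2 = 1 + Y by rewrite /Y exprMn.
have Yp : 0 < 1 + Y by rewrite ltr_pwDl.
rewrite ler_pdivlMr//.
have h := hC2 Y Y0.
set b1 := B ^+ n.+1 + B; set ed := expR `|delta0|.
have b10 : 0 <= b1 by rewrite addr_ge0// exprn_ge0.
apply: le_trans (_ : b1 * ed * r0^-1 ^+ n.+1 *
    ((1 + Y) ^+ (n.+1 + n.+1).+1 * expR (- (3 * kap / 8 * Y))) <= _); last first.
  rewrite [leRHS]mulrAC ler_wpM2l// !mulr_ge0 ?exprn_ge0 ?invr_ge0 ?expR_ge0 ?(ltW r00)//.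
have -> : expR (- (3 * kap / 8 * Y)) = expR (- (kap / 2 * Y)) * expR (kap / 8 * Y).
  by rewrite -expRD; congr expR; field.
set e1 := expR (- _); set e2 := expR (kap / 8 * Y).
have -> : (1 + Y) ^+ (n.+1 + n.+1).+1 = (1 + Y) ^+ n.+1 * (1 + Y) ^+ n.+1 * (1 + Y).
  by rewrite exprSr exprD.
have -> : e1 * (`|y| ^+ n.+1 * (b1 * (1 + Y) ^+ n.+1) * (ed * e2)) * (1 + Y) =
  (b1 * ed * (e1 * e2) * ((1 + Y) ^+ n.+1 * (1 + Y))) * `|y| ^+ n.+1 by ring.
have -> : b1 * ed * r0^-1 ^+ n.+1 * ((1 + Y) ^+ n.+1 * (1 + Y) ^+ n.+1 * (1 + Y) * (e1 * e2)) =
  (b1 * ed * (e1 * e2) * ((1 + Y) ^+ n.+1 * (1 + Y))) * (r0^-1 ^+ n.+1 * (1 + Y) ^+ n.+1) by ring.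
apply: ler_wpM2l => //; apply: mulr_ge0; first by rewrite !mulr_ge0 ?expR_ge0.
by apply: mulr_ge0; [apply: exprn_ge0|]; exact: ltW.
Qed.

End Saddle.

Section SaddleExpansion.
Context {R : realType}.
Variables (sigma delta0 : R).
Hypothesis sigma01 : 0 < sigma < 1.
Implicit Types (r t x y l b : R) (n m k : nat) (z : R[i]).

Let kap : R := 1 - sigma.
Let kap0 : 0 < kap := kap_gt0 sigma01.

Notation gq := (gauss_prim kap).
Notation gmoment := (gauss_moment kap).

Lemma trunc_meval n : exists s, forall z y, trunc sigma delta0 n z y = meval s z y.
Proof.
have WIm : is_meval (WI sigma delta0 n).
  have h1 : is_meval (fun z y => delta0%:C * z ^+ 1 * y%:C ^+ 0) by exact: is_meval_mono.
  have h2 : is_meval (fun z y => \sum_(j < n) (- kc sigma j)%:C * z ^+ j.+1 * y%:C ^+ 1).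
    apply: (@is_meval_sum R n (fun j z y => (- kc sigma j)%:C * z ^+ j.+1 * y%:C ^+ 1)) => j.
    exact: is_meval_mono.
  apply: is_meval_ext (is_mevalD h1 h2) => z y; rewrite /WI expr1 expr0 mulr1; congr (_ + _).
  by rewrite mulr_sumr -sumrN; apply: eq_bigr => j _; rewrite rmorphN expr1; ring.
apply: (@is_meval_sum _ n.+1 (fun i z y => WI sigma delta0 n z y ^+ i / i`!%:R)) => i.
have h : is_meval (fun (z : R[i]) (y : R) => (i`!%:R^-1)%:C * z ^+ 0 * y%:C ^+ 0).
  exact: is_meval_mono.
apply: is_meval_ext (is_mevalM (is_meval_exp i WIm) h) => z y.
by rewrite !expr0 !mulr1 fmorphV rmorph_nat.
Qed.

(** Contribution of the monomial c z^j Y^l on the line z = y e^(- i b): rescaling y by r0 yields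
    (e^(- i b) / r0)^(j + 1) times an incomplete moment [v] of order j + 2 l. *)
Let term (rr : R) b (p : R * nat * nat) (v : R) : R[i] :=
  (p.1.1 * v * rr ^+ p.1.2.+1)%:C * expi (- b) ^+ p.1.2.+1.

(** The coefficients [alpha] depend neither on the direction b, nor on l, nor on the length [rho] of
    the segment. The first lets one direction identify them; the last allows segments that shrink
    with b. *)
Lemma saddle_segment M : (0 < M)%N -> exists (alpha : nat -> R) (rho0 : R),
  [/\ 0 < rho0, rho0 <= 1 & forall rho, 0 < rho -> rho <= rho0 -> exists2 C, 0 <= C &
  forall l b (F : R[i] -> R[i]), 0 <= l -> hol F (dY sigma delta0 l b) ->
  cmod (F (rho%:C * expi (- b)) - F ((- rho)%:C * expi (- b)) -
    ce (saddle_exp sigma l b) * \sum_(i < M) (alpha i * expR (- (l / 2)) ^+ i.*2.+1)%:C *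
       expi (- b) ^+ i.*2.+1) <=
  cmod (ce (saddle_exp sigma l b)) * (C * expR (- (l / 2)) ^+ M.*2.+1)].
Proof.
move=> M0; have [n nE] : exists n, n.+1 = M.*2 by exists M.*2.-1; rewrite prednK// double_gt0.
have [rho0 [rho_gt0 rho1 [C C0 hC]]] := saddle_err delta0 sigma01 n.
have [s hs] := trunc_meval n.
(* Monomials with odd exponent of z have odd moments, which vanish; those with j >= 2 M belong to
   the error, which explains n + 1 = 2 M. *)
pose alpha i := \sum_(p <- s | p.1.2 == i.*2) p.1.1 * gmoment (p.1.2 + p.2.*2).
exists alpha, rho0; split=> // rho rho_pos rho_le.
have [cm hcm] := choice (gauss_momentP kap0).
have [Cp Cp0 hCp] : exists2 C, 0 <= C & forall u : R, 0 <= u -> u ^+ M.*2.+1 * expR (- (rho * u)) <= C.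
  have [C' C'0 hC'] := poly_exp_le M.*2.+1 rho_pos; exists C' => // u u0.
  apply: le_trans (hC' u u0); rewrite ler_wpM2r ?expR_ge0// lerXn2r ?nnegrE ?addr_ge0//.
  by rewrite lerDr.
pose K1 := \sum_(p <- s) `|p.1.1| * cm (p.1.2 + p.2.*2)%N * Cp.
pose K2 := \sum_(p <- s) `|p.1.1 * gmoment (p.1.2 + p.2.*2)|.
have cm0 k : 0 <= cm k by have [] := hcm k.
have K10 : 0 <= K1 by apply: sumr_ge0 => p _; rewrite !mulr_ge0.
have K20 : 0 <= K2 by apply: sumr_ge0 => p _.
exists (4 * C + K1 + K2); first by rewrite !addr_ge0// mulr_ge0.
move=> l b F l0 hF; set Z := expi (- b); set E := ce (saddle_exp sigma l b).
set r0 := expR (l / 2); set rr := expR (- (l / 2)).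
have r00 : 0 < r0 by exact: expR_gt0.
have rr0 : 0 < rr by exact: expR_gt0.
have rE : rr = r0^-1 by rewrite /rr expRN.
have rr1 : rr <= 1 by rewrite -expR0 ler_expR oppr_le0 divr_ge0.
have cZ k : cmod (Z ^+ k) = 1 by rewrite cmodX cmod_expi expr1n.
pose Mn (y : R) := E * \sum_(p <- s) term rr b p (gq (p.1.2 + p.2.*2) (r0 * y)).
have h1 : cmod ((F (rho%:C * Z) - Mn rho) - (F ((- rho)%:C * Z) - Mn (- rho))) <=
    cmod E * (C * rr ^+ n.+1) * (r0^-1 * atan (r0 * rho)) -
    cmod E * (C * rr ^+ n.+1) * (r0^-1 * atan (r0 * - rho)).
  apply: (@complex_mvt R (fun y => F (y%:C * Z) - Mn y)
     (fun y => Z * dY sigma delta0 l b (y%:C * Z) - Z * (E *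
    (expR (- (kap / 2 * (r0 * y) ^+ 2)))%:C * trunc sigma delta0 n (y%:C * Z) ((r0 * y) ^+ 2)))
     (fun y => cmod E * (C * rr ^+ n.+1) * (r0^-1 * atan (r0 * y)))
     (fun y => cmod E * (C * rr ^+ n.+1) * (1 + r0 ^+ 2 * y ^+ 2)^-1)).
  - by lra.
  - move=> y _; apply: is_cderiveB.
      have := hF 0 Z y; rewrite add0r; apply: is_cderive_ext => r; rewrite add0r//.
    pose ey := (expR (- (kap / 2 * (r0 * y) ^+ 2)))%:C.
    pose dt (p : R * nat * nat) := Z * (ey *
      ((p.1.1)%:C * (y%:C * Z) ^+ p.1.2 * ((r0 * y) ^+ 2)%:C ^+ p.2)).
    suff hd p : is_cderive (fun r : R => term rr b p (gq (p.1.2 + p.2.*2) (r0 * r))) y (dt p).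
      apply: is_cderive_eq (is_cderiveZ E (is_cderive_sum s hd)) _.
      by rewrite hs /meval /dt -!mulr_sumr -/ey; set S := \sum_(p <- s) _; ring.
    rewrite /term /dt /ey.
    set N := (p.1.2 + p.2.*2)%N.
    apply: (@is_cderive_ext _ (fun r => (p.1.1 * rr ^+ p.1.2.+1)%:C * Z ^+ p.1.2.+1 *
       (gq N (r0 * r))%:C)).
      by move=> r; rewrite !rmorphM; ring.
    have hlin : is_derive y 1 (fun r : R => r0 * r) r0.
      by have := is_derive_affine 0 r0 y; rewrite (_ : (fun s => _) = (fun r : R => r0 * r))//;
         apply/funext => r; rewrite add0r.
    have hd := @is_derive1_comp R (gq N) (fun r => r0 * r) y _ _ (is_derive_gauss_prim kap N (r0 * y)) hlin.
    apply: is_cderive_eq (is_cderiveZ _ (is_cderive_real hd)) _.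
    rewrite rE exprVn.
    have -> : (r0 * y) ^+ N = (r0 * y) ^+ p.1.2 * ((r0 * y) ^+ 2) ^+ p.2.
      by rewrite /N exprD -exprM mul2n.
    have r0C : r0%:C != 0 :> R[i] by rewrite fmorph_eq0 gt_eqF.
    rewrite !(rmorphM, rmorphXn, fmorphV) !exprMn !exprS.
    by field; rewrite expf_neq0.
  - move=> y _; apply: is_deriveZ_real.
    by have := is_derive_atan_scale r0 y; rewrite gt_eqF.
  - move=> y /andP[y1 y2]; rewrite -mulrBr cmodM [cmod Z](cmod_expi) mul1r.
    have yrho : `|y| <= rho0 by rewrite ler_norml; apply/andP; split; lra.
    apply: le_trans (hC l b y yrho) _; rewrite -/E -/r0 -[leRHS]mulrA rE.
    by rewrite ler_wpM2l ?cmod_ge0.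
have h2 : cmod E * (C * rr ^+ n.+1) * (r0^-1 * atan (r0 * rho)) -
    cmod E * (C * rr ^+ n.+1) * (r0^-1 * atan (r0 * - rho)) <=
    cmod E * (4 * C * rr ^+ M.*2.+1).
  rewrite mulrN atanN mulrN mulrN opprK -mulrDr -mulrDr -!mulrA ler_wpM2l ?cmod_ge0//.
  rewrite [leRHS]mulrCA ler_wpM2l// -rE nE exprSr [leRHS]mulrCA ler_wpM2l ?exprn_ge0 ?(ltW rr0)//.
  rewrite mulrC ler_wpM2r ?(ltW rr0)//.
  by have := atan_ltpi2 (r0 * rho); have /andP[_] := @pihalf_02 R; lra.
pose S := \sum_(p <- s) term rr b p (gmoment (p.1.2 + p.2.*2)).
have h3 : cmod (Mn rho - Mn (- rho) - E * S) <= cmod E * (K1 * rr ^+ M.*2.+1).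
  rewrite /Mn -mulrBr -mulrBr cmodM ler_wpM2l ?cmod_ge0// -sumrB -sumrB /K1 mulr_suml.
  apply: le_trans (cmod_sum _ _ _) _; apply: ler_sum => p _.
  set N := (p.1.2 + p.2.*2)%N; rewrite /term.
  have -> : (p.1.1 * gq N (r0 * rho) * rr ^+ p.1.2.+1)%:C * Z ^+ p.1.2.+1 -
     (p.1.1 * gq N (r0 * - rho) * rr ^+ p.1.2.+1)%:C * Z ^+ p.1.2.+1 -
     (p.1.1 * gmoment N * rr ^+ p.1.2.+1)%:C * Z ^+ p.1.2.+1 =
     (p.1.1 * rr ^+ p.1.2.+1 * (gq N (r0 * rho) - gq N (r0 * - rho) - gmoment N))%:C * Z ^+ p.1.2.+1.
    by rewrite !rmorphM !rmorphB; ring.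
  rewrite cmodM cZ mulr1 cmod_real !normrM -!mulrA ler_wpM2l// mulrN.
  have [_ hN] := hcm N; have rrho0 : 0 <= r0 * rho by rewrite mulr_ge0 ?ltW.
  apply: le_trans (_ : 1 * (cm N * expR (- (r0 * rho))) <= _).
    rewrite ler_pM// ?hN// normrX gtr0_norm// exprn_ile1//; exact: ltW.
  rewrite mul1r ler_wpM2l// [r0 * rho]mulrC.
  have := hCp r0 (ltW r00); rewrite rE exprVn ler_pdivlMr ?exprn_gt0//.
  by rewrite (mulrC (r0 ^+ M.*2.+1)) -?mulNr.
have h4 : cmod (E * S - E * \sum_(i < M) (alpha i * rr ^+ i.*2.+1)%:C * Z ^+ i.*2.+1) <=
    cmod E * (K2 * rr ^+ M.*2.+1).
  rewrite -mulrBr cmodM ler_wpM2l ?cmod_ge0//.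
  have -> : \sum_(i < M) (alpha i * rr ^+ i.*2.+1)%:C * Z ^+ i.*2.+1 =
    \sum_(p <- s) \sum_(i < M | p.1.2 == i.*2) term rr b p (gmoment (p.1.2 + p.2.*2)).
    rewrite (exchange_big_dep xpredT) //=; apply: eq_bigr => i _.
    rewrite /alpha mulr_suml rmorph_sum mulr_suml; apply: eq_bigr => p /eqP pE.
    by rewrite /term -pE.
  rewrite -sumrB /K2 mulr_suml; apply: le_trans (cmod_sum _ _ _) _; apply: ler_sum => p _.
  set N := (p.1.2 + p.2.*2)%N.
  have ct : cmod (term rr b p (gmoment N)) = `|p.1.1 * gmoment N| * rr ^+ p.1.2.+1.
    by rewrite /term cmodM cZ mulr1 cmod_real normrM (ger0_norm (exprn_ge0 _ (ltW rr0))).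
  case: (boolP (odd p.1.2)) => op.
    have oN : odd N by rewrite /N oddD odd_double addbF.
    have t0 v : term rr b p (gmoment N) = v -> v = 0.
      by move=> <-; rewrite /term (gauss_moment_odd kap0 oN) mulr0 mul0r mul0r.
    rewrite {1}(t0 _ erefl) big1 ?subrr ?cmod0 ?mulr_ge0 ?exprn_ge0 ?(ltW rr0)//.
    by move=> i _; exact: (t0 _ erefl).
  have pE : p.1.2 = (p.1.2)./2.*2 by rewrite -{1}(odd_double_half p.1.2) (negbTE op).
  have [iM|Mi] := ltnP (p.1.2)./2 M.
    rewrite (big_pred1 (Ordinal iM)) ?subrr ?cmod0 ?mulr_ge0 ?exprn_ge0 ?(ltW rr0)//.
    by move=> i /=; rewrite {1}pE (inj_eq double_inj) eq_sym.
  rewrite big_pred0 ?subr0; last first.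
    move=> i; apply/negbTE/eqP => h; move: Mi; rewrite h doubleK leqNgt => /negP; apply.
    exact: ltn_ord.
  rewrite ct ler_wpM2l// ler_wiXn2l ?(ltW rr0)// ltnS [leqRHS]pE leq_double//.
have -> : F (rho%:C * Z) - F ((- rho)%:C * Z) -
    E * \sum_(i < M) (alpha i * rr ^+ i.*2.+1)%:C * Z ^+ i.*2.+1 =
  ((F (rho%:C * Z) - Mn rho) - (F ((- rho)%:C * Z) - Mn (- rho))) +
   (Mn rho - Mn (- rho) - E * S) +
   (E * S - E * \sum_(i < M) (alpha i * rr ^+ i.*2.+1)%:C * Z ^+ i.*2.+1).
  by set f1 := F _; set f2 := F _; set m1 := Mn _; set m2 := Mn _; ring.
apply: le_trans (cmodD _ _) _; apply: le_trans (lerD (cmodD _ _) (lexx _)) _.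
apply: le_trans (lerD (lerD (le_trans h1 h2) h3) h4) _.
by rewrite -!mulrDr -!mulrDl.
Qed.

End SaddleExpansion.

(** * Angles at the ends of the steepest descent segment *)

Section Trig.
Context {R : realType}.
Implicit Types (x y b s rho sigma : R).

Lemma sin_le_id x : 0 <= x -> sin x <= x.
Proof.
move=> x0; have := @is_derive_le R sin id cos (fun=> 1) 0 x x0
  (fun t _ => is_derive_sin t) (fun t _ => is_derive_id t 1) (fun t _ => cos_le1 t).
by rewrite sin0 !subr0.
Qed.

Lemma cos_anti x y : `|x| <= `|y| -> `|y| <= pi -> cos y <= cos x.
Proof.
move=> xy yp; rewrite -(cos_norm x) -(cos_norm y) le_eqVlt.
move: xy; rewrite le_eqVlt => /orP[/eqP ->|xy]; first by rewrite eqxx.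
by rewrite ltr_cos ?xy ?orbT// in_itv /= normr_ge0 //= (le_trans (ltW xy)).
Qed.

(* The slanted segment through the saddle point ends closer to the positive
   real direction on the right and farther from it on the left. *)
Lemma angle_right b rho sigma : `|b| <= pi / 4 -> 0 < rho <= 1 -> 0 <= sigma <= 1 ->
  `|2 * b - rho * sin b| <= `|2 * b - sigma * (rho * sin b)| /\ `|2 * b - rho * sin b| < pi / 2.
Proof.
have pi0 := pi_gt0 R.
wlog b0 : b / 0 <= b => [H|].
  have [|b0] := leP 0 b; first exact: H.
  move=> hb hr hs; have := H (- b); rewrite normrN sinN !mulrN -!opprD !normrN.
  by apply=> //; rewrite oppr_ge0 ltW.
rewrite ger0_norm// => hb /andP[r0 r1] /andP[s0 s1].
have sb := sin_le_id b0; have sb0 : 0 <= sin b by rewrite sin_ge0_pi// b0 /=; lra.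
have rs : 0 <= rho * sin b by rewrite mulr_ge0// ltW.
have rs1 : rho * sin b <= b by apply: le_trans sb; rewrite ler_piMl.
have srs : sigma * (rho * sin b) <= rho * sin b by rewrite ler_piMl.
rewrite !ger0_norm; [|lra|lra].
split; first by lra.
have [b00|b00] := eqVneq b 0; first by rewrite b00 sin0; lra.
have : 0 < rho * sin b by rewrite mulr_gt0// sin_gt0_pi// lt0r b00 b0 /=; lra.
by lra.
Qed.

Lemma angle_left b rho sigma : 2 * `|b| + rho <= pi / 2 -> 0 < rho -> 0 <= sigma <= 1 ->
  `|2 * b + sigma * (rho * sin b)| <= `|2 * b + rho * sin b| /\ `|2 * b + rho * sin b| <= pi / 2.
Proof.
have pi0 := pi_gt0 R.
wlog b0 : b / 0 <= b => [H|].
  have [|b0] := leP 0 b; first exact: H.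
  move=> hb hr hs; have := H (- b); rewrite normrN sinN !mulrN -!opprD !normrN.
  by apply=> //; rewrite oppr_ge0 ltW.
rewrite ger0_norm// => hb r0 /andP[s0 s1].
have sb0 : 0 <= sin b by rewrite sin_ge0_pi// b0 /=; lra.
have rs : 0 <= rho * sin b by rewrite mulr_ge0// ltW.
have rs1 : rho * sin b <= rho by rewrite ler_piMr ?sin_le1// ltW.
have srs : sigma * (rho * sin b) <= rho * sin b by rewrite ler_piMl.
have srs0 : 0 <= sigma * (rho * sin b) by rewrite mulr_ge0.
by rewrite !ger0_norm; [split; lra|lra|lra].
Qed.

End Trig.

(** * Steepest descent for the loop integrals *)

Section SaddleContour.
Context {R : realType}.
Variables (sigma delta0 : R).
Hypothesis sigma01 : 0 < sigma < 1.
Implicit Types (r t x y l b rho : R) (n m k : nat) (z : R[i]).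

Let kap : R := 1 - sigma.
Let kap0 : 0 < kap := kap_gt0 sigma01.
Let s0 : 0 < sigma := sig0 sigma01.

Definition height b y r : R :=
  expR (sigma * r) / sigma * cos (2 * b + sigma * y) - expR r * cos (2 * b + y).

Lemma Re_gph b y r : Re (expi (2 * b) * gph sigma (r +i* y)) = height b y r.
Proof.
rewrite /gph ReM ReB ImB (ReZ sigma^-1) (ImZ sigma^-1) !Re_cexp !Im_cexp !ReZ !ImZ.
by rewrite Re_expi Im_expi /height !cosD /=; ring.
Qed.

Lemma cmod_dY l b y r :
  cmod (dY sigma delta0 l b (r +i* y)) = expR (expR l * height b y r + delta0 * r).
Proof.
rewrite /dY cmod_cexp ReD -[_ * _ * gph _ _]mulrA (ReZ (expR l)) Re_gph.
by rewrite (ReZ delta0).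
Qed.

Lemma zetaE t b : t%:C * expi (- b) = (t * cos b) +i* (- (t * sin b)).
Proof.
by apply: complex_ext; rewrite ?ReZ ?ImZ ?Re_expi ?Im_expi ?cosN ?sinN ?mulrN.
Qed.

(** The quadratic term lowers the height by kap t^2 / 2, and [rho0] is chosen so that the cubic
    remainder gives back at most half of it. *)
Lemma height_end : exists2 rho0, 0 < rho0 & forall b t, `|t| <= rho0 ->
  height b (- (t * sin b)) (t * cos b) <= kap / sigma * cos (2 * b) - kap / 4 * t ^+ 2.
Proof.
have [C C0 hC] := grem_le sigma01 0.
pose rho0 := Num.min 1 (kap / 4 / (C + 1)).
have C1 : 0 < C + 1 by rewrite ltr_wpDl.
exists rho0; first by rewrite lt_min ltr01 !divr_gt0.
move=> b t; rewrite le_min => /andP[t1 tC]; rewrite -Re_gph -zetaE.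
set z := t%:C * expi (- b); have cz : cmod z = `|t| by rewrite cmodM cmod_expi cmod_real mulr1.
have := hC z; rewrite cz => /(_ t1).
have zz : expi (2 * b) * z ^+ 2 = (t ^+ 2)%:C.
  by rewrite exprMn expiX mulrCA -expiD mulrN subrr expi0 mulr1 rmorphXn.
rewrite /grem big_ord0 addr0; set g := gph _ _ => hg.
have -> : expi (2 * b) * g = expi (2 * b) * (g - (kap / sigma)%:C + (kap / 2)%:C * z ^+ 2) +
   (kap / sigma)%:C * expi (2 * b) - (kap / 2)%:C * (expi (2 * b) * z ^+ 2) by ring.
rewrite zz ReB ReD (ReZ (kap / sigma)) Re_expi -rmorphM /= /kap.
have h : Re (expi (2 * b) * (g - (kap / sigma)%:C + (kap / 2)%:C * z ^+ 2)) <= C * `|t| ^+ 3.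
  by apply: le_trans (ler_Re_cmod _) _; rewrite cmodM cmod_expi mul1r.
have h2 : C * `|t| ^+ 3 <= kap / 4 * t ^+ 2.
  rewrite exprSr mulrA mulrAC -[t ^+ 2]real_normK ?num_real// ler_wpM2r ?sqr_ge0//.
  move: tC; rewrite ler_pdivlMr// mulrDr mulr1 mulrC; have := normr_ge0 t; lra.
by move: h h2; rewrite /kap; set u := Re _; lra.
Qed.

Lemma is_derive_height b y r : is_derive r 1 (height b y)
  (expR (sigma * r) * cos (2 * b + sigma * y) - expR r * cos (2 * b + y)).
Proof.
have h1 : is_derive r 1 (fun r => expR (sigma * r)) (sigma * expR (sigma * r)).
  apply: is_derive_expR_comp; have := is_derive_affine 0 sigma r.
  by rewrite (_ : (fun s => _) = (fun r : R => sigma * r))//; apply/funext => ?; rewrite add0r.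
have h2 := is_deriveZ_real (cos (2 * b + sigma * y) / sigma) h1.
have h3 := is_deriveZ_real (cos (2 * b + y)) (is_derive_expR r).
have := is_deriveB h2 h3.
rewrite (_ : (fun r => _) - _ = height b y); last first.
  by apply/funext => u; rewrite /height !fctE; ring.
by move=> h; apply: is_derive_eq h _; field; rewrite gt_eqF.
Qed.

Lemma cmod_saddle_exp l b : cmod (ce (saddle_exp sigma l b)) = expR (expR l * (kap / sigma * cos (2 * b))).
Proof.
have -> : saddle_exp sigma l b = (expR l * (kap / sigma))%:C * expi (2 * b).
  by rewrite /saddle_exp mulrAC -rmorphM.
by rewrite cmod_cexp (ReZ (expR l * (kap / sigma))) Re_expi -mulrA.
Qed.

Lemma exp_small M (c : R) : 0 < c ->
  exists2 C, 0 <= C & forall l, expR (- (c * expR l)) <= C * expR (- (l / 2)) ^+ M.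
Proof.
move=> c0; have [C C0 hC] := poly_exp_le M c0; exists C => // l.
rewrite [expR (- (l / 2))]expRN exprVn ler_pdivlMr ?exprn_gt0 ?expR_gt0// mulrC.
apply: le_trans (hC _ (expR_ge0 l)); rewrite ler_wpM2r ?expR_ge0//.
rewrite lerXn2r ?nnegrE ?addr_ge0 ?expR_ge0//.
have -> : expR l = expR (l / 2) ^+ 2 by rewrite expr2 -expRD; congr expR; field.
by have := sqr_ge0 (expR (l / 2) - 1); rewrite sqrrB expr1n mulr1; have := expR_ge0 (l / 2); lra.
Qed.

(* For x = [saddle_mod l] and w = [saddle_arg b] the exponent has its saddle point at
   [saddle_base l b], i.e. e^(kap z) = - sigma x e^(i w). *)
Definition saddle_arg b : R := 2 * kap * b - sigma * pi.
Definition saddle_mod l : R := expR (kap * l) / sigma.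
Definition saddle_base l b : R[i] := l +i* (pi + 2 * b).
Definition saddle_int l b z : R[i] := ce (- (delta0%:C * saddle_base l b)) *
  loop_prim sigma 1 ((saddle_mod l)%:C * expi (saddle_arg b)) delta0 (z + saddle_base l b).

Lemma hol_saddle_int l b : hol (saddle_int l b) (dY sigma delta0 l b).
Proof.
have h := holZ (ce (- (delta0%:C * saddle_base l b)))
  (hol_affine 1 (saddle_base l b) (hol_loop_prim sigma 1 ((saddle_mod l)%:C * expi (saddle_arg b)) delta0)).
apply: hol_ext h => z; rewrite ?mul1r// -cexpD; congr ce.
rewrite /expo !cexpD mulrDr cexpD.
have -> : ce (saddle_base l b) = - ((expR l)%:C * expi (2 * b)).
  by rewrite /saddle_base ceLw expiD expi_pi mulN1r mulrN.
have -> : ce (sigma%:C * saddle_base l b) = (expR (sigma * l))%:C * expi (sigma * (pi + 2 * b)).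
  rewrite -ceLw; congr ce; apply: complex_ext; first by rewrite ReZ.
  by rewrite ImZ.
have -> : expi (2 * b) = expi (saddle_arg b) * expi (sigma * (pi + 2 * b)).
  by rewrite -expiD; congr expi; rewrite /saddle_arg /kap; ring.
have -> : (expR l)%:C = sigma%:C * (saddle_mod l)%:C * (expR (sigma * l))%:C :> R[i].
  rewrite -!rmorphM /= /saddle_mod mulrCA divff ?gt_eqF// mulr1 -expRD; congr (expR _)%:C.
  by rewrite /kap; ring.
have sC : sigma%:C != 0 :> R[i] by rewrite fmorph_eq0 gt_eqF.
rewrite /gph fmorphV /= mul1r; clearbody s0 kap0.
set u1 := ce (_ * z); set u2 := ce z; set u3 := saddle_base l b; set u4 := expi (saddle_arg b).
set u5 := expi _; set u6 := (saddle_mod l)%:C; set u7 := (expR _)%:C.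
by field.
Qed.

Definition saddle_lup l b : R[i] := ce (- (delta0%:C * saddle_base l b)) *
  lup sigma 1 (saddle_mod l) (saddle_arg b) delta0.

(** To the right of the endpoint the derivative e^(sigma r) c2 - e^r c1 is nonpositive, since c2 <=
    c1 by [angle_right]. The second bound, from c1 > 0, supplies decay for integrability. *)
Lemma height_right b rho : `|b| <= pi / 4 -> 0 < rho <= 1 ->
  let y := - (rho * sin b) in exists2 C, 0 <= C & forall r, rho * cos b <= r ->
  height b y r <= height b y (rho * cos b) /\ height b y r + delta0 * r <= C - r.
Proof.
move=> hb hr y; have s01 : 0 <= sigma <= 1 by have /andP[? ?] := sigma01; rewrite !ltW.
have [a1 a2] := angle_right hb hr s01; have /andP[r0 r1] := hr.
have pi0 := pi_gt0 R; have s1 : sigma < 1 by have /andP[] := sigma01.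
set c1 := cos (2 * b + y); set c2 := cos (2 * b + sigma * y).
have cb : 0 <= cos b.
  by apply: cos_ge0_pihalf; move: hb; rewrite ler_norml => /andP[? ?]; apply/andP; split; lra.
have sy : sigma * y = - (sigma * (rho * sin b)) by rewrite mulrN.
have c10 : 0 < c1.
  by apply: cos_gt0_pihalf; move: a2; rewrite ltr_norml.
have c21 : c2 <= c1.
  rewrite /c2 sy; apply: cos_anti => //.
  have := hb; rewrite ler_norml => /andP[b1 b2].
  have [sb1 sb2] : - 1 <= sin b /\ sin b <= 1 by split; [exact: sin_geN1|exact: sin_le1].
  have h2 : `|sigma * (rho * sin b)| <= 1.
    rewrite normrM (gtr0_norm s0) normrM (gtr0_norm r0) mulr_ile1 ?(ltW s1) ?(ltW s0) ?mulr_ge0 ?(ltW r0)//.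
    by rewrite mulr_ile1 ?(ltW r0)// ler_norml sb1.
  apply: le_trans (ler_normB _ _) _; rewrite normrM (gtr0_norm (_ : (0 : R) < 2))//.
  have := pi_ge2 R; lra.
have [C1 C10 hC1] := exp_dominate (c1 / sigma) sigma01 (divr_gt0 c10 (ltr0n _ 2)).
have [C2 C20 hC2] := lin_dominate (delta0 + 1) (divr_gt0 c10 (ltr0n _ 2)).
exists (C1 + C2); first exact: addr_ge0.
have rc0 : 0 <= rho * cos b by rewrite mulr_ge0// ltW.
move=> r rr; split.
  have := @is_derive_le R (height b y) (fun=> 0) _ (fun=> 0) _ _ rr
    (fun t _ => is_derive_height b y t) (fun t _ => is_derive_real_cst 0 t).
  rewrite subrr subr_le0; apply => t /andP[t1 _].
  have t0 : 0 <= t by exact: le_trans t1.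
  rewrite subr_le0 -/c1 -/c2.
  apply: le_trans (_ : expR (sigma * t) * c1 <= _); first by rewrite ler_wpM2l ?expR_ge0.
  by rewrite ler_wpM2r ?(ltW c10)// ler_expR ler_piMl// ltW.
have := hC1 r; have := hC2 r (le_trans rc0 rr).
have : expR (sigma * r) / sigma * c2 <= c1 / sigma * expR (sigma * r).
  have -> : c1 / sigma * expR (sigma * r) = expR (sigma * r) / sigma * c1 by ring.
  by rewrite ler_wpM2l// divr_ge0 ?expR_ge0// ltW.
rewrite /height -/c1 -/c2; set e1 := expR r; set e2 := expR _; rewrite mulrDl mul1r.
move=> h1 h2 h3; have : e1 * c1 = c1 / 2 * e1 + c1 / 2 * e1 by field.
by lra.
Qed.

Lemma tail_right b rho : `|b| <= pi / 4 -> 0 < rho <= 1 ->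
  exists2 C, 0 <= C & forall l, 0 <= l ->
  cmod (saddle_lup l b - saddle_int l b (rho%:C * expi (- b))) <=
  C * expR (expR l * height b (- (rho * sin b)) (rho * cos b)).
Proof.
move=> hb hr; have [C C0 hC] := height_right hb hr.
set y := - (rho * sin b); set r1 := rho * cos b; set h1 := height b y r1.
have r1C := hC r1 (lexx _).
exists (expR (C - h1)); first exact: expR_ge0.
move=> l l0; pose A := expR (C - h1) * expR (expR l * h1).
have [D hD] : exists D, forall s, 0 <= s ->
   cmod (saddle_int l b (s +i* y) - saddle_lup l b) <= D * expR (- 1 * s).
  have s01 : 0 <= sigma <= 1 by have /andP[? ?] := sigma01; rewrite !ltW.
  have [_] := angle_right hb hr s01; rewrite -/y ltr_norml => /andP[a1 a2].
  have chi_in : pi / 2 < pi + 2 * b + y < 3 * pi / 2 by apply/andP; split; lra.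
  have x0 : 0 <= saddle_mod l by rewrite divr_ge0 ?expR_ge0// ltW.
  have [C1 hC1] := lupP sigma01 (saddle_arg b) delta0 ltr01 x0 chi_in ltr01.
  exists (cmod (ce (- (delta0%:C * saddle_base l b))) * `|C1|) => s s1.
  rewrite /saddle_int /saddle_lup -mulrBr cmodM -mulrA ler_wpM2l ?cmod_ge0//.
  have -> : s +i* y + saddle_base l b = (s + l) +i* (pi + 2 * b + y).
    by apply: complex_ext; rewrite ?ReD ?ImD /=; ring.
  apply: le_trans (hC1 _ (addr_ge0 s1 l0)) _.
  apply: le_trans (_ : `|C1| * expR (- 1 * (s + l)) <= _).
    by rewrite ler_wpM2r ?expR_ge0// ler_norm.
  by rewrite ler_wpM2l// ler_expR; lra.
apply: (@le_exp_lim R _ _ `|D| (Num.max 0 r1) 1 ltr01) => s.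
rewrite ge_max => /andP[sp sr].
have h2 : cmod (saddle_int l b (s +i* y) - saddle_int l b (r1 +i* y)) <= - A * expR (- s) - - A * expR (- r1).
  apply: (@complex_mvt R (fun r => saddle_int l b (r +i* y)) (fun r => dY sigma delta0 l b (r +i* y))
    (fun r => - A * expR (- r)) (fun r => A * expR (- r))) => //.
  - by move=> t _; apply: hol_hor; exact: hol_saddle_int.
  - move=> t _.
    have := is_deriveZ_real (- A) (is_derive_expR_comp (is_deriveN (is_derive_id t (1:R)))).
    by rewrite mulN1r mulrNN.
  - move=> t /andP[t1 _]; rewrite cmod_dY /A -!expRD ler_expR.
    have [g1 g2] := hC t t1; rewrite -/h1 in g1.
    (* Split e^l = (e^l - 1) + 1: the first part is multiplied by at most the endpoint height, the
       second yields the factor e^(- t) uniformly in l. *)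
    have e1 : 1 <= expR l by rewrite -expR0 ler_expR.
    have : (expR l - 1) * height b y t <= (expR l - 1) * h1 by rewrite ler_wpM2l// subr_ge0.
    rewrite !mulrBl !mul1r; lra.
have h3 : A * expR (- r1) <= A.
  have r10 : 0 <= r1.
    rewrite mulr_ge0//; first by have /andP[/ltW] := hr.
    apply: cos_ge0_pihalf; move: hb; have := pi_gt0 R; rewrite ler_norml.
    by move=> ? /andP[? ?]; apply/andP; split; lra.
  by rewrite ler_piMr ?mulr_ge0 ?expR_ge0// -expR0 ler_expR oppr_le0.
have h4 : 0 <= A * expR (- s) by rewrite !mulr_ge0 ?expR_ge0.
have h5 := hD s sp; have h6 : D * expR (- 1 * s) <= `|D| * expR (- 1 * s).
  by rewrite ler_wpM2r ?expR_ge0// ler_norm.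
rewrite zetaE -/y -/r1 -/A.
have -> : saddle_lup l b - saddle_int l b (r1 +i* y) =
  (saddle_int l b (s +i* y) - saddle_int l b (r1 +i* y)) - (saddle_int l b (s +i* y) - saddle_lup l b) by ring.
apply: le_trans (cmodB _ _) _; move: h2 h3 h4 h5 h6; rewrite !mulNr opprK; lra.
Qed.

End SaddleContour.

Section SaddleSum.
Context {R : realType}.
Variables (sigma delta0 : R).
Hypothesis sigma01 : 0 < sigma < 1.
Implicit Types (r t x y l b rho : R) (n m k : nat) (z : R[i]).

Let kap : R := 1 - sigma.
Let kap0 : 0 < kap := kap_gt0 sigma01.
Let s0 : 0 < sigma := sig0 sigma01.
Let s1 : sigma < 1. Proof. by have /andP[] := sigma01. Qed.
Let kap01 : 0 < kap < 1.
Proof. by rewrite kap0 /kap gtrBl. Qed.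

Notation FF := (saddle_int sigma delta0).
Notation lupn := (saddle_lup sigma delta0).
Notation saddle_base := (@saddle_base R).
Notation height := (height sigma).
Notation lamX := (saddle_exp sigma).

Definition saddle_sum (alpha : nat -> R) M l b : R[i] :=
  \sum_(i < M) (alpha i * expR (- (l / 2)) ^+ i.*2.+1)%:C * expi (- b) ^+ i.*2.+1.

Lemma height_end_exp : exists2 rho0, 0 < rho0 & forall l b t, `|t| <= rho0 ->
  expR (expR l * height b (- (t * sin b)) (t * cos b)) <=
  cmod (ce (lamX l b)) * expR (- (kap / 4 * t ^+ 2 * expR l)).
Proof.
have [rho0 rho00 h] := height_end sigma01; exists rho0 => // l b t ht.
rewrite cmod_saddle_exp -expRD ler_expR.
have := ler_wpM2l (expR_ge0 l) (h b t ht); rewrite -/kap => h2.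
by apply: le_trans h2 _; rewrite mulrBr [expR l * (kap / 4 * _)]mulrC.
Qed.

Lemma saddle_right M : (0 < M)%N -> exists (alpha : nat -> R) (rho0 : R),
  [/\ 0 < rho0, rho0 <= 1 & forall b rho, `|b| <= pi / 4 -> 0 < rho -> rho <= rho0 ->
  exists2 C, 0 <= C & forall l, 0 <= l ->
  cmod (lupn l b - FF l b ((- rho)%:C * expi (- b)) - ce (lamX l b) * saddle_sum alpha M l b) <=
  C * (cmod (ce (lamX l b)) * expR (- (l / 2)) ^+ M.*2.+1)].
Proof.
move=> M0; have [alpha [rho1 [r1 r11 H]]] := saddle_segment delta0 sigma01 M0.
have [rho2 r2 H2] := height_end_exp.
exists alpha, (Num.min rho1 rho2); split; rewrite ?lt_min ?r1 ?r2 ?ge_min ?r11//.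
move=> b rho hb rho0; rewrite le_min => /andP[rr1 rr2].
have [C1 C10 hC1] := H rho rho0 rr1.
have hr : 0 < rho <= 1 by rewrite rho0 (le_trans rr1).
have [C2 C20 hC2] := tail_right delta0 sigma01 hb hr.
have k4 : 0 < kap / 4 * rho ^+ 2 by rewrite mulr_gt0 ?divr_gt0 ?exprn_gt0.
have [C3 C30 hC3] := exp_small M.*2.+1 k4.
exists (C1 + C2 * C3) => [|l l0]; first by rewrite addr_ge0 ?mulr_ge0.
have e1 := hC1 l b (FF l b) l0 (hol_saddle_int delta0 sigma01 l b).
have e2 := hC2 l l0.
have arho : `|rho| <= rho2 by rewrite gtr0_norm.
have e3 := H2 l b rho arho.
have e4 := hC3 l.
set E := cmod (ce _) in e1 e3 *; set u := _ ^+ M.*2.+1 in e1 e4 *.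
have E0 : 0 <= E by exact: cmod_ge0.
have e5 : C2 * expR (expR l * height b (- (rho * sin b)) (rho * cos b)) <= C2 * (E * (C3 * u)).
  by rewrite ler_wpM2l// (le_trans e3)// ler_wpM2l.
move: e1 e2 e5; set f1 := FF _ _ _; set f2 := FF _ _ _; set S := \sum_(i < M) _ => e1 e2 e5.
have -> : lupn l b - f2 - ce (lamX l b) * saddle_sum alpha M l b =
   (f1 - f2 - ce (lamX l b) * S) + (lupn l b - f1) by rewrite /saddle_sum -/S; ring.
apply: le_trans (cmodD _ _) _; apply: le_trans (lerD e1 (le_trans e2 e5)) _.
by rewrite le_eqVlt; apply/orP; left; apply/eqP; ring.
Qed.

Lemma loop_prim_ver x w beta chi : 0 <= x -> 0 <= chi ->
  cmod (loop_prim sigma 1 (x%:C * expi w) beta (0 +i* chi)) <= chi * expR (1 + x).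
Proof.
move=> x0 chi0; set B := expR (1 + x); set F := loop_prim _ _ _ _.
have -> : F (0 +i* chi) = F (0 +i* chi) - F (0 +i* 0).
  by rewrite (_ : 0 +i* 0 = 0 :> R[i])// /F loop_prim0 subr0.
have -> : chi * B = B * chi - B * 0 by ring.
apply: (@complex_mvt R (fun y => F (0 +i* y)) (fun y => 'i * loop_exp sigma 1 (x%:C * expi w) beta (0 +i* y))
   (fun y => B * y) (fun=> B)) => //.
- by move=> y _; apply: hol_ver; exact: hol_loop_prim.
- move=> y _; have := is_deriveZ_real B (is_derive_id y (1 : R)).
  by rewrite mulr1.
- move=> y _; rewrite cmodM cmod_i mul1r cmod_loop_exp !mulr0 expR0 !mulr1 mul1r addr0 ler_expR.
  by rewrite lerD ?cos_le1// ler_piMr ?cos_le1.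
Qed.

Lemma exp_absorb M (c B : R) : 0 < c ->
  exists2 C, 0 <= C & forall l, 0 <= l -> expR (B * l - c * expR l) <= C * expR (- (l / 2)) ^+ M.
Proof.
move=> c0; have c2 : 0 < c / 2 by rewrite divr_gt0.
have [C1 C10 h1] := lin_dominate B c2; have [C2 C20 h2] := exp_small M c2.
exists (expR C1 * C2) => [|l l0]; first by rewrite mulr_ge0 ?expR_ge0.
apply: le_trans (_ : expR C1 * expR (- (c / 2 * expR l)) <= _).
  rewrite -expRD ler_expR; have := h1 l l0.
  have : c * expR l = c / 2 * expR l + c / 2 * expR l by field.
  by lra.
by rewrite -[leRHS]mulrA ler_wpM2l ?expR_ge0.
Qed.

(** x = e^(kap l) / sigma is of lower order than e^l because kap < 1, so factors e^x are negligible
    next to a growing exponential. *)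
Lemma saddle_mod_le (c : R) : 0 < c ->
  exists2 C, 0 <= C & forall l, saddle_mod sigma l <= c * expR l + C.
Proof.
move=> c0; have [C C0 h] := exp_dominate sigma^-1 kap01 c0.
by exists C => // l; rewrite /saddle_mod mulrC.
Qed.

Lemma saddle_mod_ge0 l : 0 <= saddle_mod sigma l.
Proof. by rewrite divr_ge0 ?expR_ge0 ?ltW. Qed.

Lemma cmod_saddle_baseN l b : cmod (ce (- (delta0%:C * saddle_base l b))) = expR (- (delta0 * l)).
Proof. by rewrite cmod_cexp ReN (ReZ delta0). Qed.

Lemma endE l b rho : (- rho)%:C * expi (- b) + saddle_base l b =
  (l - rho * cos b) +i* (pi + 2 * b + rho * sin b).
Proof.
rewrite zetaE; apply: complex_ext; rewrite ?ReD ?ImD /=; first by rewrite mulNr addrC.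
by rewrite mulNr opprK addrC.
Qed.

Lemma height_left b rho : 2 * `|b| + rho <= pi / 2 -> 0 < rho -> forall r,
  r <= - (rho * cos b) -> height b (rho * sin b) r <= height b (rho * sin b) (- (rho * cos b)).
Proof.
move=> hb r0 r rr; set y := rho * sin b.
have s01 : 0 <= sigma <= 1 by rewrite !ltW.
have [a1 a2] := angle_left hb r0 s01; rewrite -/y in a1 a2.
have pi0 := pi_gt0 R.
have cb : 0 <= cos b.
  have : `|b| <= pi / 2 by have := normr_ge0 b; lra.
  by rewrite ler_norml => /andP[? ?]; apply: cos_ge0_pihalf; apply/andP; split; lra.
set c1 := cos (2 * b + y); set c2 := cos (2 * b + sigma * y).
have c10 : 0 <= c1 by apply: cos_ge0_pihalf; move: a2; rewrite ler_norml.
have c12 : c1 <= c2 by apply: cos_anti => //; lra.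
rewrite -subr_ge0.
have := @is_derive_le R (fun=> 0) (height b y) (fun=> 0) _ _ _ rr
    (fun t _ => is_derive_real_cst 0 t) (fun t _ => is_derive_height sigma01 b y t).
rewrite subrr; apply => t /andP[_ t1].
have t0 : t <= 0 by apply: le_trans t1 _; rewrite oppr_le0 mulr_ge0// ltW.
rewrite subr_ge0 -/c1 -/c2.
apply: le_trans (_ : expR (sigma * t) * c1 <= _); last by rewrite ler_wpM2l ?expR_ge0.
rewrite ler_wpM2r// ler_expR -subr_ge0.
by have -> : sigma * t - t = kap * - t; [rewrite /kap; ring|rewrite mulr_ge0 ?oppr_ge0 ?(ltW kap0)].
Qed.

(** From the left endpoint the path runs horizontally to the line on which the original variable has
    real part 0, then vertically to z = 0, where the primitive vanishes. The first leg gives the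
    factor l, the second the factor e^x. *)
Lemma tail_left b rho : `|b| < pi / 4 -> 2 * `|b| + rho <= pi / 2 -> 0 < rho <= 1 ->
  exists2 C, 0 <= C & forall l, 1 <= l ->
  cmod (FF l b ((- rho)%:C * expi (- b))) <=
  l * expR (`|delta0| * l) * expR (expR l * height b (rho * sin b) (- (rho * cos b))) +
  C * expR (`|delta0| * l + saddle_mod sigma l).
Proof.
move=> hb hb2 /andP[r0 r1]; have pi0 := pi_gt0 R.
exists (2 * pi * expR 1) => [|l l1]; first by rewrite !mulr_ge0 ?expR_ge0 ?pi_ge0.
have l0 : 0 <= l by lra.
set y := rho * sin b; set r2 := rho * cos b; set h1 := height b y (- r2).
have cb0 : 0 <= cos b.
  by move: hb; rewrite ltr_norml => /andP[? ?]; apply: cos_ge0_pihalf; apply/andP; split; lra.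
have r20 : 0 <= r2 by rewrite mulr_ge0// ltW.
have r21 : r2 <= 1 by rewrite mulr_ile1 ?cos_le1// ltW.
have dl r : - l <= r -> r <= 0 -> delta0 * r <= `|delta0| * l.
  move=> q1 q2; apply: le_trans (ler_norm _) _; rewrite normrM ler_wpM2l//.
  by rewrite ler0_norm//; lra.
have -> : (- rho)%:C * expi (- b) = - r2 +i* y by rewrite zetaE mulNr mulNr opprK.
set A := expR (`|delta0| * l) * expR (expR l * h1).
have A0 : 0 <= A by rewrite mulr_ge0 ?expR_ge0.
have e1 : cmod (FF l b (- r2 +i* y) - FF l b (- l +i* y)) <= A * - r2 - A * - l.
  apply: (@complex_mvt R (fun r => FF l b (r +i* y)) (fun r => dY sigma delta0 l b (r +i* y))
    (fun r => A * r) (fun=> A)); first by lra.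
  - by move=> t _; apply: hol_hor; exact: hol_saddle_int.
  - by move=> t _; have := is_deriveZ_real A (is_derive_id t (1 : R)); rewrite mulr1.
  - move=> t /andP[t1 t2]; rewrite cmod_dY /A -expRD ler_expR addrC.
    apply: lerD; first by apply: dl => //; lra.
    by rewrite ler_wpM2l ?expR_ge0// height_left.
have e2 : cmod (FF l b (- l +i* y)) <= 2 * pi * expR 1 * expR (`|delta0| * l + saddle_mod sigma l).
  rewrite /saddle_int cmodM cmod_saddle_baseN.
  have -> : (- l +i* y) + saddle_base l b = 0 +i* (pi + 2 * b + y).
    by apply: complex_ext; rewrite ?ReD ?ImD /= ?addNr// addrC.
  have yb : `|y| <= 1 by rewrite normrM (gtr0_norm r0) mulr_ile1 ?(ltW r0)// ler_norml sin_geN1 sin_le1.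
  move: yb hb; rewrite ler_norml ltr_norml => /andP[y1 y2] /andP[b1 b2].
  have pi2 := pi_ge2 R.
  have chi0 : 0 <= pi + 2 * b + y by lra.
  have chi2 : pi + 2 * b + y <= 2 * pi by lra.
  have h := loop_prim_ver (saddle_arg sigma b) delta0 (saddle_mod_ge0 l) chi0.
  apply: le_trans (_ : expR (`|delta0| * l) * (2 * pi * expR (1 + saddle_mod sigma l)) <= _).
    apply: ler_pM; rewrite ?expR_ge0 ?cmod_ge0//.
      rewrite ler_expR -mulNr ler_wpM2r//.
      by have := ler_norm (- delta0); rewrite normrN.
    by apply: le_trans h _; rewrite ler_wpM2r ?expR_ge0.
  by rewrite !expRD le_eqVlt; apply/orP; left; apply/eqP; ring.
have -> : FF l b (- r2 +i* y) = (FF l b (- r2 +i* y) - FF l b (- l +i* y)) + FF l b (- l +i* y).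
  by ring.
apply: le_trans (cmodD _ _) _; apply: lerD e2; apply: le_trans e1 _.
rewrite -[leRHS]mulrA -/A [leRHS]mulrC -mulrBr ler_wpM2l//; lra.
Qed.

(** For |b| < pi / 4 the exponential grows like e^(q e^l) with q > 0; half of q beats the vertical
    leg, and the drop of height at the endpoint beats the horizontal one. *)
Lemma saddle_left_small M b rho : `|b| < pi / 4 -> 2 * `|b| + rho <= pi / 2 -> 0 < rho <= 1 ->
  (exists2 rho0, rho <= rho0 & forall l b t, `|t| <= rho0 ->
  expR (expR l * height b (- (t * sin b)) (t * cos b)) <=
  cmod (ce (lamX l b)) * expR (- (kap / 4 * t ^+ 2 * expR l))) ->
  exists2 C, 0 <= C & forall l, 1 <= l ->
  cmod (FF l b ((- rho)%:C * expi (- b))) <= C * (cmod (ce (lamX l b)) * expR (- (l / 2)) ^+ M).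
Proof.
move=> hb hb2 hr [rho0 rr0 H].
have [C1 C10 h1] := tail_left hb hb2 hr; have /andP[r0 _] := hr.
have k4 : 0 < kap / 4 * rho ^+ 2 by rewrite mulr_gt0 ?divr_gt0 ?exprn_gt0.
have [C2 C20 h2] := exp_absorb M (1 + `|delta0|) k4.
pose q := kap / sigma * cos (2 * b).
have q0 : 0 < q.
  rewrite mulr_gt0 ?divr_gt0// cos_gt0_pihalf//.
  by move: hb; rewrite ltr_norml => /andP[? ?]; apply/andP; split; lra.
have q2 : 0 < q / 2 by rewrite divr_gt0.
have [C3 C30 h3] := saddle_mod_le q2.
have [C4 C40 h4] := exp_absorb M `|delta0| q2.
exists (C2 + C1 * (expR C3 * C4)) => [|l l1]; first by rewrite addr_ge0 ?mulr_ge0 ?expR_ge0.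
have l0 : 0 <= l by lra.
apply: le_trans (h1 l l1) _; rewrite mulrDl.
have arho : `|- rho| <= rho0 by rewrite normrN gtr0_norm.
have := H l b (- rho) arho; rewrite !mulNr opprK sqrrN => e1.
set E := cmod _ in e1 *; have E0 : 0 <= E by exact: cmod_ge0.
apply: lerD.
  apply: le_trans (_ : l * expR (`|delta0| * l) * (E * expR (- (kap / 4 * rho ^+ 2 * expR l))) <= _).
    by rewrite ler_wpM2l// mulr_ge0 ?expR_ge0.
  rewrite mulrCA [leRHS]mulrCA ler_wpM2l//.
  apply: (le_trans _ (h2 l l0)); rewrite [leRHS]expRD ler_wpM2r ?expR_ge0//.
  rewrite mulrDl mul1r expRD ler_wpM2r ?expR_ge0//; have := expR_ge1Dx l; lra.
rewrite -mulrA ler_wpM2l// /E cmod_saddle_exp -/q.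
have -> : expR C3 * C4 * (expR (expR l * q) * expR (- (l / 2)) ^+ M) =
  expR C3 * expR (expR l * q) * (C4 * expR (- (l / 2)) ^+ M) by ring.
apply: le_trans (ler_wpM2l _ (h4 l l0)); last by rewrite mulr_ge0 ?expR_ge0.
rewrite -!expRD ler_expR; have := h3 l.
have : expR l * q = q / 2 * expR l + q / 2 * expR l by field.
by lra.
Qed.

End SaddleSum.

(** * Expansions of the loop integral according to the direction *)

Section DirectionExpansions.
Context {R : realType}.
Variables (sigma delta0 : R).
Hypothesis sigma01 : 0 < sigma < 1.
Implicit Types (r s t x y l b w chi rho : R) (n m k : nat) (z : R[i]).

Let kap : R := 1 - sigma.
Let kap0 : 0 < kap := kap_gt0 sigma01.
Let s0 : 0 < sigma := sig0 sigma01.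
Let s1 : sigma < 1. Proof. by have /andP[] := sigma01. Qed.

Notation FF := (saddle_int sigma delta0).
Notation lupn := (saddle_lup sigma delta0).
Notation saddle_base := (@saddle_base R).
Notation lamX := (saddle_exp sigma).
Notation xof := (saddle_mod sigma).
Notation wof := (saddle_arg sigma).
Notation algT := (algT sigma delta0).
Notation algF := (algF sigma delta0).

Definition log_mod l : R := kap * l - ln sigma.

Lemma expR_log_mod l : expR (log_mod l) = xof l.
Proof. by rewrite expRD expRN lnK ?posrE. Qed.

Lemma log_mod_ge0 l : 0 <= l -> 0 <= log_mod l.
Proof.
move=> l0; rewrite addr_ge0 ?mulr_ge0 ?(ltW kap0)// oppr_ge0 ltW//.
by rewrite ln_lt0// s0 s1.
Qed.

Lemma expR_shift l s : expR (log_mod l + sigma * s) = expR l * (expR (sigma * (s - l)) / sigma).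
Proof.
rewrite expRD expR_log_mod /saddle_mod mulrAC -expRD [RHS]mulrA -expRD; congr (expR _ / _).
by rewrite /kap; ring.
Qed.

(** Compare derivatives from 0: sigma cos t <= sigma cos(sigma t). *)
Lemma sin_scale y : 0 <= y <= pi -> sigma * sin y <= sin (sigma * y).
Proof.
move=> /andP[y0 yp]; rewrite -subr_ge0.
have h t : is_derive t 1 (fun t => sin (sigma * t)) (sigma * cos (sigma * t)).
  have h1 : is_derive t 1 (fun r : R => sigma * r) sigma.
    by have := is_deriveZ_real sigma (is_derive_id t (1:R)); rewrite mulr1.
  have := @is_derive1_comp R sin (fun r => sigma * r) t _ _ (is_derive_sin (sigma * t)) h1.
  by rewrite mulrC.
have := @is_derive_le R (fun t => sigma * sin t) (fun t => sin (sigma * t)) _ _ 0 y y0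
  (fun t _ => is_deriveZ_real sigma (is_derive_sin t)) (fun t _ => h t).
rewrite mulr0 sin0 mulr0 !subr0 subr_ge0; apply => t /andP[t0 ty].
rewrite ler_wpM2l ?(ltW s0)//; apply: cos_anti; rewrite !ger0_norm ?mulr_ge0 ?(ltW s0)//.
  by rewrite ler_piMl// ltW.
exact: le_trans yp.
Qed.

(** At b = pi / 4 the exponential does not grow, so the part left of the saddle cannot be discarded:
    it is run down to u = 0 by [alg_partial] and produces the algebraic terms. *)
Lemma left_critical m rho : 0 < m%:R + delta0 -> 0 < rho <= 1 ->
  let w := wof (pi / 4) in exists2 C, 0 <= C & forall l, 1 <= l -> exists C', forall s, s <= 0 ->
  cmod (ce (delta0%:C * saddle_base l (pi / 4)) * FF l (pi / 4) ((- rho)%:C * expi (- (pi / 4))) -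
     algT m (log_mod l) w - algF m (log_mod l) w (s +i* 0)) <=
  C * expR (- ((m%:R + delta0) / sigma * log_mod l)) + C' * expR ((m%:R + delta0) * s).
Proof.
move=> m0 /andP[r0 r1] w; have pi0 := pi_gt0 R; have pi2 := pi_ge2 R.
set y := rho * sin (pi / 4); set r2 := rho * cos (pi / 4).
have sp : 0 < sin (pi / 4 : R) by rewrite sin_gt0_pi//; apply/andP; split; lra.
have cp : 0 < cos (pi / 4 : R) by rewrite cos_gt0_pihalf//; apply/andP; split; lra.
have y0 : 0 < y by exact: mulr_gt0.
have y1 : y <= 1 by rewrite mulr_ile1 ?sin_le1 ?(ltW r0) ?(ltW sp)//.
have r20 : 0 < r2 by exact: mulr_gt0.
have r21 : r2 <= 1 by rewrite mulr_ile1 ?cos_le1 ?(ltW r0) ?(ltW cp)//.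
set chi := pi + 2 * (pi / 4) + y.
have chi0 : 0 <= chi by rewrite /chi; lra.
have chiE : w + sigma * chi = sigma * y + pi / 2 by rewrite /w /saddle_arg /chi; field.
have sy1 : sigma * y <= 1 by rewrite mulr_ile1 ?(ltW s0) ?(ltW y0) ?(ltW s1)//.
have sy0 : 0 < sigma * y by exact: mulr_gt0.
have psi_in : pi / 2 < w + sigma * chi < 3 * pi / 2 by rewrite chiE; apply/andP; split; lra.
have siny : 0 < sin y by rewrite sin_gt0_pi//; apply/andP; split; lra.
(* On Im z = chi the cosines are - sin(sigma y) and sin y > 0, so e^u grows. Up to real part l - r2
   one has e^t <= sigma e^(- kap r2) x e^(sigma t), and [k] is the decay that survives, positive by
   [sin_scale]. *)
pose k := sin (sigma * y) - sigma * expR (- (kap * r2)) * sin y.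
have k0 : 0 < k.
  rewrite subr_gt0; apply: lt_le_trans (sin_scale (_ : 0 <= y <= pi)); last by rewrite ltW//=; lra.
  rewrite ltr_pM2r// gtr_pMr// -expR0 ltr_expR oppr_lt0; exact: mulr_gt0.
(* Large enough to cancel the factor e^(|delta0| L / sigma) of the tail and to leave e^(- K_m L). *)
pose N := `|delta0| / sigma + (m%:R + delta0) / sigma.
have N0 : 0 < N by rewrite ltr_wpDl ?divr_gt0// divr_ge0// ltW.
have [C C0 hC] := alg_partial sigma01 m0 k0 N0 chi0 psi_in.
exists (C + C) => [|l l1]; first exact: addr_ge0.
have l0 : 0 <= l by lra.
have [C' hC'] := hC (log_mod l) (log_mod_ge0 l0); exists C' => s s0'.
have b0 : 0 <= l - r2 by lra.
have hb t : t <= l - r2 -> expR (log_mod l + sigma * t) * cos (w + sigma * chi) +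
     Num.max (expR t * cos chi) 0 <= - (k * expR (log_mod l + sigma * t)).
  move=> tb; rewrite chiE cosDpihalf.
  have -> : cos chi = sin y.
    have -> : chi = y + pi / 2 + pi by rewrite /chi; field.
    by rewrite cosDpi cosDpihalf opprK.
  rewrite max_l ?mulr_ge0 ?expR_ge0 ?(ltW siny)//.
  have e1 : expR t <= sigma * expR (- (kap * r2)) * expR (log_mod l + sigma * t).
    rewrite expRD expR_log_mod /saddle_mod.
    have -> : sigma * expR (- (kap * r2)) * (expR (kap * l) / sigma * expR (sigma * t)) =
      expR (- (kap * r2)) * expR (kap * l) * expR (sigma * t) by field; rewrite gt_eqF.
    rewrite -!expRD ler_expR.
    have := ler_wpM2l (ltW kap0) tb; rewrite mulrBr /kap; lra.
  have := ler_wpM2r (ltW siny) e1; rewrite /k; set e := expR (log_mod l + _); lra.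
have := hC' (l - r2) b0 hb s s0'.
rewrite /saddle_int mulrA -cexpD subrr cexp0 mul1r endE -/y -/r2 -/chi expR_log_mod -/w.
move=> /le_trans; apply; rewrite lerD2r [leRHS]mulrDl lerD2l ler_wpM2l// -expRD ler_expR.
have : 0 <= N * (sigma * (l - r2)) by rewrite !mulr_ge0 ?(ltW N0) ?(ltW s0).
by rewrite mulNr mulrDr {2}/N mulrDl; lra.
Qed.

(** One family [alpha] serves the open range |b| < pi / 4 and the critical b = pi / 4. In the former
    the segment is shortened until 2 |b| + rho <= pi / 2, so that the height also decreases to the
    left of it. *)
Lemma saddle_expansion M : (0 < M)%N -> exists alpha : nat -> R,
  (forall b, `|b| < pi / 4 -> exists2 C, 0 <= C & forall l, 1 <= l ->
    cmod (lupn l b - ce (lamX l b) * saddle_sum alpha M l b) <=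
    C * (cmod (ce (lamX l b)) * expR (- (l / 2)) ^+ M.*2.+1)) /\
  (forall m, 0 < m%:R + delta0 -> let b := pi / 4 in
    exists2 C, 0 <= C & forall l, 1 <= l -> exists C', forall s, s <= 0 ->
    cmod (lup sigma 1 (xof l) (wof b) delta0 -
       ce (delta0%:C * saddle_base l b) * (ce (lamX l b) * saddle_sum alpha M l b) -
       algT m (log_mod l) (wof b) - algF m (log_mod l) (wof b) (s +i* 0)) <=
    C * (expR (delta0 * l) * cmod (ce (lamX l b)) * expR (- (l / 2)) ^+ M.*2.+1) +
    C * expR (- ((m%:R + delta0) / sigma * log_mod l)) + C' * expR ((m%:R + delta0) * s)).
Proof.
move=> M0; have [alpha [rho1 [r1 r11 H]]] := saddle_right delta0 sigma01 M0.
have [rho2 r2 H2] := height_end_exp sigma01.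
have pi0 := pi_gt0 R.
exists alpha; split.
  move=> b hb; pose rho := Num.min (Num.min rho1 rho2) (pi / 2 - 2 * `|b|).
  have rho0 : 0 < rho by rewrite !lt_min r1 r2 /=; lra.
  have rr1 : rho <= rho1 by rewrite !ge_min lexx.
  have rr2 : rho <= rho2 by rewrite !ge_min lexx orbT.
  have rrb : 2 * `|b| + rho <= pi / 2.
    by have : rho <= pi / 2 - 2 * `|b|; [rewrite ge_min lexx orbT|lra].
  have hr : 0 < rho <= 1 by rewrite rho0 (le_trans rr1).
  have [C1 C10 h1] := H b rho (ltW hb) rho0 rr1.
  have [C2 C20 h2] := saddle_left_small delta0 sigma01 M.*2.+1 hb rrb hr (ex_intro2 _ _ rho2 rr2 H2).
  exists (C1 + C2) => [|l l1]; first exact: addr_ge0.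
  have l0 : 0 <= l by lra.
  have := lerD (h1 l l0) (h2 l l1); rewrite -mulrDl; apply: le_trans.
  by apply: le_trans (cmodD _ _); rewrite le_eqVlt; apply/orP; left; apply/eqP; congr cmod; ring.
move=> m m0 b; have hb : `|b| <= pi / 4 by rewrite ger0_norm// /b; lra.
have [C1 C10 h1] := H b rho1 hb r1 (lexx _).
have hr : 0 < rho1 <= 1 by rewrite r1.
have [C2 C20 h2] := left_critical m0 hr.
exists (C1 + C2) => [|l l1]; first exact: addr_ge0.
have l0 : 0 <= l by lra.
have [C' h2'] := h2 l l1; exists C' => s s0'.
have e2 := h2' s s0'; rewrite -/b in e2; have e1 := h1 l l0.
set E := ce (lamX l b) in e1 *; set D := ce (delta0%:C * saddle_base l b) in e2 *.
have cD : cmod D = expR (delta0 * l) by rewrite /D cmod_cexp (ReZ delta0).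
have e3 : cmod (D * (lupn l b - FF l b ((- rho1)%:C * expi (- b)) - E * saddle_sum alpha M l b)) <=
   C1 * (expR (delta0 * l) * cmod E * expR (- (l / 2)) ^+ M.*2.+1).
  rewrite cmodM cD -[_ * cmod E * _]mulrA [leRHS]mulrCA; by rewrite ler_wpM2l ?expR_ge0.
have DD : D * lupn l b = lup sigma 1 (xof l) (wof b) delta0.
  by rewrite /saddle_lup mulrA -cexpD subrr cexp0 mul1r.
move: e2 e3; rewrite !mulrBr DD; set lu := lup _ _ _ _ _; set Q := D * FF _ _ _.
set S := D * (E * _); set T := algT _ _ _; set F := algF _ _ _ _ => e2 e3.
have -> : lu - S - T - F = (Q - T - F) + (lu - Q - S) by ring.
apply: le_trans (cmodD _ _) _; apply: le_trans (lerD e2 e3) _.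
rewrite !mulrDl.
set a1 := _ * expR _; set a2 := _ * expR _; set a3 := C1 * _; set a4 := C1 * expR _; set a5 := C2 * _.
have : 0 <= a4 by rewrite mulr_ge0 ?expR_ge0.
have : 0 <= a5 by rewrite !mulr_ge0 ?cmod_ge0 ?exprn_ge0 ?expR_ge0.
lra.
Qed.

Lemma lup_subexp_dir w chi (eps : R) : 0 < eps -> pi / 2 < chi < 3 * pi / 2 ->
  (forall r, expR (sigma * r) / sigma * cos (w + sigma * chi) <= - cos chi / 2 * expR r + eps) ->
  exists2 C, 0 <= C & forall l, 0 <= l ->
  cmod (lup sigma 1 (xof l) w delta0) <= C * expR (eps * expR l).
Proof.
move=> e0 chi_in hw; have c0 : 0 < - cos chi / 2 by rewrite divr_gt0// oppr_gt0 cos_lt0.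
have pi0 := pi_gt0 R; have /andP[chi1 chi2] := chi_in; have chi0 : 0 <= chi by lra.
have [C1 C10 h1] := lin_dominate (delta0 + 1) c0.
have [C2 C20 h2] := saddle_mod_le sigma01 e0.
exists (expR C1 + chi * expR (1 + C2)) => [|l l0].
  by rewrite addr_ge0 ?mulr_ge0 ?expR_ge0.
set x := xof l; have x0 : 0 <= x by exact: saddle_mod_ge0.
have [D hD] := lupP sigma01 w delta0 ltr01 x0 chi_in ltr01.
apply: (@le_exp_lim R _ _ D 0 1 ltr01) => s s0'.
pose A := expR C1 * expR (eps * expR l).
set F := loop_prim _ _ _ _ in hD.
have e1 : cmod (F (s +i* chi) - F (0 +i* chi)) <= - A * expR (- s) - - A * expR (- 0).
  apply: (@complex_mvt R (fun r => F (r +i* chi)) (fun r => loop_exp sigma 1 (x%:C * expi w) delta0 (r +i* chi))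
    (fun r => - A * expR (- r)) (fun r => A * expR (- r))) => //.
  - by move=> t _; apply: hol_hor; exact: hol_loop_prim.
  - move=> t _.
    have := is_deriveZ_real (- A) (is_derive_expR_comp (is_deriveN (is_derive_id t (1:R)))).
    by rewrite mulN1r mulrNN.
  - move=> t /andP[t0 _]; rewrite cmod_loop_exp /A -!expRD ler_expR mul1r.
    have -> : x * expR (sigma * t) = expR l * (expR (sigma * (t - l)) / sigma).
      by rewrite -expR_shift expRD expR_log_mod.
    have h3 := ler_wpM2l (expR_ge0 l) (hw (t - l)).
    rewrite -[expR l * _ * cos _]mulrA.
    apply: le_trans (lerD (lerD (lexx _) h3) (lexx _)) _.
    have -> : expR l * (- cos chi / 2 * expR (t - l) + eps) = - cos chi / 2 * expR t + eps * expR l.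
      by rewrite mulrDr mulrCA -expRD [l + _]addrC subrK [eps * _]mulrC.
    have := h1 t t0; set e := expR t; lra.
have e2 := loop_prim_ver sigma w delta0 x0 chi0; rewrite -/F in e2.
have e3 : chi * expR (1 + x) <= chi * expR (1 + C2) * expR (eps * expR l).
  by rewrite -mulrA ler_wpM2l// -expRD ler_expR; have := h2 l; rewrite -/x; lra.
have e4 := hD s s0'.
have e5 : 0 <= A * expR (- s) by rewrite !mulr_ge0 ?expR_ge0.
set lu := lup _ _ _ _ _ in e4 *.
have -> : lu = (F (s +i* chi) - F (0 +i* chi)) + F (0 +i* chi) - (F (s +i* chi) - lu) by ring.
apply: le_trans (cmodB _ _) _; apply: le_trans (lerD (cmodD _ _) e4) _.
move: e1; rewrite oppr0 expR0 mulr1 mulrDl -/A mulNr opprK.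
lra.
Qed.

(** Both conditions are open intervals of chi. That they meet is, in the decisive comparison of
    endpoints, (pi / 2 - w) / sigma < 3 pi / 2, which is the hypothesis on w + sigma pi. *)
Lemma chi_exists w : - (pi / 2) < w < pi / 2 -> pi * kap / 2 < w + sigma * pi ->
  exists chi, pi / 2 < chi < 3 * pi / 2 /\ pi / 2 < w + sigma * chi < 3 * pi / 2.
Proof.
move=> /andP[w1 w2]; rewrite /kap => hw; have pi0 := pi_gt0 R.
pose u := Num.max (pi / 2) ((pi / 2 - w) / sigma).
pose v := Num.min (3 * pi / 2) ((3 * pi / 2 - w) / sigma).
have sg : sigma * (pi / 2) < pi / 2 by rewrite gtr_pMl// divr_gt0.
have uv : u < v.
  rewrite gt_max !lt_min; apply/andP; split; apply/andP; split.
  - by lra.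
  - by rewrite ltr_pdivlMr//; lra.
  - by rewrite ltr_pdivrMr//; lra.
  - by rewrite ltr_pM2r ?invr_gt0//; lra.
exists ((u + v) / 2); set chi := (u + v) / 2.
have : u < chi by rewrite /chi; lra.
have : chi < v by rewrite /chi; lra.
clearbody chi; rewrite lt_min gt_max (ltr_pdivlMr _ _ s0) (ltr_pdivrMr _ _ s0) => /andP[a1 a2] /andP[a3 a4].
split; apply/andP; split; lra.
Qed.

Lemma lup_subexp w (eps : R) : 0 < eps -> - (pi / 2) < w < pi / 2 -> pi * kap / 2 <= w + sigma * pi ->
  exists2 C, 0 <= C & forall l, 0 <= l ->
  cmod (lup sigma 1 (xof l) w delta0) <= C * expR (eps * expR l).
Proof.
move=> e0 hw; rewrite le_eqVlt => /orP[/eqP hE|hlt]; last first.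
  have [chi [chi_in psi_in]] := chi_exists hw hlt.
  apply: (lup_subexp_dir e0 chi_in) => r; apply: le_trans (_ : 0 <= _).
    by rewrite mulr_ge0_le0 ?divr_ge0 ?expR_ge0 ?(ltW s0)// ltW// cos_lt0.
  by rewrite addr_ge0 ?(ltW e0)// mulr_ge0 ?expR_ge0// divr_ge0// oppr_ge0 ltW// cos_lt0.
have pi0 := pi_gt0 R; have pi2 := pi_ge2 R.
(* On chi = 3 pi / 2 - eta the growing part is at most eta e^(sigma r), and half of the decay of e^u
   is at least (eta / 16) e^r by [sin_ge_lin]. Both scale with eta, hence the excess eta C can be
   made smaller than eps. *)
have k16 : (0 : R) < 16^-1 by rewrite invr_gt0.
have [C C0 hC] := exp_dominate 1 sigma01 k16.
have C1 : 0 < C + 1 by rewrite ltr_wpDl.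
pose eta := Num.min 1 (eps / (C + 1)).
have eta0 : 0 < eta by rewrite lt_min ltr01 divr_gt0.
have eta1 : eta <= 1 by rewrite ge_min lexx.
have etaC : eta * C <= eps.
  apply: le_trans (_ : eta * (C + 1) <= _); first by rewrite ler_wpM2l ?(ltW eta0)// lerDl.
  by rewrite -ler_pdivlMr// ge_min lexx orbT.
pose chi := 3 * pi / 2 - eta.
have chi_in : pi / 2 < chi < 3 * pi / 2 by apply/andP; rewrite /chi; split; lra.
apply: (lup_subexp_dir e0 chi_in) => r.
have -> : w + sigma * chi = - (sigma * eta) + pi / 2.
  have -> : w = pi * kap / 2 - sigma * pi by lra.
  by rewrite /chi /kap; field.
have -> : chi = - eta + pi / 2 + pi by rewrite /chi; field.
rewrite cosDpi !cosDpihalf !sinN !opprK.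
have a1 : sin (sigma * eta) <= sigma * eta by rewrite sin_le_id// mulr_ge0 ?ltW.
have a2 : eta / 8 <= sin eta by rewrite sin_ge_lin// ltW//=; lra.
apply: le_trans (_ : eta * expR (sigma * r) <= _).
  have -> : eta * expR (sigma * r) = expR (sigma * r) / sigma * (sigma * eta).
    by field; rewrite gt_eqF.
  by rewrite ler_wpM2l// divr_ge0 ?expR_ge0 ?ltW.
apply: le_trans (_ : eta * (16^-1 * expR r + C) <= _).
  by rewrite ler_wpM2l ?(ltW eta0)//; have := hC r; rewrite mul1r.
rewrite mulrDr lerD// mulrA ler_wpM2r ?expR_ge0//; lra.
Qed.

End DirectionExpansions.

(** * Incomplete gamma functions and Euler's integral *)

Section IncompleteGamma.
Context {R : realType}.
Variable sigma : R.
Hypothesis sigma01 : 0 < sigma < 1.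
Implicit Types (a c r s t u : R) (n m k : nat).

Definition gamma_density c a r : R := expR (- expR r + c * expR (sigma * r) + a * r).
(** Euler's integrand is a = -1 in the same entire family, restricted to the real axis, so its
    antiderivative is already available. *)
Definition RF c a r : R := Re (loop_prim sigma (-1) (c%:C * expi 0) a (r +i* 0)).

Lemma is_derive_RF c a r : is_derive r 1 (RF c a) (gamma_density c a r).
Proof.
have [h _] := hol_hor 0 r (hol_loop_prim sigma (-1) (c%:C * expi 0) a).
apply: is_derive_eq h _; rewrite /loop_exp Re_cexp /expo expi0 mulr1.
rewrite !ReD !ImD (ReZ (-1)) (ImZ (-1)) (ReZ c) (ImZ c) (ReZ a) (ImZ a) !Re_cexp !Im_cexp.
rewrite (ReZ sigma) (ImZ sigma) /= !mulr0 cos0 sin0 !mulr0 !addr0 cos0 !mulr1.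
by rewrite /gamma_density mulN1r.
Qed.

Lemma gamma_density_decay c a : exists2 C, 0 <= C & forall r, 0 <= r -> gamma_density c a r <= C * expR (- 1 * r).
Proof.
have h2 : (0 : R) < 1 / 2 by lra.
have [C1 C10 h1] := exp_dominate c sigma01 h2; have [C2 C20 h3] := lin_dominate (a + 1) h2.
exists (expR (C1 + C2)); first exact: expR_ge0.
move=> r r0; rewrite /gamma_density -expRD ler_expR.
by have := h1 r; have := h3 r r0; lra.
Qed.

Lemma gamma_density_ge0 c a r : 0 <= gamma_density c a r. Proof. exact: expR_ge0. Qed.

Definition ginf c a : R := xget 0 [set l | exists2 C, 0 <= C & forall s, 0 <= s ->
  `|RF c a s - l| <= C * expR (- 1 * s)].

Lemma ginfP c a : exists2 C, 0 <= C & forall s, 0 <= s ->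
  `|RF c a s - ginf c a| <= C * expR (- 1 * s).
Proof.
suff [l hl] : exists l, [set l | exists2 C, 0 <= C & forall s, 0 <= s ->
  `|RF c a s - l| <= C * expR (- 1 * s)] l by exact: (xgetI 0 hl).
have [C C0 hC] := gamma_density_decay c a.
have [s s0|l hl] := @real_tail_limit R (RF c a) (gamma_density c a) C 1 0 ltr01 (is_derive_RF c a).
  by rewrite ger0_norm ?gamma_density_ge0// hC.
by exists l, C => // s s0; rewrite (le_trans (hl s s0))// divr1.
Qed.

(* The integral of exp (- e^r + c e^(sigma r) + a r) over r >= t; Gamma(a, e^t) if c = 0. *)
Definition incgamma c a t : R := ginf c a - RF c a t.

(** Positivity of integration for combinations of powers u^p; all comparisons between incomplete
    gamma values follow from pointwise inequalities between powers. *)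
Lemma incgamma_lin (l : seq (R * R)) c t :
  (forall r, t <= r -> 0 <= \sum_(p <- l) p.1 * expR (p.2 * r)) ->
  0 <= \sum_(p <- l) p.1 * incgamma c p.2 t.
Proof.
move=> hl; have hC (p : R * R) := ginfP c p.2.
have [cm hcm] := choice (fun p => let: ex_intro2 C C0 h := hC p in ex_intro _ C (conj C0 h)).
rewrite -oppr_le0; apply: (@le_exp_lim R _ 0 (\sum_(p <- l) `|p.1| * cm p) (Num.max 0 t) 1 ltr01) => s.
rewrite ge_max => /andP[s0 st].
have h1 : 0 <= \sum_(p <- l) p.1 * (RF c p.2 s - RF c p.2 t).
  have hd r : is_derive r 1 (fun r => \sum_(p <- l) p.1 * RF c p.2 r) (\sum_(p <- l) p.1 * gamma_density c p.2 r).
    elim: (l) => [|p q IH].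
      rewrite (_ : (fun r => _) = (fun=> 0)) ?big_nil; first exact: is_derive_real_cst.
      by apply/funext => ?; rewrite big_nil.
    have := is_deriveD (is_deriveZ_real p.1 (is_derive_RF c p.2 r)) IH; rewrite big_cons.
    rewrite (_ : _ + _ = (fun r => \sum_(p <- p :: q) p.1 * RF c p.2 r))//.
    by apply/funext => ?; rewrite big_cons.
  have := @is_derive_le R (fun=> 0) _ (fun=> 0) _ t s st
    (fun r _ => is_derive_real_cst 0 r) (fun r _ => hd r).
  rewrite subrr -sumrB.
  have -> : \sum_(p <- l) (p.1 * RF c p.2 s - p.1 * RF c p.2 t) =
     \sum_(p <- l) p.1 * (RF c p.2 s - RF c p.2 t) by apply: eq_bigr => p _; rewrite mulrBr.
  apply => r /andP[r1 _].
  have -> : \sum_(p <- l) p.1 * gamma_density c p.2 r =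
      expR (- expR r + c * expR (sigma * r)) * \sum_(p <- l) p.1 * expR (p.2 * r).
    by rewrite mulr_sumr; apply: eq_bigr => p _; rewrite /gamma_density expRD mulrCA.
  by rewrite mulr_ge0 ?expR_ge0// hl.
rewrite add0r; have -> : - \sum_(p <- l) p.1 * incgamma c p.2 t =
   \sum_(p <- l) p.1 * (RF c p.2 s - ginf c p.2) - \sum_(p <- l) p.1 * (RF c p.2 s - RF c p.2 t).
  by rewrite -sumrB -sumrN; apply: eq_bigr => p _; rewrite /incgamma; ring.
apply: le_trans (_ : \sum_(p <- l) p.1 * (RF c p.2 s - ginf c p.2) <= _); first by rewrite gerBl.
rewrite mulr_suml; apply: ler_sum => p _.
apply: le_trans (ler_norm _) _; rewrite normrM -mulrA ler_wpM2l//.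
by have [_] := hcm p; apply.
Qed.

Lemma incgamma_le c a b t : (forall r, t <= r -> expR (a * r) <= expR (b * r)) -> incgamma c a t <= incgamma c b t.
Proof.
move=> h; have := @incgamma_lin [:: (1, b); (-1, a)] c t.
rewrite !big_cons !big_nil /= !addr0 mul1r mulN1r subr_ge0; apply => r tr.
by rewrite !big_cons !big_nil /= addr0 mul1r mulN1r subr_ge0 h.
Qed.

Lemma incgamma_ge0 c a t : 0 <= incgamma c a t.
Proof.
have := @incgamma_lin [:: (1, a)] c t; rewrite !big_cons !big_nil /= addr0 mul1r; apply => r _.
by rewrite !big_cons !big_nil /= addr0 mul1r expR_ge0.
Qed.

Lemma real_exp_eq0 (x C S : R) : (forall s, S <= s -> `|x| <= C * expR (- 1 * s)) -> x = 0.
Proof.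
move=> h; apply/eqP; rewrite -normr_le0; apply: (@le_exp_lim R _ 0 C S 1 ltr01) => s Ss.
by rewrite add0r h.
Qed.

Lemma incgamma_rec a t : incgamma 0 (a + 1) t = a * incgamma 0 a t + expR (a * t - expR t).
Proof.
have hd r : is_derive r 1 (fun r => expR (a * r - expR r)) ((a - expR r) * expR (a * r - expR r)).
  apply: is_derive_expR_comp.
  have h1 := is_derive_affine 0 a r; have := is_deriveB h1 (is_derive_expR r).
  rewrite (_ : _ - _ = (fun r : R => a * r - expR r))//.
  by apply/funext => u; rewrite !fctE add0r.
have hc r : is_cderive (fun r => (RF 0 (a + 1) r - a * RF 0 a r + expR (a * r - expR r))%:C) r 0.
  apply: is_cderive_real.
  have := is_deriveD (is_deriveB (is_derive_RF 0 (a + 1) r) (is_deriveZ_real a (is_derive_RF 0 a r))) (hd r).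
  move=> h; apply: is_derive_eq h _; rewrite /gamma_density !mul0r !addr0 mulrDl mul1r addrA !expRD expRN.
  by field; rewrite gt_eqF// expR_gt0.
have key s : RF 0 (a + 1) s - a * RF 0 a s + expR (a * s - expR s) =
    RF 0 (a + 1) t - a * RF 0 a t + expR (a * t - expR t).
  by have := is_cderive0_cst hc s t => -[].
have [C1 C10 h1] := ginfP 0 (a + 1); have [C2 C20 h2] := ginfP 0 a.
have [C3 C30 h3] := gamma_density_decay 0 a.
suff : incgamma 0 (a + 1) t - a * incgamma 0 a t - expR (a * t - expR t) = 0.
  by move=> /eqP; rewrite subr_eq0 subr_eq [_ + a * _]addrC => /eqP.
apply: (@real_exp_eq0 _ (C1 + `|a| * C2 + C3) 0) => s s0.
have -> : incgamma 0 (a + 1) t - a * incgamma 0 a t - expR (a * t - expR t) =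
  - (RF 0 (a + 1) s - ginf 0 (a + 1)) + a * (RF 0 a s - ginf 0 a) - expR (a * s - expR s) +
  (RF 0 (a + 1) s - a * RF 0 a s + expR (a * s - expR s)) -
  (RF 0 (a + 1) t - a * RF 0 a t + expR (a * t - expR t)).
  by rewrite /incgamma; ring.
rewrite -(key s) addrK; apply: le_trans (ler_normB _ _) _.
apply: le_trans (lerD (ler_normD _ _) (lexx _)) _; rewrite normrN normrM !mulrDl.
apply: lerD; first by apply: lerD; [exact: h1|rewrite -mulrA ler_wpM2l// h2].
rewrite ger0_norm ?expR_ge0//; have := h3 s s0; rewrite /gamma_density mul0r addr0.
by rewrite [- _ + _]addrC.
Qed.

Lemma continuous_gamma_density c a : continuous (gamma_density c a).
Proof.
move=> r; apply: (@continuous_comp _ _ _ (fun r => - expR r + c * expR (sigma * r) + a * r) expR); last exact: continuous_expR.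
apply: cvgD; first apply: cvgD.
- by apply: cvgN; exact: continuous_expR.
- apply: cvgM; first exact: cvg_cst.
  apply: (@continuous_comp _ _ _ (fun r => sigma * r) expR); last exact: continuous_expR.
  by apply: cvgM; [exact: cvg_cst|exact: cvg_id].
- by apply: cvgM; [exact: cvg_cst|exact: cvg_id].
Qed.

Lemma incgamma_integral c a t :
  (\int[@lebesgue_measure R]_(r in `[t, +oo[) (gamma_density c a r)%:E = (incgamma c a t)%:E)%E.
Proof.
rewrite (@ge0_continuous_FTC2y R (gamma_density c a) (RF c a) t (ginf c a)).
- by rewrite /incgamma EFinB.
- by move=> r _; exact: gamma_density_ge0.
- by apply: continuous_subspaceT; exact: continuous_gamma_density.
- have [C C0 hC] := ginfP c a.
  apply/cvgrPdist_le => e e0; near=> s.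
  have s0 : 0 <= s by near: s; exact: nbhs_pinfty_ge.
  rewrite distrC; apply: le_trans (hC s s0) _; rewrite mulN1r expRN ler_pdivrMr ?expR_gt0//.
  rewrite -ler_pdivrMl//; apply: le_trans (expR_ge1Dx s).
  have : e^-1 * C <= s by near: s; apply: nbhs_pinfty_ge; rewrite num_real.
  by lra.
- by move=> r _; have [] := is_derive_RF c a r.
- have hc := @is_derive_continuous R (RF c a) (gamma_density c a) (is_derive_RF c a).
  by apply: cvg_at_right_filter; exact: hc.
- by move=> r _; rewrite derive1E; have [_ ->] := is_derive_RF c a r.
Unshelve. all: by end_near. Qed.

End IncompleteGamma.

Section GammaSeries.
Context {R : realType}.
Variable sigma : R.
Hypothesis sigma01 : 0 < sigma < 1.
Implicit Types (a r s t u : R) (n m k : nat).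

Notation gi := (incgamma sigma 0).
Notation lup0 a beta := (lup sigma a 0 0 beta).
Notation h beta := (Im (lup0 1 beta)).

(** Weighted arithmetic and geometric means of 1 and e^u, obtained from 1 + v <= e^v at v = - a u
    and v = (1 - a) u. *)
Lemma exp_amgm a u : 0 <= a <= 1 -> expR (a * u) <= 1 - a + a * expR u.
Proof.
move=> /andP[a0 a1].
have h1 := ler_wpM2l (_ : 0 <= 1 - a) (expR_ge1Dx (- (a * u))).
have h2 := ler_wpM2l a0 (expR_ge1Dx ((1 - a) * u)).
have {}h1 := h1 ltac:(by lra).
have e0 := expR_gt0 (a * u).
have := ler_wpM2l (ltW e0) (lerD h1 h2).
have -> : expR (a * u) * ((1 - a) * expR (- (a * u)) + a * expR ((1 - a) * u)) =
  1 - a + a * expR u.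
  rewrite mulrDr mulrCA -expRD subrr expR0 mulr1 mulrCA -expRD.
  by congr (_ + _ * expR _); ring.
apply: le_trans; rewrite le_eqVlt; apply/orP; left; apply/eqP; ring.
Qed.

Lemma rgamma_ge0 a : 0 <= a -> 0 <= rgamma a.
Proof.
move=> a0; have hc := @gauss_seq_cvg R sigma sigma01 a.
rewrite (rgamma_lup sigma01) -(cvg_lim (@Rhausdorff R) hc).
apply: limr_ge; first by apply/cvg_ex; exists (h (1 - a) / pi).
near=> m; rewrite /gauss_seq divr_ge0 ?mulr_ge0 ?powR_ge0//.
by apply: prodr_ge0 => i _; rewrite addr_ge0.
Unshelve. all: by end_near. Qed.

(** The ratio that governed the Gauss limit, rewritten: Gamma(m + a + 1) is asymptotic to m! m^a. *)
Lemma rgamma_ratio a :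
  (fun m => rgamma (m%:R + a + 1) * (m`!%:R * expR (a * ln m%:R))) @ \oo --> (1 : R).
Proof.
apply: cvg_trans (@lup_ratio_cvg1 R sigma sigma01 a); apply: near_eq_cvg; near=> m.
have m0 : (0 < m)%N by near: m; exact: nbhs_infty_gt.
rewrite !(lup_scaleE sigma01)// (h_neg sigma01) (rgamma_lup sigma01).
have -> : 1 - (m%:R + a + 1) = - (m%:R + a) :> R by ring.
rewrite !mulNr !opprK mulrDl expRD.
have pi0 := pi_gt0 R; set e1 := expR _; set e2 := expR _; set hh := Im _.
have e10 : e1 != 0 by rewrite gt_eqF ?expR_gt0.
have f0 : m`!%:R != 0 :> R by rewrite pnatr_eq0 -lt0n fact_gt0.
by generalize (@pi R) pi0 => q q0; field; rewrite f0 e10 gt_eqF.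
Unshelve. all: by end_near. Qed.

Lemma incgamma_nat n t : gi n.+1%:R t = n`!%:R * (expR (- expR t) * \sum_(0 <= k < n.+1) expR t ^+ k / k`!%:R).
Proof.
elim: n => [|n IH].
  rewrite big_nat1 fact0 expr0 divr1 mulr1 mul1r.
  have := incgamma_rec sigma01 0 t; rewrite add0r mul0r add0r mul0r add0r//.
have -> : n.+2%:R = n.+1%:R + 1 :> R by rewrite natr1.
rewrite (incgamma_rec sigma01) IH [in RHS]big_nat_recr //= expRD -expRM_natl factS natrM.
field; rewrite addrC natr1 !pnatr_eq0 -lt0n fact_gt0//.
Qed.

Lemma incgamma_nat_cvg t : (fun n => gi n.+1%:R t / n`!%:R) @ \oo --> (1 : R).
Proof.
have hc := @is_cvg_series_exp_coeff R (expR t).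
have : (fun n => expR (- expR t) * series (exp_coeff (expR t)) n.+1) @ \oo --> (1 : R).
  rewrite -[X in _ --> X](_ : expR (- expR t) * expR (expR t) = 1); last by rewrite -expRD addNr expR0.
  apply: cvgM; first exact: cvg_cst.
  by rewrite [X in X @ _ --> _](_ : _ = [sequence series (exp_coeff (expR t)) n.+1]_n)// cvg_shiftS.
apply: cvg_trans; apply: near_eq_cvg; near=> n.
rewrite incgamma_nat [RHS]mulrC mulKf//.
Unshelve. all: by end_near. Qed.

Let w a t m : R := rgamma (m%:R + a + 1) * gi (m%:R + a + 1) t.

Lemma incgamma_upper a t m : 0 <= a <= 1 -> (0 < m)%N -> gi (m%:R + a + 1) t <=
  expR (a * ln m%:R) * ((1 - a) * gi m.+1%:R t + a / m%:R * gi m.+2%:R t).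
Proof.
move=> ha m0; have M0 : 0 < m%:R :> R by rewrite ltr0n.
set A := expR _; have hl := @incgamma_lin R sigma sigma01
  [:: (-1, m%:R + a + 1); (A * (1 - a), m.+1%:R); (A * (a / m%:R), m.+2%:R)] 0 t.
move: hl; rewrite !big_cons !big_nil /= => hl.
have {hl} : 0 <= -1 * gi (m%:R + a + 1) t + (A * (1 - a) * gi m.+1%:R t + (A * (a / m%:R) * gi m.+2%:R t + 0)).
  apply: hl => r tr; rewrite !big_cons !big_nil /= addr0.
  have := exp_amgm (r - ln m%:R) ha; rewrite mulrBr expRB expRB lnK ?posrE// -/A => H.
  have A0 : 0 < A by exact: expR_gt0.
  have E1 : expR ((m%:R + a + 1) * r) = expR (m.+1%:R * r) * expR (a * r).
    by rewrite -expRD -natr1; congr expR; ring.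
  have E2 : expR (m.+2%:R * r) = expR (m.+1%:R * r) * expR r.
    by rewrite -expRD -[in LHS]natr1; congr expR; ring.
  rewrite E1 E2; set e := expR (m.+1%:R * r).
  have -> : -1 * (e * expR (a * r)) + (A * (1 - a) * e + A * (a / m%:R) * (e * expR r)) =
    e * A * (1 - a + a * (expR r / m%:R) - expR (a * r) / A).
    by field; rewrite gt_eqF//= gt_eqF.
  by rewrite mulr_ge0 ?subr_ge0// mulr_ge0 ?expR_ge0// ltW.
by rewrite addr0 => H; rewrite -subr_ge0; apply: le_trans H _; rewrite le_eqVlt; apply/orP; left; apply/eqP; ring.
Qed.

(** With v = u / m the power v^a lies between (2 - a) v - (1 - a) v^2 and 1 - a + a v. Both
    polynomials reduce to integer orders, where the incomplete gamma function is explicit, and both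
    are sharp at v = 1. *)
Lemma incgamma_lower a t m : 0 <= a <= 1 -> (0 < m)%N ->
  expR (a * ln m%:R) * ((2 - a) / m%:R * gi m.+2%:R t - (1 - a) / m%:R ^+ 2 * gi m.+3%:R t) <=
  gi (m%:R + a + 1) t.
Proof.
move=> /andP[a0 a1] m0; have M0 : 0 < m%:R :> R by rewrite ltr0n.
set A := expR _; have hl := @incgamma_lin R sigma sigma01
  [:: (1, m%:R + a + 1); (- (A * ((2 - a) / m%:R)), m.+2%:R); (A * ((1 - a) / m%:R ^+ 2), m.+3%:R)] 0 t.
move: hl; rewrite !big_cons !big_nil /= => hl.
have {hl} : 0 <= 1 * gi (m%:R + a + 1) t + (- (A * ((2 - a) / m%:R)) * gi m.+2%:R t +
    (A * ((1 - a) / m%:R ^+ 2) * gi m.+3%:R t + 0)).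
  apply: hl => r tr; rewrite !big_cons !big_nil /= addr0.
  have a2 : 0 < 2 - a by lra.
  have hq : 0 <= (1 - a) / (2 - a) <= 1.
    by apply/andP; split; [apply: divr_ge0; lra|rewrite ler_pdivrMr//; lra].
  have := exp_amgm ((2 - a) * (r - ln m%:R)) hq.
  have -> : (1 - a) / (2 - a) * ((2 - a) * (r - ln m%:R)) = (1 - a) * (r - ln m%:R).
    by field; rewrite gt_eqF.
  set u := r - ln m%:R => H.
  have E0 : expR r / m%:R = expR u by rewrite /u expRB lnK.
  have E1 : expR ((m%:R + a + 1) * r) = A * expR (m.+1%:R * r) * expR (a * u).
    by rewrite -!expRD -natr1; congr expR; rewrite /u; ring.
  have E2 : expR (m.+2%:R * r) = expR (m.+1%:R * r) * (expR u * m%:R).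
    by rewrite -E0 divfK ?gt_eqF// -expRD -[in LHS]natr1; congr expR; ring.
  have E3 : expR (m.+3%:R * r) = expR (m.+1%:R * r) * (expR u * m%:R) ^+ 2.
    by rewrite -E0 divfK ?gt_eqF// -expRM_natl -expRD -[m.+3]addn2 -[m.+1]addn1 !natrD; congr expR; ring.
  have E4 : expR u = expR (a * u) * expR ((1 - a) * u) by rewrite -expRD; congr expR; ring.
  have E5 : expR ((2 - a) * u) * expR (a * u) = expR u * expR u.
    by rewrite -!expRD; congr expR; ring.
  rewrite E1 E2 E3; set e := expR (m.+1%:R * r).
  have -> : 1 * (A * e * expR (a * u)) + (- (A * ((2 - a) / m%:R)) * (e * (expR u * m%:R)) +
     A * ((1 - a) / m%:R ^+ 2) * (e * (expR u * m%:R) ^+ 2)) =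
     A * e * (expR (a * u) - (2 - a) * expR u + (1 - a) * (expR u * expR u)).
    by field; rewrite gt_eqF.
  apply: mulr_ge0; first by rewrite mulr_ge0 ?expR_ge0.
  rewrite -E5 E4.
  have -> : expR (a * u) - (2 - a) * (expR (a * u) * expR ((1 - a) * u)) +
     (1 - a) * (expR ((2 - a) * u) * expR (a * u)) = (2 - a) * expR (a * u) *
     (1 - (1 - a) / (2 - a) + (1 - a) / (2 - a) * expR ((2 - a) * u) - expR ((1 - a) * u)).
    by field; rewrite gt_eqF.
  by rewrite mulr_ge0 ?subr_ge0// mulr_ge0 ?expR_ge0// ltW.
by rewrite addr0 mul1r => H; rewrite -subr_ge0; apply: le_trans H _; rewrite le_eqVlt; apply/orP; left; apply/eqP; ring.
Qed.

(** The regularised upper incomplete gamma function tends to 1 with its order. At integers it is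
    e^(- y) times a partial sum of e^y, where y = e^t; in between it is squeezed. *)
Lemma w_cvg a t : 0 <= a <= 1 -> w a t @ \oo --> (1 : R).
Proof.
move=> ha; have hG := incgamma_nat_cvg t; have hr := rgamma_ratio a.
have /andP[a0 a1] := ha.
pose G m := gi m.+1%:R t / m`!%:R.
have hG1 : (fun m => G m.+1) @ \oo --> (1 : R).
  by have := hG; rewrite -(cvg_shiftS G).
have hG2 : (fun m => G m.+2) @ \oo --> (1 : R).
  by have := hG1; rewrite -(cvg_shiftS (fun n => G n.+1)).
have hm k : (fun m => 1 + k%:R / m%:R) @ \oo --> (1 : R).
  rewrite -[X in _ --> X]addr0; apply: cvgD; first exact: cvg_cst.
  rewrite -(mulr0 k%:R); apply: cvgM; first exact: cvg_cst.
  by have := @cvg_harmonic R; rewrite -(cvg_shiftS (fun m : nat => m%:R^-1 : R)).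
pose U m := rgamma (m%:R + a + 1) * (m`!%:R * expR (a * ln m%:R)) *
   ((1 - a) * G m + a * (1 + 1%:R / m%:R) * G m.+1).
pose L m := rgamma (m%:R + a + 1) * (m`!%:R * expR (a * ln m%:R)) *
   ((2 - a) * (1 + 1%:R / m%:R) * G m.+1 - (1 - a) * ((1 + 1%:R / m%:R) * (1 + 2%:R / m%:R)) * G m.+2).
have hU : U @ \oo --> (1 : R).
  have E : 1 = 1 * ((1 - a) * 1 + a * 1 * 1) :> R by ring.
  rewrite E; apply: cvgM; first exact: hr.
  apply: cvgD; first by apply: cvgM; [exact: cvg_cst|].
  by apply: cvgM => //; apply: cvgM; [exact: cvg_cst|exact: hm].
have hL : L @ \oo --> (1 : R).
  have E : 1 = 1 * ((2 - a) * 1 * 1 - (1 - a) * (1 * 1) * 1) :> R by ring.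
  rewrite E; apply: cvgM; first exact: hr.
  apply: cvgB; first by apply: cvgM => //; apply: cvgM; [exact: cvg_cst|exact: hm].
  apply: cvgM => //; apply: cvgM; first exact: cvg_cst.
  by apply: cvgM; exact: hm.
apply: (squeeze_cvgr _ hL hU); near=> m.
have m0 : (0 < m)%N by near: m; exact: nbhs_infty_gt.
have M0 : m%:R != 0 :> R by rewrite pnatr_eq0 -lt0n.
have f0 k : k`!%:R != 0 :> R by rewrite pnatr_eq0 -lt0n fact_gt0.
have rg0 : 0 <= rgamma (m%:R + a + 1) :> R by rewrite rgamma_ge0// !addr_ge0.
have nS k : k.+1%:R = k%:R + 1 :> R by rewrite natr1.
have nS0 k : k%:R + 1 != 0 :> R by rewrite natr1 pnatr_eq0.
have nS1 k : k%:R + 1 + 1 != 0 :> R by rewrite !natr1 pnatr_eq0.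
apply/andP; split.
  have := ler_wpM2l rg0 (incgamma_lower t ha m0); rewrite /w; apply: le_trans.
  rewrite /L /G !factS !natrM le_eqVlt; apply/orP; left; apply/eqP.
  have := f0 m; have := nS0 m; have := nS1 m; rewrite -/(_.+1) !(nS m.+1) !(nS m).
  set gg := gi _ _; set gg' := gi _ _; set fm := m`!%:R; set e := expR _; set M := m%:R in M0 *.
  by move=> *; field; apply/and4P.
have := ler_wpM2l rg0 (incgamma_upper t ha m0); rewrite /w => /le_trans; apply.
rewrite /U /G !factS !natrM le_eqVlt; apply/orP; left; apply/eqP.
have := f0 m; have := nS0 m; rewrite !(nS m).
set gg := gi _ _; set gg' := gi _ _; set fm := m`!%:R; set e := expR _; set M := m%:R in M0 *.
by move=> *; field; apply/and3P.
Unshelve. all: by end_near. Qed.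

End GammaSeries.

Section EulerIntegral.
Context {R : realType}.
Variable sigma : R.
Hypothesis sigma01 : 0 < sigma < 1.
Implicit Types (a r s t u : R) (n m k : nat).

Notation gi := (incgamma sigma 0).


(** The recursion iterated: m steps collect the terms y^(s + k) / Gamma(s + k + 1), so letting m
    tend to infinity sums this series. *)
Lemma rgamma_incgamma_sum s t m : rgamma (s + m%:R) * gi (s + m%:R) t =
  rgamma s * gi s t + expR (- expR t) * \sum_(0 <= k < m) rgamma (s + k%:R + 1) * expR ((s + k%:R) * t).
Proof.
elim: m => [|m IH]; first by rewrite addr0 big_geq// mulr0 addr0.
rewrite big_nat_recr //= (mulrDr (expR (- expR t))) addrA -IH.
have -> : s + m.+1%:R = s + m%:R + 1 by rewrite -natr1 addrA.
rewrite (incgamma_rec sigma01) (rgammaS sigma01 (s + m%:R)) expRD.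
by set u := s + m%:R; ring.
Qed.

Lemma rgamma_incgamma_cvg s t : 1 <= s -> (fun m => rgamma (s + m%:R) * gi (s + m%:R) t) @ \oo --> (1 : R).
Proof.
move=> s1; have s0 : 0 <= s - 1 by rewrite subr_ge0.
have /andP[j1 j2] := truncn_itv s0; set j := Num.truncn (s - 1) in j1 j2.
have ha : 0 <= s - 1 - j%:R <= 1.
  by apply/andP; split; [rewrite subr_ge0|move: j2; rewrite -natr1; lra].
have hw := w_cvg sigma01 t ha.
rewrite -(cvg_shiftn j) in hw; apply: cvg_trans hw; apply: near_eq_cvg; near=> m => /=.
rewrite natrD; have -> : m%:R + j%:R + (s - 1 - j%:R) + 1 = s + m%:R :> R by ring.
by [].
Unshelve. all: by end_near. Qed.

Lemma rgamma_series s t : 1 <= s ->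
  (fun m => \sum_(0 <= k < m) rgamma (s + k%:R + 1) * expR ((s + k%:R) * t)) @ \oo -->
  expR (expR t) * (1 - rgamma s * gi s t).
Proof.
move=> s1; have h := rgamma_incgamma_cvg t s1.
have : (fun m => expR (expR t) * (rgamma (s + m%:R) * gi (s + m%:R) t - rgamma s * gi s t)) @ \oo -->
   expR (expR t) * (1 - rgamma s * gi s t).
  apply: cvgM; first exact: cvg_cst.
  by apply: cvgB => //; exact: cvg_cst.
apply: cvg_trans; apply: near_eq_cvg; near=> m.
rewrite rgamma_incgamma_sum addrC addKr mulrA -expRD subrr expR0 mul1r//.
Unshelve. all: by end_near. Qed.

Lemma rgamma_incgamma_le1 s t : 1 <= s -> rgamma s * gi s t <= 1.
Proof.
move=> s1; have h := rgamma_incgamma_cvg t s1.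
rewrite -(cvg_lim (@Rhausdorff R) h); apply: limr_ge; first by apply/cvg_ex; exists 1.
near=> m; rewrite rgamma_incgamma_sum lerDl mulr_ge0 ?expR_ge0// big_mkord sumr_ge0// => k _.
by rewrite mulr_ge0 ?expR_ge0// (rgamma_ge0 sigma01) ?addr_ge0//; lra.
Unshelve. all: by end_near. Qed.

(** A zero at s would spread by the functional equation to every s + m, against the limit 1 of the
    regularised function. *)
Lemma rgamma_gt0 s : 1 <= s -> 0 < rgamma s.
Proof.
move=> s1; rewrite lt_neqAle (rgamma_ge0 sigma01) ?andbT; last by lra.
rewrite eq_sym; apply/eqP => s0.
have z m : rgamma (s + m%:R) = 0.
  elim: m => [|m IH]; first by rewrite addr0.
  have := rgammaS sigma01 (s + m%:R); rewrite IH -natr1 addrA => /esym/eqP.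
  rewrite mulf_eq0 => /orP[/eqP|/eqP//].
  by have : 0 <= (m%:R : R) by []; lra.
have h := rgamma_incgamma_cvg 0 s1.
have : (fun m => rgamma (s + m%:R) * gi (s + m%:R) 0) = (fun=> 0).
  by apply/funext => m; rewrite z mul0r.
move=> E; rewrite E in h; have := cvg_lim (@Rhausdorff R) h; rewrite lim_cst; last exact: Rhausdorff.
by move=> H; have := H _ => H0; have := oner_neq0 R; rewrite -H0 eqxx.
Qed.

Lemma incgamma_nat_le n : exists2 C, 0 <= C & forall t, 0 <= t -> gi n.+1%:R t <= C * expR (n%:R * t - expR t).
Proof.
elim: n => [|n [C C0 IH]].
  exists 1 => // t _; have := incgamma_rec sigma01 0 t; rewrite add0r mul0r add0r => ->.
  by rewrite mul1r.
exists (n.+1%:R * C + 1); first by rewrite addr_ge0 ?mulr_ge0.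
move=> t t0; have -> : n.+2%:R = n.+1%:R + 1 :> R by rewrite natr1.
rewrite (incgamma_rec sigma01) mulrDl mul1r lerD2r -mulrA ler_wpM2l// (le_trans (IH t t0))//.
rewrite ler_wpM2l// ler_expR lerD2r ler_wpM2r// ler_nat//.
Qed.

Lemma rgamma_le_e s : 1 <= s -> rgamma s <= expR 1.
Proof.
move=> s1; have h := rgamma_incgamma_le1 0 s1.
have g1 : expR (- 1) <= gi s 0.
  have <- : gi 1 0 = expR (- 1).
    by have := incgamma_rec sigma01 0 0; rewrite add0r mul0r add0r expR0 mul0r sub0r.
  by apply: incgamma_le => // r r0; rewrite ler_expR ler_wpM2r.
have rg0 := ltW (rgamma_gt0 s1).
have := le_trans (ler_wpM2l rg0 g1) h.
by rewrite expRN ler_pdivrMr ?expR_gt0// mul1r.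
Qed.

Lemma rgamma_incgamma_tail n : exists2 D, 0 <= D & forall s t, 1 <= s -> s <= n.+1%:R -> 0 <= t ->
  0 <= expR (expR t) * (rgamma s * gi s t) <= D * expR (n%:R * t).
Proof.
have [C C0 hC] := incgamma_nat_le n; exists (expR 1 * C); first by rewrite mulr_ge0 ?expR_ge0.
move=> s t s1 sn t0.
have rg0 := ltW (rgamma_gt0 s1); have g0 := incgamma_ge0 sigma01 0 s t.
apply/andP; split; first by rewrite !mulr_ge0 ?expR_ge0.
have h : gi s t <= C * expR (n%:R * t - expR t).
  apply: le_trans (hC t t0); apply: incgamma_le => // r tr.
  by rewrite ler_expR ler_wpM2r// (le_trans t0).
apply: le_trans (_ : expR (expR t) * (expR 1 * (C * expR (n%:R * t - expR t))) <= _).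
  by rewrite ler_wpM2l ?expR_ge0// ler_pM// rgamma_le_e.
rewrite expRD expRN le_eqVlt; apply/orP; left; apply/eqP; field.
by rewrite gt_eqF// expR_gt0.
Qed.

(* Euler's integral, up to the part of it over (0, 1). *)
Lemma rgamma_incgamma_inv s : 1 <= s -> `|(rgamma s)^-1 - gi s 0| <= 1.
Proof.
move=> s1; have rg0 := rgamma_gt0 s1; have h1 := rgamma_incgamma_le1 0 s1.
(* Each step of the functional equation after the first divides by at least 2, so the series at t =
   0 is at most 2 / Gamma(s); multiplied by 1 / e this is below 1 / Gamma(s). *)
have h2 k : rgamma (s + k%:R + 1) <= rgamma s / 2 ^+ k.
  elim: k => [|k IH].
    rewrite addr0 expr0 divr1 (rgammaS sigma01 s) ler_peMl//.
    by rewrite (rgamma_ge0 sigma01)//; lra.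
  have sk1 : 1 <= s + k%:R by rewrite (le_trans s1)// lerDl.
  have -> : s + k.+1%:R + 1 = s + k%:R + 1 + 1 by rewrite -natr1; ring.
  move: IH; rewrite (rgammaS sigma01 (s + k%:R + 1)) => IH; rewrite exprS invfM mulrCA.
  set x := s + k%:R + 1 + 1 in IH *; set q := rgamma s / _ in IH *.
  have : 2 * rgamma x <= (s + k%:R + 1) * rgamma x.
    by rewrite ler_wpM2r ?(rgamma_ge0 sigma01) /x//; lra.
  by lra.
have h3 m : \sum_(0 <= k < m) rgamma (s + k%:R + 1) * expR ((s + k%:R) * 0) <= 2 * rgamma s.
  apply: le_trans (_ : rgamma s * (2 - 2 * 2^-1 ^+ m) <= _); last first.
    rewrite mulrC ler_wpM2r ?(ltW rg0)//.
    by have H : 0 <= (2^-1 : R) ^+ m; [rewrite exprn_ge0 ?invr_ge0|lra].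
  elim: m => [|m IH]; first by rewrite big_geq// expr0 mulr1 subrr mulr0.
  rewrite big_nat_recr //= mulr0 expR0 mulr1.
  apply: le_trans (lerD IH (h2 m)) _; rewrite exprS -exprVn.
  by rewrite le_eqVlt; apply/orP; left; apply/eqP; field.
have h4 : 1 - rgamma s * gi s 0 <= rgamma s.
  have h := rgamma_incgamma_cvg 0 s1.
  rewrite lerBlDr -(cvg_lim (@Rhausdorff R) h); apply: limr_le; first by apply/cvg_ex; exists 1.
  near=> m; rewrite rgamma_incgamma_sum expR0 addrC lerD2r.
  apply: le_trans (ler_wpM2l (expR_ge0 _) (h3 m)) _.
  rewrite mulrA ler_piMl ?(ltW rg0)// expRN mulrC ler_pdivrMr ?expR_gt0// mul1r.
  by have := expR_ge1Dx (1 : R); lra.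
have -> : (rgamma s)^-1 - gi s 0 = (rgamma s)^-1 * (1 - rgamma s * gi s 0).
  by field; rewrite gt_eqF.
rewrite ger0_norm; last by rewrite mulr_ge0 ?invr_ge0 ?subr_ge0 ?(ltW rg0).
by rewrite mulrC ler_pdivrMr// mul1r.
Unshelve. all: by end_near. Qed.

End EulerIntegral.

(** * Folding an integral over a half-line into one period *)

Section Translation.
Context {R : realType}.
Notation mu := (@lebesgue_measure R).
Implicit Types (a b c x : R).

Definition shiftf c (x : measurableTypeR R) : measurableTypeR R := x + c.

Lemma measurable_shiftf c : measurable_fun [set: measurableTypeR R] (shiftf c).
Proof. exact: measurable_funD. Qed.

HB.instance Definition _ c :=
  @isMeasurableFun.Build _ _ (measurableTypeR R) (measurableTypeR R) (shiftf c) (measurable_shiftf c).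

Lemma lebesgue_measure_shift c (A : set R) : measurable A ->
  pushforward mu (shiftf c) A = mu A.
Proof.
move=> mA; apply/esym/lebesgue_measure_unique => //= _ [[a b]] _ <-.
rewrite /pushforward.
have -> : shiftf c @^-1` [set` `]a, b]] = [set` `](a - c), (b - c)]].
  by apply/seteqP; split => x /=; rewrite !in_itv /= ltrBlDr lerBrDr.
by rewrite !lebesgue_measure_itv /= !lte_fin ltrD2r -EFinD -EFinD opprB addrA subrK.
Qed.

Lemma ge0_integral_shift (f : R -> \bar R) a b c : measurable_fun [set: R] f ->
  (forall x, 0 <= f x)%E ->
  (\int[mu]_(x in `[(a + c)%R, (b + c)%R[) f x = \int[mu]_(x in `[a, b[) f (x + c)%R)%E.
Proof.
move=> mf f0.
have -> : `[a, b[%classic = shiftf c @^-1` `[(a + c)%R, (b + c)%R[.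
  by apply/seteqP; split => x /=; rewrite !in_itv /= lerD2r ltrD2r.
transitivity (\int[pushforward mu (shiftf c)]_(x in `[(a + c)%R, (b + c)%R[) f x)%E.
  by apply: eq_measure_integral => //= A mA AS; exact/esym/lebesgue_measure_shift.
by rewrite ge0_integral_pushforward//=; exact: measurable_funS mf.
Qed.

Lemma tiles a c : 0 < c ->
  `[a, +oo[%classic = \bigcup_k `[(a + k%:R * c)%R, (a + c + k%:R * c)%R[%classic :> set R.
Proof.
move=> c0; apply/seteqP; split => [x|x [k _]] /=; rewrite !in_itv /= ?andbT; last first.
  by move=> /andP[h _]; apply: le_trans h; rewrite lerDl mulr_ge0// ltW.
move=> ax.
have x0 : 0 <= (x - a) / c by rewrite divr_ge0 ?subr_ge0// ltW.
have /andP[h1 h2] := truncn_itv x0; exists (Num.truncn ((x - a) / c)) => //=.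
rewrite in_itv /=; apply/andP; split.
  by rewrite addrC -lerBrDr -ler_pdivlMr.
have -> : a + c + (Num.truncn ((x - a) / c))%:R * c = a + (Num.truncn ((x - a) / c)).+1%:R * c.
  by rewrite -natr1; ring.
by rewrite addrC -ltrBlDr -ltr_pdivrMr.
Qed.

(** Folding turns an integral over s of y^s / Gamma(s + 1) into an integral over one period of the
    series that [rgamma_series] sums exactly. *)
Lemma ge0_integral_tiles (f : R -> \bar R) a c : 0 < c -> measurable_fun [set: R] f ->
  (forall x, 0 <= f x)%E ->
  (\int[mu]_(x in `[a, +oo[) f x =
   \int[mu]_(x in `[a, (a + c)%R[) \sum_(k <oo) f (x + k%:R * c)%R)%E.
Proof.
move=> c0 mf f0.
rewrite (tiles a c0) ge0_integral_bigcup//=; last 2 first.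
- exact: measurable_funS mf.
- move=> i j _ _ [x [/=]]; rewrite !in_itv /= => /andP[i1 i2] /andP[j1 j2].
  apply/eqP; rewrite eqn_leq -ltnS -[(j <= i)%N]ltnS; apply/andP; split; rewrite -(ltr_nat R) -natr1.
    have : i%:R * c < (j%:R + 1) * c by rewrite mulrDl mul1r; lra.
    by rewrite ltr_pM2r.
  have : j%:R * c < (i%:R + 1) * c by rewrite mulrDl mul1r; lra.
  by rewrite ltr_pM2r.
rewrite integral_nneseries//.
- by apply: eq_eseriesr => k _; exact: ge0_integral_shift.
- move=> k; apply: measurable_funTS; apply: measurableT_comp => //.
  exact: measurable_funD.
Qed.

End Translation.

(** * Power integrals of the reciprocal gamma function *)

Section RgammaIntegral.
Context {R : realType}.
Variable sigma : R.
Hypothesis sigma01 : 0 < sigma < 1.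
Notation mu := (@lebesgue_measure R).
Implicit Types (a b c x s t kap beta : R).
Notation gi := (incgamma sigma 0).

Lemma measurable_rgamma : measurable_fun [set: R] (@rgamma R).
Proof.
apply: (@measurable_fun_cvg _ _ _ _ (fun m (a : R) => (\prod_(i < m.+2) (a + i%:R)) *
   (m.+1`!%:R^-1 * expR (- (a * ln m.+1%:R))))); last first.
  move=> a _; rewrite (rgamma_lup sigma01).
  have := @gauss_seq_cvg R sigma sigma01 a; rewrite -(cvg_shiftS (gauss_seq a)).
  apply: cvg_trans; apply: near_eq_cvg; near=> m; rewrite /= /gauss_seq /powR.
  by rewrite pnatr_eq0 /= invfM expRN.
move=> m; apply: measurable_funM.
  apply: (@measurable_prod _ _ _ _ _ _ (fun (i : 'I_m.+2) (a : R) => a + i%:R)) => i _.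
  exact: measurable_funD.
apply: measurable_funM => //; apply: measurableT_comp; first exact: measurable_expR.
apply: measurableT_comp => //; exact: measurable_funM.
Unshelve. all: by end_near. Qed.

(** The absolute value makes the integrand nonnegative on the whole line, as folding and Tonelli
    ask; on the ranges of use the argument is nonnegative and so is [rgamma]. *)
Definition rgamma_int kap beta s1 t : \bar R :=
  (\int[mu]_(x in `[s1, +oo[) (kap * expR ((kap * x + beta) * t) * `|rgamma (kap * x + beta + 1)|)%:E)%E.

Lemma measurable_rgamma_int kap beta t :
  measurable_fun [set: R] (fun x => kap * expR ((kap * x + beta) * t) * `|rgamma (kap * x + beta + 1)|).
Proof.
have ml : measurable_fun [set: R] (fun x => kap * x + beta).
  by apply: measurable_funD => //; exact: measurable_funM.
apply: measurable_funM.
  apply: measurable_funM => //; apply: measurableT_comp; first exact: measurable_expR.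
  exact: measurable_funM.
apply: measurableT_comp => //; apply: measurableT_comp; first exact: measurable_rgamma.
exact: measurable_funD.
Qed.

Lemma rgamma_int_bounds kap beta s1 : 0 < kap -> 1 <= kap * s1 + beta ->
  exists n D, 0 <= D /\ forall t, 0 <= t ->
  ((expR (expR t) - D * expR (n%:R * t))%:E <= rgamma_int kap beta s1 t)%E /\
  (rgamma_int kap beta s1 t <= (expR (expR t))%:E)%E.
Proof.
move=> k0 hs1.
pose n := Num.bound (kap * s1 + beta + 1).
have hn : kap * s1 + beta + 1 <= n.+1%:R.
  apply/ltW; apply: lt_trans (_ : n%:R < _); last by rewrite ltr_nat.
  by apply: archi_boundP; lra.
have [D D0 hD] := rgamma_incgamma_tail sigma01 n.
exists n, D; split => // t t0; set E := expR (expR t).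
have ik0 : 0 < kap^-1 by rewrite invr_gt0.
pose f x := kap * expR ((kap * x + beta) * t) * `|rgamma (kap * x + beta + 1)|.
have f0 x : 0 <= f x by rewrite !mulr_ge0 ?expR_ge0// ltW.
have mf : measurable_fun [set: R] (EFin \o f).
  by apply/measurable_EFinP; exact: measurable_rgamma_int.
have -> : rgamma_int kap beta s1 t =
  (\int[mu]_(x in `[s1, (s1 + kap^-1)%R[) \sum_(k <oo) (EFin \o f) (x + k%:R * kap^-1)%R)%E.
  by rewrite /rgamma_int -(ge0_integral_tiles s1 ik0 mf)// => x; rewrite lee_fin f0.
have rng x : x \in `[s1, (s1 + kap^-1)[ -> 1 <= kap * x + beta <= n.+1%:R.
  rewrite in_itv /= => /andP[x1 x2]; apply/andP; split.
    by apply: le_trans hs1 _; rewrite lerD2r ler_wpM2l// ltW.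
  apply: le_trans hn; rewrite addrAC lerD2r.
  have : kap * x <= kap * (s1 + kap^-1) by rewrite ler_wpM2l ?(ltW k0)// ltW.
  by rewrite mulrDr divff// gt_eqF.
have serE x : x \in `[s1, (s1 + kap^-1)[ ->
    (\sum_(k <oo) (EFin \o f) (x + k%:R * kap^-1)%R)%E =
    (kap * (E - E * (rgamma (kap * x + beta) * gi (kap * x + beta) t)))%:E.
  move=> /rng /andP[x1 _]; set s := kap * x + beta.
  have hc := @rgamma_series R sigma sigma01 s t x1; rewrite -/s -/E in hc.
  have hc2 : (fun m => kap * \sum_(0 <= k < m) rgamma (s + k%:R + 1) * expR ((s + k%:R) * t)) @ \oo
      --> kap * (E * (1 - rgamma s * gi s t)) by apply: cvgM => //; exact: cvg_cst.
  rewrite mulrBr mulr1 in hc2; apply/cvg_lim => //.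
  apply: cvg_trans (cvg_EFin _ (hc2 : (fine \o (fun m => (kap * \sum_(0 <= k < m) rgamma (s + k%:R + 1) * expR ((s + k%:R) * t))%:E)) @ \oo --> _)); last by near=> m.
  apply: near_eq_cvg; near=> m.
  rewrite /= sumEFin; congr EFin; rewrite mulr_sumr; apply: eq_bigr => k _.
  have E1 : kap * (x + k%:R * kap^-1) + beta = s + k%:R.
    by rewrite /s; field; rewrite gt_eqF.
  rewrite /f E1 ger0_norm; first by ring.
  by apply: (rgamma_ge0 sigma01); rewrite addr_ge0// addr_ge0//; exact: le_trans ler01 x1.
have mI : mu `[s1, (s1 + kap^-1)%R[ = (kap^-1)%:E.
  by rewrite lebesgue_measure_itv /= lte_fin ltrDl ik0 -EFinD addrAC subrr add0r.
have mS : measurable_fun `[s1, (s1 + kap^-1)%R[ (fun x => (\sum_(k <oo) (EFin \o f) (x + k%:R * kap^-1)%R)%E).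
  apply: ge0_emeasurable_sum => [k x _ _|k _]; first by rewrite lee_fin.
  by apply: measurable_funTS; apply: measurableT_comp => //; exact: measurable_funD.
have cstE (v : R) : (\int[mu]_(x in `[s1, (s1 + kap^-1)%R[) (kap * v)%:E = v%:E)%E.
  rewrite integral_cst//= [X in (_ * X)%E]mI -EFinM; congr EFin.
  by rewrite mulrAC divff ?mul1r// gt_eqF.
split; last first.
  rewrite -(cstE E); apply: ge0_le_integral => //.
  - by move=> x _; apply: nneseries_ge0 => k _ _; rewrite lee_fin.
  - move=> x /= xI; rewrite serE// lee_fin ler_wpM2l ?(ltW k0)// gerBl.
    by have /andP[x1 x2] := rng x xI; have /andP[] := hD _ _ x1 x2 t0.
have [Ep|En] := leP 0 (E - D * expR (n%:R * t)); last first.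
  apply: le_trans (_ : 0%:E <= _)%E; first by rewrite lee_fin ltW.
  by apply: integral_ge0 => x _; apply: nneseries_ge0 => k _ _; rewrite lee_fin.
rewrite -(cstE (E - _)); apply: ge0_le_integral => //.
- by move=> x _; rewrite lee_fin mulr_ge0// ltW.
- move=> x /= xI; rewrite serE// lee_fin ler_wpM2l ?(ltW k0)// lerD2l lerN2.
  by have /andP[x1 x2] := rng x xI; have /andP[] := hD _ _ x1 x2 t0.
Unshelve. all: by end_near. Qed.

End RgammaIntegral.

Section SignedIntegral.
Context (d : measure_display) (T : measurableType d) (R : realType).
Variable mu : {measure set T -> \bar R}.

Lemma ge0_fin_integrable (D : set T) (f : T -> R) (v : R) : measurable D ->
  measurable_fun D f -> (forall x, D x -> 0 <= f x) ->
  (\int[mu]_(x in D) (f x)%:E = v%:E)%E -> mu.-integrable D (EFin \o f).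
Proof.
move=> mD mf f0 If; apply/integrableP; split; first exact/measurable_EFinP.
apply: le_lt_trans (ltry v); rewrite -If le_eqVlt; apply/orP; left; apply/eqP.
by apply: eq_integral => x; rewrite inE => Dx /=; rewrite ger0_norm ?f0.
Qed.

(** Carries a pointwise truncated expansion with signed coefficients over to the integrals:
    nonnegative functions with finite integrals are integrable, then linearity and the triangle
    inequality apply. *)
Lemma signed_integral M (f h : T -> R) (g : nat -> T -> R) (a : nat -> R) (D : set T)
    (vf vh : R) (v : nat -> R) : measurable D ->
  measurable_fun D f -> (forall j, measurable_fun D (g j)) -> measurable_fun D h ->
  (forall x, D x -> 0 <= f x) -> (forall j x, D x -> (j < M)%N -> 0 <= g j x) ->
  (forall x, D x -> `|f x - \sum_(j < M) a j * g j x| <= h x) ->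
  (\int[mu]_(x in D) (f x)%:E = vf%:E)%E ->
  (forall j, (j < M)%N -> \int[mu]_(x in D) (g j x)%:E = (v j)%:E)%E ->
  (\int[mu]_(x in D) (h x)%:E = vh%:E)%E ->
  `|vf - \sum_(j < M) a j * v j| <= vh.
Proof.
move=> mD mf mg mh f0 g0 fgh If Ig Ih.
have intf : mu.-integrable D (EFin \o f) by exact: ge0_fin_integrable If.
have intgj (j : 'I_M) : mu.-integrable D (EFin \o g j).
  by apply: (ge0_fin_integrable mD (mg j) _ (Ig j (ltn_ord j))) => x Dx; exact: g0.
have intg (j : 'I_M) : mu.-integrable D (fun x => (a j * g j x)%:E).
  have := integrableZl mD (a j) (intgj j).
  by apply: eq_integrable => // x _ /=; rewrite EFinM.
have E : (\int[mu]_(x in D) (f x - \sum_(j < M) a j * g j x)%:E =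
    (vf - \sum_(j < M) a j * v j)%:E)%E.
  have ints : mu.-integrable D (EFin \o (fun x => \sum_(j < M) a j * g j x)).
    have := @integrable_sum d T R mu D mD 'I_M (index_enum 'I_M) xpredT (fun j x => (a j * g j x)%:E) (fun j _ => intg j).
    by apply: eq_integrable => // x _ /=; rewrite sumEFin.
  transitivity (\int[mu]_(x in D) ((f x)%:E - (\sum_(j < M) a j * g j x)%:E))%E.
    by apply: eq_integral => x _; rewrite EFinB.
  rewrite (integralB_EFin mD intf ints) If EFinB; congr (_ - _)%E.
  transitivity (\int[mu]_(x in D) (\sum_(j < M) (a j * g j x)%:E))%E.
    by apply: eq_integral => x _ /=; rewrite sumEFin.
  rewrite (integral_sum mD intg) -sumEFin; apply: eq_bigr => j _.
  under eq_integral do rewrite EFinM.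
  by rewrite integralZl ?Ig//; exact: intgj.
have mu1 : measurable_fun D (fun x => f x - \sum_(j < M) a j * g j x).
  apply: measurable_funB => //.
  apply: (@measurable_sum _ _ _ _ _ _ (fun (j : 'I_M) x => a j * g j x)) => j.
  exact: measurable_funM.
rewrite -lee_fin -Ih; apply: le_trans (_ : `|(vf - \sum_(j < M) a j * v j)%:E| <= _)%E; first by [].
rewrite -E; apply: le_trans (le_abse_integral _ mD _) _; first exact/measurable_EFinP.
apply: ge0_le_integral => //.
- by apply: measurableT_comp => //; exact/measurable_EFinP.
- exact/measurable_EFinP.
Qed.

End SignedIntegral.

(** * Interchange of the integrations over s and u *)

Section Tonelli.
Context {R : realType}.
Variable sigma : R.
Hypothesis sigma01 : 0 < sigma < 1.
Notation mu := (@lebesgue_measure R).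
Implicit Types (a c s t r L : R).
Notation fR := (gamma_density sigma).
Notation gi := (incgamma sigma).

Lemma integral_indicE (D : set R) (f : R -> R) :
  (\int[mu]_(x in D) (f x)%:E = \int[mu]_x (f x * \1_D x)%:E)%E.
Proof.
rewrite integral_mkcond; apply: eq_integral => x _; rewrite patchE indicE.
by case: (x \in D); rewrite ?mulr1 ?mulr0.
Qed.

Lemma measurable_gamma_density (d : measure_display) (T : measurableType d) (c a : T -> R) (u : T -> R) :
  measurable_fun [set: T] c -> measurable_fun [set: T] a -> measurable_fun [set: T] u ->
  measurable_fun [set: T] (fun z => fR (c z) (a z) (u z)).
Proof.
move=> mc ma mu'; apply: measurableT_comp; first exact: measurable_expR.
apply: measurable_funD; last exact: measurable_funM.
apply: measurable_funD; first by apply: measurableT_comp => //; apply: measurableT_comp => //; exact: measurable_expR.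
apply: measurable_funM => //; apply: measurableT_comp; first exact: measurable_expR.
exact: measurable_funM.
Qed.

Lemma incgamma_indic c a : (\int[mu]_r (fR c a r * \1_`[0, +oo[%classic r)%:E = (gi c a 0)%:E)%E.
Proof. by rewrite -integral_indicE (incgamma_integral sigma01). Qed.

Lemma measurable_incgamma delta0 : measurable_fun [set: R] (fun s => gi 0 (sigma * s + delta0) 0).
Proof.
pose H (z : R * R) := (fR 0 (sigma * z.1 + delta0) z.2 * \1_`[0, +oo[%classic z.2)%:E.
have mH : measurable_fun [set: R * R] H.
  apply/measurable_EFinP; apply: measurable_funM; last by apply: measurableT_comp => //; exact: measurable_indic.
  apply: measurable_gamma_density => //; apply: measurable_funD => //; exact: measurable_funM.
have H0 z : (0 <= H z)%E by rewrite lee_fin mulr_ge0 ?gamma_density_ge0.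
have := @measurable_fun_fubini_tonelli_F _ _ _ _ _ mu H mH H0.
rewrite /fubini_F => h; apply/measurable_EFinP; apply: eq_measurable_fun h => s _.
by rewrite /H /= incgamma_indic.
Qed.

Section MixedIntegral.
Variables (delta0 s1 : R).
Hypothesis s11 : 1 <= s1.

Definition rgamma_incgamma_int L : \bar R := (\int[mu]_(s in `[s1, +oo[)
  (`|rgamma (s + 1)| * expR (s * L) * gi 0 (sigma * s + delta0) 0)%:E)%E.

(** With x = e^L and u = e^r >= 1, the inner integral over s is [rgamma_int] at t = sigma r + L,
    that is exp(x u^sigma) up to D (x u^sigma)^n. Integrated against the gamma density, the main
    part is [incgamma] with exponent x u^sigma and the error is O(x^n). *)
Lemma rgamma_incgamma_int_bounds : exists n D, 0 <= D /\ forall L, 0 <= L ->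
  (rgamma_incgamma_int L <= (gi (expR L) delta0 0)%:E)%E /\
  ((gi (expR L) delta0 0)%:E <= rgamma_incgamma_int L + (D * expR (n%:R * L))%:E)%E.
Proof.
have hs1 : 1 <= 1 * s1 + 0 by rewrite mul1r addr0.
have [n [D [D0 hPI]]] := rgamma_int_bounds sigma01 ltr01 hs1.
exists n, (D * gi 0 (n%:R * sigma + delta0) 0); split; first by rewrite mulr_ge0 ?(incgamma_ge0 sigma01).
move=> L L0.
pose D1 : set R := `[s1, +oo[%classic; pose D2 : set R := `[0, +oo[%classic.
have mD1 : measurable D1 by exact: measurable_itv.
have mD2 : measurable D2 by exact: measurable_itv.
pose hh (s r : R) := 1 * expR ((1 * s + 0) * (sigma * r + L)) * `|rgamma (1 * s + 0 + 1)| * fR 0 delta0 r.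
have hh0 s r : 0 <= hh s r by rewrite !mulr_ge0 ?expR_ge0 ?gamma_density_ge0.
pose H (z : R * R) := (hh z.1 z.2 * \1_D2 z.2 * \1_D1 z.1)%:E.
have mH : measurable_fun [set: R * R] H.
  apply/measurable_EFinP; apply: measurable_funM; last by apply: measurableT_comp => //; exact: measurable_indic.
  apply: measurable_funM; last by apply: measurableT_comp => //; exact: measurable_indic.
  apply: measurable_funM; last exact: measurable_gamma_density.
  have ml : measurable_fun [set: R * R] (fun z : R * R => 1 * z.1 + 0).
    by apply: measurable_funD => //; exact: measurable_funM.
  apply: measurable_funM.
    apply: measurable_funM => //; apply: measurableT_comp; first exact: measurable_expR.
    apply: measurable_funM => //; apply: measurable_funD => //; exact: measurable_funM.
  apply: measurableT_comp => //; apply: measurableT_comp; first exact: measurable_rgamma sigma01.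
  exact: measurable_funD.
have H0 z : (0 <= H z)%E.
  by rewrite lee_fin mulr_ge0// mulr_ge0// hh0.
have JE : rgamma_incgamma_int L = (\int[mu]_r \int[mu]_s H (s, r))%E.
  rewrite -(@fubini_tonelli _ _ _ _ _ mu mu H mH H0) /rgamma_incgamma_int integral_indicE.
  apply: eq_integral => s _.
  transitivity (\int[mu]_r (((`|rgamma (s + 1)| * expR (s * L) * \1_D1 s)%:E) *
    (fR 0 (sigma * s + delta0) r * \1_D2 r)%:E))%E; last first.
    apply: eq_integral => r _; rewrite /H /hh /= -EFinM; congr EFin.
    rewrite !mul1r !addr0.
    have -> : expR (s * (sigma * r + L)) = expR (s * L) * expR (sigma * s * r).
      by rewrite -expRD; congr expR; ring.
    have -> : fR 0 (sigma * s + delta0) r = expR (sigma * s * r) * fR 0 delta0 r.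
      by rewrite /gamma_density -expRD; congr expR; ring.
    by ring.
  rewrite ge0_integralZl_EFin//=.
  - by rewrite incgamma_indic -EFinM; congr EFin; ring.
  - by move=> r _; rewrite lee_fin mulr_ge0 ?gamma_density_ge0.
  - apply/measurable_EFinP; apply: measurable_funM; last exact: measurable_indic.
    by apply: measurable_gamma_density.
have mG := @measurable_fun_fubini_tonelli_G _ _ _ _ _ mu H mH H0.
rewrite /fubini_G in mG.
have GE r : (\int[mu]_s H (s, r) = (fR 0 delta0 r * \1_D2 r)%:E * rgamma_int 1 0 s1 (sigma * r + L))%E.
  rewrite /rgamma_int [X in (_ * X)%E]integral_indicE -ge0_integralZl_EFin//=.
  - by apply: eq_integral => s _; rewrite /H /hh /= -EFinM; congr EFin; ring.
  - apply/measurable_EFinP; apply: measurable_funM; last exact: measurable_indic.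
    exact: measurable_rgamma_int sigma01 _ _ _.
  - by rewrite mulr_ge0 ?gamma_density_ge0.
have G0' r : (0 <= \int[mu]_s H (s, r))%E by apply: integral_ge0 => s _; exact: H0.
pose G r := (\int[mu]_s H (s, r))%E.
have {}JE : rgamma_incgamma_int L = (\int[mu]_r G r)%E by exact: JE.
have {}mG : measurable_fun [set: R] G by exact: mG.
have {}GE r : G r = ((fR 0 delta0 r * \1_D2 r)%:E * rgamma_int 1 0 s1 (sigma * r + L))%E by exact: GE.
have {G0'}G0 r : (0 <= G r)%E by exact: G0'.
clearbody G; move: JE mG GE G0 => JE mG GE G0.
have fE r : fR 0 delta0 r * expR (expR (sigma * r + L)) = fR (expR L) delta0 r.
  by rewrite /gamma_density -expRD; congr expR; rewrite expRD; ring.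
have tau0 r : r \in D2 -> 0 <= sigma * r + L.
  rewrite inE /D2 /= in_itv /= andbT => r0; have /andP[/ltW sg0 _] := sigma01.
  by rewrite addr_ge0// mulr_ge0.
have mf1 c a : measurable_fun [set: R] (fun r => (fR c a r * \1_D2 r)%:E).
  apply/measurable_EFinP; apply: measurable_funM; last exact: measurable_indic.
  exact: measurable_gamma_density.
have f10 c a r : (0 <= (fR c a r * \1_D2 r)%:E)%E by rewrite lee_fin mulr_ge0 ?gamma_density_ge0.
rewrite JE; split.
  rewrite -incgamma_indic; apply: ge0_le_integral => //.
  - exact: mf1.
  - move=> r _; rewrite GE -fE mulrAC (EFinM (fR 0 delta0 r * \1_D2 r)).
    have [rD|rD] := boolP (r \in D2).
      by rewrite lee_wpmul2l// (hPI _ (tau0 r rD)).2.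
    by rewrite indicE (negbTE rD) mulr0 !mul0e.
pose K r := ((D * expR (n%:R * L))%:E * (fR 0 (n%:R * sigma + delta0) r * \1_D2 r)%:E)%E.
have mK : measurable_fun [set: R] K by exact: measurable_funeM.
have K0 r : (0 <= K r)%E by rewrite mule_ge0// lee_fin mulr_ge0 ?expR_ge0.
have -> : (\int[mu]_r G r +
    (D * gi 0 (n%:R * sigma + delta0) 0 * expR (n%:R * L))%:E =
    \int[mu]_r (G r + K r))%E.
  rewrite ge0_integralD//.
  congr (_ + _)%E; rewrite /K ge0_integralZl_EFin//.
  - by rewrite incgamma_indic -EFinM; congr EFin; ring.
  - exact: mf1.
  - by rewrite mulr_ge0 ?expR_ge0.
rewrite -incgamma_indic; apply: ge0_le_integral => //.
- exact: mf1.
- exact: emeasurable_funD.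
move=> r _; rewrite GE /K.
have [rD|rD] := boolP (r \in D2); last first.
  rewrite indicE (negbTE rD) !mulr0 mul0e add0e mule0//.
rewrite indicE rD !mulr1.
apply: le_trans (_ : _ <= (fR 0 delta0 r)%:E * (expR (expR (sigma * r + L)) - D * expR (n%:R * (sigma * r + L)))%:E +
   (D * expR (n%:R * L))%:E * (fR 0 (n%:R * sigma + delta0) r)%:E)%E _; last first.
  rewrite leeD2r// lee_wpmul2l//; first by rewrite lee_fin gamma_density_ge0.
  exact: (hPI _ (tau0 r rD)).1.
rewrite -!EFinM -EFinD lee_fin -fE mulrBr.
have -> : fR 0 (n%:R * sigma + delta0) r = fR 0 delta0 r * expR (n%:R * (sigma * r)).
  by rewrite /gamma_density -expRD; congr expR; ring.
rewrite [n%:R * (sigma * r + L)]mulrDr (expRD (n%:R * (sigma * r))) le_eqVlt; apply/orP; left; apply/eqP; ring.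
Qed.

End MixedIntegral.
End Tonelli.

Section BigO.
Context {R : realType}.
Implicit Types f g : R -> R.

Lemma bigO_ex f g : f =O_+oo g ->
  exists2 C, 0 <= C & exists s0, forall s, s0 <= s -> `|f s| <= C * `|g s|.
Proof.
move=> /eqOP [C0 [_ hC]]; pose C := Num.max 0 (C0 + 1).
have C0C : C0 < C by rewrite lt_max ltrDl ltr01 orbT.
have [s0 [_ hs]] := hC C C0C; exists C; first by rewrite le_max lexx.
by exists (s0 + 1) => s ss; apply: hs; apply: lt_le_trans ss; rewrite ltrDl.
Qed.

Lemma bigO_intro f g (C s0 : R) : (forall s, s0 <= s -> `|f s| <= C * `|g s|) -> f =O_+oo g.
Proof.
move=> h; apply/eqOP; exists C; split; first exact: num_real.
move=> k Ck; exists s0; split; first exact: num_real.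
move=> s /ltW ss; apply: le_trans (h s ss) _; rewrite ler_wpM2r// ltW//.
Qed.

(** Uniqueness of asymptotic coefficients in powers of e^(- l): l -> +oo kills the leading one,
    dividing by e^(- l) starts again. *)
Lemma exp_poly_zero M : forall (d : nat -> R) (C l0 : R),
  (forall l, l0 <= l -> `|\sum_(i < M) d i * expR (- (i%:R * l))| <= C * expR (- (M%:R * l))) ->
  forall i, (i < M)%N -> d i = 0.
Proof.
elim: M => // M IH d C l0 h.
have d0 : d 0%N = 0.
  apply: (@real_exp_eq0 R (d 0%N) (`|C| + \sum_(i < M) `|d i.+1|) (Num.max 0 l0)) => l.
  rewrite ge_max => /andP[lp ll]; have := h l ll.
  rewrite big_ord_recl mul0r oppr0 expR0 mulr1 => h1.
  set T := \sum_(i < M) _ in h1.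
  have h2 : `|T| <= (\sum_(i < M) `|d i.+1|) * expR (- 1 * l).
    apply: le_trans (ler_norm_sum _ _ _) _; rewrite mulr_suml; apply: ler_sum => i _.
    rewrite normrM (ger0_norm (expR_ge0 _)) ler_wpM2l// ler_expR mulN1r lerN2 ler_peMl//.
    by rewrite ler1n.
  have h3 : C * expR (- (M.+1%:R * l)) <= `|C| * expR (- 1 * l).
    apply: le_trans (_ : `|C| * expR (- (M.+1%:R * l)) <= _).
      by rewrite ler_wpM2r ?expR_ge0// ler_norm.
    by rewrite ler_wpM2l// ler_expR mulN1r lerN2 ler_peMl// ler1n.
  have -> : d 0%N = (d 0%N + T) - T by rewrite addrK.
  apply: le_trans (ler_normB _ _) _; rewrite mulrDl; apply: lerD => //.
  exact: le_trans h1 h3.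
case=> [//|i]; rewrite ltnS; apply: (IH (fun i => d i.+1) C l0) => l ll.
have := h l ll; rewrite big_ord_recl d0 mul0r add0r.
have -> : \sum_(j < M) d (lift ord0 j) * expR (- ((lift ord0 j)%:R * l)) =
  expR (- l) * \sum_(j < M) d j.+1 * expR (- (j%:R * l)).
  rewrite mulr_sumr; apply: eq_bigr => j _; rewrite lift0 mulrCA -expRD; congr (_ * expR _).
  by rewrite -natr1; ring.
rewrite normrM ger0_norm ?expR_ge0//.
have -> : C * expR (- (M.+1%:R * l)) = expR (- l) * (C * expR (- (M%:R * l))).
  by rewrite mulrCA -expRD; congr (_ * expR _); rewrite -natr1; ring.
by rewrite ler_pM2l ?expR_gt0.
Qed.

End BigO.

(** * Identification of the saddle-point coefficients *)

Section Identification.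
Context {R : realType}.
Variables (sigma mu0 : R) (A : nat -> R).
Hypothesis sigma01 : 0 < sigma < 1.
Hypothesis hA : inverse_factorial_coef sigma mu0 A.
Implicit Types (r s t x y l : R) (n m k j : nat).

Let kap : R := 1 - sigma.
Let delta0 : R := delta mu0.
Let vt : R := vartheta mu0.
Let kap0 : 0 < kap := kap_gt0 sigma01.
Let s0 : 0 < sigma := sig0 sigma01.
Let q : R := kap / sigma.
Let q0 : 0 < q. Proof. exact: divr_gt0. Qed.

Notation gi := (incgamma sigma).
Notation lupn := (saddle_lup sigma delta0).
Notation lamX := (saddle_exp sigma).
Notation mu := (@lebesgue_measure R).
Notation Lof := (log_mod sigma).
Notation xof := (saddle_mod sigma).

(** For b = 0 the direction is w = - sigma pi, so on Im z = pi the exponent is real up to the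
    constant i pi delta. The loop integral there is a multiple of a positive integral over u >= 1,
    and the difference is the vertical leg from 0 to i pi. *)
Lemma saddle_lup0 l : 0 <= l -> cmod (lupn l 0 - (expR (- (delta0 * l)) * gi (xof l) delta0 0)%:C) <=
  expR (- (delta0 * l)) * (pi * expR (1 + xof l)).
Proof.
move=> l0; set x := xof l; have x0 : 0 <= x by exact: (saddle_mod_ge0 sigma01).
set F := loop_prim sigma 1 (x%:C * expi (saddle_arg sigma 0)) delta0.
set c : R[i] := ce (0 +i* (delta0 * pi)).
have hd s : is_cderive (fun s => F (s +i* pi) - c * (RF sigma x delta0 s)%:C) s 0.
  have h := is_cderiveB (hol_hor pi s (hol_loop_prim sigma 1 (x%:C * expi (saddle_arg sigma 0)) delta0))
    (is_cderiveZ c (is_cderive_real (is_derive_RF sigma x delta0 s))).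
  apply: is_cderive_eq h _; rewrite /c /gamma_density /loop_exp -cexp_real -cexpD.
  apply/eqP; rewrite subr_eq0; apply/eqP; congr ce; rewrite /expo.
  have -> : ce (s +i* pi) = (- expR s)%:C.
    by rewrite ceLw expi_pi mulrN1 rmorphN.
  have -> : x%:C * expi (saddle_arg sigma 0) * ce (sigma%:C * (s +i* pi)) = (x * expR (sigma * s))%:C.
    have -> : sigma%:C * (s +i* pi) = (sigma * s) +i* (sigma * pi).
      by apply: complex_ext; rewrite ?ReZ ?ImZ.
    rewrite ceLw mulrACA -expiD /saddle_arg mulr0 sub0r addNr expi0 mulr1 -rmorphM//.
  by apply: complex_ext; rewrite ?ReD ?ImD ?(ReZ 1) ?(ImZ 1) ?(ReZ delta0) ?(ImZ delta0) /=; ring.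
have pi0 := pi_gt0 R; have pi_in := @pi_in R.
have [C1 hC1] := lupP sigma01 (saddle_arg sigma 0) delta0 ltr01 x0 pi_in ltr01.
have [C2 C20 hC2] := ginfP sigma01 x delta0.
have E : lup sigma 1 x (saddle_arg sigma 0) delta0 = F (0 +i* pi) + c * (gi x delta0 0)%:C.
  apply/eqP; rewrite -subr_eq0; apply/eqP.
  apply: (@cmod_exp_eq0 R _ (C1 + C2) 0 1 ltr01) => s s0'.
  have := is_cderive0_cst hd s 0 => key.
  set lu := lup _ _ _ _ _ in hC1 *.
  have -> : lu - (F (0 +i* pi) + c * (gi x delta0 0)%:C) =
     - (F (s +i* pi) - lu) + c * (RF sigma x delta0 s - ginf sigma x delta0)%:C.
    have : F (s +i* pi) - c * (RF sigma x delta0 s)%:C = F (0 +i* pi) - c * (RF sigma x delta0 0)%:C by [].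
    rewrite /incgamma !rmorphB /=; set a1 := F _; set a2 := F _; set b1 := (RF _ _ _ _)%:C; set b2 := (RF _ _ _ _)%:C => E1.
    have -> : a2 = a1 - c * b1 + c * b2 by rewrite E1 subrK.
    by ring.
  apply: le_trans (cmodD _ _) _; rewrite cmodN mulrDl; apply: lerD; first exact: hC1.
  have c1 : cmod c = 1 by rewrite /c cmod_cexp /= expR0.
  rewrite cmodM c1 mul1r cmod_real; exact: hC2.
rewrite /saddle_lup -/x E mulrDr.
have -> : ce (- (delta0%:C * saddle_base l 0)) * (c * (gi x delta0 0)%:C) = (expR (- (delta0 * l)) * gi x delta0 0)%:C.
  rewrite mulrA -cexpD rmorphM /= -cexp_real; congr (ce _ * _).
  by apply: complex_ext; rewrite ?ReD ?ImD ?ReN ?ImN ?(ReZ delta0) ?(ImZ delta0) /=; ring.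
rewrite addrK cmodM cmod_saddle_baseN ler_wpM2l ?expR_ge0//.
exact: (loop_prim_ver _ _ _ x0 (ltW pi0)).
Qed.

Lemma exp_negligible (B c : R) : 0 < c -> exists2 C, 0 <= C & forall l, 0 <= l ->
  expR (B * l + xof l) <= C * expR (c * expR l).
Proof.
move=> c0; have c2 : 0 < c / 2 by rewrite divr_gt0.
have [C1 C10 h1] := lin_dominate B c2; have [C2 C20 h2] := saddle_mod_le sigma01 c2.
exists (expR (C1 + C2)) => [|l l0]; first exact: expR_ge0.
rewrite -expRD ler_expR; have := h1 l l0; have := h2 l; lra.
Qed.

Let tau l : R := l + ln q.

(** The part of Euler's integral over (0, 1) is at most 1 by [rgamma_incgamma_inv], which accounts
    for the extra [rgamma (s + 1)]. *)
Lemma inverse_factorial_bound M : (0 < M)%N -> exists2 C, 0 <= C & exists s1, forall s, s1 <= s ->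
  `|rgamma (s + 1) * gi 0 (sigma * s + delta0) 0 - kap * (hsig sigma * kap `^ kap) `^ s *
    \sum_(j < M) A j * rgamma (kap * s + 1 - vt + j%:R)| <=
  C * (kap * (hsig sigma * kap `^ kap) `^ s * rgamma (kap * s + 1 - vt + M%:R)) + rgamma (s + 1).
Proof.
move=> M0; have [C C0 [s1 h]] := bigO_ex (hA M0); exists C => //.
pose s2 := Num.max s1 (Num.max 0 (Num.max ((1 - delta0) / sigma) (vt / kap))).
exists s2 => s; rewrite !ge_max => /andP[ss /andP[sp /andP[sd sk]]].
have := h s ss; rewrite -/vt -/kap -/delta0.
rewrite ler_pdivrMr// in sd; rewrite ler_pdivrMr// in sk.
set sc := kap * _ `^ s; have sc0 : 0 <= sc by rewrite mulr_ge0 ?powR_ge0// ltW.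
have rM : 0 <= rgamma (kap * s + 1 - vt + M%:R) :> R.
  by rewrite (rgamma_ge0 sigma01)// addr_ge0//; lra.
rewrite (ger0_norm (mulr_ge0 sc0 rM)) /gamma invrK [1 + s]addrC.
set a := sigma * s + delta0; set S := \sum_(j < M) _ => h1.
have a1 : 1 <= a by rewrite /a; lra.
have h2 := rgamma_incgamma_inv sigma01 a1.
have rs : 0 <= rgamma (s + 1) :> R by rewrite (rgamma_ge0 sigma01)// addr_ge0.
have -> : rgamma (s + 1) * gi 0 a 0 - sc * S = ((rgamma a)^-1 * rgamma (s + 1) - sc * S) -
  rgamma (s + 1) * ((rgamma a)^-1 - gi 0 a 0) by ring.
apply: le_trans (ler_normB _ _) _; apply: lerD; first exact: h1.
by rewrite normrM (ger0_norm rs) ler_piMr.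
Qed.

(** (h kap^kap)^s x^s = X^(kap s), where X = e^(tau l) is the variable of the exponential
    expansion. *)
Lemma scale_shift s l : (hsig sigma * kap `^ kap) `^ s * expR (s * Lof l) = expR (kap * s * tau l).
Proof.
rewrite /hsig /powR (gt_eqF s0) (gt_eqF kap0) -expRD gt_eqF ?expR_gt0// expRK -expRD.
by rewrite /log_mod /tau /q ln_div ?posrE//; congr expR; rewrite /kap; ring.
Qed.

Lemma fin_between (z : \bar R) (a b : R) : (a%:E <= z)%E -> (z <= b%:E)%E ->
  exists2 v : R, z = v%:E & a <= v <= b.
Proof.
case: z => [v| |]; rewrite ?lee_fin ?leye_eq ?leeNy_eq // => h1 h2.
by exists v => //; rewrite h1.
Qed.

Let big M l : R := expR ((vt - M%:R) * tau l) * expR (expR (tau l)).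

Lemma expR_tau l : expR (tau l) = q * expR l.
Proof. by rewrite /tau expRD lnK ?posrE// mulrC. Qed.

Lemma negligible M (B c : R) : exists2 C, 0 <= C & forall l, 0 <= l ->
  expR (B * l + c) <= C * big M l /\ expR (B * l + c + xof l) <= C * big M l.
Proof.
have [C C0 hC] := exp_negligible (B - (vt - M%:R)) q0.
pose K := expR (c - (vt - M%:R) * ln q).
exists (K * C) => [|l l0]; first by rewrite mulr_ge0 ?expR_ge0.
have h2 : expR (B * l + c + xof l) <= K * C * big M l.
  have -> : B * l + c + xof l = (c - (vt - M%:R) * ln q) + (vt - M%:R) * tau l + ((B - (vt - M%:R)) * l + xof l).
    by rewrite /tau; ring.
  rewrite expRD expRD -/K /big expR_tau.
  have := ler_wpM2l (_ : 0 <= K * expR ((vt - M%:R) * tau l)) (hC l l0).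
  rewrite mulr_ge0 ?expR_ge0// => /(_ isT) h; apply: le_trans h _.
  by rewrite le_eqVlt; apply/orP; left; apply/eqP; ring.
split => //; apply: le_trans h2; rewrite ler_expR lerDl; exact: (saddle_mod_ge0 sigma01).
Qed.

(** The factorial expansion times x^s is integrated over s >= s1: its j-th term gives X^(vt - j) e^X
    up to powers of X, and the extra term at most e^x. Powers of X and e^x are negligible against
    X^(vt - M) e^X. *)
Lemma incgamma_asymp M : (0 < M)%N -> exists C l0, 0 <= l0 /\ forall l, l0 <= l ->
  `|gi (xof l) delta0 0 - \sum_(j < M) A j * expR ((vt - j%:R) * tau l) * expR (expR (tau l))|
  <= C * big M l.
Proof.
move=> M0; have [C C0 [sa hpt]] := inverse_factorial_bound M0.
(* Beyond [sa] the expansion holds, s1 >= 1 is required by the mixed integral, and kap s1 >= 1 + vt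
   puts every order kap s + j - vt in the range s >= 1 of the series estimates. *)
pose s1 := Num.max sa (Num.max 1 ((1 + vt) / kap)).
have ssa : sa <= s1 by rewrite le_max lexx.
have s11 : 1 <= s1 by rewrite !le_max lexx orbT.
have sk : 1 + vt <= kap * s1 by rewrite mulrC -ler_pdivrMr// !le_max lexx !orbT.
have [nJ [DJ [DJ0 hJ]]] := rgamma_incgamma_int_bounds sigma01 delta0 s11.
have sj j : 1 <= kap * s1 + (j%:R - vt) by have : 0 <= (j%:R : R) by []; lra.
have hPI j : exists p : nat * R, 0 <= p.2 /\ forall t, 0 <= t ->
    ((expR (expR t) - p.2 * expR (p.1%:R * t))%:E <= rgamma_int kap (j%:R - vt) s1 t)%E /\
    (rgamma_int kap (j%:R - vt) s1 t <= (expR (expR t))%:E)%E.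
  by have [n [D [D0 h]]] := rgamma_int_bounds sigma01 kap0 (sj j); exists (n, D).
have [p hp] := choice hPI.
have s1P : 1 <= 1 * s1 + 0 by rewrite mul1r addr0.
have [nP [DP [DP0 hP]]] := rgamma_int_bounds sigma01 ltr01 s1P.
have [CJ CJ0 hCJ] := negligible M (nJ%:R * kap) (- (nJ%:R * ln sigma)).
have [CP CP0 hCP] := negligible M 0 0.
have hj (j : nat) : exists c, 0 <= c /\ forall l, 0 <= l ->
    expR ((vt - j%:R) * tau l) * expR ((p j).1%:R * tau l) <= c * big M l.
  have [c c0 h] := negligible M (vt - j%:R + (p j).1%:R) ((vt - j%:R + (p j).1%:R) * ln q).
  exists c; split => // l l0; have [h1 _] := h l l0; apply: le_trans h1.
  by rewrite -expRD ler_expR /tau le_eqVlt; apply/orP; left; apply/eqP; ring.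
have [cj hcj] := choice hj.
exists (DJ * CJ + C + CP + \sum_(j < M) `|A j| * (p j).2 * cj j), (Num.max 0 (- ln q)).
split; first by rewrite le_max lexx.
move=> l; rewrite ge_max => /andP[l0 lq].
have t0 : 0 <= tau l by rewrite /tau; lra.
have L0 : 0 <= Lof l by exact: log_mod_ge0.
have xL : expR (Lof l) = xof l by exact: expR_log_mod.
set X := expR (expR (tau l)).
have hv j : exists v : R, rgamma_int kap (j%:R - vt) s1 (tau l) = v%:E /\
    X - (p j).2 * expR ((p j).1%:R * tau l) <= v <= X.
  have [_ h] := hp j; have [h1 h2] := h _ t0.
  by have [v vE vb] := fin_between h1 h2; exists v.
have [v hv'] := choice hv.
have [P1' P2'] := hP _ L0; have [vP vPE /andP[_ vPle]] := fin_between P1' P2'; rewrite xL in vPle.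
have [J1 J2] := hJ _ L0; rewrite xL in J1 J2.
have J0 : (0%:E <= rgamma_incgamma_int sigma delta0 s1 (Lof l))%E.
  by apply: integral_ge0 => x _; rewrite lee_fin !mulr_ge0 ?expR_ge0 ?(incgamma_ge0 sigma01).
have [vJ vJE /andP[_ vJle]] := fin_between J0 J1.
rewrite vJE -EFinD lee_fin in J2.
pose g (j : nat) (s : R) := kap * expR ((kap * s + (j%:R - vt)) * tau l) * `|rgamma (kap * s + (j%:R - vt) + 1)|.
pose pP (s : R) := 1 * expR ((1 * s + 0) * Lof l) * `|rgamma (1 * s + 0 + 1)|.
pose cM := C * expR ((vt - M%:R) * tau l).
have cM0 : 0 <= cM by rewrite mulr_ge0 ?expR_ge0.
have g0 j s : 0 <= g j s by rewrite mulr_ge0// mulr_ge0 ?expR_ge0 ?(ltW kap0).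
have pP0 s : 0 <= pP s by rewrite mulr_ge0// mulr_ge0 ?expR_ge0.
have mg j : measurable_fun [set: R] (g j) by exact: (measurable_rgamma_int sigma01).
have mp : measurable_fun [set: R] pP by exact: (measurable_rgamma_int sigma01).
have key : `|vJ - \sum_(j < M) A j * expR ((vt - j%:R) * tau l) * v j| <= cM * v M + vP.
  apply: (@signed_integral _ _ R mu M (fun s => `|rgamma (s + 1)| * expR (s * Lof l) * gi 0 (sigma * s + delta0) 0)
    (fun s => cM * g M s + pP s) g (fun j => A j * expR ((vt - j%:R) * tau l)) `[s1, +oo[ vJ _ v).
  - exact: measurable_itv.
  - apply: measurable_funTS; apply: measurable_funM; last exact: (measurable_incgamma sigma01).
    apply: measurable_funM.
      apply: measurableT_comp => //; apply: measurableT_comp; first exact: (measurable_rgamma sigma01).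
      exact: measurable_funD.
    apply: measurableT_comp; first exact: measurable_expR.
    exact: measurable_funM.
  - by move=> j; exact: measurable_funTS (mg j).
  - apply: measurable_funTS; apply: measurable_funD; last exact: mp.
    by apply: measurable_funM; [exact: measurable_cst|exact: mg].
  - by move=> s _; rewrite !mulr_ge0 ?expR_ge0 ?(incgamma_ge0 sigma01).
  - by move=> j s _ _; exact: g0.
  - move=> s; rewrite /= in_itv /= andbT => ss.
    have s0' : 0 <= s by apply: le_trans ss; lra.
    have gE j : expR ((vt - j%:R) * tau l) * g j s =
       kap * (hsig sigma * kap `^ kap) `^ s * rgamma (kap * s + 1 - vt + j%:R) * expR (s * Lof l).
      have -> : kap * (hsig sigma * kap `^ kap) `^ s * rgamma (kap * s + 1 - vt + j%:R) * expR (s * Lof l) =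
        kap * rgamma (kap * s + 1 - vt + j%:R) * ((hsig sigma * kap `^ kap) `^ s * expR (s * Lof l)) by ring.
      rewrite scale_shift /g.
      have -> : kap * s + (j%:R - vt) + 1 = kap * s + 1 - vt + j%:R by ring.
      rewrite ger0_norm; last first.
        apply: (rgamma_ge0 sigma01); have : kap * s1 <= kap * s by rewrite ler_wpM2l// ltW.
        by have : 0 <= (j%:R : R) by []; lra.
      have -> : kap * s * tau l = (vt - j%:R) * tau l + (kap * s + (j%:R - vt)) * tau l by ring.
      by rewrite expRD; ring.
    have r1 : 0 <= rgamma (s + 1) :> R by rewrite (rgamma_ge0 sigma01)// addr_ge0.
    have := hpt s (le_trans ssa ss); rewrite -(ler_pM2l (expR_gt0 (s * Lof l))).
    rewrite -{1}(ger0_norm (expR_ge0 (s * Lof l))) -normrM.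
    have -> : expR (s * Lof l) * (rgamma (s + 1) * gi 0 (sigma * s + delta0) 0 -
       kap * (hsig sigma * kap `^ kap) `^ s * \sum_(j < M) A j * rgamma (kap * s + 1 - vt + j%:R)) =
       `|rgamma (s + 1)| * expR (s * Lof l) * gi 0 (sigma * s + delta0) 0 -
       \sum_(j < M) A j * expR ((vt - j%:R) * tau l) * g j s.
      rewrite (ger0_norm r1) mulrBr; congr (_ - _); first by ring.
      rewrite !mulr_sumr; apply: eq_bigr => j _.
      by rewrite -[RHS]mulrA gE; ring.
    move=> /le_trans; apply.
    have -> : pP s = expR (s * Lof l) * rgamma (s + 1) by rewrite /pP !mul1r !addr0 ger0_norm.
    have -> : cM * g M s = C * (expR ((vt - M%:R) * tau l) * g M s) by rewrite /cM -(mulrA C).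
    rewrite gE.
    by rewrite le_eqVlt; apply/orP; left; apply/eqP; ring.
  - exact: vJE.
  - by move=> j _; have [+ _] := hv' j.
  - have [vM _] := hv' M.
    transitivity (\int[mu]_(s in `[s1, +oo[) ((cM%:E * (g M s)%:E) + (pP s)%:E))%E.
      by apply: eq_integral => s _; rewrite EFinD EFinM.
    rewrite ge0_integralD//.
    + rewrite EFinD; congr (_ + _)%E; last exact: vPE.
      rewrite ge0_integralZl_EFin//; last by apply/measurable_EFinP; exact: measurable_funTS (mg M).
      transitivity (cM%:E * rgamma_int kap (M%:R - vt) s1 (tau l))%E; first by [].
      - by rewrite vM -EFinM.
      - by move=> s _; rewrite lee_fin.
    + by move=> s _; rewrite -EFinM lee_fin mulr_ge0.
    + by apply: measurable_funeM; apply/measurable_EFinP; exact: measurable_funTS (mg M).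
    + by move=> s _; rewrite lee_fin.
    + by apply/measurable_EFinP; exact: measurable_funTS mp.
set G := gi (xof l) delta0 0 in J1 J2 vJle *.
have e1 : `|G - vJ| <= DJ * CJ * big M l.
  rewrite ger0_norm ?subr_ge0// -mulrA; apply: le_trans (_ : DJ * expR (nJ%:R * Lof l) <= _).
    by rewrite lerBlDl.
  rewrite ler_wpM2l//; have [h1 _] := hCJ l l0; apply: le_trans h1.
  by rewrite ler_expR /log_mod -/kap le_eqVlt; apply/orP; left; apply/eqP; ring.
have e2 : cM * v M + vP <= (C + CP) * big M l.
  rewrite mulrDl; apply: lerD.
    have [_ /andP[_ vM]] := hv' M.
    by rewrite /cM /big -mulrA ler_wpM2l// ler_wpM2l ?expR_ge0.
  apply: le_trans vPle _; have [_ h1] := hCP l l0; apply: le_trans h1.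
  by rewrite mul0r !add0r.
have e3 : `|\sum_(j < M) A j * expR ((vt - j%:R) * tau l) * v j -
    \sum_(j < M) A j * expR ((vt - j%:R) * tau l) * X| <= (\sum_(j < M) `|A j| * (p j).2 * cj j) * big M l.
  rewrite -sumrB mulr_suml; apply: le_trans (ler_norm_sum _ _ _) _; apply: ler_sum => j _.
  rewrite -mulrBr !normrM (ger0_norm (expR_ge0 _)) -!mulrA ler_wpM2l//.
  have [_ /andP[v1 v2]] := hv' j; rewrite ler0_norm ?subr_le0// opprB.
  apply: le_trans (_ : expR ((vt - j%:R) * tau l) * ((p j).2 * expR ((p j).1%:R * tau l)) <= _).
    by rewrite ler_wpM2l ?expR_ge0//; move: v1; lra.
  rewrite mulrCA ler_wpM2l//; first by have [] := hp j.
  by have [_] := hcj j; apply.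
have -> : G - \sum_(j < M) A j * expR ((vt - j%:R) * tau l) * X = (G - vJ) +
   (vJ - \sum_(j < M) A j * expR ((vt - j%:R) * tau l) * v j) +
   (\sum_(j < M) A j * expR ((vt - j%:R) * tau l) * v j -
    \sum_(j < M) A j * expR ((vt - j%:R) * tau l) * X) by ring.
apply: le_trans (ler_normD _ _) _; apply: le_trans (lerD (ler_normD _ _) (lexx _)) _.
apply: le_trans (lerD (lerD e1 (le_trans key e2)) e3) _.
by rewrite -!mulrDl !addrA.
Qed.

(** The same real integral is expanded by Laplace's method and by [incgamma_asymp]; divided by X
    e^(vt l), where now X stands for the exponential of q e^l, both are polynomials in e^(- l) with
    error e^(- M l), so their coefficients agree. *)
Theorem saddle_coef alpha M : (0 < M)%N ->
  (exists2 C, 0 <= C & forall l, 1 <= l ->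
    cmod (lupn l 0 - ce (lamX l 0) * saddle_sum alpha M l 0) <=
    C * (cmod (ce (lamX l 0)) * expR (- (l / 2)) ^+ M.*2.+1)) ->
  forall i, (i < M)%N -> alpha i = A i * expR ((vt - i%:R) * ln q).
Proof.
move=> M0 [Cs Cs0 hs] i iM.
have [C [l0 [l00 hG]]] := incgamma_asymp M0.
have [Cn Cn0 hn] := negligible M 0 1.
pose d j := alpha j - A j * expR ((vt - j%:R) * ln q).
pose c0 := expR ((vt - M%:R) * ln q).
suff : d i = 0 by move=> /eqP; rewrite subr_eq0 => /eqP.
apply: (@exp_poly_zero R M d (Cs + (pi * Cn + C) * c0) (Num.max l0 1)) => // l.
rewrite ge_max => /andP[ll l1]; have lp : 0 <= l by lra.
have h1 := hG l ll; have h2 := hs l l1; have h3 := saddle_lup0 lp.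
set X := expR (expR (tau l)) in h1.
have XE : cmod (ce (lamX l 0)) = X by rewrite cmod_saddle_exp mulr0 cos0 mulr1 /X expR_tau mulrC.
have X0 : 0 < X by exact: expR_gt0.
have lamE : ce (lamX l 0) = X%:C.
  rewrite /saddle_exp mulr0 expi0 mulr1 -rmorphM cexp_real /X expR_tau.
  by congr (expR _)%:C; rewrite mulrC.
have sumE : saddle_sum alpha M l 0 = (\sum_(j < M) alpha j * expR (- (l / 2)) ^+ j.*2.+1)%:C.
  rewrite /saddle_sum rmorph_sum; apply: eq_bigr => j _.
  by rewrite oppr0 expi0 expr1n mulr1.
rewrite XE lamE sumE -rmorphM /= in h2.
set S := \sum_(j < M) _ in h2; set G := gi (xof l) delta0 0 in h1 h3.
set e := expR (- (delta0 * l)) in h3.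
have h4 : `|e * G - X * S| <= Cs * (X * expR (- (l / 2)) ^+ M.*2.+1) + e * (pi * expR (1 + xof l)).
  have E : (e * G - X * S)%:C = (lupn l 0 - (X * S)%:C) - (lupn l 0 - (e * G)%:C).
    by rewrite rmorphB; set u := lupn l 0; ring.
  rewrite -cmod_real E.
  by apply: le_trans (cmodB _ _) _; apply: lerD.
have e0 : 0 < e by exact: expR_gt0.
(* Since vt = delta - 1/2, the half-integer power (2 k + 1) / 2 of e^(- l) splits into e^(- delta l)
   e^(vt l) and the integer power k. *)
have powE k : expR (- (l / 2)) ^+ k.*2.+1 = e * expR (vt * l) * expR (- (k%:R * l)).
  rewrite -expRM_natl /e -!expRD; congr expR; rewrite -natr1 -mul2n natrM /vt /vartheta -/delta0.
  by field.
have SE : S = e * expR (vt * l) * \sum_(j < M) alpha j * expR (- (j%:R * l)).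
  by rewrite /S mulr_sumr; apply: eq_bigr => j _; rewrite powE; ring.
have AE : \sum_(j < M) A j * expR ((vt - j%:R) * tau l) * X =
   X * expR (vt * l) * \sum_(j < M) (A j * expR ((vt - j%:R) * ln q)) * expR (- (j%:R * l)).
  rewrite mulr_sumr; apply: eq_bigr => j _.
  have -> : expR ((vt - j%:R) * tau l) = expR ((vt - j%:R) * ln q) * expR (vt * l) * expR (- (j%:R * l)).
    by rewrite -!expRD /tau; congr expR; ring.
  by ring.
rewrite AE in h1; have v0 : 0 < expR (vt * l) by exact: expR_gt0.
have bigE : big M l = X * expR (vt * l) * (c0 * expR (- (M%:R * l))).
  rewrite /big -/X mulrC -!mulrA; congr (_ * _); rewrite /c0 -!expRD /tau; congr expR; ring.
have h5 : pi * expR (1 + xof l) <= pi * Cn * big M l.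
  rewrite -mulrA ler_wpM2l ?pi_ge0//; have [_] := hn l lp.
  by rewrite mul0r add0r.
have XV : 0 < X * expR (vt * l) by exact: mulr_gt0.
rewrite -(ler_pM2l XV) -{1}(gtr0_norm XV) -normrM.
have -> : X * expR (vt * l) * \sum_(j < M) d j * expR (- (j%:R * l)) =
   (G - X * expR (vt * l) * \sum_(j < M) (A j * expR ((vt - j%:R) * ln q)) * expR (- (j%:R * l)))
   - e^-1 * (e * G - X * S).
  have -> : \sum_(j < M) d j * expR (- (j%:R * l)) = \sum_(j < M) alpha j * expR (- (j%:R * l)) -
     \sum_(j < M) (A j * expR ((vt - j%:R) * ln q)) * expR (- (j%:R * l)).
    by rewrite -sumrB; apply: eq_bigr => j _; rewrite /d mulrBl.
  by rewrite SE; field; rewrite gt_eqF.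
apply: le_trans (ler_normB _ _) _; rewrite normrM (gtr0_norm (_ : 0 < e^-1)) ?invr_gt0//.
have h6 : e^-1 * `|e * G - X * S| <= Cs * (X * expR (vt * l) * expR (- (M%:R * l))) + pi * Cn * big M l.
  apply: le_trans (ler_wpM2l _ h4) _; first by rewrite invr_ge0 ltW.
  rewrite mulrDr mulKf ?gt_eqF// powE; apply: lerD => //.
  by rewrite le_eqVlt; apply/orP; left; apply/eqP; field; rewrite gt_eqF.
apply: le_trans (lerD h1 h6) _; rewrite bigE le_eqVlt; apply/orP; left; apply/eqP; ring.
Qed.

End Identification.

(** * The compound expansion *)

Section Symmetry.
Context {R : realType}.
Implicit Types (w a b : R) (n r : nat).

(** The last half of the directions is the reflection of the first, and for odd n the middle one is
    omega = 0, the source of the Delta_n terms. *)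
Lemma omega_sum (V : nmodType) n (g : R -> V) :
  \sum_(r < n) g (omega R n r) = \sum_(0 <= r < n./2) g (- omega R n r) +
    \sum_(0 <= r < n./2) g (omega R n r) + (if odd n then g 0 else 0).
Proof.
rewrite -(big_mkord xpredT (fun r => g (omega R n r))).
set h := n./2; have nE : n = (odd n + h.*2)%N by rewrite odd_double_half.
have hn : (h <= n)%N by rewrite nE -addnn addnA leq_addl.
have hnh : (h <= n - h)%N by rewrite leq_subRL// [X in (_ <= X)%N]nE -addnn leq_addl.
rewrite (@big_cat_nat _ _ _ h)//= (@big_cat_nat _ _ _ (n - h) h n)//= ?leq_subr//.
rewrite addrC -addrA [RHS]addrC; congr (_ + _); last first.
  congr (_ + _).
  have E (F : nat -> V) : \sum_(n - h <= i < n) F i = \sum_(0 <= i < h) F (i + (n - h))%N.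
    by have := @big_addn V 0 +%R 0 n (n - h) xpredT F; rewrite add0n subKn.
  rewrite E big_nat_rev /= add0n !big_nat; apply: eq_bigr => r /andP[_ rh].
  have rn : (r < n)%N by exact: leq_trans hn.
  congr g; rewrite /omega.
  have -> : (h - r.+1 + (n - h) = n - r.+1)%N by rewrite addnC addnBA// subnK.
  rewrite natrB//; have n0 : (n%:R : R) != 0 by rewrite pnatr_eq0 -lt0n (leq_ltn_trans _ rn).
  by rewrite -natr1; generalize (@pi R) => q; field.
case: ifP => on; last first.
  by rewrite big_geq// [X in (X - _)%N]nE on add0n -addnn addnK.
have nh : (n - h = h.+1)%N by rewrite [X in (X - _)%N]nE on -addnn add1n -addSn addnK.
rewrite nh big_nat1; congr g; rewrite /omega [in n%:R - _]nE on -addnn add1n -natr1 natrD.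
by rewrite (_ : _ - _ - 1 = 0) ?mul0r//; ring.
Qed.

End Symmetry.

Section Terms.
Context {R : realType}.
Variables (sigma mu0 : R) (A : nat -> R).
Hypothesis sigma01 : 0 < sigma < 1.
Implicit Types (w l x : R) (n M : nat) (p : R * R).

Let kap : R := 1 - sigma.
Let kap0 : 0 < kap := kap_gt0 sigma01.
Let s0 : 0 < sigma := sig0 sigma01.
Let delta0 : R := delta mu0.
Let vt : R := vartheta mu0.
Let q : R := kap / sigma.
Let q0 : 0 < q. Proof. exact: divr_gt0. Qed.
Notation xof := (saddle_mod sigma).

(* The pairs (phi, Phi) of the exponential expansion are, up to the sign of both components,
   those attached to the directions w = omega_r, 0 <= r < n. *)
Definition phi_Phi w : R * R := (w + pi * sigma, w * (1 + vt / kap) + pi * vt / kap).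

Lemma exp_terms_sum (V : nmodType) n (G : R * R -> V) : (forall a b, G (- a, - b) = G (a, b)) ->
  \sum_(p <- exp_terms n sigma mu0) G p = \sum_(r < n) G (phi_Phi (omega R n r)).
Proof.
move=> Gs; rewrite /exp_terms !big_cat /= !big_map.
rewrite (omega_sum n (fun w => G (phi_Phi w))) addrA; congr (_ + _); last first.
  case: (odd n); last by rewrite big_nil.
  by rewrite big_seq1 /phi_Phi add0r mul0r add0r.
rewrite /index_iota subn0; congr (_ + _); apply: eq_bigr => r _.
  by congr G; rewrite /phi /Phi /phi_Phi /kappa -/kap -/vt; congr (_, _); ring.
rewrite -[RHS]Gs; congr G; rewrite /phi /Phi /phi_Phi /kappa -/kap -/vt; congr (_, _); ring.
Qed.

Definition kept p : bool := `|p.1| <= pi * kap / 2.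

Lemma retained_sum (V : nmodType) n (G : R * R -> V) : (forall a b, G (- a, - b) = G (a, b)) ->
  \sum_(p <- retained n sigma mu0) G p =
  \sum_(r < n | kept (phi_Phi (omega R n r))) G (phi_Phi (omega R n r)).
Proof.
move=> Gs; rewrite /retained big_filter big_mkcond /= [RHS]big_mkcond /=.
pose G' p := if `|p.1| <= pi * kappa sigma / 2 then G p else 0.
have Gs' a b : G' (- a, - b) = G' (a, b) by rewrite /G' /= normrN Gs.
exact: (exp_terms_sum n Gs').
Qed.

Definition exp_term_trunc M l p : R := Re (exp_factor sigma p (xof l) * S_trunc sigma A M (Xvar sigma (xof l)) p.1).

Lemma Xvar_saddle_mod l : Xvar sigma (xof l) = q * expR l.
Proof.
have hs : hsig sigma = expR (sigma * ln sigma) by rewrite /hsig /powR gt_eqF.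
have xE : xof l = expR (kap * l - ln sigma) by rewrite expRB lnK ?posrE.
rewrite /Xvar hs xE -expRD /powR gt_eqF ?expR_gt0// expRK /kappa -/kap /q -mulrA; congr (_ * _).
have -> : 1 / kap * (sigma * ln sigma + (kap * l - ln sigma)) = l - ln sigma.
  by have -> : sigma = 1 - kap; [rewrite /kap; ring|field; rewrite gt_eqF].
by rewrite expRB lnK ?posrE// mulrC.
Qed.

Lemma exp_factorE l a b : exp_factor sigma (a, b) (xof l) =
  ce ((q * expR l)%:C * expi (a / kap)) * expi b.
Proof. by rewrite /exp_factor Xvar_saddle_mod -ceE cexpD cexp_im. Qed.

Lemma exp_factorJ l a b : exp_factor sigma (- a, - b) (xof l) = conjc (exp_factor sigma (a, b) (xof l)).
Proof. by rewrite !exp_factorE conjM -cexpJ conjM conjc_real -!expiN -mulNr. Qed.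

Lemma S_truncJ M X a : S_trunc sigma A M X (- a) = conjc (S_trunc sigma A M X a).
Proof.
rewrite /S_trunc (big_morph _ (@conjD R) (conjc0 R)); apply: eq_bigr => j _.
rewrite conjM conjc_real; congr (_ * _).
have -> : X%:C * expi (- a / kappa sigma) = conjc (X%:C * expi (a / kappa sigma)).
  by rewrite conjM conjc_real -expiN -mulNr.
by rewrite fmorphV rmorphXn.
Qed.

Lemma exp_term_truncN M l a b : exp_term_trunc M l (- a, - b) = exp_term_trunc M l (a, b).
Proof. by rewrite /exp_term_trunc exp_factorJ [(- a, - b).1]/(- a) S_truncJ -conjM ReJ. Qed.

Definition exp_term_mod M l p : R := expR ((vt - M%:R) * (l + ln q)) * cmod (exp_factor sigma p (xof l)).

Lemma X_pow l c : (q * expR l) `^ c = expR (c * (l + ln q)).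
Proof.
have -> : q * expR l = expR (l + ln q) by rewrite expRD lnK ?posrE// mulrC.
by rewrite /powR gt_eqF ?expR_gt0// expRK.
Qed.

Lemma E_truncE n M l : E_trunc n sigma mu0 A M (xof l) = expR (vt * (l + ln q)) / pi *
  \sum_(r < n | kept (phi_Phi (omega R n r))) exp_term_trunc M l (phi_Phi (omega R n r)).
Proof.
rewrite /E_trunc Xvar_saddle_mod X_pow -/vt; congr (_ * _).
have -> : Re (\sum_(p <- retained n sigma mu0) exp_factor sigma p (xof l) *
    S_trunc sigma A M (q * expR l) p.1) = \sum_(p <- retained n sigma mu0) exp_term_trunc M l p.
  by rewrite Re_sum; apply: eq_bigr => p _; rewrite /exp_term_trunc Xvar_saddle_mod.
by rewrite (retained_sum n (@exp_term_truncN M l)).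
Qed.

Lemma E_errorE n M l : E_error n sigma mu0 M (xof l) =
  \sum_(r < n | kept (phi_Phi (omega R n r))) exp_term_mod M l (phi_Phi (omega R n r)).
Proof.
rewrite /E_error; have -> : \sum_(p <- retained n sigma mu0)
    Xvar sigma (xof l) `^ (vartheta mu0 - M%:R) * cmod (exp_factor sigma p (xof l)) =
    \sum_(p <- retained n sigma mu0) exp_term_mod M l p.
  by apply: eq_bigr => p _; rewrite Xvar_saddle_mod X_pow.
have MS a b : exp_term_mod M l (- a, - b) = exp_term_mod M l (a, b) by rewrite /exp_term_mod exp_factorJ cmodJ.
exact: (retained_sum n MS).
Qed.

(** The b that solves [saddle_arg] b = w; |b| = pi / 4 is the boundary of retention. *)
Definition saddle_dir w : R := (w + pi * sigma) / (2 * kap).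

Definition saddle_main alpha M l b : R[i] :=
  ce (delta0%:C * saddle_base l b) * (ce (saddle_exp sigma l b) * saddle_sum alpha M l b).

Lemma saddle_expE l w : saddle_exp sigma l (saddle_dir w) = (q * expR l)%:C * expi ((phi_Phi w).1 / kap).
Proof.
rewrite /saddle_exp -mulrA [expi _ * _]mulrC mulrA -rmorphM [expR l * _]mulrC; congr (_ * expi _).
by rewrite /saddle_dir /=; field; rewrite gt_eqF.
Qed.

Lemma cmod_saddle_exp_dir l w : cmod (ce (saddle_exp sigma l (saddle_dir w))) = cmod (exp_factor sigma (phi_Phi w) (xof l)).
Proof. by rewrite saddle_expE [phi_Phi w]surjective_pairing exp_factorE cmodM cmod_expi mulr1. Qed.

(** Collecting phases, w + delta (pi + 2 b) - b = Phi + pi / 2: the quarter turn changes the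
    imaginary part into the real part of the expansion. In the modulus, delta l - l / 2 = vt l; the
    factors q^(vt - i) in [alpha] complete e^l to X. *)
Lemma Im_saddle_main alpha M l w : (forall i, (i < M)%N -> alpha i = A i * expR ((vt - i%:R) * ln q)) ->
  Im (expi w * saddle_main alpha M l (saddle_dir w)) = expR (vt * (l + ln q)) * exp_term_trunc M l (phi_Phi w).
Proof.
move=> ha; set b := saddle_dir w; set t := l + ln q.
have SE : saddle_sum alpha M l b = (expR (- (l / 2) - vt * l + vt * t))%:C * expi (- b) *
    S_trunc sigma A M (Xvar sigma (xof l)) (phi_Phi w).1.
  rewrite /saddle_sum /S_trunc mulr_sumr; apply: eq_bigr => i _.
  rewrite ha// Xvar_saddle_mod.
  have -> : ((q * expR l)%:C * expi ((phi_Phi w).1 / kappa sigma)) ^- i =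
     (expR (- (i%:R * t)))%:C * expi (- (i%:R * (2 * b))).
    have -> : q * expR l = expR t by rewrite /t expRD lnK ?posrE// mulrC.
    rewrite exprMn invfM -rmorphXn -expRM_natl -fmorphV -expRN expiX expiVN; congr (_ * expi (- (_ * _))).
    by rewrite /b /saddle_dir /kappa -/kap /=; generalize (@pi R) => pp; field; rewrite gt_eqF.
  rewrite expiX -expRM_natl.
  have -> : expi (i.*2.+1%:R * - b) = expi (- b) * expi (- (i%:R * (2 * b))) :> R[i].
    by rewrite -expiD; congr expi; rewrite -natr1 -mul2n natrM; ring.
  have -> : (A i * expR ((vt - i%:R) * ln q) * expR (i.*2.+1%:R * - (l / 2)))%:C =
    (A i)%:C * (expR (- (l / 2) - vt * l + vt * t))%:C * (expR (- (i%:R * t)))%:C :> R[i].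
    rewrite -!rmorphM -!mulrA -!expRD; congr (_ * expR _)%:C.
    by rewrite /t -natr1 -mul2n natrM; field.
  by ring.
rewrite /saddle_main SE saddle_expE /exp_term_trunc [in exp_factor _ _ _](surjective_pairing (phi_Phi w)) exp_factorE.
set S := S_trunc _ _ _ _ _; set X := ce (_ * expi ((phi_Phi w).1 / kap)).
have -> : ce (delta0%:C * saddle_base l b) = (expR (delta0 * l))%:C * expi (delta0 * (pi + 2 * b)).
  by rewrite -ceLw; congr ce; apply: complex_ext; rewrite ?(ReZ delta0) ?(ImZ delta0).
have -> : expi w * ((expR (delta0 * l))%:C * expi (delta0 * (pi + 2 * b)) *
    (X * ((expR (- (l / 2) - vt * l + vt * t))%:C * expi (- b) * S))) =
  (expR (delta0 * l) * expR (- (l / 2) - vt * l + vt * t))%:C *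
  ((expi w * expi (delta0 * (pi + 2 * b)) * expi (- b)) * (X * S)).
  by rewrite rmorphM; ring.
rewrite -!expiD -expRD.
have -> : w + delta0 * (pi + 2 * b) - b = (phi_Phi w).2 + pi / 2.
  rewrite /= (_ : delta0 = vt + 1 / 2); last by rewrite /vt /vartheta -/delta0; ring.
  rewrite /b /saddle_dir; have k0 : kap != 0 by rewrite gt_eqF.
  have -> : sigma = 1 - kap by rewrite /kap; ring.
  by generalize (@pi R) => pp; field.
rewrite expiD expi_pihalf (ImZ (expR _)); congr (_ * _).
  congr expR; rewrite (_ : delta0 = vt + 1 / 2); last by rewrite /vt /vartheta -/delta0; ring.
  by field.
have -> : expi (phi_Phi w).2 * 'i * (X * S) = 'i * (X * expi (phi_Phi w).2 * S) by ring.
by rewrite ImM /= mul0r mul1r add0r.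
Qed.

End Terms.

Section Assembly.
Context {R : realType}.
Variables (sigma mu0 : R) (A : nat -> R).
Hypothesis sigma01 : 0 < sigma < 1.
Implicit Types (w l x c : R) (n M m : nat) (p : R * R).

Let kap : R := 1 - sigma.
Let kap0 : 0 < kap := kap_gt0 sigma01.
Let s0 : 0 < sigma := sig0 sigma01.
Let delta0 : R := delta mu0.
Let vt : R := vartheta mu0.
Let q : R := kap / sigma.
Let q0 : 0 < q. Proof. exact: divr_gt0. Qed.
Notation xof := (saddle_mod sigma).
Notation Lof := (log_mod sigma).
Notation bof := (saddle_dir sigma).
Notation KK k := ((k%:R + delta0) / sigma).
Notation pr w := (phi_Phi sigma mu0 w).

Lemma saddle_dirK w : saddle_arg sigma (bof w) = w.
Proof.
rewrite /saddle_arg /bof -/kap; generalize (@pi R) => pp; field.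
by rewrite gt_eqF.
Qed.

Lemma omega_bound n r : (r < n)%N -> - (pi / 2) < omega R n r < pi / 2.
Proof.
move=> rn; have n0 : (0 : R) < n%:R by rewrite ltr0n (leq_ltn_trans _ rn).
have r1 : r.+1%:R <= n%:R :> R by rewrite ler_nat.
rewrite -natr1 in r1; have r0 : 0 <= r%:R :> R by [].
have -> : omega R n r = (n%:R - 2 * r%:R - 1) / n%:R * (pi / 2).
  by rewrite /omega; generalize (@pi R) => pp; field; rewrite gt_eqF.
have p0 : (0 : R) < pi / 2 by rewrite divr_gt0// pi_gt0.
apply/andP; split; first by rewrite -(mulN1r (pi / 2)) ltr_pM2r// ltr_pdivlMr//; lra.
by rewrite -[ltRHS](mul1r (pi / 2)) ltr_pM2r// ltr_pdivrMr//; lra.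
Qed.

Lemma omega_ge n r : (r < n)%N -> omega R n n.-1 <= omega R n r.
Proof.
case: n => // n rn; rewrite /omega /= ler_pM2r; last by rewrite invr_gt0 mulr_gt0.
rewrite ler_pM2r ?pi_gt0// lerB// lerB// ler_pM2l// ler_nat.
by rewrite -ltnS.
Qed.

Lemma lup_saddle_lup l b : lup sigma 1 (xof l) (saddle_arg sigma b) delta0 =
  ce (delta0%:C * saddle_base l b) * saddle_lup sigma delta0 l b.
Proof. by rewrite /saddle_lup mulrA -cexpD subrr cexp0 mul1r. Qed.

Lemma cmod_saddle_base l b : cmod (ce (delta0%:C * saddle_base l b)) = expR (delta0 * l).
Proof. by rewrite cmod_cexp ReZ. Qed.

Lemma exp_term_modE M l w : exp_term_mod sigma mu0 M l (pr w) =
  expR ((vt - M%:R) * (l + ln q)) * expR (expR l * (q * cos ((w + pi * sigma) / kap))).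
Proof.
rewrite /exp_term_mod -(cmod_saddle_exp_dir mu0 sigma01) cmod_saddle_exp; congr (_ * expR (_ * (_ * cos _))).
by rewrite /bof -/kap; generalize (@pi R) => pp; field; rewrite gt_eqF.
Qed.

Lemma exp_term_mod_scale M l w : expR (delta0 * l) * cmod (ce (saddle_exp sigma l (bof w))) * expR (- (l / 2)) ^+ M.*2.+1 =
  expR (- ((vt - M%:R) * ln q)) * exp_term_mod sigma mu0 M l (pr w).
Proof.
rewrite /exp_term_mod -(cmod_saddle_exp_dir mu0 sigma01) mulrA -expRD -expRM_natl mulrAC -expRD; congr (expR _ * _).
rewrite -natr1 -mul2n natrM -/vt -/kap -/q (_ : delta0 = vt + 1 / 2); last by rewrite /vt /vartheta -/delta0; ring.
by field.
Qed.

Lemma saddle_sum_le (alpha : nat -> R) M l b : 0 <= l ->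
  cmod (saddle_sum alpha M l b) <= \sum_(i < M) `|alpha i|.
Proof.
move=> l0; apply: le_trans (cmod_sum _ _ _) _; apply: ler_sum => i _.
rewrite cmodM cmodX cmod_expi expr1n mulr1 cmod_real normrM; apply: ler_piMr => //; rewrite ger0_norm ?exprn_ge0 ?expR_ge0// exprn_ile1 ?expR_ge0//.
by rewrite -[leRHS]expR0 ler_expR; lra.
Qed.

Lemma saddle_main_le alpha M l b : 0 <= l -> cmod (saddle_main sigma mu0 alpha M l b) <=
  (\sum_(i < M) `|alpha i|) * (expR (delta0 * l) * cmod (ce (saddle_exp sigma l b))).
Proof.
move=> l0; rewrite /saddle_main !cmodM cmod_saddle_base mulrA mulrC.
by apply: ler_wpM2r; [rewrite mulr_ge0 ?expR_ge0 ?cmod_ge0|exact: saddle_sum_le].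
Qed.

Section Expansion.
Variables (n M : nat).
Hypotheses (n0 : (0 < n)%N) (M0 : (0 < M)%N).
Hypothesis hA : inverse_factorial_coef sigma mu0 A.

Notation w_ r := (omega R n r).
Let tmin : R := w_ n.-1 + pi * sigma.
Let wlast : w_ n.-1 < pi / 2 /\ - (pi / 2) < w_ n.-1.
Proof. by have /andP[] : - (pi / 2) < w_ n.-1 < pi / 2 by apply: omega_bound; rewrite prednK. Qed.
Notation keep r := (kept sigma (pr (w_ r))).
Notation err l := (E_error n sigma mu0 M (xof l)).

Lemma keptE r : (r < n)%N -> keep r = (w_ r + pi * sigma <= pi * kap / 2).
Proof.
move=> rn; have /andP[h1 h2] := omega_bound rn.
rewrite /kept /= ler_norml -/kap; case: leP => //= h; exfalso.
have ps : 0 < pi * sigma by rewrite mulr_gt0 ?pi_gt0.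
by move: h; rewrite /kap mulrBr mulr1; lra.
Qed.

Lemma err_ge r l : (r < n)%N -> keep r -> exp_term_mod sigma mu0 M l (pr (w_ r)) <= err l.
Proof.
move=> rn kr; rewrite E_errorE// (bigD1 (Ordinal rn))//= lerDl sumr_ge0// => i _.
by rewrite mulr_ge0 ?expR_ge0 ?cmod_ge0.
Qed.

Lemma err_ge0 l : 0 <= err l.
Proof. by rewrite E_errorE// sumr_ge0// => i _; rewrite mulr_ge0 ?expR_ge0 ?cmod_ge0. Qed.

Lemma Fsum_E_H l m : Fsum n sigma mu0 (xof l) - (E_trunc n sigma mu0 A M (xof l) + H_trunc n sigma mu0 m (xof l)) =
  (Im (\sum_(r < n) expi (w_ r) * lup sigma 1 (xof l) (w_ r) delta0) -
   \sum_(r < n | keep r) expR (vt * (l + ln q)) * exp_term_trunc sigma A M l (pr (w_ r))) / pi - H_trunc n sigma mu0 m (xof l).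
Proof.
rewrite (Fsum_lup sigma01)// ?saddle_mod_ge0// E_truncE// -mulr_sumr.
by rewrite -/vt -/kap -/q; set I := Im _; set S := \sum_(_ < _ | _) _; set H := H_trunc _ _ _ _ _; ring.
Qed.

Lemma H_truncE l m : H_trunc n sigma mu0 m (xof l) = sigma^-1 * \sum_(k < m)
  expR (- (KK k * Lof l)) / k`!%:R * rgamma (1 - KK k) * theta n sigma mu0 k.
Proof.
rewrite /H_trunc; congr (_ * _); apply: eq_bigr => k _; congr (_ / _ * _ * _).
by rewrite -expR_log_mod// /powR gt_eqF ?expR_gt0// expRK mulNr.
Qed.

(** Summed over the directions, e^(i (1 - K) omega_r) is real and equals [theta], while Hankel's
    formula at K gives 1 / Gamma(1 - K). *)
Lemma Im_algT l m : Im (\sum_(r < n) expi (w_ r) * algT sigma delta0 m (Lof l) (w_ r)) / pi =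
  H_trunc n sigma mu0 m (xof l).
Proof.
rewrite H_truncE mulr_sumr.
have -> : \sum_(r < n) expi (w_ r) * algT sigma delta0 m (Lof l) (w_ r) =
    \sum_(k < m) (\sum_(r < n) expi ((1 - KK k) * w_ r)) *
      (((k`!%:R * sigma)^-1 * expR (- (KK k * Lof l)))%:C * lup sigma 1 0 0 (KK k)).
  under eq_bigr => r _ do rewrite /algT mulr_sumr.
  rewrite exchange_big; apply: eq_bigr => k _; rewrite mulr_suml; apply: eq_bigr => r _.
  rewrite /alg_coef.
  have -> : - (KK k)%:C * (Lof l +i* w_ r) = (- (KK k * Lof l)) +i* (- (KK k * w_ r)).
    by rewrite -rmorphN; apply: complex_ext; rewrite ?(ReZ (- _)) ?(ImZ (- _)) mulNr.
  have -> : (1 - KK k) * w_ r = w_ r + - (KK k * w_ r) by ring.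
  by rewrite ceLw expiD rmorphM; ring.
rewrite Im_sum mulr_suml; apply: eq_bigr => k _.
set c := (k`!%:R * sigma)^-1 * _.
have S : \sum_(r < n) expi ((1 - KK k) * w_ r) = (theta n sigma mu0 k)%:C.
  apply: complex_ext; last first.
    by apply: (Im_sym_sum n (f := fun w => expi ((1 - KK k) * w))) => w; rewrite mulrN expiN.
  rewrite Re_sum [LHS](omega_sum n (fun w => cos ((1 - KK k) * w))) /theta ReD mulr_natl.
  have -> : Re ((\sum_(r < n./2) expi ((Kexp sigma mu0 k - 1) * omega R n r)) *+ 2) =
     \sum_(0 <= r < n./2) cos ((1 - KK k) * - w_ r) + \sum_(0 <= r < n./2) cos ((1 - KK k) * w_ r).
    rewrite mulr2n ReD Re_sum !big_mkord; congr (_ + _); apply: eq_bigr => r _ /=.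
      by congr cos; rewrite /Kexp -/delta0; ring.
    by rewrite -cosN; congr cos; rewrite /Kexp -/delta0; ring.
  congr (_ + _); rewrite mulr0 cos0; case: (odd n) => //=.
rewrite S !ImZ (rgamma_lup sigma01) subKr /c invfM.
generalize (lup sigma 1 0 0 (KK k)) => z; ring.
Qed.

Lemma H_tail M' m : (M' <= m)%N -> exists2 C, 0 <= C & forall l, 0 <= l ->
  `|H_trunc n sigma mu0 m (xof l) - H_trunc n sigma mu0 M' (xof l)| <= C * expR (- (KK M' * Lof l)).
Proof.
move=> Mm; pose a k := `|sigma^-1 * (k`!%:R^-1 * rgamma (1 - KK k) * theta n sigma mu0 k)|.
exists (\sum_(M' <= k < m) a k); first by rewrite sumr_ge0// => i _; exact: normr_ge0.
move=> l l0; have L0 := log_mod_ge0 sigma01 l0.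
rewrite !H_truncE -mulrBr -!(big_mkord xpredT (fun k => expR (- (KK k * Lof l)) / k`!%:R * rgamma (1 - KK k) * theta n sigma mu0 k)).
rewrite (@big_cat_nat _ _ _ M' 0 m)//= addrAC subrr add0r mulr_sumr mulr_suml.
apply: le_trans (ler_norm_sum _ _ _) _; rewrite !big_nat; apply: ler_sum => k /andP[Mk _].
have -> : sigma^-1 * (expR (- (KK k * Lof l)) / k`!%:R * rgamma (1 - KK k) * theta n sigma mu0 k) =
   sigma^-1 * (k`!%:R^-1 * rgamma (1 - KK k) * theta n sigma mu0 k) * expR (- (KK k * Lof l)) by ring.
rewrite normrM [`|expR _|]ger0_norm ?expR_ge0//; apply: ler_wpM2l => //.
rewrite ler_expR lerN2 ler_wpM2r// ler_pM2r ?invr_gt0// lerD2r ler_nat//.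
Qed.

Lemma sum_bound (F : 'I_n -> R -> R) (G : R -> R) :
  (forall r, exists2 C, 0 <= C & forall l, 1 <= l -> F r l <= C * G l) ->
  exists2 C, 0 <= C & forall l, 1 <= l -> \sum_(r < n) F r l <= C * G l.
Proof.
move=> h; exists (\sum_r s2val (cid2 (h r))).
  by rewrite sumr_ge0// => r _; case: (cid2 _).
move=> l l1; rewrite mulr_suml; apply: ler_sum => r _.
by case: (cid2 _) => C C0 /= hC; exact: hC.
Qed.

Lemma saddle_dir_lt r : (r < n)%N -> w_ r + pi * sigma < pi * kap / 2 -> `|bof (w_ r)| < pi / 4.
Proof.
move=> rn h; have kr : keep r by rewrite keptE// ltW.
have k2 : 0 < 2 * kap by rewrite mulr_gt0.
have wlo : - (pi * kap / 2) < w_ r + pi * sigma.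
  have /andP[h1 h2] := omega_bound rn.
  have ps : 0 < pi * sigma by rewrite mulr_gt0 ?pi_gt0.
  by rewrite /kap mulrBr mulr1; lra.
rewrite /bof normrM [`|_^-1|]ger0_norm ?invr_ge0 ?ltW// ltr_pdivrMr// ltr_norml -/kap.
by have -> : pi / 4 * (2 * kap) = pi * kap / 2; [field|rewrite wlo h].
Qed.

Lemma saddle_region alpha r :
  (forall b, `|b| < pi / 4 -> exists2 C, 0 <= C & forall l, 1 <= l ->
    cmod (saddle_lup sigma delta0 l b - ce (saddle_exp sigma l b) * saddle_sum alpha M l b) <=
    C * (cmod (ce (saddle_exp sigma l b)) * expR (- (l / 2)) ^+ M.*2.+1)) ->
  (r < n)%N -> w_ r + pi * sigma < pi * kap / 2 -> exists2 C, 0 <= C & forall l, 1 <= l ->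
    cmod (lup sigma 1 (xof l) (w_ r) delta0 - saddle_main sigma mu0 alpha M l (bof (w_ r))) <= C * err l.
Proof.
move=> h rn hw; have [C C0 hC] := h _ (saddle_dir_lt rn hw).
exists (C * expR (- ((vt - M%:R) * ln q))); first by rewrite mulr_ge0 ?expR_ge0.
move=> l l1; rewrite -{1}[w_ r]saddle_dirK lup_saddle_lup /saddle_main -mulrBr cmodM cmod_saddle_base.
apply: le_trans (ler_wpM2l (expR_ge0 _) (hC l l1)) _.
rewrite mulrCA [expR _ * (_ * _)]mulrA exp_term_mod_scale -!mulrA; apply: ler_wpM2l => //; apply: ler_wpM2l; first exact: expR_ge0.
by apply: err_ge => //; rewrite keptE// ltW.
Qed.

Section Dominant.
(* A growing exponential is retained, and its error term absorbs everything that is not. *)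
Hypothesis small : tmin < pi * kap / 2.
Let g : R := q * cos (tmin / kap).

Lemma g_gt0 : 0 < g.
Proof.
rewrite mulr_gt0// cos_gt0_pihalf//; have [h1 h2] := wlast.
have ps : 0 < pi * sigma by rewrite mulr_gt0 ?pi_gt0.
rewrite ltr_pdivlMr// ltr_pdivrMr//; apply/andP; split; last by move: small; lra.
by rewrite /tmin /kap mulNr mulrBr mulr1; lra.
Qed.

(** The retained term of r = n - 1 alone grows like e^(g e^l) with g > 0; the gap g - eps pays for
    any power e^(B l). *)
Lemma err_absorb (B eps : R) : eps < g -> exists2 C, 0 <= C & forall l, 0 <= l ->
  expR (B * l + eps * expR l) <= C * err l.
Proof.
move=> eg; have ge : 0 < g - eps by rewrite subr_gt0.
have [C C0 hC] := exp_absorb 0 (B - (vt - M%:R)) ge.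
exists (C * expR (- ((vt - M%:R) * ln q))); first by rewrite mulr_ge0 ?expR_ge0.
have nn : (n.-1 < n)%N by rewrite prednK.
have kn : keep n.-1 by rewrite keptE// -/tmin ltW.
move=> l l0; apply: le_trans (ler_wpM2l _ (err_ge l nn kn)); last by rewrite mulr_ge0 ?expR_ge0.
have := hC l l0; rewrite expr0 mulr1 => h; rewrite exp_term_modE -/tmin -/g.
rewrite -!mulrA -!expRD; apply: le_trans (ler_wpM2r (expR_ge0 _) h).
by rewrite -expRD ler_expR; lra.
Qed.

(** Below the critical angle the saddle expansion applies. From it on the integral is subexponential
    and absorbed; exactly at it a main term is also subtracted, but this is only a power because the
    exponential has modulus 1. *)
Lemma dominated_term alpha r : (forall i, (i < M)%N -> alpha i = A i * expR ((vt - i%:R) * ln q)) ->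
  (forall b, `|b| < pi / 4 -> exists2 C, 0 <= C & forall l, 1 <= l ->
    cmod (saddle_lup sigma delta0 l b - ce (saddle_exp sigma l b) * saddle_sum alpha M l b) <=
    C * (cmod (ce (saddle_exp sigma l b)) * expR (- (l / 2)) ^+ M.*2.+1)) ->
  (r < n)%N -> exists2 C, 0 <= C & forall l, 1 <= l ->
    `|Im (expi (w_ r) * lup sigma 1 (xof l) (w_ r) delta0) -
      (if keep r then expR (vt * (l + ln q)) * exp_term_trunc sigma A M l (pr (w_ r)) else 0)| <= C * err l.
Proof.
move=> ha hL rn; have wb := omega_bound rn; case: (ltP (w_ r + pi * sigma) (pi * kap / 2)) => hw.
  have [C C0 hC] := saddle_region hL rn hw; exists C => // l l1.
  rewrite keptE// (ltW hw) -(Im_saddle_main sigma01 l (w_ r) ha) -ImB -mulrBr.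
  by apply: le_trans (Im_le_cmod _) _; rewrite cmodM cmod_expi mul1r; exact: hC.
have g2 : 0 < g / 2 by rewrite divr_gt0// g_gt0.
have hw' : pi * (1 - sigma) / 2 <= w_ r + sigma * pi by rewrite (mulrC sigma).
have [C1 C10 h1] := lup_subexp delta0 sigma01 g2 wb hw'.
have [C2 C20 h2] : exists2 C, 0 <= C & forall l, 0 <= l -> expR (0 * l + g / 2 * expR l) <= C * err l.
  by apply: err_absorb; move: g2; lra.
have [C3 C30 h3] := err_absorb delta0 g_gt0.
have hlup l : 1 <= l -> `|Im (expi (w_ r) * lup sigma 1 (xof l) (w_ r) delta0)| <= C1 * C2 * err l.
  move=> l1; have l0 : 0 <= l by rewrite (le_trans _ l1).
  apply: le_trans (Im_le_cmod _) _; rewrite cmodM cmod_expi mul1r -mulrA.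
  apply: le_trans (h1 l l0) _; apply: ler_wpM2l => //.
  by have := h2 l l0; rewrite mul0r add0r.
exists (C1 * C2 + (\sum_(i < M) `|alpha i|) * C3).
  by rewrite addr_ge0 ?mulr_ge0// sumr_ge0.
move=> l l1; have l0 : 0 <= l by rewrite (le_trans _ l1).
apply: le_trans (ler_normB _ _) _; rewrite [leRHS]mulrDl; apply: lerD; first exact: hlup.
case: ifP => kr; last by rewrite normr0 !mulr_ge0 ?err_ge0// sumr_ge0.
rewrite -(Im_saddle_main sigma01 l (w_ r) ha); apply: le_trans (Im_le_cmod _) _.
rewrite cmodM cmod_expi mul1r; apply: le_trans (saddle_main_le _ _ _ l0) _.
rewrite -mulrA; apply: ler_wpM2l; first by rewrite sumr_ge0.
have -> : cmod (ce (saddle_exp sigma l (bof (w_ r)))) = 1.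
  rewrite cmod_saddle_exp (_ : 2 * bof (w_ r) = pi / 2) ?cos_pihalf ?mulr0 ?expR0//.
  have -> : w_ r = pi * kap / 2 - pi * sigma by move: kr hw; rewrite keptE//; lra.
  by rewrite /bof -/kap; generalize (@pi R) => pp; field; rewrite gt_eqF.
by rewrite mulr1; have := h3 l l0; rewrite mul0r addr0.
Qed.

(** The whole truncated algebraic sum is O(x^(- K_0)), hence absorbed as well, and may be subtracted
    freely. *)
Lemma dominant_case m : exists2 C, 0 <= C & forall l, 1 <= l ->
  `|Fsum n sigma mu0 (xof l) - (E_trunc n sigma mu0 A M (xof l) + H_trunc n sigma mu0 m (xof l))| <= C * err l.
Proof.
have [alpha [hL _]] := saddle_expansion delta0 sigma01 M0.
have b0 : `|0 : R| < pi / 4 by rewrite normr0 divr_gt0 ?pi_gt0.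
have ha := saddle_coef sigma01 hA M0 (hL 0 b0).
have [C1 C10 h1] := sum_bound (G := fun l => err l) (fun r : 'I_n => dominated_term ha hL (ltn_ord r)).
have [C2 C20 h2] := H_tail (leq0n m).
have [C3 C30 h3] := err_absorb (- (KK 0 * kap)) g_gt0.
exists (C1 / pi + C2 * (expR (KK 0 * ln sigma) * C3)).
  by rewrite addr_ge0 ?divr_ge0 ?pi_ge0 ?mulr_ge0 ?expR_ge0.
move=> l l1; have l0 : 0 <= l by rewrite (le_trans _ l1).
rewrite Fsum_E_H; apply: le_trans (ler_normB _ _) _; rewrite [leRHS]mulrDl; apply: lerD.
  rewrite normrM [`|pi^-1|]ger0_norm ?invr_ge0 ?pi_ge0// [leRHS]mulrAC; apply: ler_wpM2r; first by rewrite invr_ge0 pi_ge0.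
  apply: le_trans (h1 l l1); rewrite Im_sum [X in _ - X]big_mkcond -sumrB; exact: ler_norm_sum.
have := h2 l l0; rewrite [X in _ - X](_ : _ = 0) ?subr0 => [h|]; last by rewrite H_truncE big_ord0 mulr0.
apply: le_trans h _; rewrite -[leRHS]mulrA -[_ * _ * err l]mulrA; apply: ler_wpM2l => //.
have -> : - (KK 0 * Lof l) = KK 0 * ln sigma + (- (KK 0 * kap) * l + 0 * expR l).
  by rewrite /Lof -/kap; ring.
by rewrite expRD; apply: ler_wpM2l; [exact: expR_ge0|exact: h3].
Qed.

End Dominant.

Section Critical.
(* No growing exponential is retained, so every direction has to be expanded down to the
   algebraic series. *)
Hypothesis large : pi * kap / 2 <= tmin.

Lemma critical_term alpha m r :
  (forall m : nat, 0 < m%:R + delta0 -> let b := pi / 4 in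
    exists2 C, 0 <= C & forall l, 1 <= l -> exists C' : R, forall s, s <= 0 ->
     cmod (lup sigma 1 (xof l) (saddle_arg sigma b) delta0 -
          ce (delta0%:C * saddle_base l b) * (ce (saddle_exp sigma l b) * saddle_sum alpha M l b) -
          algT sigma delta0 m (Lof l) (saddle_arg sigma b) -
          algF sigma delta0 m (Lof l) (saddle_arg sigma b) (s +i* 0)) <=
       C * (expR (delta0 * l) * cmod (ce (saddle_exp sigma l b)) * expR (- (l / 2)) ^+ M.*2.+1) +
       C * expR (- ((m%:R + delta0) / sigma * Lof l)) + C' * expR ((m%:R + delta0) * s)) ->
  0 < m%:R + delta0 -> (r < n)%N ->
  exists2 C, 0 <= C & forall l, 1 <= l -> exists C', forall s, s <= 0 ->
    cmod (lup sigma 1 (xof l) (w_ r) delta0 -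
      (if keep r then saddle_main sigma mu0 alpha M l (bof (w_ r)) else 0) -
      algT sigma delta0 m (Lof l) (w_ r) - algF sigma delta0 m (Lof l) (w_ r) (s +i* 0)) <=
    C * (err l + expR (- (KK m * Lof l))) + C' * expR ((m%:R + delta0) * s).
Proof.
move=> hB m0 rn; have wb := omega_bound rn.
have wr : pi * kap / 2 <= w_ r + pi * sigma.
  by apply: le_trans large _; rewrite lerD2r; exact: omega_ge.
case: (boolP (keep r)) => kr; last first.
  have hw : pi * (1 - sigma) / 2 < w_ r + sigma * pi.
    by rewrite (mulrC sigma) ltNge -/kap -keptE.
  have [chi [c1 c2]] := chi_exists sigma01 wb hw.
  have [C C0 hC] := alg_expansion sigma01 m0 c1 c2.
  exists C => // l l1; have l0 : 0 <= l by rewrite (le_trans _ l1).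
  have [C' hC'] := hC _ (log_mod_ge0 sigma01 l0); exists C' => s ss.
  rewrite subr0; have := hC' s ss; rewrite (expR_log_mod sigma01) => h; apply: le_trans h _.
  by rewrite lerD2r ler_wpM2l// lerDr err_ge0.
have bE : bof (w_ r) = pi / 4.
  have -> : w_ r = pi * kap / 2 - pi * sigma by move: kr wr; rewrite keptE//; lra.
  by rewrite /bof -/kap; generalize (@pi R) => pp; field; rewrite gt_eqF.
have wE : saddle_arg sigma (pi / 4) = w_ r by rewrite -bE saddle_dirK.
have [C C0 hC] := hB m m0; exists (C * expR (- ((vt - M%:R) * ln q)) + C).
  by rewrite addr_ge0 ?mulr_ge0 ?expR_ge0.
move=> l l1; have [C' hC'] := hC l l1; exists C' => s ss.
have := hC' s ss; rewrite wE -bE exp_term_mod_scale => h; apply: le_trans h _.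
rewrite lerD2r [leRHS]mulrDr; apply: lerD; last by rewrite ler_wpM2r ?expR_ge0// lerDr mulr_ge0 ?expR_ge0.
rewrite [leRHS]mulrDl -[leLHS]addr0 mulrA; apply: lerD; last by rewrite mulr_ge0 ?err_ge0.
apply: ler_wpM2l; first by rewrite mulr_ge0 ?expR_ge0.
exact: err_ge.
Qed.

(** The terms [algF] at the common base point s add up to a real number by [algF_sym], so they leave
    the imaginary part; then s -> -oo with l fixed removes the constants C', which may depend on
    l. *)
Lemma critical_case m : 0 < m%:R + delta0 -> exists2 C, 0 <= C & forall l, 1 <= l ->
  `|Fsum n sigma mu0 (xof l) - (E_trunc n sigma mu0 A M (xof l) + H_trunc n sigma mu0 m (xof l))| <=
  C * (err l + expR (- (KK m * Lof l))).
Proof.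
move=> m0; have [alpha [hL hB]] := saddle_expansion delta0 sigma01 M0.
have b0 : `|0 : R| < pi / 4 by rewrite normr0 divr_gt0 ?pi_gt0.
have ha := saddle_coef sigma01 hA M0 (hL 0 b0).
pose h (r : 'I_n) := cid2 (critical_term hB m0 (ltn_ord r)).
pose C := \sum_(r < n) s2val (h r).
have C0 : 0 <= C by rewrite sumr_ge0// => r _; case: (h r).
exists (C / pi); first by rewrite divr_ge0 ?pi_ge0.
move=> l l1; rewrite Fsum_E_H -Im_algT -mulrBl normrM [`|pi^-1|]ger0_norm ?invr_ge0 ?pi_ge0//.
rewrite [leRHS]mulrAC; apply: ler_wpM2r; first by rewrite invr_ge0 pi_ge0.
pose main r := if keep r then saddle_main sigma mu0 alpha M l (bof (w_ r)) else 0.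
have -> : \sum_(r < n | keep r) expR (vt * (l + ln q)) * exp_term_trunc sigma A M l (pr (w_ r)) =
    Im (\sum_(r < n) expi (w_ r) * main r).
  rewrite big_mkcond Im_sum; apply: eq_bigr => r _; rewrite /main.
  by case: ifP => _; rewrite ?mulr0// (Im_saddle_main sigma01 l (w_ r) ha).
have hl (r : 'I_n) := s2valP' (h r) l l1.
pose h' (r : 'I_n) := cid (hl r).
have FS s : Im (\sum_(r < n) expi (w_ r) * algF sigma delta0 m (Lof l) (w_ r) (s +i* 0)) = 0.
  apply: (Im_sym_sum n (f := fun w => expi w * algF sigma delta0 m (Lof l) w (s +i* 0))) => w.
  exact: algF_sym.
apply: (@le_exp_lim R _ _ (\sum_(r < n) sval (h' r)) 0 (m%:R + delta0) m0) => s ss.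
have ss' : - s <= 0 by rewrite oppr_le0.
have FE Y : Im Y = Im (Y - \sum_(r < n) expi (w_ r) * algF sigma delta0 m (Lof l) (w_ r) ((- s) +i* 0)).
  by rewrite ImB FS subr0.
rewrite -!ImB FE -!sumrB.
apply: le_trans (Im_le_cmod _) _; apply: le_trans (cmod_sum _ _ _) _.
rewrite /C !mulr_suml -big_split; apply: ler_sum => r _ /=.
rewrite -!mulrBr cmodM cmod_expi mul1r mulNr -mulrN.
exact: (svalP (h' r) (- s) ss').
Qed.

End Critical.

Lemma expansion_bound M' : exists2 C, 0 <= C & forall l, 1 <= l ->
  `|Fsum n sigma mu0 (xof l) - (E_trunc n sigma mu0 A M (xof l) + H_trunc n sigma mu0 M' (xof l))| <=
  C * (err l + expR (- (KK M' * Lof l))).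
Proof.
case: (ltP tmin (pi * kap / 2)) => ht.
  have [C C0 hC] := dominant_case ht M'; exists C => // l l1; apply: le_trans (hC l l1) _.
  by rewrite ler_wpM2l// lerDl expR_ge0.
(* delta = 1 - mu may be negative, and integrability at u = 0 requires m + delta > 0. The surplus
   algebraic terms are absorbed by [H_tail]. *)
pose m := (M' + (Num.truncn (`|delta0|)%R).+1)%N.
have m0 : 0 < m%:R + delta0.
  rewrite /m natrD; have := ler_norm (- delta0); rewrite normrN => h1.
  have h2 : `|delta0| < (Num.truncn `|delta0|).+1%:R by exact: truncnS_gt.
  by have h3 : (0 : R) <= M'%:R by []; move: h1 h2; lra.
have [C1 C10 h1] := critical_case ht m0.
have Mm : (M' <= m)%N by exact: leq_addr.
have [C2 C20 h2] := H_tail Mm.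
exists (C1 + C2); first exact: addr_ge0.
move=> l l1; have l0 : 0 <= l by rewrite (le_trans _ l1).
set F := Fsum _ _ _ _; set E := E_trunc _ _ _ _ _ _; set H := H_trunc n sigma mu0 M' _.
have -> : F - (E + H) = (F - (E + H_trunc n sigma mu0 m (xof l))) + (H_trunc n sigma mu0 m (xof l) - H) by ring.
apply: le_trans (ler_normD _ _) _; rewrite [leRHS]mulrDl; apply: lerD.
  apply: le_trans (h1 l l1) _; apply: ler_wpM2l => //; rewrite lerD2l ler_expR lerN2.
  by rewrite ler_wpM2r ?log_mod_ge0// ler_pM2r ?invr_gt0// lerD2r ler_nat.
by apply: le_trans (h2 l l0) _; rewrite ler_wpM2l// lerDr err_ge0.
Qed.

End Expansion.

Lemma saddle_mod_surj x : xof 1 <= x -> exists2 l, 1 <= l & x = xof l.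
Proof.
move=> hx; have x0 : 0 < x by apply: lt_le_trans hx; rewrite divr_gt0 ?expR_gt0.
exists ((ln x + ln sigma) / kap); last first.
  have kx : kap * ((ln x + ln sigma) / kap) = ln x + ln sigma by rewrite mulrC divfK// gt_eqF.
  by rewrite /saddle_mod -/kap kx expRD !lnK ?posrE// mulfK// gt_eqF.
rewrite ler_pdivlMr// mul1r -lnM ?posrE// -ler_expR lnK ?posrE ?mulr_gt0//.
by rewrite -ler_pdivrMr//; move: hx; rewrite /saddle_mod -/kap mulr1.
Qed.

Lemma powR_saddle_mod c l : xof l `^ (- c) = expR (- (c * Lof l)).
Proof. by rewrite -expR_log_mod// /powR gt_eqF ?expR_gt0// expRK mulNr. Qed.

Lemma Fsum_sim_E_plus_H n : (0 < n)%N -> inverse_factorial_coef sigma mu0 A ->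
  sim_E_plus_H n sigma mu0 A (Fsum n sigma mu0).
Proof.
move=> n0 hA M M' M0 _; have [C C0 hC] := expansion_bound n0 M0 hA M'.
apply: (@bigO_intro R _ _ C (xof 1)) => x /saddle_mod_surj[l l1 ->].
by apply: le_trans (hC l l1) _; rewrite powR_saddle_mod ler_wpM2l// ler_norm.
Qed.

(** The direction r = n - 1 exceeds pi kap / 2 by (pi / 2) (1 - n (2 - 3 sigma)) / n. When this is
    positive nothing is retained, and both the exponential sum and its error in the compound
    expansion are empty. *)
Lemma Fsum_sim_H n : (0 < n)%N -> inverse_factorial_coef sigma mu0 A ->
  n%:R * (2 - 3 * sigma) < 1 -> sim_H n sigma mu0 (Fsum n sigma mu0).
Proof.
move=> n0 hA hn M' M'0.
have [C C0 [x0 hC]] := bigO_ex (Fsum_sim_E_plus_H n0 hA (ltn0Sn 0) M'0).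
have kN (r : 'I_n) : ~~ kept sigma (pr (omega R n r)).
  rewrite keptE// -ltNge; apply: lt_le_trans (_ : omega R n n.-1 + pi * sigma <= _); last first.
    by rewrite lerD2r omega_ge.
  have nR : (0 : R) < n%:R by rewrite ltr0n.
  have -> : omega R n n.-1 + pi * sigma = pi * kap / 2 + pi / 2 * (1 - n%:R * (2 - 3 * sigma)) / n%:R.
    rewrite /omega -subn1 natrB//= /kap; generalize (@pi R) => pp; field.
    by rewrite gt_eqF.
  by rewrite ltrDl divr_gt0// mulr_gt0 ?divr_gt0 ?pi_gt0// subr_gt0.
apply: (@bigO_intro R _ _ C (Num.max (xof 1) x0)) => x; rewrite ge_max => /andP[/saddle_mod_surj[l l1 xE] xx0].
have := hC x xx0; rewrite xE E_truncE// E_errorE// !big_pred0 => [|r|r]; try exact/negbTE.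
by rewrite mulr0 !add0r.
Qed.

End Assembly.

Theorem theorem1 (R : realType) (mu sigma : R) (n : nat) (A : nat -> R)
    (hmu : 0 < mu) (hsigma0 : 0 < sigma) (hsigma1 : sigma < 1) (hn : (0 < n)%N)
    (hA : inverse_factorial_coef sigma mu A) :
  let n0 : R := 1 / (2 - 3 * sigma) in
  [/\ sigma < 1 / 2 -> (2 <= n)%N ->
        sim_E_plus_H n sigma mu A (Fsum n sigma mu),
      1 / 2 <= sigma < 2 / 3 -> n0 <= n%:R ->
        sim_E_plus_H n sigma mu A (Fsum n sigma mu),
      1 / 2 <= sigma < 2 / 3 -> n%:R < n0 ->
        sim_H n sigma mu (Fsum n sigma mu)
    & 2 / 3 <= sigma -> (2 <= n)%N ->
        sim_H n sigma mu (Fsum n sigma mu)].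
Proof.
move=> n0; have sigma01 : 0 < sigma < 1 by rewrite hsigma0.
have EH := Fsum_sim_E_plus_H sigma01 hn hA; have H := Fsum_sim_H sigma01 hn hA.
(* For sigma < 2/3 the condition n < n0 is n (2 - 3 sigma) < 1; for sigma >= 2/3 the product is at
   most 0. *)
split=> // [/andP[_ h1] h2|h1 _]; apply: H.
  by rewrite -ltr_pdivlMr//; lra.
apply: le_lt_trans ltr01; rewrite mulr_ge0_le0//; lra.
Qed.
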